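(* Let $m\in(1,\infty)$, $\gamma\in(0,\infty)$, $\alpha\in[\tfrac1m,1]$, and set $s(\gamma)=\min\{\tfrac14,\tfrac m4(1-\tfrac1\gamma)^+\}$. For every admissible curve $\Gamma$ with Hölder exponent $\alpha$ and every $s>s(\gamma)$, $\lim_{t\to0^+}P^m_\gamma f(\Gamma(x,t),t)=f(x)$ for a.e. $x\in\mathbb{R}$, for all $f\in H^s(\mathbb{R})$. Conversely, there exists an admissible curve $\Gamma$ with Hölder exponent $\alpha$ such that for every $s<s(\gamma)$ there is $f\in H^s(\mathbb{R})$ for which this a.e. convergence fails.
   Context: For $m>0$, $\gamma>0$, $f\in H^s(\mathbb{R})$, $\Gamma:\mathbb{R}\times[-1,1]\to\mathbb{R}$ and $t\in[0,1]$, define $$P^m_\gamma f(\Gamma(x,t),t)=\frac1{2\pi}\int_{\mathbb{R}}e^{i(\Gamma(x,t)\xi+t|\xi|^m)}e^{-t^\gamma|\xi|^m}\hat f(\xi)\,d\xi,$$ where $\hat f(\xi)=\int e^{-ix\xi}f(x)\,dx$. An admissible curve with Hölder exponent $\alpha\in(0,1]$ is a continuous $\Gamma:\mathbb{R}\times[-1,1]\to\mathbb{R}$ with $\Gamma(x,0)=x$, bilipschitz in $x$: $C_1|x-x'|\le|\Gamma(x,t)-\Gamma(x',t)|\le C_2|x-x'|$ for all $t\in[-1,1]$, $x,x'\in\mathbb{R}$, and $\alpha$-Hölder in $t$: $|\Gamma(x,t)-\Gamma(x,t')|\le C_3|t-t'|^\alpha$ for all $x\in\mathbb{R}$, $t,t'\in[-1,1]$,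 with constants $C_1,C_2,C_3>0$. $a^+=\max\{a,0\}$.
   Formalization: In the converse, s is restricted to 0 ≤ s < s(γ), with f in L²: for s < 0 an element of H^s need not be a function, so f(x) is undefined; if s(γ) > 0, the case s < 0 follows from s = 0 since L² ⊂ H^s. *)

(* Defs.v *)
From HB Require Import structures.
From mathcomp Require Import all_boot all_order all_algebra.
From mathcomp Require Import all_classical all_reals all_analysis.
From mathcomp Require Import complex.
Set Implicit Arguments. Unset Strict Implicit. Unset Printing Implicit Defensive.
Import Order.TTheory GRing.Theory Num.Theory numFieldNormedType.Exports.
Local Open Scope classical_set_scope.
Local Open Scope ring_scope.

Definition cRe (R : Type) (z : complex R) : R := let: Complex a _ := z in a.
Definition cIm (R : Type) (z : complex R) : R := let: Complex _ b := z in b.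

Definition cexp (R : realType) (th : R) : complex R := Complex (cos th) (sin th).

Definition creal (R : realType) (r : R) : complex R := Complex r 0.

Definition cnorm2 (R : realType) (z : complex R) : R := cRe z ^+ 2 + cIm z ^+ 2.

Definition cintegral (R : realType) (D : set R) (h : R -> complex R) : complex R :=
  Complex (Rintegral (@lebesgue_measure R) D (fun x => cRe (h x)))
          (Rintegral (@lebesgue_measure R) D (fun x => cIm (h x))).

Definition cmeasurable (R : realType) (h : R -> complex R) : Prop :=
  measurable_fun setT (fun x => cRe (h x)) /\ measurable_fun setT (fun x => cIm (h x)).

Definition L2 (R : realType) (h : R -> complex R) : Prop :=
  cmeasurable h /\
  (\int[@lebesgue_measure R]_x (cnorm2 (h x))%:E < +oo)%E.

Definition fourier_trunc (R : realType) (f : R -> complex R) (N : R) (xi : R)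
  : complex R :=
  cintegral `[- N, N] (fun x => cexp (- (x * xi)) * f x).

(* g is the (Plancherel) Fourier transform of f in L^2, with the convention
   \hat f(xi) = \int e^{-i x xi} f(x) dx : g is the L^2-limit of the truncated
   transforms. *)
Definition fourier_pair (R : realType) (f g : R -> complex R) : Prop :=
  L2 f /\ L2 g /\
  (fun N : nat =>
     (\int[@lebesgue_measure R]_xi (cnorm2 (g xi - fourier_trunc f N%:R xi))%:E)%E)
    @ \oo --> 0%E.

Definition Hs_pair (R : realType) (s : R) (f g : R -> complex R) : Prop :=
  fourier_pair f g /\
  (\int[@lebesgue_measure R]_xi ((1 + xi ^+ 2) `^ s * cnorm2 (g xi))%:E < +oo)%E.

(* P^m_gamma f (y, t), with fhat = g :
   (1/2pi) \int e^{i (y xi + t |xi|^m)} e^{- t^gamma |xi|^m} fhat(xi) dxi *)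
Definition Pmg (R : realType) (m gamma : R) (g : R -> complex R) (y t : R)
  : complex R :=
  creal (2 * pi)^-1 *
  cintegral setT (fun xi =>
    cexp (y * xi + t * `|xi| `^ m) *
    (creal (expR (- (t `^ gamma * `|xi| `^ m))) * g xi)).

Definition admissible (R : realType) (alpha : R) (Gam : R -> R -> R) : Prop :=
  0 < alpha <= 1 /\
  {within [set p : R * R | -1 <= p.2 <= 1], continuous (fun p : R * R => Gam p.1 p.2)} /\
  (forall x, Gam x 0 = x) /\
  exists C1 C2 C3 : R, [/\ 0 < C1, 0 < C2, 0 < C3,
    (forall t x x', -1 <= t <= 1 ->
       C1 * `|x - x'| <= `|Gam x t - Gam x' t| <= C2 * `|x - x'|) &
    (forall x t t', -1 <= t <= 1 -> -1 <= t' <= 1 ->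
       `|Gam x t - Gam x t'| <= C3 * `|t - t'| `^ alpha)].

Definition conv_at (R : realType) (m gamma : R) (Gam : R -> R -> R)
  (f g : R -> complex R) (x : R) : Prop :=
  (fun t => cRe (Pmg m gamma g (Gam x t) t)) @ 0^'+ --> cRe (f x) /\
  (fun t => cIm (Pmg m gamma g (Gam x t) t)) @ 0^'+ --> cIm (f x).

Definition ae_conv (R : realType) (m gamma : R) (Gam : R -> R -> R)
  (f g : R -> complex R) : Prop :=
  {ae @lebesgue_measure R, forall x, conv_at m gamma Gam f g x}.

Definition scrit (R : realType) (m gamma : R) : R :=
  Num.min (4^-1) (m / 4 * Num.max (1 - gamma^-1) 0).

(* Main.v *)
(** Convergence. Linearize the maximal function by a measurable time [u x] and
    split the frequencies dyadically. On [|xi| ~ l], a TT* argument reduces the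
    L^1 bound on unit intervals to the kernel
    [\int cos (a xi + b xi^m) e^(- c xi^m)] over [[l, 2 l]], with
    [a = Gam x t - Gam y t'], [b = t - t'], [c = t^gam + t'^gam]. The first or
    second derivative test, combined with the damping when [|b|] is large and
    with [b^alpha <= b l^(m-1) + l^-1] (this is where [alpha >= 1/m] enters),
    bounds it by [l^sg (|x - y| + l^-1)^(- th)] with [th < 1] and [sg < 2 s].
    The dyadic pieces then sum to an integrable majorant, so the truncated
    operators are uniformly Cauchy in [t] almost everywhere. Their value at
    [t = 0] is identified with [f] by Fourier inversion integrated over an
    interval, which follows from Poisson summability.

    Divergence, for [Gam x t = x]. Let [phi(x) = max(1 - |x|, 0)] and superpose
    [M ~ lam^nu] copies of [phi] modulated at frequencies
    [lam + n (2 pi lam^kap)], normalized by [1/M]. By almost orthogonality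
    the [H^s] norm squared is about [lam^(2 s - nu)]. For every [x >= 0] there
    is a time [t ~ lam^(1 - m - kap)] at which [x + m lam^(m-1) t] is a multiple
    of [lam^(- kap)]: all the copies are then in phase, the damping and the
    curvature of the phase are negligible, and the wave has modulus about
    [phi x] although the packet is small in L^2. A gliding hump over rapidly
    increasing [lam] gives one function for which the limit does not exist on a
    set of positive measure. *)

Require Import Defs.
From HB Require Import structures.
From mathcomp Require Import all_boot all_order all_algebra.
From mathcomp Require Import all_classical all_reals all_analysis.
From mathcomp Require Import complex ring lra measurable_realfun.
Import Order.TTheory GRing.Theory Num.Theory numFieldNormedType.Exports.
Local Open Scope classical_set_scope.
Local Open Scope ring_scope.
Set Implicit Arguments. Unset Strict Implicit. Unset Printing Implicit Defensive.

(** Only real integrals occur: a transform is a pair [(g1, g2)], and multiplication by [- i] sends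
    it to [(g2, - g1)], so one real statement yields both the real and the imaginary part.

    Both halves meet at the same exponent. For convergence, the damping exponent is at least |b|^gam
    l^m, so decay of order N in it improves the |b|^(-1/2) of the second derivative test to
    |b|^(-th), th = 1/2 + gam N. The resulting power of l is affine in th: it is 1/2 at th = 1/2 and
    m/2 (1 - 1/gam) at th = 1, twice the two terms whose minimum defines [scrit]. For divergence,
    the phases align if kap > m/gam - m + 1 (damping) and 2 nu + kap < 1 (curvature), while
    smallness in H^s asks 2 s < nu; eliminating nu and kap > 0 leaves 4 s < min (1, m (1 - 1/gam)).

    In the convergence half the obstacle is time 0: the transform is only square integrable, so
    without damping the integral need not converge absolutely. There, values at time 0 are taken on
    truncated frequencies only. *)

Local Notation L1 D f :=
  ((@lebesgue_measure _).-integrable D (fun x => (f x)%:E)).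
Local Notation mu := (@lebesgue_measure _).

Lemma measurable_sin (R : realType) : measurable_fun setT (@sin R).
Proof. by apply: continuous_measurable_fun => x; exact: continuous_sin. Qed.

Lemma measurable_cos (R : realType) : measurable_fun setT (@cos R).
Proof. by apply: continuous_measurable_fun => x; exact: continuous_cos. Qed.

Ltac meas := repeat first
  [ assumption | exact: measurable_cst | exact: measurable_id
  | exact: measurable_fst | exact: measurable_snd
  | apply: measurable_funD | apply: measurable_funB | apply: measurable_funM
  | apply: (measurableT_comp (@measurable_sin _))
  | apply: (measurableT_comp (@measurable_cos _))
  | apply: (measurableT_comp (@measurable_expR _))
  | apply: (measurableT_comp (@measurable_powR _ _))
  | apply: (measurableT_comp (@normr_measurable _ setT))
  | apply: (measurableT_comp (@oppr_measurable _ setT))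
  | apply: measurable_funX ].

(** * Real-valued Lebesgue integrals *)

Section Toolkit.
Variable R : realType.
Implicit Types (D : set R) (f g h : R -> R).

Lemma L1_meas D f : L1 D f -> measurable_fun D f.
Proof. by move=> /measurable_int /measurable_EFinP. Qed.

Lemma L1_le D f g : measurable D -> measurable_fun D f -> L1 D g ->
  (forall x, D x -> `|f x| <= g x) -> L1 D f.
Proof.
move=> mD mf ig fg; apply: le_integrable ig => //.
  exact/measurable_EFinP.
by move=> x Dx; rewrite lee_fin (le_trans (fg _ Dx))// ler_norm.
Qed.

Lemma L1_bounded D f (C : R) : measurable D -> (mu D < +oo)%E ->
  measurable_fun D f -> (forall x, D x -> `|f x| <= C) -> L1 D f.
Proof.
move=> mD Doo mf fC; apply: (@L1_le _ _ (cst C)) => //.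
apply/integrableP; split; first exact/measurable_EFinP.
by rewrite (_ : (fun x => _) = cst `|C|%:E)// integral_cst// lte_mul_pinfty// lee_fin.
Qed.

Lemma L1_itv_bounded (a b : R) f (C : R) : measurable_fun `[a, b] f ->
  (forall x, x \in `[a, b] -> `|f x| <= C) -> L1 `[a, b] f.
Proof.
move=> mf fC; apply: (@L1_bounded _ _ C) => //.
by rewrite /= lebesgue_measure_itv; case: ifPn => // _; rewrite -EFinD ltry.
Qed.

Lemma L1D D f g : measurable D -> L1 D f -> L1 D g ->
  L1 D (fun x => f x + g x).
Proof. move=> mD fi gi; exact: (integrableD _ fi gi). Qed.

Lemma L1Zl D (r : R) f : measurable D -> L1 D f -> L1 D (fun x => r * f x).
Proof. move=> mD fi; exact: (integrableZl _ r fi). Qed.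

Lemma L1N D f : measurable D -> L1 D f -> L1 D (fun x => - f x).
Proof.
move=> mD fi; rewrite [X in L1 _ X](_ : _ = (fun x => -1 * f x)).
  exact: L1Zl.
by apply/funext => x; rewrite mulN1r.
Qed.

Lemma L1B D f g : measurable D -> L1 D f -> L1 D g ->
  L1 D (fun x => f x - g x).
Proof. by move=> mD fi gi; apply: L1D => //; apply: L1N. Qed.

Lemma L1_norm D f : measurable D -> L1 D f -> L1 D (fun x => `|f x|).
Proof. move=> mD fi; exact: integrable_norm. Qed.

Lemma L1_mulb D f h (C : R) : measurable D -> L1 D f -> measurable_fun D h ->
  (forall x, D x -> `|h x| <= C) -> L1 D (fun x => h x * f x).
Proof.
move=> mD fi mh hC; apply: (@L1_le _ _ (fun x => C * `|f x|)) => //.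
- by apply: measurable_funM => //; exact: L1_meas.
- by apply: L1Zl => //; apply: L1_norm.
- by move=> x Dx; rewrite normrM ler_wpM2r// hC.
Qed.

Lemma L1S (D E : set R) f : measurable D -> measurable E -> D `<=` E ->
  L1 E f -> L1 D f.
Proof. move=> mD mE DE; exact: integrableS. Qed.

Lemma norm_Rint_le D f g : measurable D -> L1 D f -> L1 D g ->
  (forall x, D x -> `|f x| <= g x) ->
  `|\int[mu]_(x in D) f x| <= \int[mu]_(x in D) g x.
Proof.
move=> mD fi gi fg; apply: le_trans (le_normr_Rintegral _ fi) _ => //.
by apply: le_Rintegral => //; exact: L1_norm.
Qed.

Lemma Rint_le D f g : measurable D -> L1 D f -> L1 D g ->
  (forall x, D x -> f x <= g x) ->
  \int[mu]_(x in D) f x <= \int[mu]_(x in D) g x.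
Proof. by move=> mD fi gi fg; apply: le_Rintegral. Qed.

Lemma Rint_eq D f g : (forall x, D x -> f x = g x) ->
  \int[mu]_(x in D) f x = \int[mu]_(x in D) g x.
Proof. by move=> fg; apply: eq_Rintegral => x /set_mem /fg. Qed.

Lemma RintD D f g : measurable D -> L1 D f -> L1 D g ->
  \int[mu]_(x in D) (f x + g x) = \int[mu]_(x in D) f x + \int[mu]_(x in D) g x.
Proof. by move=> mD fi gi; rewrite RintegralD. Qed.

Lemma RintB D f g : measurable D -> L1 D f -> L1 D g ->
  \int[mu]_(x in D) (f x - g x) = \int[mu]_(x in D) f x - \int[mu]_(x in D) g x.
Proof. by move=> mD fi gi; rewrite RintegralB. Qed.

Lemma RintZl D f (r : R) : measurable D -> L1 D f ->
  \int[mu]_(x in D) (r * f x) = r * \int[mu]_(x in D) f x.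
Proof. by move=> mD fi; rewrite RintegralZl. Qed.

Lemma RintZr D f (r : R) : measurable D -> L1 D f ->
  \int[mu]_(x in D) (f x * r) = \int[mu]_(x in D) f x * r.
Proof. by move=> mD fi; rewrite RintegralZr. Qed.

Lemma EFin_Rint D f : measurable D -> L1 D f ->
  ((\int[mu]_(x in D) f x)%:E = \int[mu]_(x in D) (f x)%:E)%E.
Proof. by move=> mD fi; rewrite /Rintegral fineK//; exact: integrable_fin_num. Qed.

Lemma L1_ge0 D f : measurable D -> measurable_fun D f ->
  (forall x, D x -> 0 <= f x) -> (\int[mu]_(x in D) (f x)%:E < +oo)%E -> L1 D f.
Proof.
move=> mD mf f0 foo; apply/integrableP; split; first exact/measurable_EFinP.
apply: le_lt_trans foo; rewrite le_eqVlt; apply/orP; left; apply/eqP.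
by apply: eq_integral => x /set_mem Dx /=; rewrite ger0_norm// f0.
Qed.

Lemma Rint_bound_itv (a b : R) f (C : R) : a <= b -> measurable_fun `[a, b] f ->
  (forall x, x \in `[a, b] -> `|f x| <= C) ->
  `|\int[mu]_(x in `[a, b]) f x| <= C * (b - a).
Proof.
move=> ab mf fC; have fi := L1_itv_bounded mf fC.
apply: (@le_trans _ _ (\int[mu]_(x in `[a, b]) (cst C) x)).
  apply: norm_Rint_le => //.
  by apply: (@L1_itv_bounded _ _ _ `|C|) => //.
rewrite Rintegral_cst//= lebesgue_measure_itv/= lte_fin.
case: ltP => //= ba; have -> : b = a by apply/le_anti/andP.
by rewrite subrr.
Qed.

Lemma FTC2_Rint (a b : R) f F : a <= b ->
  {within `[a, b], continuous f} ->
  (forall x, x \in `[a, b] -> is_derive x 1 F (f x)) ->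
  \int[mu]_(x in `[a, b]) f x = F b - F a.
Proof.
move=> ab cf dF; have [<-|neab] := eqVneq a b.
  by rewrite set_itv1 Rintegral_set1 subrr.
have altb : a < b by rewrite lt_neqAle neab.
have cF x : x \in `[a, b] -> {for x, continuous F}.
  by move=> /dF dFx; apply/differentiable_continuous/derivable1_diffP.
rewrite /Rintegral (@continuous_FTC2 _ f F)//.
- split.
  + by move=> x xab; have := dF _ (subset_itv_oo_cc xab) => -[].
  + by apply/cvg_at_right_filter/cF; rewrite in_itv/= lexx.
  + by apply/cvg_at_left_filter/cF; rewrite in_itv/= lexx ltW.
- move=> x xab; have [_ <-] := dF _ (subset_itv_oo_cc xab).
  by rewrite derive1E.
Qed.

Lemma L1_restrict D f : measurable D -> L1 D f <-> L1 setT (f \_ D).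
Proof.
move=> mD; have := @integrable_mkcond _ _ _ mu _ (EFin \o f) mD.
by rewrite restrict_EFin.
Qed.

(** Cutting [F] off to [D] times [E] leaves a function on the plane dominated by a product of
    integrable functions, so Tonelli makes it integrable for the product measure. Integrability of
    both partial integrals belongs to the conclusion because it is also how measurability of such
    integrals is obtained later. *)
Lemma Fubini_Rint (D E : set R) (F : R * R -> R) (a b : R -> R) :
  measurable D -> measurable E -> measurable_fun setT F ->
  L1 D a -> L1 E b ->
  (forall x y, D x -> E y -> `|F (x, y)| <= a x * b y) ->
  [/\ L1 D (fun x => \int[mu]_(y in E) F (x, y)),
      L1 E (fun y => \int[mu]_(x in D) F (x, y)) &
  \int[mu]_(x in D) (\int[mu]_(y in E) F (x, y)) =
  \int[mu]_(y in E) (\int[mu]_(x in D) F (x, y))].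
Proof.
move=> mD mE mF ia ib Fab.
pose G := fun z : R * R => (\1_D z.1 * \1_E z.2 * F z).
have mG : measurable_fun setT G.
  apply: measurable_funM => //; apply: measurable_funM.
    by apply: (measurableT_comp (measurable_indic mD)); exact: measurable_fst.
  by apply: (measurableT_comp (measurable_indic mE)); exact: measurable_snd.
have mGE : measurable_fun setT (EFin \o G) by exact/measurable_EFinP.
have dom x y : `|G (x, y)| <= \1_D x * `|a x| * (\1_E y * `|b y|).
  rewrite /G /= !normrM !indicE; case: (boolP (x \in D)) => xD; last first.
    by rewrite normr0 !mul0r.
  case: (boolP (y \in E)) => yE; last by rewrite normr0 mulr0 !mul0r mulr0.
  rewrite normr1 !mul1r; apply: le_trans (Fab _ _ (set_mem xD) (set_mem yE)) _.
  by rewrite -normrM ler_norm.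
have ia' : L1 setT (fun x => \1_D x * `|a x|).
  rewrite [X in L1 _ X](_ : _ = (fun x => `|a x|) \_ D); last first.
    by apply/funext => x; rewrite patchE indicE; case: ifP => _; rewrite ?mul1r ?mul0r.
  by apply/(L1_restrict _ mD); exact: L1_norm.
have ib' : L1 setT (fun x => \1_E x * `|b x|).
  rewrite [X in L1 _ X](_ : _ = (fun x => `|b x|) \_ E); last first.
    by apply/funext => x; rewrite patchE indicE; case: ifP => _; rewrite ?mul1r ?mul0r.
  by apply/(L1_restrict _ mE); exact: L1_norm.
have mG1 (x : R) : measurable_fun setT (fun y => G (x, y)).
  exact: (measurableT_comp mG (pair1_measurable x)).
have mG2 (y : R) : measurable_fun setT (fun x => G (x, y)).
  exact: (measurableT_comp mG (pair2_measurable y)).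
have iG : (mu \x mu)%E.-integrable setT (EFin \o G).
  apply/integrable12ltyP => //.
  apply: (@le_lt_trans _ _ (\int[mu]_x ((\1_D x * `|a x|)%:E *
     \int[mu]_y (\1_E y * `|b y|)%:E))%E).
    apply: ge0_le_integral => //.
    - by move=> x _; apply: integral_ge0.
    - apply: (@measurable_fun_fubini_tonelli_F _ _ _ _ R mu (abse \o (EFin \o G))).
      + exact: measurableT_comp.
      + by move=> z; exact: abse_ge0.
    - apply: emeasurable_funM => //; exact: (measurable_int _ ia').
    - move=> x _; rewrite -ge0_integralZl//.
      + apply: ge0_le_integral => //.
        * by apply: measurableT_comp => //; apply/measurable_EFinP; exact: mG1.
        * by apply: emeasurable_funM => //; exact: (measurable_int _ ib').
        * by move=> y _; rewrite /= lee_fin.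
      + exact: (measurable_int _ ib').
  rewrite -(EFin_Rint measurableT ib').
  rewrite ge0_integralZr//; last first.
  - by rewrite lee_fin Rintegral_ge0// => y _; rewrite mulr_ge0.
  - exact: (measurable_int _ ia').
  by rewrite -(EFin_Rint measurableT ia') -EFinM ltry.
have slice1 x : L1 setT (fun y => G (x, y)).
  apply: (@L1_le _ _ (fun y => (\1_D x * `|a x|) * (\1_E y * `|b y|))) => //.
  exact: L1Zl.
have slice2 y : L1 setT (fun x => G (x, y)).
  apply: (@L1_le _ _ (fun x => (\1_E y * `|b y|) * (\1_D x * `|a x|))) => //.
  - exact: L1Zl.
  - by move=> x _; rewrite mulrC.
have inner1 : (fun x => \int[mu]_y G (x, y)) =
    (fun x => \int[mu]_(y in E) F (x, y)) \_ D.
  apply/funext => x; rewrite patchE; case: ifPn => xD; last first.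
    rewrite (_ : (fun y => _) = cst 0) ?Rintegral_cst ?mul0r//.
    by apply/funext => y; rewrite /G /= indicE (negbTE xD) !mul0r.
  rewrite [RHS]Rintegral_mkcond; congr Rintegral; apply/funext => y.
  by rewrite /G/= !indicE xD patchE; case: ifPn => yE; rewrite !(mul1r,mul0r).
have inner2 : (fun y => \int[mu]_x G (x, y)) =
    (fun y => \int[mu]_(x in D) F (x, y)) \_ E.
  apply/funext => y; rewrite patchE; case: ifPn => yE; last first.
    rewrite (_ : (fun x => _) = cst 0) ?Rintegral_cst ?mul0r//.
    by apply/funext => x; rewrite /G /= !indicE (negbTE yE) mulr0 !mul0r.
  rewrite [RHS]Rintegral_mkcond; congr Rintegral; apply/funext => x.
  by rewrite /G/= !indicE yE patchE; case: ifPn => xD; rewrite !(mul1r,mul0r).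
have E1 : (fun x => \int[mu]_y (G (x, y))%:E)%E =
   (fun x => (\int[mu]_y G (x, y))%:E).
  by apply/funext => x; rewrite EFin_Rint.
have E2 : (fun y => \int[mu]_x (G (x, y))%:E)%E =
   (fun y => (\int[mu]_x G (x, y))%:E).
  by apply/funext => x; rewrite EFin_Rint.
have I1 : L1 setT (fun x => \int[mu]_y G (x, y)).
  by have := integrable_fubini_F iG; rewrite /fubini_F/= E1.
have I2 : L1 setT (fun y => \int[mu]_x G (x, y)).
  have i21 : (\int[mu]_y \int[mu]_x `|(EFin \o G) (x, y)| < +oo)%E.
    exact/(integrable21ltyP _ _ _).1.
  apply/integrableP; split.
    have := measurable_fubini_G iG; rewrite /fubini_G/= E2 //.
  apply: le_lt_trans i21; apply: ge0_le_integral => //.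
  - apply: measurableT_comp => //.
    by have := measurable_fubini_G iG; rewrite /fubini_G/= E2.
  - apply: (@measurable_fun_fubini_tonelli_G _ _ _ _ R mu (abse \o (EFin \o G))).
    + exact: measurableT_comp.
    + by move=> z; exact: abse_ge0.
  - move=> y _ /=; rewrite -[leLHS]/(`|(\int[mu]_x G (x, y))%:E|%E).
    rewrite (EFin_Rint measurableT (slice2 y)).
    apply: le_abse_integral => //; exact: (measurable_int _ (slice2 y)).
split.
- by apply/(L1_restrict _ mD); rewrite -inner1.
- by apply/(L1_restrict _ mE); rewrite -inner2.
- rewrite Rintegral_mkcond -inner1 [RHS]Rintegral_mkcond -inner2.
  apply: EFin_inj; rewrite (EFin_Rint measurableT I1) (EFin_Rint measurableT I2).
  by rewrite -E1 -E2; exact: (Fubini iG).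
Qed.

End Toolkit.

(** * Oscillatory integrals *)

Section Calculus.
Variable R : realType.
Implicit Types (f g : R -> R) (a b x : R).

Lemma D_add f g x a b : is_derive x 1 f a -> is_derive x 1 g b ->
  is_derive x 1 (fun y => f y + g y) (a + b).
Proof. exact: is_deriveD. Qed.

Lemma D_mul f g x a b : is_derive x 1 f a -> is_derive x 1 g b ->
  is_derive x 1 (fun y => f y * g y) (a * g x + f x * b).
Proof.
move=> fa gb.
have h : is_derive x 1 (f * g) (f x *: b + g x *: a) by exact: is_deriveM.
apply: (is_derive_eq h); by rewrite /GRing.scale /= addrC (mulrC a).
Qed.

Lemma D_opp f x a : is_derive x 1 f a -> is_derive x 1 (fun y => - f y) (- a).
Proof. exact: is_deriveN. Qed.

Lemma D_sub f g x a b : is_derive x 1 f a -> is_derive x 1 g b ->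
  is_derive x 1 (fun y => f y - g y) (a - b).
Proof. exact: is_deriveB. Qed.

Lemma D_cmul k f x a : is_derive x 1 f a ->
  is_derive x 1 (fun y => k * f y) (k * a).
Proof. exact: is_deriveZ. Qed.

Lemma D_inv f x a : f x != 0 -> is_derive x 1 f a ->
  is_derive x 1 (fun y => (f y)^-1) (- (a / f x ^+ 2)).
Proof.
move=> fx0 fa.
have h : is_derive x 1 (fun y => (f y)^-1) (- f x ^- 2 *: a) by exact: is_deriveV.
apply: (is_derive_eq h); by rewrite /GRing.scale /= mulNr mulrC.
Qed.

Lemma D_comp f g x a b : is_derive (g x) 1 f a -> is_derive x 1 g b ->
  is_derive x 1 (fun y => f (g y)) (a * b).
Proof. exact: is_derive1_comp. Qed.

Lemma D_continuous f x a : is_derive x 1 f a -> {for x, continuous f}.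
Proof. by move=> fa; apply/differentiable_continuous/derivable1_diffP. Qed.

Lemma cont_itv p q f : (forall x, x \in `[p, q] -> {for x, continuous f}) ->
  {within `[p, q], continuous f}.
Proof.
by move=> cf; apply: continuous_in_subspaceT => x xpq; apply: cf; rewrite inE in xpq.
Qed.

Lemma within_meas p q f : {within `[p, q], continuous f} ->
  measurable_fun `[p, q] f.
Proof. by move=> cf; exact: subspace_continuous_measurable_fun. Qed.

Lemma L1_within p q f : {within `[p, q], continuous f} -> L1 `[p, q] f.
Proof. by move=> cf; apply: continuous_compact_integrable => //; exact: segment_compact. Qed.

Lemma L1_cont p q f : (forall x, x \in `[p, q] -> {for x, continuous f}) ->
  L1 `[p, q] f.
Proof. by move=> /cont_itv /L1_within. Qed.

Lemma le_Rint_FTC p q f g G : p <= q ->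
  (forall x, x \in `[p, q] -> {for x, continuous f}) ->
  (forall x, x \in `[p, q] -> {for x, continuous g}) ->
  (forall x, x \in `[p, q] -> is_derive x 1 G (g x)) ->
  (forall x, x \in `[p, q] -> f x <= g x) ->
  \int[mu]_(x in `[p, q]) f x <= G q - G p.
Proof.
move=> pq cf cg dG fg; rewrite -(@FTC2_Rint _ p q g G)//; last exact: cont_itv.
by apply: le_Rintegral => //; exact: L1_cont.
Qed.

Lemma Rint_split p z q f : p <= z -> z <= q -> L1 `[p, q] f ->
  \int[mu]_(x in `[p, q]) f x =
  \int[mu]_(x in `[p, z]) f x + \int[mu]_(x in `[z, q]) f x.
Proof.
move=> pz zq fi; apply/eqP; rewrite addrC -subr_eq; apply/eqP.
rewrite Rintegral_itvB ?bnd_simp//; rewrite Rintegral_itv_obnd_cbnd//.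
apply: (L1S _ _ _ fi) => //; apply: subset_itv; rewrite bnd_simp//.
Qed.

(** First derivative test by comparison of primitives. [H] is the boundary term of one integration
    by parts; what it misses is at most [B'], because [A] decreases and [d] is monotone, in the
    direction recorded by [sg]. [H] and [B] each vary by at most [2 * A p / nu], hence the factor
    4. *)
Lemma oscillatory1 (p q nu sg : R) (phi d e A A' : R -> R) : p <= q -> 0 < nu ->
  sg = 1 \/ sg = -1 ->
  (forall x, x \in `[p, q] -> is_derive x 1 phi (d x)) ->
  (forall x, x \in `[p, q] -> is_derive x 1 d (e x)) ->
  (forall x, x \in `[p, q] -> is_derive x 1 A (A' x)) ->
  (forall x, x \in `[p, q] -> {for x, continuous e}) ->
  (forall x, x \in `[p, q] -> {for x, continuous A'}) ->
  (forall x, x \in `[p, q] -> nu <= d x) ->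
  (forall x, x \in `[p, q] -> 0 <= sg * e x) ->
  (forall x, x \in `[p, q] -> 0 <= A x <= A p) ->
  (forall x, x \in `[p, q] -> A' x <= 0) ->
  `|\int[mu]_(x in `[p, q]) (cos (phi x) * A x)| <= 4 * A p / nu.
Proof.
move=> pq nu0 sg1 dphi dd dA ce cA' nud sge A0 A'0.
have d0 x : x \in `[p, q] -> 0 < d x by move=> /nud; exact: lt_le_trans.
have pin : p \in `[p, q] by rewrite in_itv/= lexx.
have qin : q \in `[p, q] by rewrite in_itv/= lexx andbT.
have Ap0 : 0 <= A p.
  by have /andP[A1 A2] := A0 p pin; exact: le_trans A2.
pose H x := A x * sin (phi x) / d x.
pose H' x := (A' x * sin (phi x) + A x * (cos (phi x) * d x)) / d x
  + (A x * sin (phi x)) * - (e x / d x ^+ 2).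
have dH x : x \in `[p, q] -> is_derive x 1 H (H' x).
  move=> xpq; apply: D_mul.
    by apply: D_mul; [exact: dA | apply: D_comp; exact: dphi].
  by apply: D_inv; [rewrite gt_eqF// d0 | exact: dd].
pose B x := - (A x / nu) - sg * A p / d x.
pose B' x := - (A' x / nu) - sg * A p * - (e x / d x ^+ 2).
have dB x : x \in `[p, q] -> is_derive x 1 B (B' x).
  move=> xpq; apply: D_sub.
    apply: D_opp; apply: is_derive_eq; first exact: (D_mul (dA _ xpq) (is_derive_cst _ _ _)).
    by rewrite mulr0 addr0.
  apply: is_derive_eq.
    apply: D_cmul; apply: D_inv; [by rewrite gt_eqF// d0 | exact: dd].
  by [].
have cA x (xpq : x \in `[p, q]) := D_continuous (dA _ xpq).
have cphi x (xpq : x \in `[p, q]) := D_continuous (dphi _ xpq).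
have cd x (xpq : x \in `[p, q]) := D_continuous (dd _ xpq).
have ccos x : x \in `[p, q] -> {for x, continuous (fun x => cos (phi x))}.
  by move=> /cphi c; apply: continuous_comp => //; exact: continuous_cos.
have csin x : x \in `[p, q] -> {for x, continuous (fun x => sin (phi x))}.
  by move=> /cphi c; apply: continuous_comp => //; exact: continuous_sin.
have cdi x : x \in `[p, q] -> {for x, continuous (fun x => (d x)^-1)}.
  by move=> xpq; apply: continuousV; [rewrite gt_eqF// d0 | exact: cd].
have ced x : x \in `[p, q] -> {for x, continuous (fun x => - (e x / d x ^+ 2))}.
  move=> xpq; apply: continuousN; apply: continuousM; first exact: ce.
  apply: continuousV; first by rewrite expf_eq0/= gt_eqF// d0.
  by apply: continuousM; exact: cd.
have cH' x : x \in `[p, q] -> {for x, continuous H'}.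
  move=> xpq; apply: continuousD; last first.
    by apply: continuousM; [apply: continuousM; [exact: cA|exact: csin]|exact: ced].
  apply: continuousM; last exact: cdi.
  apply: continuousD; first by apply: continuousM; [exact: cA'|exact: csin].
  by apply: continuousM; [exact: cA|apply: continuousM; [exact: ccos|exact: cd]].
have cB' x : x \in `[p, q] -> {for x, continuous B'}.
  move=> xpq; apply: continuousB.
    by apply: continuousN; apply: continuousM; [exact: cA'|exact: cst_continuous].
  by apply: continuousM; [exact: cst_continuous|exact: ced].
have key x : x \in `[p, q] -> `|cos (phi x) * A x - H' x| <= B' x.
  move=> xpq; have dx := d0 _ xpq; have dx0 : d x != 0 by rewrite gt_eqF.
  have -> : cos (phi x) * A x - H' x =
     - (A' x / d x) * sin (phi x) + A x * (e x / d x ^+ 2) * sin (phi x).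
    by rewrite /H'; field.
  have ES : `|e x| = sg * e x.
    case: sg1 (sge _ xpq) => -> s0; first by rewrite mul1r in s0 *; rewrite ger0_norm.
    by rewrite mulN1r in s0 *; rewrite ler0_norm// -oppr_ge0.
  apply: le_trans (ler_normD _ _) _; rewrite /B' mulrN opprK.
  apply: lerD; rewrite normrM.
    apply: (@le_trans _ _ (`|- (A' x / d x)| * 1)).
      by apply: ler_wpM2l => //; exact: sin_max.
    rewrite mulr1 normrN normrM ler0_norm ?A'0// mulNr lerN2 normfV gtr0_norm//.
    by rewrite ler_wnM2l ?A'0// lef_pV2 ?nud ?posrE.
  apply: (@le_trans _ _ (`|A x * (e x / d x ^+ 2)| * 1)).
    by apply: ler_wpM2l => //; exact: sin_max.
  have /andP[A1 A2] := A0 _ xpq.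
  rewrite mulr1 !normrM ES ger0_norm// [in leRHS](mulrC sg) -!mulrA ler_pM//.
    by rewrite mulrA mulr_ge0// sge.
  by rewrite normfV normrX gtr0_norm.
have dV x : x \in `[p, q] -> 0 <= (d x)^-1 <= nu^-1.
  move=> xpq; rewrite invr_ge0 (ltW (d0 _ xpq))/=.
  by rewrite lef_pV2 ?posrE ?nud ?d0.
have bndH1 x : x \in `[p, q] -> `|H x| <= A p / nu.
  move=> xpq; have /andP[A1 A2] := A0 _ xpq; have /andP[d1 d2] := dV _ xpq.
  rewrite /H normrM (ger0_norm d1) ler_pM// normrM ger0_norm//.
  by rewrite (le_trans _ A2)// ler_piMr// sin_max.
have E2 : 2 * A p / nu = A p / nu + A p / nu by field; rewrite gt_eqF.
have bndH : `|H q - H p| <= 2 * A p / nu.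
  by rewrite E2 (le_trans (ler_normB _ _))// lerD ?bndH1.
have bndB : `|B q - B p| <= 2 * A p / nu.
  have -> : B q - B p = (A p / nu - A q / nu) + sg * (A p * ((d p)^-1 - (d q)^-1)).
    by rewrite /B; ring.
  have /andP[A1 A2] := A0 _ qin; have /andP[p1 p2] := dV _ pin.
  have /andP[q1 q2] := dV _ qin.
  rewrite E2 (le_trans (ler_normD _ _))// lerD//.
    rewrite -mulrBl normrM (ger0_norm (_ : 0 <= nu^-1)) ?invr_ge0 ?(ltW nu0)//.
    rewrite ler_wpM2r ?invr_ge0 ?(ltW nu0)// ger0_norm; first by rewrite lerBlDr lerDl.
    by rewrite subr_ge0.
  have -> : `|sg * (A p * ((d p)^-1 - (d q)^-1))| = A p * `|(d p)^-1 - (d q)^-1|.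
    by case: sg1 => ->; rewrite !normrM ?normrN normr1 mul1r ger0_norm.
  by rewrite ler_wpM2l// ler_norml; apply/andP; split; lra.
have cint x : x \in `[p, q] -> {for x, continuous (fun x => cos (phi x) * A x)}.
  by move=> xpq; apply: continuousM; [exact: ccos|exact: cA].
have up : \int[mu]_(x in `[p, q]) (cos (phi x) * A x) <= (H q + B q) - (H p + B p).
  apply: (@le_Rint_FTC p q _ (fun x => H' x + B' x) (fun x => H x + B x) pq cint).
  - by move=> x xpq; apply: continuousD; [exact: cH'|exact: cB'].
  - by move=> x xpq; apply: D_add; [exact: dH|exact: dB].
  - by move=> x xpq; have := key _ xpq; rewrite ler_norml => /andP[_]; rewrite lerBlDl.
have dn : \int[mu]_(x in `[p, q]) (cos (phi x) * A x) >= (H q - B q) - (H p - B p).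
  have cHB x : x \in `[p, q] -> {for x, continuous (fun x => H' x - B' x)}.
    by move=> xpq; apply: continuousB; [exact: cH'|exact: cB'].
  have dHB x : x \in `[p, q] -> is_derive x 1 (fun x => H x - B x) (H' x - B' x).
    by move=> xpq; apply: D_sub; [exact: dH|exact: dB].
  rewrite -(FTC2_Rint pq (cont_itv cHB) dHB).
  apply: le_Rintegral; [by []|exact: L1_cont|exact: L1_cont|].
  move=> x xpq; have := key _ xpq; rewrite ler_norml => /andP[+ _].
  by rewrite lerNl opprB lerBlDl -lerBlDr.
move: bndH bndB up dn; rewrite !ler_norml => /andP[h1 h2] /andP[b1 b2] up dn.
have -> : 4 * A p / nu = 2 * A p / nu + 2 * A p / nu by field; rewrite gt_eqF.
by lra.
Qed.

Lemma oscillatory1N (p q nu sg : R) (phi d e A A' : R -> R) : p <= q -> 0 < nu ->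
  sg = 1 \/ sg = -1 ->
  (forall x, x \in `[p, q] -> is_derive x 1 phi (d x)) ->
  (forall x, x \in `[p, q] -> is_derive x 1 d (e x)) ->
  (forall x, x \in `[p, q] -> is_derive x 1 A (A' x)) ->
  (forall x, x \in `[p, q] -> {for x, continuous e}) ->
  (forall x, x \in `[p, q] -> {for x, continuous A'}) ->
  (forall x, x \in `[p, q] -> d x <= - nu) ->
  (forall x, x \in `[p, q] -> 0 <= sg * e x) ->
  (forall x, x \in `[p, q] -> 0 <= A x <= A p) ->
  (forall x, x \in `[p, q] -> A' x <= 0) ->
  `|\int[mu]_(x in `[p, q]) (cos (phi x) * A x)| <= 4 * A p / nu.
Proof.
move=> pq nu0 sg1 dphi dd dA ce cA' nud sge A0 A'0.
under eq_Rintegral do rewrite -cosN.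
apply: (@oscillatory1 p q nu (- sg) (fun x => - phi x) (fun x => - d x)
  (fun x => - e x) A A' pq nu0).
- by case: sg1 => ->; rewrite ?opprK; [right|left].
- by move=> x /dphi; exact: D_opp.
- by move=> x /dd; exact: D_opp.
- by move=> x xpq; apply: continuousN; exact: ce.
- exact: cA'.
- by move=> x xpq; rewrite lerNr nud.
- by move=> x xpq; rewrite mulrNN sge.
- exact: A0.
- exact: A'0.
Qed.

Lemma MVT_ge p q (d e : R -> R) rho : p <= q ->
  (forall x, x \in `[p, q] -> is_derive x 1 d (e x)) ->
  (forall x, x \in `[p, q] -> rho <= e x) ->
  rho * (q - p) <= d q - d p.
Proof.
move=> pq dd re; have [c cpq ->] := @MVT_segment _ d e p q pq
  (fun x xpq => dd x (subset_itv_oo_cc xpq))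
  (cont_itv (fun x xpq => D_continuous (dd x xpq))).
by rewrite ler_wpM2r ?subr_ge0// re.
Qed.

(** Second derivative test: the derivative [d] grows at rate at least [rho], so [|d|] is at least
    [Num.sqrt rho] outside a window of radius [rho^(-1/2)] around one point. The two sides give 4
    each by the first derivative test and the window gives 2 trivially. *)
Lemma oscillatory2 (p q rho : R) (phi d e A A' : R -> R) : p <= q -> 0 < rho ->
  (forall x, x \in `[p, q] -> is_derive x 1 phi (d x)) ->
  (forall x, x \in `[p, q] -> is_derive x 1 d (e x)) ->
  (forall x, x \in `[p, q] -> is_derive x 1 A (A' x)) ->
  (forall x, x \in `[p, q] -> {for x, continuous e}) ->
  (forall x, x \in `[p, q] -> {for x, continuous A'}) ->
  (forall x, x \in `[p, q] -> rho <= e x) ->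
  (forall x, x \in `[p, q] -> 0 <= A x) ->
  (forall x, x \in `[p, q] -> A' x <= 0) ->
  `|\int[mu]_(x in `[p, q]) (cos (phi x) * A x)| <= 10 * A p / Num.sqrt rho.
Proof.
move=> pq rho0 dphi dd dA ce cA' re A0 A'0.
have pin : p \in `[p, q] by rewrite in_itv/= lexx.
have sub u v x : p <= u -> v <= q -> x \in `[u, v] -> x \in `[p, q].
  by rewrite !in_itv/= => pu vq /andP[? ?]; apply/andP; split; lra.
have Amono u v : p <= u -> u <= v -> v <= q -> A v <= A u.
  move=> pu uv vq.
  have dN x : x \in `[u, v] -> is_derive x 1 (fun x => - A x) (- A' x).
    by move=> xuv; apply/D_opp/dA; exact: sub xuv.
  have pN x : x \in `[u, v] -> 0 <= - A' x.
    by move=> xuv; rewrite oppr_ge0; apply: A'0; exact: sub xuv.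
  by have := MVT_ge uv dN pN; rewrite mul0r opprK addrC subr_ge0.
have Ap0 := A0 _ pin.
have growth u v : p <= u -> u <= v -> v <= q -> rho * (v - u) <= d v - d u.
  move=> pu uv vq.
  have dN x : x \in `[u, v] -> is_derive x 1 d (e x).
    by move=> xuv; apply: dd; exact: sub xuv.
  have pN x : x \in `[u, v] -> rho <= e x.
    by move=> xuv; apply: re; exact: sub xuv.
  exact: MVT_ge uv dN pN.
have cd : {within `[p, q], continuous d}.
  by apply: cont_itv => x xpq; exact: D_continuous (dd _ xpq).
(* [z] is the zero of [d] if it has one, and otherwise the end of the interval where [|d|] is
   smallest: [p] for positive [d], [q] for negative [d]. *)
have [z zpq [zr zl]] : exists2 z, z \in `[p, q] &
    (forall x, x \in `[p, q] -> z < x -> rho * (x - z) <= d x) /\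
    (forall x, x \in `[p, q] -> x < z -> d x <= - (rho * (z - x))).
  have zero z : z \in `[p, q] -> d z = 0 -> exists2 z, z \in `[p, q] &
    (forall x, x \in `[p, q] -> z < x -> rho * (x - z) <= d x) /\
    (forall x, x \in `[p, q] -> x < z -> d x <= - (rho * (z - x))).
    move=> zpq z0; exists z => //; move: zpq; rewrite in_itv/= => /andP[pz zq].
    split=> x; rewrite in_itv/= => /andP[px xq] H.
      by have := growth z x pz (ltW H) xq; lra.
    by have := growth x z px (ltW H) zq; lra.
  have [dp|dp] := ltP 0 (d p).
    exists p => //; split=> x; rewrite in_itv/= => /andP[px xq] H.
      by have := growth p x (lexx _) px xq; lra.
    by lra.
  have [dq|dq] := ltP (d q) 0.
    exists q; first by rewrite in_itv/= lexx andbT.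
    split=> x; rewrite in_itv/= => /andP[px xq] H; first by lra.
    by have := growth x q px xq (lexx _); lra.
  have [|z zpq z0] := @IVT _ d p q 0 pq cd.
    by rewrite ge_min dp/= le_max dq orbT.
  exact: zero z0.
set s := Num.sqrt rho.
have s0 : 0 < s by rewrite sqrtr_gt0.
have ss : rho = s * s by rewrite -expr2 sqr_sqrtr// ltW.
move: zpq; rewrite in_itv/= => /andP[pz zq].
set u := Num.max p (z - s^-1); set v := Num.min q (z + s^-1).
have sV : 0 < s^-1 by rewrite invr_gt0.
have pu : p <= u by rewrite le_max lexx.
have vq : v <= q by rewrite ge_min lexx.
have uz : u <= z by rewrite ge_max pz/= lerBlDr lerDl ltW.
have zv : z <= v by rewrite le_min zq/= lerDl ltW.
have cint x : x \in `[p, q] -> {for x, continuous (fun x => cos (phi x) * A x)}.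
  move=> xpq; apply: continuousM; last exact: D_continuous (dA _ xpq).
  apply: continuous_comp; first exact: D_continuous (dphi _ xpq).
  exact: continuous_cos.
have fi := L1_cont cint.
have fi2 : L1 `[u, q] (fun x => cos (phi x) * A x).
  by apply: L1_cont => x xuq; apply: cint; exact: sub xuq.
rewrite (@Rint_split p u q)//; last lra.
rewrite (@Rint_split u v q)//; last lra.
have b2 : `|\int[mu]_(x in `[u, v]) (cos (phi x) * A x)| <= 2 * A p / s.
  have uv : u <= v by lra.
  apply: (@le_trans _ _ (A p * (v - u))).
    apply: Rint_bound_itv => //.
      by apply: within_meas; apply: cont_itv => x xuv; apply: cint; exact: sub xuv.
    move=> x xuv; rewrite normrM -[leRHS]mul1r ler_pM//.
      by rewrite ler_norml cos_geN1 cos_le1.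
    have := sub _ _ _ pu vq xuv => xpq; rewrite ger0_norm ?A0//.
    by move: xpq; rewrite in_itv/= => /andP[px xq]; exact: Amono.
  rewrite [2 * _]mulrC -mulrA ler_wpM2l//.
  have : z - s^-1 <= u by rewrite le_max lexx orbT.
  have : v <= z + s^-1 by rewrite ge_min lexx orbT.
  by lra.
have b1 : `|\int[mu]_(x in `[p, u]) (cos (phi x) * A x)| <= 4 * A p / s.
  have [uE|upp] := eqVneq u p.
    by rewrite uE set_itv1 Rintegral_set1 normr0 divr_ge0 ?mulr_ge0// ltW.
  have uE : u = z - s^-1.
    by move: upp; rewrite /u /Num.max; case: ifP => // _; rewrite eqxx.
  have subu x : x \in `[p, u] -> x \in `[p, q] by apply: sub => //; lra.
  apply: (@oscillatory1N p u s 1 phi d e A A' pu s0 (or_introl erefl)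
     (fun x xu => dphi x (subu x xu)) (fun x xu => dd x (subu x xu))
     (fun x xu => dA x (subu x xu)) (fun x xu => ce x (subu x xu))
     (fun x xu => cA' x (subu x xu)) _ _ _ (fun x xu => A'0 x (subu x xu))).
  - move=> x xpu; have xpq := subu _ xpu.
    move: xpu; rewrite in_itv/= uE => /andP[px xu].
    apply: le_trans (zl _ xpq _) _; first by lra.
    rewrite lerN2 ss -mulrA -[leLHS]mulr1 ler_wpM2l ?(ltW s0)//.
    by rewrite -(mulfV (lt0r_neq0 s0)) ler_wpM2l ?(ltW s0)//; lra.
  - by move=> x xpu; rewrite mul1r; apply: le_trans (ltW rho0) (re _ (subu _ xpu)).
  - move=> x xpu; rewrite A0/=; last exact: subu.
    by move: xpu; rewrite in_itv/= => /andP[px xu]; apply: Amono => //; lra.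
have b3 : `|\int[mu]_(x in `[v, q]) (cos (phi x) * A x)| <= 4 * A p / s.
  have [vE|vqq] := eqVneq v q.
    by rewrite vE set_itv1 Rintegral_set1 normr0 divr_ge0 ?mulr_ge0// ltW.
  have vE : v = z + s^-1.
    by move: vqq; rewrite /v /Num.min; case: ifP => // _; rewrite eqxx.
  have pv : p <= v by lra.
  apply: (@le_trans _ _ (4 * A v / s)); last first.
    by rewrite ler_pM2r ?invr_gt0// ler_pM2l//; exact: Amono.
  have subv x : x \in `[v, q] -> x \in `[p, q] by exact: sub.
  apply: (@oscillatory1 v q s 1 phi d e A A' vq s0 (or_introl erefl)
     (fun x xu => dphi x (subv x xu)) (fun x xu => dd x (subv x xu))
     (fun x xu => dA x (subv x xu)) (fun x xu => ce x (subv x xu))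
     (fun x xu => cA' x (subv x xu)) _ _ _ (fun x xu => A'0 x (subv x xu))).
  - move=> x xv; have xpq := subv _ xv; move: xv; rewrite in_itv/= vE => /andP[vx xq].
    apply: le_trans (zr _ xpq _); last by lra.
    rewrite ss -mulrA -[leLHS]mulr1 ler_wpM2l ?(ltW s0)//.
    by rewrite -(mulfV (lt0r_neq0 s0)) ler_wpM2l ?(ltW s0)//; lra.
  - by move=> x /subv xpq; rewrite mul1r (le_trans (ltW rho0))// re.
  - move=> x xv; rewrite A0/= ?subv//.
    by move: xv; rewrite in_itv/= => /andP[vx xq]; apply: Amono => //; lra.
have -> : 10 * A p / s = 4 * A p / s + (2 * A p / s + 4 * A p / s).
  by field; rewrite gt_eqF.
rewrite (le_trans (ler_normD _ _))// lerD//.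
by rewrite (le_trans (ler_normD _ _))// lerD.
Qed.
End Calculus.

(** * Bounds for the kernel of one dyadic block *)

Section Kernel.
Variable R : realType.
Implicit Types (a b c m l x p q : R).

(** For [N > 0] the constant is [N^N]: raise [x / N <= expR (x / N)] to the power [N]. *)
Lemma powR_decay (N : R) : 0 <= N ->
  exists2 C : R, 0 < C & forall x : R, 0 < x -> expR (- x) <= C * x `^ (- N).
Proof.
rewrite le_eqVlt => /predU1P[<-|N0].
  exists 1 => // x x0; rewrite oppr0 powRr0 mulr1.
  by rewrite -[leRHS]expR0 ler_expR oppr_le0 ltW.
exists (N `^ N); first exact: powR_gt0.
move=> x x0; rewrite powRN expRN ler_pdivlMr ?powR_gt0// mulrC ler_pdivrMr ?expR_gt0//.
apply: (@le_trans _ _ ((N * expR (x / N)) `^ N)).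
  rewrite ge0_ler_powR ?nnegrE ?(ltW x0) ?(ltW N0)//.
    by rewrite mulr_ge0 ?expR_ge0// ltW.
  rewrite -ler_pdivrMl// mulrC; apply: le_trans (expR_ge1Dx _).
  by rewrite lerDr.
rewrite powRM ?expR_ge0 ?(ltW N0)// ler_pM2l ?powR_gt0//.
by rewrite {1}/powR gt_eqF ?expR_gt0// expRK mulrC divfK ?gt_eqF.
Qed.

Lemma powR_add (x r s : R) : 0 < x -> x `^ (r + s) = x `^ r * x `^ s.
Proof. by move=> x0; rewrite powRD// (gt_eqF x0) implybT. Qed.

Definition Jker m a b c l : R :=
  \int[mu]_(x in `[l, 2 * l]) (cos (a * x + b * x `^ m) * expR (- (c * x `^ m))).

Lemma D_phase m a b x : 0 < x ->
  is_derive x 1 (fun y => a * y + b * y `^ m) (a + b * (m * x `^ (m - 1))).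
Proof.
move=> x0; apply: D_add; last by apply: D_cmul; exact: is_derive1_powR.
by rewrite -[X in is_derive _ _ _ X]mulr1; apply: D_cmul; exact: is_derive_id.
Qed.

Lemma D_phase' m a b x : 0 < x ->
  is_derive x 1 (fun y => a + b * (m * y `^ (m - 1)))
    (b * (m * ((m - 1) * x `^ (m - 1 - 1)))).
Proof.
move=> x0; rewrite -[X in is_derive _ _ _ X]add0r.
exact: (D_add (is_derive_cst a x 1) (D_cmul b (D_cmul m (is_derive1_powR (m - 1) x0)))).
Qed.

Lemma D_amp m c x : 0 < x ->
  is_derive x 1 (fun y => expR (- (c * y `^ m)))
    (expR (- (c * x `^ m)) * - (c * (m * x `^ (m - 1)))).
Proof.
move=> x0; apply: D_comp; apply: D_opp; apply: D_cmul; exact: is_derive1_powR.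
Qed.

Lemma cont_powR p x : 0 < x -> {for x, continuous (fun y : R => y `^ p)}.
Proof. by move=> x0; apply: D_continuous; exact: is_derive1_powR. Qed.

Lemma cont_e m b x : 0 < x ->
  {for x, continuous (fun x => b * (m * ((m - 1) * x `^ (m - 1 - 1))))}.
Proof.
move=> x0; do 3 (apply: continuousM; first exact: cst_continuous).
exact: cont_powR.
Qed.

Lemma cont_amp' m c x : 0 < x ->
  {for x, continuous (fun x => expR (- (c * x `^ m)) * - (c * (m * x `^ (m - 1))))}.
Proof.
move=> x0; apply: continuousM; first exact: D_continuous (D_amp _ _ x0).
apply: continuousN; do 2 (apply: continuousM; first exact: cst_continuous).
exact: cont_powR.
Qed.

Lemma amp_bounds m c p x : 0 < m -> 0 <= c -> 0 < p -> p <= x ->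
  0 <= expR (- (c * x `^ m)) <= expR (- (c * p `^ m)).
Proof.
move=> m0 c0 p0 px; rewrite expR_ge0/= ler_expR lerN2 ler_wpM2l//.
by rewrite ge0_ler_powR ?nnegrE ?(ltW m0) ?(ltW p0)//; lra.
Qed.

Lemma Jker_meas m a b c p q : 0 < p ->
  measurable_fun `[p, q] (fun x => cos (a * x + b * x `^ m) * expR (- (c * x `^ m))).
Proof.
move=> p0; apply: measurable_funTS; meas.
Qed.

Lemma Jker_triv m a b c l : 0 <= c -> 0 < l -> `|Jker m a b c l| <= l.
Proof.
move=> c0 l0; rewrite /Jker -[leRHS]mul1r; have -> : l = 2 * l - l by ring.
rewrite [X in `[X, _]](_ : _ = l); last by ring.
rewrite [X in `[_, 2 * X]](_ : _ = l); last by ring.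
apply: Rint_bound_itv; [lra|exact: Jker_meas|].
move=> x; rewrite in_itv/= => /andP[lx _]; rewrite normrM -[leRHS]mul1r ler_pM//.
  by rewrite ler_norml cos_geN1 cos_le1.
rewrite ger0_norm ?expR_ge0// -[leRHS]expR0 ler_expR oppr_le0 mulr_ge0//.
exact: powR_ge0.
Qed.

(** The assumption on [b] keeps the derivative of the phase within [|a| / 2] of [a] on the whole
    block, hence of one sign and at least [|a| / 2] in size; the second derivative has the sign of
    [b]. *)
Lemma Jker_nonstat m a b c l : 1 < m -> 0 <= c -> 0 < l -> a != 0 ->
  `|b| * (m * (2 * l) `^ (m - 1)) <= `|a| / 2 -> `|Jker m a b c l| <= 8 / `|a|.
Proof.
move=> m1 c0 l0 a0 bsmall; have an0 : 0 < `|a| by rewrite normr_gt0.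
have pos x : x \in `[l, 2 * l] -> 0 < x by rewrite in_itv/= => /andP[? _]; lra.
have lq : l <= 2 * l by lra.
have nu0 : 0 < `|a| / 2 by lra.
have small x : x \in `[l, 2 * l] -> `|b * (m * x `^ (m - 1))| <= `|a| / 2.
  move=> xi; apply: le_trans bsmall; rewrite normrM ler_wpM2l//.
  have p0 := powR_ge0 x (m - 1).
  rewrite ger0_norm ?mulr_ge0//; last lra.
  rewrite ler_wpM2l//; first lra.
  have x0 := pos _ xi; move: xi; rewrite in_itv/= => /andP[_ x2l].
  by rewrite ge0_ler_powR ?nnegrE//; lra.
have -> : 8 / `|a| = 4 * 1 / (`|a| / 2) by field; rewrite gt_eqF.
apply: (@le_trans _ _ (4 * expR (- (c * l `^ m)) / (`|a| / 2))); last first.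
  rewrite ler_pM2r ?invr_gt0// ler_pM2l// -[leRHS]expR0 ler_expR oppr_le0 mulr_ge0//.
  exact: powR_ge0.
have Ab x : x \in `[l, 2 * l] -> 0 <= expR (- (c * x `^ m)) <= expR (- (c * l `^ m)).
  by rewrite in_itv/= => /andP[lx _]; apply: amp_bounds => //; lra.
have A'0 x : x \in `[l, 2 * l] ->
    expR (- (c * x `^ m)) * - (c * (m * x `^ (m - 1))) <= 0.
  move=> xi; rewrite mulrN oppr_le0 !mulr_ge0 ?expR_ge0 ?powR_ge0//; lra.
pose sg : R := if 0 <= b then 1 else -1.
have sg1 : sg = 1 \/ sg = -1 by rewrite /sg; case: ifP; [left|right].
have sge x : x \in `[l, 2 * l] -> 0 <= sg * (b * (m * ((m - 1) * x `^ (m - 1 - 1)))).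
  move=> xi; have p0 := powR_ge0 x (m - 1 - 1).
  rewrite mulrA mulr_ge0//; last by rewrite !mulr_ge0//; lra.
  by rewrite /sg; case: (leP 0 b) => H; [rewrite mul1r|rewrite mulN1r oppr_ge0 ltW].
have [ap|an] := ltP 0 a.
  apply: (oscillatory1 lq nu0 sg1 (fun x xi => D_phase m a b (pos x xi))
    (fun x xi => D_phase' m a b (pos x xi)) (fun x xi => D_amp m c (pos x xi))
    (fun x xi => @cont_e m b x (pos x xi)) (fun x xi => @cont_amp' m c x (pos x xi))
    _ sge Ab A'0).
  move=> x /small; rewrite (gtr0_norm ap) ler_norml => /andP[h _].
  by lra.
apply: (oscillatory1N lq nu0 sg1 (fun x xi => D_phase m a b (pos x xi))
    (fun x xi => D_phase' m a b (pos x xi)) (fun x xi => D_amp m c (pos x xi))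
    (fun x xi => @cont_e m b x (pos x xi)) (fun x xi => @cont_amp' m c x (pos x xi))
    _ sge Ab A'0).
move=> x /small; rewrite (ler0_norm an) ler_norml => /andP[_ h].
by lra.
Qed.

Lemma JkerN m a b c l : Jker m (- a) (- b) c l = Jker m a b c l.
Proof.
rewrite /Jker; apply: eq_Rintegral => x _; rewrite -[in RHS]cosN; congr (cos _ * _).
by ring.
Qed.

Lemma Jker_stat m : 1 < m -> exists2 C : R, 0 < C &
  forall a b c l, 0 <= c -> 0 < l -> b != 0 ->
  `|Jker m a b c l| <= C * expR (- (c * l `^ m)) * `|b| `^ (- (1/2)) * l `^ (1 - m / 2).
Proof.
(* [k] is the least value of [(x / l)^(m-2)] on the block, attained at its left or right end
   according to the sign of [m - 2]. *)
move=> m1; pose k : R := Num.min 1 (2 `^ (m - 2)).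
have k0 : 0 < k by rewrite lt_min ltr01 powR_gt0.
pose K := m * (m - 1) * k; have K0 : 0 < K by rewrite !mulr_gt0//; lra.
exists (10 * K `^ (- (1/2))); first by rewrite mulr_gt0// powR_gt0.
move=> a b c l c0 l0 b0.
wlog bpos : a b b0 / 0 < b.
  move=> H; have [bp|bn] := ltP 0 b; first exact: H.
  rewrite -JkerN -(normrN b); apply: H; first by rewrite oppr_eq0.
  by rewrite oppr_gt0 lt_neqAle b0.
have pos x : x \in `[l, 2 * l] -> 0 < x by rewrite in_itv/= => /andP[? _]; lra.
have lq : l <= 2 * l by lra.
pose rho := b * K * l `^ (m - 2).
have rho0 : 0 < rho by apply: mulr_gt0; [exact: mulr_gt0|exact: powR_gt0].
have re x : x \in `[l, 2 * l] -> rho <= b * (m * ((m - 1) * x `^ (m - 1 - 1))).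
  move=> xi; rewrite /rho -!mulrA ler_pM2l// ler_pM2l; last lra.
  rewrite ler_pM2l; last lra.
  have -> : m - 1 - 1 = m - 2 by lra.
  have x0 := pos _ xi; move: xi; rewrite in_itv/= => /andP[lx x2].
  have [m2|m2] := leP 2 m.
    apply: (@le_trans _ _ (1 * l `^ (m - 2))).
      by rewrite ler_wpM2r ?powR_ge0// /k ge_min lexx.
    by rewrite mul1r ge0_ler_powR ?nnegrE//; lra.
  apply: (@le_trans _ _ ((2 * l) `^ (m - 2))).
    rewrite powRM//; last lra.
    by rewrite ler_wpM2r ?powR_ge0// /k ge_min lexx orbT.
  have -> : m - 2 = - (2 - m) by lra.
  rewrite !powRN lef_pV2 ?posrE ?powR_gt0//; last lra.
  by rewrite ge0_ler_powR ?nnegrE//; lra.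
have A0 x : x \in `[l, 2 * l] -> 0 <= expR (- (c * x `^ m)) by rewrite expR_ge0.
have A'0 x : x \in `[l, 2 * l] ->
    expR (- (c * x `^ m)) * - (c * (m * x `^ (m - 1))) <= 0.
  move=> xi; rewrite mulrN oppr_le0 !mulr_ge0 ?expR_ge0 ?powR_ge0//; lra.
have := oscillatory2 lq rho0 (fun x xi => D_phase m a b (pos x xi))
    (fun x xi => D_phase' m a b (pos x xi)) (fun x xi => D_amp m c (pos x xi))
    (fun x xi => @cont_e m b x (pos x xi)) (fun x xi => @cont_amp' m c x (pos x xi))
    re A0 A'0.
move=> /le_trans; apply; rewrite gtr0_norm//.
have -> : (Num.sqrt rho)^-1 = K `^ (- (1/2)) * b `^ (- (1/2)) * l `^ (1 - m / 2).
  rewrite -powR12_sqrt ?(ltW rho0)// -powRN (_ : - 2^-1 = - (1/2)); last by lra.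
  rewrite /rho powRM ?powR_ge0//; last by apply: mulr_ge0; exact: ltW.
  rewrite powRM ?ltW// -powRrM (_ : (m - 2) * _ = 1 - m / 2); last by field.
  by ring.
rewrite le_eqVlt; apply/orP; left; apply/eqP; ring.
Qed.

Lemma diff_powR_le (gam t t' : R) : 0 < gam -> 0 <= t -> 0 <= t' ->
  `|t - t'| `^ gam <= t `^ gam + t' `^ gam.
Proof.
move=> g0 t0 t'0; have p1 := powR_ge0 t gam; have p2 := powR_ge0 t' gam.
have [le_t|lt_t] := leP t' t.
  rewrite ger0_norm ?subr_ge0//; apply: (@le_trans _ _ (t `^ gam)); last lra.
  by rewrite ge0_ler_powR ?nnegrE ?subr_ge0 ?(ltW g0)//; lra.
rewrite ltr0_norm ?subr_lt0// opprB; apply: (@le_trans _ _ (t' `^ gam)); last lra.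
by rewrite ge0_ler_powR ?nnegrE ?subr_ge0 ?(ltW g0) ?(ltW lt_t)//; lra.
Qed.

(** Since [b <= 1], the exponent [alpha] may be lowered to [1/m]. If [b <= l^(-m)] then
    [b^(1/m) <= l^-1]; otherwise [b^(1/m) = b b^(1/m - 1) <= b l^(m-1)], the exponent [1/m - 1]
    being negative. *)
Lemma holder_trade m alpha b l : 1 < m -> m^-1 <= alpha -> 0 <= b <= 1 -> 1 <= l ->
  b `^ alpha <= b * l `^ (m - 1) + l^-1.
Proof.
move=> m1 ma /andP[b0 b1] l1; have l0 : 0 < l by lra.
have m0 : 0 < m by lra.
have lV : 0 < l^-1 by rewrite invr_gt0.
have pl : 0 <= l `^ (m - 1) by exact: powR_ge0.
have a0 : 0 < alpha by apply: lt_le_trans ma; rewrite invr_gt0.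
have [->|bn0] := eqVneq b 0; first by rewrite powR0 ?gt_eqF// mul0r add0r ltW.
have bp : 0 < b by rewrite lt_neqAle eq_sym bn0.
have step : b `^ alpha <= b `^ m^-1 by rewrite ger_powR// bp.
apply: le_trans step _.
have [small|big] := leP b (l `^ (- m)).
  apply: (@le_trans _ _ ((l `^ (- m)) `^ m^-1)).
    by rewrite ge0_ler_powR ?nnegrE ?invr_ge0 ?powR_ge0//; lra.
  rewrite -powRrM mulNr mulfV ?gt_eqF// powRN powRr1; last lra.
  by rewrite lerDr mulr_ge0.
apply: (@le_trans _ _ (b * l `^ (m - 1))); last by lra.
rewrite -[X in X `^ _ <= _]/(b) -{2}(powRr1 b0).
have -> : l `^ (m - 1) = (l `^ (- m)) `^ (m^-1 - 1).
  by rewrite -powRrM; congr (_ `^ _); field; rewrite gt_eqF.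
have -> : m^-1 = 1 + (m^-1 - 1) by ring.
rewrite powR_add//.
rewrite (_ : 1 + (m^-1 - 1) - 1 = m^-1 - 1); last by ring.
rewrite ler_wpM2l ?powR_ge0// -(opprB 1) (powRN b) (powRN (l `^ (- m))).
rewrite lef_pV2 ?posrE ?powR_gt0//.
rewrite ge0_ler_powR ?nnegrE ?powR_ge0 ?(ltW big)//.
by rewrite subr_ge0 invf_le1// ltW.
Qed.

(** Here [u + l^-1] is of order [l^-1], so the weight is at least of order [l^(sg + th)], where
    [sg + th >= 1]: it covers the trivial bound of the kernel near the diagonal. *)
Lemma weight_small (l u M th sg : R) : 1 <= l -> 0 <= u -> u <= M / l -> 1 <= M ->
  0 <= th < 1 -> 1 - th <= sg ->
  l <= (1 + M) * (l `^ sg * (u + l^-1) `^ (- th)).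
Proof.
move=> l1 u0 small M1 /andP[th0 th1] sg1; have l0 : 0 < l by lra.
have lV : 0 < l^-1 by rewrite invr_gt0.
have ul : 0 < u + l^-1 by lra.
have lE : l `^ (1 - th) * l `^ th = l by rewrite -powR_add// subrK powRr1// ltW.
rewrite -[leLHS]lE mulrCA ler_pM ?powR_ge0//; first by rewrite ler_powR.
rewrite powRN ler_pdivlMr ?powR_gt0//.
rewrite mulrC -powRM ?(ltW ul) ?(ltW l0)//.
apply: (@le_trans _ _ ((1 + M) `^ th)); last first.
  by rewrite -[leRHS]powRr1 ?ler_powR//; lra.
have ub : (u + l^-1) * l <= 1 + M.
  by rewrite mulrDl mulVf ?gt_eqF//; move: small; rewrite ler_pdivlMr// => ?; lra.
have um : 0 <= (u + l^-1) * l by rewrite mulr_ge0// ltW.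
by rewrite ge0_ler_powR ?nnegrE//; lra.
Qed.

Lemma weight_shift (l u th : R) : 0 < l -> l^-1 < u -> 0 <= th < 1 ->
  u `^ (- th) <= 2 * (u + l^-1) `^ (- th).
Proof.
move=> l0 lu /andP[th0 th1]; have lV : 0 < l^-1 by rewrite invr_gt0.
have up : 0 < u by lra.
apply: (@le_trans _ _ (2 `^ th * (u + l^-1) `^ (- th))); last first.
  by rewrite ler_wpM2r ?powR_ge0// -[leRHS]powRr1// ler_powR//; lra.
rewrite !powRN ler_pdivlMr ?powR_gt0//; last lra.
rewrite mulrC ler_pdivrMr ?powR_gt0// -powRM ?(ltW up)//.
by rewrite ge0_ler_powR ?nnegrE//; lra.
Qed.

(** Write [u^-1] as [u^(-(1 - th)) u^(-th)] and use [u^-1 <= l] in the first factor: away from the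
    diagonal the weight covers the bound of the first derivative test. *)
Lemma weight_large (l u th sg : R) : 1 <= l -> l^-1 < u -> 0 <= th < 1 ->
  1 - th <= sg -> u^-1 <= 2 * (l `^ sg * (u + l^-1) `^ (- th)).
Proof.
move=> l1 lu th01 sg1; have l0 : 0 < l by lra.
have uW := weight_shift l0 lu th01; case/andP: th01 => th0 th1.
have lV : 0 < l^-1 by rewrite invr_gt0.
have up : 0 < u by lra.
rewrite mulrCA; apply: (@le_trans _ _ (l `^ sg * u `^ (- th))).
  apply: (@le_trans _ _ (l `^ (1 - th) * u `^ (- th))); last first.
    by rewrite ler_wpM2r ?powR_ge0// ler_powR.
  have -> : u^-1 = u `^ (- (1 - th)) * u `^ (- th).
    rewrite -powR_add// (_ : - (1 - th) + - th = -1); last by ring.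
    by rewrite powR_inv1// ltW.
  rewrite ler_wpM2r ?powR_ge0// powRN -[leLHS]mul1r ler_pdivrMr ?powR_gt0//.
  rewrite -powRM ?(ltW up) ?(ltW l0)//.
  apply: (@le_trans _ _ (1 `^ (1 - th))); first by rewrite powR1.
  have lu1 : 1 <= l * u by rewrite -ler_pdivrMl// mulr1 ltW.
  by rewrite ge0_ler_powR ?nnegrE//; lra.
by rewrite ler_wpM2l ?powR_ge0.
Qed.

(** [B] is the size of the time term in the derivative of the phase. If it is small against [u], the
    position difference [a] keeps a quarter of [C1 * u] and dominates; [m 2^m] is twice [m 2^(m-1)],
    the coefficient of that term at the right end of the block. *)
Lemma phase_dichotomy (m C1 C3 u a b l B : R) : 1 < m -> 0 < C1 -> 0 < C3 -> 1 <= l ->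
  0 < u -> B = b * l `^ (m - 1) -> 0 <= b -> C1 * u / 2 - C3 * B <= a ->
  (C1 * u / 4 <= a /\ b * (m * (2 * l) `^ (m - 1)) <= a / 2) \/
  u < 4 * (C3 + m * 2 `^ m) / C1 * B.
Proof.
move=> m1 C10 C30 l1 u0 BE b0 ha.
have z0 : 0 < 2 `^ (m - 1) :> R by exact: powR_gt0.
have zE : 2 `^ m = 2 * 2 `^ (m - 1) :> R by rewrite mulr_powRB1//; lra.
have B0 : 0 <= B by rewrite BE mulr_ge0 ?powR_ge0.
have [nonst|st] := leP ((C3 + m * 2 `^ m) * B) (C1 * u / 4); last first.
  by right; rewrite mulrAC ltr_pdivlMr//; lra.
left.
have mzB : 0 <= m * 2 `^ (m - 1) * B by rewrite !mulr_ge0// ltW//; lra.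
have CB : 0 <= C3 * B by rewrite mulr_ge0// ltW.
have QB : C3 * B + 2 * (m * 2 `^ (m - 1) * B) <= C1 * u / 4.
  by move: nonst; rewrite zE; lra.
split; first by lra.
rewrite powRM//; last lra.
have -> : b * (m * (2 `^ (m - 1) * l `^ (m - 1))) = m * 2 `^ (m - 1) * B.
  by rewrite BE; ring.
by lra.
Qed.

(** [N] is chosen so that the decay [(b^gam l^m)^(-N)] of the damping lowers the power of [b] from
    [-1/2] to exactly [- th]; then [b] is bounded below by a multiple of [u l^(1-m)]. The hypothesis
    on [sg] collects the powers of [l]. *)
Lemma stat_weight (m gam CN N Cs Cp th sg l u b c J : R) : 0 < gam -> N = (th - 1/2) / gam ->
  0 < CN -> 0 < Cs -> 0 < Cp -> 0 < l -> 1 <= l -> 0 < u -> 0 < b -> 0 <= th ->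
  th * (m - 1) + 1 - m / 2 - m * N <= sg ->
  (forall x : R, 0 < x -> expR (- x) <= CN * x `^ (- N)) ->
  J <= Cs * expR (- (c * l `^ m)) * b `^ (- (1 / 2)) * l `^ (1 - m / 2) ->
  b `^ gam <= c -> u <= Cp * (b * l `^ (m - 1)) ->
  J <= Cs * CN * Cp `^ th * (l `^ sg * u `^ (- th)).
Proof.
move=> g0 NE CN0 Cs0 Cp0 l0 l1 u0 b0 th0 sg2 decay HJ bc Bgt; apply: le_trans HJ _.
have lm : 0 < l `^ m by exact: powR_gt0.
have e1 : expR (- (c * l `^ m)) <= CN * (b `^ (- (gam * N)) * l `^ (- (m * N))).
  apply: (@le_trans _ _ (expR (- (b `^ gam * l `^ m)))).
    by rewrite ler_expR lerN2 ler_wpM2r// ltW.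
  apply: le_trans (decay _ _) _; first by rewrite mulr_gt0 ?powR_gt0.
  by rewrite powRM ?powR_ge0// -!powRrM !mulrN.
apply: (@le_trans _ _ (Cs * (CN * (b `^ (- (gam * N)) * l `^ (- (m * N))))
    * b `^ (- (1/2)) * l `^ (1 - m / 2))).
  by rewrite !ler_wpM2r ?powR_ge0// ler_wpM2l// ltW.
have -> : Cs * (CN * (b `^ (- (gam * N)) * l `^ (- (m * N)))) * b `^ (- (1/2)) *
    l `^ (1 - m / 2) = Cs * CN * (b `^ (- th) * l `^ (1 - m / 2 - m * N)).
  have -> : - th = - (gam * N) + - (1/2) by rewrite NE; field; rewrite gt_eqF.
  have -> : 1 - m / 2 - m * N = - (m * N) + (1 - m / 2) by ring.
  by rewrite !powR_add//; ring.
rewrite -!(mulrA (Cs * CN)) ler_wpM2l ?mulr_ge0 ?(ltW Cs0) ?(ltW CN0)//.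
have bth : b `^ (- th) <= Cp `^ th * (l `^ (th * (m - 1)) * u `^ (- th)).
  rewrite !powRN mulrA ler_pdivlMr ?powR_gt0// mulrC ler_pdivrMr ?powR_gt0//.
  rewrite mulrC [th * _]mulrC powRrM mulrA -!powRM ?powR_ge0 ?(ltW Cp0) ?(ltW b0)//; last first.
    by rewrite mulr_ge0// ltW.
  rewrite ge0_ler_powR ?nnegrE ?(ltW u0)//.
    by rewrite !mulr_ge0 ?powR_ge0// ltW.
  by rewrite (le_trans Bgt)// mulrA [_ * Cp]mulrC.
apply: (@le_trans _ _ (Cp `^ th * (l `^ (th * (m - 1)) * u `^ (- th)) *
  l `^ (1 - m / 2 - m * N))); first by rewrite ler_wpM2r ?powR_ge0.
have -> : Cp `^ th * (l `^ (th * (m - 1)) * u `^ (- th)) * l `^ (1 - m / 2 - m * N) =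
  Cp `^ th * (l `^ (th * (m - 1) + (1 - m / 2 - m * N)) * u `^ (- th)).
  by rewrite (powR_add (th * (m - 1)) _ l0); ring.
rewrite ler_wpM2l ?powR_ge0// ler_wpM2r ?powR_ge0// ler_powR//; lra.
Qed.

(** Three regimes: the trivial bound near the diagonal, the first derivative test when the position
    difference dominates, the second when the time difference does. The condition [1 - th <= sg]
    serves the first two and the other condition on [sg] the third. *)
Lemma kernel_bound (m gam alpha C1 C3 th sg : R) : 1 < m -> 0 < gam -> m^-1 <= alpha ->
  0 < C1 -> 0 < C3 -> 1/2 <= th < 1 -> 1 - th <= sg ->
  th * (m - 1) + 1 - m / 2 - m * ((th - 1/2) / gam) <= sg ->
  exists2 C : R, 0 < C & forall l u a t t' : R, 1 <= l -> 0 <= u ->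
    0 <= t <= 1 -> 0 <= t' <= 1 -> C1 * u - C3 * `|t - t'| `^ alpha <= `|a| ->
    `|Jker m a (t - t') (t `^ gam + t' `^ gam) l| <=
       C * (l `^ sg * (u + l^-1) `^ (- th)).
Proof.
move=> m1 g0 ma C10 C30 /andP[th1 th2] sg1 sg2.
set N := (th - 1/2) / gam in sg2.
have N0 : 0 <= N by rewrite divr_ge0//; lra.
have [CN CN0 decay] := powR_decay N0.
have [Cs Cs0 stat] := Jker_stat m1.
(* For [u > M / l] the error [C3 / l] left by [holder_trade] is at most [C1 * u / 2]; the summand 1
   ensures [u > l^-1]. *)
pose M := 1 + 2 * C3 / C1.
have M1 : 1 <= M by rewrite lerDl divr_ge0 ?mulr_ge0// ltW.
pose C' := 4 * (C3 + m * 2 `^ m) / C1.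
have C'0 : 0 < C'.
  by rewrite divr_gt0 ?mulr_gt0// addr_gt0// mulr_gt0 ?powR_gt0//; lra.
pose K1 := 32 / C1 * 2; have K10 : 0 < K1 by rewrite mulr_gt0 ?divr_gt0.
pose K2 := Cs * CN * C' `^ th * 2; have K20 : 0 < K2 by rewrite !mulr_gt0 ?powR_gt0.
exists ((1 + M) + K1 + K2); first by lra.
move=> l u a t t' l1 u0 /andP[t0 t1] /andP[t'0 t'1] ha.
have th0 : 0 <= th < 1 by apply/andP; split; lra.
have {}th1 : 0 <= th by lra.
have l0 : 0 < l by lra.
have c0 : 0 <= t `^ gam + t' `^ gam by rewrite addr_ge0 ?powR_ge0.
have bc : `|t - t'| `^ gam <= t `^ gam + t' `^ gam by exact: diff_powR_le.
have b01 : 0 <= `|t - t'| <= 1.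
  by rewrite normr_ge0 /= ler_norml; apply/andP; split; lra.
have W0 : 0 <= l `^ sg * (u + l^-1) `^ (- th) by rewrite mulr_ge0 ?powR_ge0.
rewrite (mulrDl (1 + M + K1)) (mulrDl (1 + M)).
have P1 : 0 <= (1 + M) * (l `^ sg * (u + l^-1) `^ (- th)) by rewrite mulr_ge0//; lra.
have P2 : 0 <= K1 * (l `^ sg * (u + l^-1) `^ (- th)) by rewrite mulr_ge0// ltW.
have P3 : 0 <= K2 * (l `^ sg * (u + l^-1) `^ (- th)) by rewrite mulr_ge0// ltW.
have [small|big] := leP u (M / l).
  apply: le_trans (Jker_triv _ _ _ c0 l0) _.
  apply: le_trans (weight_small l1 u0 small M1 th0 sg1) _; lra.
have lV : 0 < l^-1 by rewrite invr_gt0.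
have u_gt : l^-1 < u.
  by apply: le_lt_trans big; rewrite -[leLHS]mul1r ler_wpM2r// ltW.
have up : 0 < u by lra.
have trade := holder_trade m1 ma b01 l1.
have ha1 : C1 * u / 2 - C3 * (`|t - t'| * l `^ (m - 1)) <= `|a|.
  apply: le_trans ha.
  have h1 : C3 * `|t - t'| `^ alpha <= C3 * (`|t - t'| * l `^ (m - 1)) + C3 * l^-1.
    by rewrite -mulrDr ler_wpM2l// ltW.
  have h2 : C3 * l^-1 <= C1 * u / 2.
    have -> : C3 * l^-1 = C1 / 2 * ((2 * C3 / C1) * l^-1) by field; rewrite !gt_eqF.
    rewrite [leRHS](_ : _ = C1 / 2 * u); last by ring.
    rewrite ler_wpM2l//; first by rewrite divr_ge0// ltW.
    by apply: le_trans (ltW big); rewrite ler_wpM2r ?(ltW lV)// /M lerDr.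
  clear -h1 h2; lra.
have [[aL cond]|Bgt] := phase_dichotomy m1 C10 C30 l1 up erefl (normr_ge0 _) ha1.
  have C1u : 0 < C1 * u by rewrite mulr_gt0.
  have a0 : a != 0 by rewrite -normr_gt0; clear -aL C1u; lra.
  apply: le_trans (Jker_nonstat m1 c0 l0 a0 cond) _.
  apply: (@le_trans _ _ (K1 * (l `^ sg * (u + l^-1) `^ (- th)))); last first.
    by clear -P1 P2 P3; lra.
  apply: (@le_trans _ _ (32 / C1 * u^-1)).
    have -> : 32 / C1 * u^-1 = 8 / (C1 * u / 4) by field; rewrite !gt_eqF.
    by rewrite ler_wpM2l// lef_pV2 ?posrE//; clear -aL C1u; lra.
  rewrite /K1 -[leRHS]mulrA ler_wpM2l ?divr_ge0 ?(ltW C10)//.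
  exact: weight_large.
have b0 : t - t' != 0.
  apply: contraTN Bgt => /eqP ->; rewrite normr0 mul0r mulr0 -leNgt; exact: ltW.
have bp : 0 < `|t - t'| by rewrite normr_gt0.
apply: le_trans (stat_weight g0 erefl CN0 Cs0 C'0 l0 l1 up bp th1 sg2 decay
  (stat a _ _ _ c0 l0 b0) bc (ltW Bgt)) _.
apply: (@le_trans _ _ (K2 * (l `^ sg * (u + l^-1) `^ (- th)))); last first.
  by clear -P1 P2 P3; lra.
rewrite -[leRHS]mulrA ler_wpM2l ?mulr_ge0 ?(ltW Cs0) ?(ltW CN0) ?powR_ge0//.
by rewrite mulrCA ler_wpM2l ?powR_ge0// weight_shift.
Qed.

End Kernel.

(** * Maximal estimate *)

Section TTstar.
Variable R : realType.

(** Adjoint of the operator with kernel [C] from functions on [E] to functions on [I]. *)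
Definition dual (I : set R) (C : R * R -> R) (h : R -> R) (xi : R) : R :=
  \int[mu]_(x in I) (h x * C (x, xi)).

Lemma am_gm (e x y : R) : 0 < e -> `|x * y| <= (e * x ^+ 2 + e^-1 * y ^+ 2) / 2.
Proof.
move=> e0; have eV : 0 < e^-1 by rewrite invr_gt0.
have H (s : R) : s = 1 \/ s = -1 -> s * (x * y) <= (e * x ^+ 2 + e^-1 * y ^+ 2) / 2.
  move=> hs; have : 0 <= e^-1 * (e * x - s * y) ^+ 2 by rewrite mulr_ge0 ?sqr_ge0// ltW.
  have -> : e^-1 * (e * x - s * y) ^+ 2 =
      e * x ^+ 2 - 2 * (s * (x * y)) + e^-1 * ((s ^+ 2) * y ^+ 2).
    by field; rewrite gt_eqF.
  have -> : s ^+ 2 = 1 by case: hs => ->; rewrite ?expr1n// sqrrN expr1n.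
  by lra.
rewrite ler_norml; apply/andP; split.
  by have := H (-1) (or_intror erefl); lra.
by have := H 1 (or_introl erefl); lra.
Qed.

Variables (I E : set R) (C : R * R -> R) (h g1 : R -> R).
Hypothesis mI : measurable I.
Hypothesis mE : measurable E.
Hypothesis Ioo : (mu I < +oo)%E.
Hypothesis Eoo : (mu E < +oo)%E.
Hypothesis mC : measurable_fun setT C.
Hypothesis C1 : forall z, `|C z| <= 1.
Hypothesis mh : measurable_fun setT h.
Hypothesis h1 : forall x, `|h x| <= 1.

Let cst1 (D : set R) : measurable D -> (mu D < +oo)%E -> L1 D (fun=> 1 : R).
Proof. by move=> mD Doo; apply: (@L1_bounded _ _ _ 1) => // x _; rewrite normr1. Qed.

Let mC1 (x : R) : measurable_fun setT (fun y => C (x, y)).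
Proof. exact: (measurableT_comp mC (pair1_measurable x)). Qed.
Let mC2 (y : R) : measurable_fun setT (fun x => C (x, y)).
Proof. exact: (measurableT_comp mC (pair2_measurable y)). Qed.


Let mI1 : \int[mu]_(x in I) (1 : R) = fine (mu I).
Proof. by rewrite Rintegral_cst// mul1r. Qed.

Let hC xi : L1 I (fun x => h x * C (x, xi)).
Proof.
apply: (@L1_bounded _ _ _ 1) => //.
  by apply: measurable_funM; apply: measurable_funTS.
by move=> x _; rewrite normrM mulr_ile1.
Qed.

Let mhC : measurable_fun setT (fun z : R * R => h z.1 * C z).
Proof.
by apply: measurable_funM => //; apply: (measurableT_comp mh); exact: measurable_fst.
Qed.

Lemma dual_L1 : L1 E (dual I C h).
Proof.
have [] := @Fubini_Rint _ I E (fun z => h z.1 * C z) (fun=> 1) (fun=> 1) mI mE mhC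
  (cst1 mI Ioo) (cst1 mE Eoo) _ => //.
by move=> x y _ _; rewrite mulr1 normrM mulr_ile1.
Qed.

Lemma dual_pairing : L1 E g1 -> 
  [/\ L1 I (fun x => h x * \int[mu]_(xi in E) (C (x, xi) * g1 xi)) ,
  L1 E (fun xi => dual I C h xi * g1 xi) &
  \int[mu]_(x in I) (h x * \int[mu]_(xi in E) (C (x, xi) * g1 xi)) =
  \int[mu]_(xi in E) (dual I C h xi * g1 xi)].
Proof.
move=> ig; have mg : measurable_fun setT (g1 \_ E).
  by apply/(measurable_restrictT _ mE); exact: L1_meas.
have [] := @Fubini_Rint _ I E (fun z => h z.1 * C z * (g1 \_ E) z.2) (fun=> 1)
   (fun xi => `|g1 xi|) mI mE _ (cst1 mI Ioo) (L1_norm mE ig) _.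
- apply: measurable_funM => //; apply: (measurableT_comp mg); exact: measurable_snd.
- move=> x y _ Ey; rewrite /= patchE (mem_set Ey) mul1r normrM ler_piMl//.
  by rewrite normrM mulr_ile1.
have E1 x : \int[mu]_(y in E) (h x * C (x, y) * (g1 \_ E) y) =
    h x * \int[mu]_(xi in E) (C (x, xi) * g1 xi).
  rewrite -RintegralZl//; last first.
    apply: (@L1_mulb _ _ _ _ 1) => //; exact: measurable_funTS.
  by apply: eq_Rintegral => y yE; rewrite patchE yE mulrA.
have E2 y : y \in E -> \int[mu]_(x in I) (h x * C (x, y) * (g1 \_ E) y) = dual I C h y * g1 y.
  move=> yE; transitivity (\int[mu]_(x in I) (h x * C (x, y) * g1 y)).
    by apply: eq_Rintegral => x _; rewrite patchE yE.
  by rewrite (RintZr _ mI (hC y)).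
move=> L1I L1E eqF; split.
- by move: L1I; under [X in L1 I X]eq_fun do rewrite E1.
- apply: eq_integrable L1E => //.
  by move=> y yE /=; rewrite E2.
- transitivity (\int[mu]_(x in I) \int[mu]_(y in E) (h x * C (x, y) * (g1 \_ E) y)).
    by apply: eq_Rintegral => x _; rewrite E1.
  by rewrite [LHS]eqF; apply: eq_Rintegral => y yE; exact: E2.
Qed.

End TTstar.
Local Opaque dual.

Section TTstar2.
Variable R : realType.
Variables (I E : set R) (C S : R * R -> R) (h g1 g2 : R -> R) (k : R -> R -> R) (B : R).
Hypothesis mI : measurable I.
Hypothesis mE : measurable E.
Hypothesis Ioo : (mu I < +oo)%E.
Hypothesis Eoo : (mu E < +oo)%E.
Hypothesis mC : measurable_fun setT C.
Hypothesis mS : measurable_fun setT S.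
Hypothesis C1 : forall z, `|C z| <= 1.
Hypothesis S1 : forall z, `|S z| <= 1.
Hypothesis mh : measurable_fun setT h.
Hypothesis h1 : forall x, `|h x| <= 1.
Hypothesis kL1 : forall y, I y -> L1 I (k ^~ y).
Hypothesis kB : forall y, I y -> \int[mu]_(x in I) k x y <= B.
Hypothesis Kk : forall x y, I x -> I y ->
  `|\int[mu]_(xi in E) (C (x, xi) * C (y, xi)) +
    \int[mu]_(xi in E) (S (x, xi) * S (y, xi))| <= k x y.


Let slice (D : R * R -> R) : measurable_fun setT D -> (forall z, `|D z| <= 1) ->
  forall y, L1 E (fun xi => D (y, xi)).
Proof.
move=> mD D1 y; apply: (@L1_bounded _ _ _ 1) => //.
apply: measurable_funTS; exact: (measurableT_comp mD (pair1_measurable y)).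
Qed.

Let dual_sq (D : R * R -> R) : measurable_fun setT D -> (forall z, `|D z| <= 1) ->
  [/\ L1 E (dual I D h), L1 E (fun xi => dual I D h xi ^+ 2),
   L1 I (fun y => h y * \int[mu]_(xi in E) (D (y, xi) * dual I D h xi)),
   \int[mu]_(y in I) (h y * \int[mu]_(xi in E) (D (y, xi) * dual I D h xi)) =
     \int[mu]_(xi in E) (dual I D h xi ^+ 2) &
   forall y, L1 I (fun x => h x * \int[mu]_(xi in E) (D (x, xi) * D (y, xi))) /\
    \int[mu]_(x in I) (h x * \int[mu]_(xi in E) (D (x, xi) * D (y, xi))) =
    \int[mu]_(xi in E) (D (y, xi) * dual I D h xi)].
Proof.
move=> mD D1; have pL := dual_L1 mI mE Ioo Eoo mD D1 mh h1.
have [a1 a2 a3] := dual_pairing mI mE Ioo mD D1 mh h1 pL.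
split.
- exact: pL.
- by apply: eq_integrable a2 => // xi _ /=; rewrite expr2.
- exact: a1.
- by rewrite a3; apply: eq_Rintegral => xi _; rewrite expr2.
- move=> y; have [b1 b2 b3] := dual_pairing mI mE Ioo mD D1 mh h1 (slice mD D1 y).
  by split; [exact: b1|rewrite b3; apply: eq_Rintegral => xi _; rewrite mulrC].
Qed.

(** Expanding the squares turns the left side into the double integral of [h x * h y] against the
    kernel bounded by [k]; integrating in one variable first is Schur's test. The cosine and sine
    operators are added before absolute values are taken, because only the sum of their kernels is
    the cosine of a phase difference. *)
Lemma dual_norm : \int[mu]_(xi in E) (dual I C h xi ^+ 2) + \int[mu]_(xi in E) (dual I S h xi ^+ 2)
  <= B * fine (mu I).
Proof.
have [_ _ c1 c2 c3] := dual_sq mC C1; have [_ _ s1 s2 s3] := dual_sq mS S1.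
rewrite -c2 -s2 -(RintD mI c1 s1).
apply: (@le_trans _ _ (\int[mu]_(y in I) (cst B y))); last first.
  by rewrite (Rintegral_cst mu mI).
have BL : L1 I (cst B).
  by apply: (@L1_bounded _ _ _ `|B|).
apply: (Rint_le mI (L1D mI c1 s1) BL).
move=> y Iy; rewrite -mulrDr; have [cy <-] := c3 y; have [sy <-] := s3 y.
rewrite -(RintD mI cy sy); apply: le_trans (ler_norm _) _; rewrite normrM.
apply: le_trans (ler_piMl (normr_ge0 _) (h1 y)) _.
apply: le_trans (kB Iy); apply: (norm_Rint_le mI (L1D mI cy sy) (kL1 Iy)).
by move=> x Ix; rewrite -mulrDr normrM (le_trans (ler_piMl _ (h1 x)))// Kk.
Qed.

(* Duality against [h], then Young's inequality with weight [e] instead of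
   Cauchy-Schwarz. *)
Lemma TTstar_bound (e : R) : 0 < e -> L1 E g1 -> L1 E g2 ->
  L1 E (fun xi => g1 xi ^+ 2) -> L1 E (fun xi => g2 xi ^+ 2) ->
  L1 I (fun x => h x * \int[mu]_(xi in E) (C (x, xi) * g1 xi - S (x, xi) * g2 xi)) /\
  `|\int[mu]_(x in I) (h x * \int[mu]_(xi in E) (C (x, xi) * g1 xi - S (x, xi) * g2 xi))|
   <= (e * (B * fine (mu I)) +
       e^-1 * (\int[mu]_(xi in E) (g1 xi ^+ 2) + \int[mu]_(xi in E) (g2 xi ^+ 2))) / 2.
Proof.
move=> e0 i1 i2 i11 i22.
have [pc c0 _ _ _] := dual_sq mC C1; have [ps s0 _ _ _] := dual_sq mS S1.
have [c1 c2 c3] := dual_pairing mI mE Ioo mC C1 mh h1 i1.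
have [s1 s2 s3] := dual_pairing mI mE Ioo mS S1 mh h1 i2.
have split_int x : h x * \int[mu]_(xi in E) (C (x, xi) * g1 xi - S (x, xi) * g2 xi) =
  h x * \int[mu]_(xi in E) (C (x, xi) * g1 xi) -
  h x * \int[mu]_(xi in E) (S (x, xi) * g2 xi).
  rewrite -mulrBr (RintB mE)//; apply: (@L1_mulb _ _ _ _ 1) => //.
    apply: measurable_funTS; exact: (measurableT_comp mC (pair1_measurable x)).
  apply: measurable_funTS; exact: (measurableT_comp mS (pair1_measurable x)).
under [X in L1 I X]eq_fun do rewrite split_int.
under eq_Rintegral do rewrite split_int.
split; first exact: (L1B mI c1 s1).
rewrite (RintB mI c1 s1) c3 s3 -(RintB mE c2 s2).
have P1 := L1Zl (e / 2) mE (L1D mE c0 s0); have P2 := L1Zl (e^-1 / 2) mE (L1D mE i11 i22).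
apply: (@le_trans _ _ (\int[mu]_(xi in E) (e / 2 * (dual I C h xi ^+ 2 + dual I S h xi ^+ 2) +
   e^-1 / 2 * (g1 xi ^+ 2 + g2 xi ^+ 2)))).
  apply: (norm_Rint_le mE (L1B mE c2 s2) (L1D mE P1 P2)).
  move=> xi _; apply: le_trans (ler_normB _ _) _.
  have := lerD (am_gm (dual I C h xi) (g1 xi) e0) (am_gm (dual I S h xi) (g2 xi) e0).
  by move/le_trans; apply; rewrite le_eqVlt; apply/orP; left; apply/eqP; field; rewrite gt_eqF.
rewrite (RintD mE P1 P2) (RintZl _ mE (L1D mE c0 s0)) (RintZl _ mE (L1D mE i11 i22)).
rewrite (RintD mE c0 s0) (RintD mE i11 i22).
have := dual_norm; have e2 : 0 <= e / 2 by lra.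
move=> /(ler_wpM2l e2) dn; rewrite mulrDl.
apply: lerD; last by rewrite mulrAC.
by apply: le_trans dn _; rewrite mulrAC.
Qed.

End TTstar2.

(** * Maximal bound for one dyadic block *)

Section Pieces.
Variable R : realType.
Variables (m gam : R).

Definition phase (G u xi : R) : R := G * xi + u * `|xi| `^ m.
Definition damp (u xi : R) : R := expR (- (u `^ gam * `|xi| `^ m)).
(** For the transform [g1 + i g2] this is [2 pi] times the real part of the damped operator with
    frequencies in [E]; the pair [(g2, - g1)] gives the imaginary part. *)
Definition osc (E : set R) (g1 g2 : R -> R) (G u : R) : R :=
  \int[mu]_(xi in E)
    (cos (phase G u xi) * damp u xi * g1 xi - sin (phase G u xi) * damp u xi * g2 xi).

Lemma damp_le1 u xi : 0 <= damp u xi <= 1.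
Proof.
rewrite expR_ge0/= -[leRHS]expR0 ler_expR oppr_le0 mulr_ge0 ?powR_ge0//.
Qed.

Lemma cos_damp_le1 G u xi : `|cos (phase G u xi) * damp u xi| <= 1.
Proof.
have /andP[d0 d1] := damp_le1 u xi.
by rewrite normrM (ger0_norm d0) mulr_ile1// ler_norml cos_geN1 cos_le1.
Qed.

Lemma sin_damp_le1 G u xi : `|sin (phase G u xi) * damp u xi| <= 1.
Proof.
have /andP[d0 d1] := damp_le1 u xi.
by rewrite normrM (ger0_norm d0) mulr_ile1// sin_max.
Qed.

Lemma meas_phase (G u : R -> R) : measurable_fun setT G -> measurable_fun setT u ->
  measurable_fun setT (fun z : R * R => phase (G z.1) (u z.1) z.2).
Proof.
move=> mG mU; apply: measurable_funD; apply: measurable_funM.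
- exact: (measurableT_comp mG measurable_fst).
- exact: measurable_snd.
- exact: (measurableT_comp mU measurable_fst).
- apply: (measurableT_comp (@measurable_powR R m)).
  exact: (measurableT_comp (@normr_measurable R setT) measurable_snd).
Qed.

Lemma meas_damp (u : R -> R) : measurable_fun setT u ->
  measurable_fun setT (fun z : R * R => damp (u z.1) z.2).
Proof.
move=> mU; apply: (measurableT_comp (@measurable_expR R)).
apply: (measurableT_comp (@oppr_measurable R setT)); apply: measurable_funM.
- apply: (measurableT_comp (@measurable_powR R gam)).
  exact: (measurableT_comp mU measurable_fst).
- apply: (measurableT_comp (@measurable_powR R m)).
  exact: (measurableT_comp (@normr_measurable R setT) measurable_snd).
Qed.

Lemma meas_cos_damp (G u : R -> R) : measurable_fun setT G -> measurable_fun setT u ->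
  measurable_fun setT (fun z : R * R => cos (phase (G z.1) (u z.1) z.2) * damp (u z.1) z.2).
Proof.
move=> mG mU; apply: measurable_funM; last exact: meas_damp.
by apply: (measurableT_comp (@measurable_cos R)); exact: meas_phase.
Qed.

Lemma meas_sin_damp (G u : R -> R) : measurable_fun setT G -> measurable_fun setT u ->
  measurable_fun setT (fun z : R * R => sin (phase (G z.1) (u z.1) z.2) * damp (u z.1) z.2).
Proof.
move=> mG mU; apply: measurable_funM; last exact: meas_damp.
by apply: (measurableT_comp (@measurable_sin R)); exact: meas_phase.
Qed.

Lemma meas_cos_damp1 (G u : R) :
  measurable_fun setT (fun xi : R => cos (phase G u xi) * damp u xi).
Proof.
exact: (measurableT_comp (meas_cos_damp (measurable_cst G) (measurable_cst u))
  (pair1_measurable (0 : R))).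
Qed.

Lemma meas_sin_damp1 (G u : R) :
  measurable_fun setT (fun xi : R => sin (phase G u xi) * damp u xi).
Proof.
exact: (measurableT_comp (meas_sin_damp (measurable_cst G) (measurable_cst u))
  (pair1_measurable (0 : R))).
Qed.

Lemma itv_lty (a b : R) : (mu `[a, b] < +oo)%E.
Proof.
by rewrite /= lebesgue_measure_itv; case: ifPn => // _; rewrite -EFinD ltry.
Qed.

Lemma L1_itv_1 (a b : R) (f : R -> R) : measurable_fun setT f -> (forall x, `|f x| <= 1) ->
  L1 `[a, b] f.
Proof.
by move=> mf f1; apply: (@L1_itv_bounded _ _ _ _ 1) => //; exact: measurable_funTS.
Qed.

Lemma kern_sum (a b : R) (G G' u u' : R) :
  \int[mu]_(xi in `[a, b]) ((cos (phase G u xi) * damp u xi) * (cos (phase G' u' xi) * damp u' xi)) +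
  \int[mu]_(xi in `[a, b]) ((sin (phase G u xi) * damp u xi) * (sin (phase G' u' xi) * damp u' xi)) =
  \int[mu]_(xi in `[a, b]) (cos ((G - G') * xi + (u - u') * `|xi| `^ m) *
     expR (- ((u `^ gam + u' `^ gam) * `|xi| `^ m))).
Proof.
rewrite -RintD//.
- apply: eq_Rintegral => xi _.
  have -> : (G - G') * xi + (u - u') * `|xi| `^ m = phase G u xi - phase G' u' xi.
    by rewrite /phase; ring.
  rewrite cosB (_ : - ((u `^ gam + u' `^ gam) * `|xi| `^ m) =
    - (u `^ gam * `|xi| `^ m) + - (u' `^ gam * `|xi| `^ m)); last by ring.
  by rewrite expRD /damp; ring.
- apply: L1_itv_1; first by apply: measurable_funM; exact: meas_cos_damp1.
  by move=> x; rewrite normrM mulr_ile1// cos_damp_le1.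
- apply: L1_itv_1; first by apply: measurable_funM; exact: meas_sin_damp1.
  by move=> x; rewrite normrM mulr_ile1// sin_damp_le1.
Qed.

Lemma kern_pos (l a b c : R) : 0 < l ->
  \int[mu]_(xi in `[l, 2 * l]) (cos (a * xi + b * `|xi| `^ m) * expR (- (c * `|xi| `^ m)))
  = Jker m a b c l.
Proof.
move=> l0; apply: eq_Rintegral => x; rewrite inE/= in_itv/= => /andP[lx _].
by rewrite ger0_norm//; lra.
Qed.

Lemma cont_norm (f : R -> R) (x : R) : {for x, continuous f} ->
  {for x, continuous (fun y => `|f y|)}.
Proof. by move=> cf; apply: cvg_norm. Qed.

Lemma cont_comp_powR (p : R) (f : R -> R) (x : R) : 0 < f x -> {for x, continuous f} ->
  {for x, continuous (fun y => f y `^ p)}.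
Proof.
move=> fx cf; apply: (@continuous_comp _ _ _ f (fun y => y `^ p)) => //.
exact: cont_powR.
Qed.

Lemma Rint_reflect (a b : R) (f : R -> R) : a <= b ->
  {within `[- b, - a], continuous f} ->
  \int[mu]_(x in `[- b, - a]) f x = \int[mu]_(x in `[a, b]) f (- x).
Proof. by move=> ab cf; rewrite /Rintegral integration_by_substitution_oppr. Qed.

Lemma kern_neg (l a b c : R) : 0 < l ->
  \int[mu]_(xi in `[- (2 * l), - l]) (cos (a * xi + b * `|xi| `^ m) * expR (- (c * `|xi| `^ m)))
  = Jker m (- a) b c l.
Proof.
move=> l0; rewrite Rint_reflect; first last.
- apply: cont_itv => x; rewrite in_itv/= => /andP[_ xl].
  have xn0 : x < 0 by lra.
  have cn : {for x, continuous (fun x : R => `|x| `^ m)}.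
    apply: cont_comp_powR; first by rewrite normr_gt0 lt_eqF.
    exact: norm_continuous.
  apply: continuousM.
    apply: (@continuous_comp _ _ _ _ (@cos R)); last exact: continuous_cos.
    apply: continuousD; first by apply: continuousM => //; exact: cst_continuous.
    by apply: continuousM => //; exact: cst_continuous.
  apply: (@continuous_comp _ _ _ _ (@expR R)); last exact: continuous_expR.
  by apply: continuousN; apply: continuousM => //; exact: cst_continuous.
- lra.
apply: eq_Rintegral => x; rewrite inE/= in_itv/= => /andP[lx _].
by rewrite normrN ger0_norm ?mulrN ?mulNr//; lra.
Qed.

(** The condition [th < 1] makes the singularity integrable uniformly in [l]. Each side of [y]
    contributes at most [2 / (1 - th)], since [(z + l^-1)^(1 - th) <= 2] for [z <= 1]. *)
Lemma weight_integral (th A y l : R) : 0 <= th < 1 -> 1 <= l -> y \in `[A, A + 1] ->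
  L1 `[A, A + 1] (fun x => (`|x - y| + l^-1) `^ (- th)) /\
  \int[mu]_(x in `[A, A + 1]) (`|x - y| + l^-1) `^ (- th) <= 4 / (1 - th).
Proof.
move=> /andP[th0 th1] l1; rewrite in_itv/= => /andP[Ay yA].
have l0 : 0 < l by lra.
have lV : 0 < l^-1 by rewrite invr_gt0.
have lV1 : l^-1 <= 1 by rewrite invf_le1.
have pos x : 0 < `|x - y| + l^-1 by rewrite ltr_wpDl.
have c x : {for x, continuous (fun x => (`|x - y| + l^-1) `^ (- th))}.
  apply: cont_comp_powR => //; apply: continuousD; last exact: cst_continuous.
  by apply: cont_norm; apply: continuousB => //; exact: cst_continuous.
have Li a b : L1 `[a, b] (fun x => (`|x - y| + l^-1) `^ (- th)).
  by apply: L1_cont => x _.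
split => //.
have s0 : 0 < 1 - th by lra.
have H (z : R) : 0 <= z -> z <= 1 -> (z + l^-1) `^ (1 - th) / (1 - th) <= 2 / (1 - th).
  move=> z0 z1; rewrite ler_pM2r ?invr_gt0//.
  apply: (@le_trans _ _ (2 `^ (1 - th))).
    by rewrite ge0_ler_powR ?nnegrE//; lra.
  by rewrite -[leRHS]powRr1// ler_powR//; lra.
(* The sign [s] gives one primitive for both sides of [y], where [|x - y|] is [s * (x - y)]. *)
have dp (x : R) s : s * s = 1 -> 0 < s * (x - y) + l^-1 ->
    is_derive x 1 (fun x => s * ((s * (x - y) + l^-1) `^ (1 - th) / (1 - th)))
     ((s * (x - y) + l^-1) `^ (- th)).
  move=> ss p0.
  have h1 : is_derive x 1 (fun x => s * (x - y) + l^-1) s.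
    apply: is_derive_eq (D_add (D_cmul s (D_sub (is_derive_id x (1 : R))
      (is_derive_cst y x 1))) (is_derive_cst l^-1 x 1)) _.
    by rewrite subr0 mulr1 addr0.
  have h2 := D_cmul s (D_cmul ((1 - th)^-1)
    (@D_comp R (fun z => z `^ (1 - th)) (fun x => s * (x - y) + l^-1) x _ _
      (is_derive1_powR (1 - th) p0) h1)).
  rewrite (_ : (fun x => _) = (fun x => s * ((1 - th)^-1 * (s * (x - y) + l^-1) `^ (1 - th)))).
    apply: is_derive_eq h2 _.
    rewrite (_ : 1 - th - 1 = - th); last by ring.
    transitivity (s * s * (s * (x - y) + l^-1) `^ (- th)); last by rewrite ss mul1r.
    by field; rewrite gt_eqF.
  by apply/funext => z; rewrite [_ / (1 - th)]mulrC.
have cs s (x : R) : 0 < s * (x - y) + l^-1 ->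
    {for x, continuous (fun x => (s * (x - y) + l^-1) `^ (- th))}.
  move=> p0; apply: cont_comp_powR => //; apply: continuousD; last exact: cst_continuous.
  apply: continuousM; first exact: cst_continuous.
  by apply: continuousB => //; exact: cst_continuous.
rewrite (Rint_split Ay yA (Li _ _)).
have ss1 : 1 * 1 = 1 :> R by ring.
have ssN : (-1) * (-1) = 1 :> R by ring.
have F0 : 0 <= l^-1 `^ (1 - th) / (1 - th) by rewrite divr_ge0 ?powR_ge0// ltW.
have E1 : \int[mu]_(x in `[A, y]) (`|x - y| + l^-1) `^ (- th) <= 2 / (1 - th).
  rewrite (@Rint_eq _ _ _ (fun x => (-1 * (x - y) + l^-1) `^ (- th))); last first.
    move=> x; rewrite /= in_itv/= => /andP[_ xy].
    by rewrite ler0_norm ?mulN1r// subr_le0.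
  have ppos x : x \in `[A, y] -> 0 < -1 * (x - y) + l^-1.
    by rewrite in_itv/= => /andP[_ xy]; lra.
  rewrite (FTC2_Rint Ay (cont_itv (fun x xi => cs (-1) x (ppos x xi)))
     (fun x xi => dp x (-1) ssN (ppos x xi))).
  rewrite subrr mulr0 add0r !mulN1r opprK (opprB A) -[leLHS]addrC.
  by apply: le_trans (H (y - A) _ _); lra.
have E2 : \int[mu]_(x in `[y, A + 1]) (`|x - y| + l^-1) `^ (- th) <= 2 / (1 - th).
  rewrite (@Rint_eq _ _ _ (fun x => (1 * (x - y) + l^-1) `^ (- th))); last first.
    move=> x; rewrite /= in_itv/= => /andP[xy _].
    by rewrite ger0_norm ?mul1r// subr_ge0.
  have ppos x : x \in `[y, A + 1] -> 0 < 1 * (x - y) + l^-1.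
    by rewrite in_itv/= => /andP[xy _]; lra.
  rewrite (FTC2_Rint yA (cont_itv (fun x xi => cs 1 x (ppos x xi)))
     (fun x xi => dp x 1 ss1 (ppos x xi))).
  rewrite subrr mulr0 add0r !mul1r.
  by apply: le_trans (H (A + 1 - y) _ _); lra.
apply: le_trans (lerD E1 E2) _; rewrite -mulrDl.
by rewrite (_ : 2 + 2 = 4)//; ring.
Qed.

(** For [s > 1/4] the choice [th = 1/2], which uses no decay of the damping, is enough. Otherwise
    [th] is taken close to 1 but below it, since the weight must stay integrable uniformly in
    [l]. *)
Lemma scrit_params (s : R) : 1 < m -> 0 < gam -> scrit m gam < s ->
  exists sg th : R, [/\ 0 <= sg, sg < 2 * s, 1/2 <= th < 1, 1 - th <= sg &
    th * (m - 1) + 1 - m / 2 - m * ((th - 1/2) / gam) <= sg].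
Proof.
move=> m1 g0; rewrite /scrit => hs.
have [s4|s4] := ltP (1/4) s.
  exists (1/2), (1/2); split; [lra|lra| |lra|].
    by apply/andP; split; lra.
  by rewrite subrr mul0r mulr0; lra.
move: hs; rewrite gt_min => /orP[hs|hs]; first by lra.
set w := m / 4 * _ in hs.
have w1 : m / 4 * (1 - gam^-1) <= w by rewrite ler_wpM2l ?le_max ?lexx//; lra.
have w0 : 0 <= w by rewrite mulr_ge0 ?le_max ?lexx ?orbT//; lra.
(* With [th = 1 - d] the exponent exceeds [2 w] by at most [d m / gam], which the last term of the
   minimum keeps below [s - w]; hence [sg = w + s], which is still below [2 s]. The first term gives
   [th >= 1/2] and the second [1 - th <= sg]. *)
pose d := Num.min (1/2) (Num.min (s - w) ((s - w) * (gam / m))).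
have gm0 : 0 < gam / m by rewrite divr_gt0//; lra.
have d0 : 0 < d.
  by rewrite !lt_min; apply/and3P; split; [lra|lra|rewrite mulr_gt0//; lra].
have d1 : d <= 1/2 by rewrite ge_min lexx.
have d2 : d <= s - w by rewrite !ge_min lexx orbT.
have d3 : d <= (s - w) * (gam / m) by rewrite !ge_min lexx !orbT.
exists (w + s), (1 - d); split; [lra|lra| |lra|].
  by apply/andP; split; lra.
have -> : (1 - d) * (m - 1) + 1 - m / 2 - m * ((1 - d - 1 / 2) / gam) =
  2 * (m / 4 * (1 - gam^-1)) - d * (m - 1) + d / (gam / m).
  by field; apply/andP; split; rewrite gt_eqF//; lra.
have h1 : d / (gam / m) <= s - w by rewrite ler_pdivrMr.
have h2 : 0 <= d * (m - 1) by rewrite mulr_ge0//; lra.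
by lra.
Qed.

Section PieceBound.
Variables (Gam : R -> R -> R) (alpha C1 C3 : R).
Hypothesis m1 : 1 < m.
Hypothesis g0 : 0 < gam.
Hypothesis ma : m^-1 <= alpha.
Hypothesis C10 : 0 < C1.
Hypothesis C30 : 0 < C3.
Hypothesis GamL : forall t x x', 0 <= t <= 1 -> C1 * `|x - x'| <= `|Gam x t - Gam x' t|.
Hypothesis GamH : forall x t t', 0 <= t <= 1 -> 0 <= t' <= 1 ->
  `|Gam x t - Gam x t'| <= C3 * `|t - t'| `^ alpha.

Lemma Gam_separation x y t t' : 0 <= t <= 1 -> 0 <= t' <= 1 ->
  C1 * `|x - y| - C3 * `|t - t'| `^ alpha <= `|Gam x t - Gam y t'|.
Proof.
move=> h h'; have l := GamL x y h; have r := GamH y h h'.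
have -> : Gam x t - Gam y t' = (Gam x t - Gam y t) - (- (Gam y t - Gam y t')) by ring.
apply: le_trans (lerB_dist _ _); rewrite normrN; lra.
Qed.

Lemma piece_bound (s : R) (A : R) : scrit m gam < s -> exists C kappa : R,
  [/\ 0 < C, 0 < kappa & forall (l : R) (b : bool) (g1 g2 u : R -> R) (H : R),
   1 <= l -> 
   let E := if b then `[l, 2 * l]%classic else `[- (2 * l), - l]%classic in
   L1 E g1 -> L1 E g2 -> L1 E (fun xi => g1 xi ^+ 2) -> L1 E (fun xi => g2 xi ^+ 2) ->
   \int[mu]_(xi in E) (g1 xi ^+ 2) + \int[mu]_(xi in E) (g2 xi ^+ 2) <= l `^ (- (2 * s)) * H ->
   measurable_fun setT u -> measurable_fun setT (fun x => Gam x (u x)) ->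
   (forall x, 0 <= u x <= 1) ->
   L1 `[A, A + 1] (fun x => osc E g1 g2 (Gam x (u x)) (u x)) /\
   \int[mu]_(x in `[A, A + 1]) `|osc E g1 g2 (Gam x (u x)) (u x)| <=
     C * l `^ (- kappa) * (1 + H)].
Proof.
move=> hs; have [sg [th [sg0 sgs th12 th1 th2]]] := scrit_params m1 g0 hs.
have [Ck Ck0 kb] := kernel_bound m1 g0 ma C10 C30 th12 th1 th2.
have th01 : 0 <= th < 1 by case/andP: th12 => ? ?; apply/andP; split; lra.
have th10 : 0 < 1 - th by case/andP: th01; lra.
pose B := Ck * (4 / (1 - th)); have B0 : 0 < B by rewrite mulr_gt0 ?divr_gt0.
exists (B + 1), (s - sg / 2); split; [lra|lra|].
move=> l b g1 g2 u H l1 E i1 i2 i11 i22 iH mU mG u01.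
have l0 : 0 < l by lra.
have mE : measurable E by rewrite /E; case: b {E i1 i2 i11 i22 iH}.
have Eoo : (mu E < +oo)%E by rewrite /E; case: b {E i1 i2 i11 i22 iH mE}; exact: itv_lty.
pose C z := cos (phase (Gam z.1 (u z.1)) (u z.1) z.2) * damp (u z.1) z.2.
pose S z := sin (phase (Gam z.1 (u z.1)) (u z.1) z.2) * damp (u z.1) z.2.
have mC : measurable_fun setT C by exact: meas_cos_damp mG mU.
have mS : measurable_fun setT S by exact: meas_sin_damp mG mU.
have C1' z : `|C z| <= 1 by exact: cos_damp_le1.
have S1' z : `|S z| <= 1 by exact: sin_damp_le1.
pose k (x y : R) := Ck * l `^ sg * (`|x - y| + l^-1) `^ (- th).
pose I : set R := `[A, A + 1]%classic.
have mI : measurable I by rewrite /I.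
have Ioo : (mu I < +oo)%E by exact: itv_lty.
have I1 : fine (mu I) = 1.
  by rewrite /= lebesgue_measure_itv/= lte_fin ltrDl ltr01/= addrAC subrr add0r.
have kL1 y : I y -> L1 I (k ^~ y).
  by move=> yI; apply: L1Zl => //; have [] := weight_integral th01 l1 yI.
have kB y : I y -> \int[mu]_(x in I) k x y <= B * l `^ sg.
  move=> yI; have [w1 w2] := weight_integral th01 l1 yI.
  rewrite RintZl// /B [leRHS]mulrAC ler_wpM2l//.
  by rewrite mulr_ge0 ?powR_ge0// ltW.
have Kk x y : I x -> I y ->
  `|\int[mu]_(xi in E) (C (x, xi) * C (y, xi)) +
    \int[mu]_(xi in E) (S (x, xi) * S (y, xi))| <= k x y.
  move=> xI yI; have sep := Gam_separation x y (u01 x) (u01 y).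
  rewrite /k -mulrA /E; case: b {E i1 i2 i11 i22 iH mE Eoo}.
    by rewrite /C /S /= kern_sum kern_pos//; apply: kb.
  by rewrite /C /S /= kern_sum kern_neg//; apply: kb => //; rewrite normrN.
have TT (h : R -> R) mh h1 (e : R) e0 :=
  @TTstar_bound R I E C S h g1 g2 k (B * l `^ sg) mI mE Ioo Eoo mC mS C1' S1'
    mh h1 kL1 kB Kk e e0 i1 i2 i11 i22.
pose T x := osc E g1 g2 (Gam x (u x)) (u x).
have TL : L1 I T.
  have [|x|h _] := TT (cst 1) _ _ 1 ltr01; [exact: measurable_cst|by rewrite normr1|].
  by move: h; under [X in L1 I X -> _]eq_fun do rewrite mul1r.
split; first exact: TL.
have mT : measurable_fun setT (T \_ I).
  by apply/(measurable_restrictT _ mI); exact: L1_meas.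
(* Testing against the sign of [T] turns the bound for the integral of [h * T] into a bound for the
   L^1 norm of [T]. *)
pose h x : R := if 0 <= (T \_ I) x then 1 else -1.
have mh : measurable_fun setT h.
  apply: measurable_fun_ifT; [|exact: measurable_cst|exact: measurable_cst].
  by apply: measurable_fun_ler => //; exact: measurable_cst.
have h1 x : `|h x| <= 1 by rewrite /h; case: ifP => _; rewrite ?normrN normr1.
(* This weight balances Young's inequality: [e l^sg] and [e^-1 l^(-2 s)] are both
   [l^(-(s - sg / 2))]. *)
pose e := l `^ (- (sg / 2 + s)).
have e0 : 0 < e by exact: powR_gt0.
have [_ bound] := TT h mh h1 e e0.
have -> : \int[mu]_(x in I) `|T x| = \int[mu]_(x in I) (h x * T x).
  apply: Rint_eq => x Ix; rewrite /h patchE mem_set//.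
  by case: leP => Tx; [rewrite mul1r ger0_norm|rewrite mulN1r ltr0_norm].
apply: le_trans (ler_norm _) _; apply: le_trans bound _.
rewrite I1 mulr1.
have H0 : 0 <= H.
  rewrite -(pmulr_rge0 _ (powR_gt0 (- (2 * s)) l0)); apply: le_trans iH.
  by rewrite addr_ge0// Rintegral_ge0// => xi _; exact: sqr_ge0.
have eB : e * (B * l `^ sg) = B * l `^ (- (s - sg / 2)).
  by rewrite mulrCA -powR_add//; congr (_ * _ `^ _); field.
have eH : e^-1 * (\int[mu]_(xi in E) (g1 xi ^+ 2) + \int[mu]_(xi in E) (g2 xi ^+ 2)) <=
  l `^ (- (s - sg / 2)) * H.
  apply: (@le_trans _ _ (e^-1 * (l `^ (- (2 * s)) * H))).
    by rewrite ler_wpM2l// invr_ge0 ltW.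
  rewrite /e -powRN mulrA -powR_add//.
  by rewrite (_ : - - (sg / 2 + s) + - (2 * s) = - (s - sg / 2))//; field.
have L0 : 0 <= l `^ (- (s - sg / 2)) by exact: powR_ge0.
rewrite eB; move: eH L0; set L := l `^ _; set Q := e^-1 * _ => eH L0.
have h2 : 0 <= B * L by rewrite mulr_ge0// ltW.
have h3 : 0 <= L * H by rewrite mulr_ge0.
have h4 : 0 <= B * L * H by rewrite mulr_ge0.
have -> : (B + 1) * L * (1 + H) = B * L + L + B * L * H + L * H by ring.
clear -eH L0 h2 h3 h4; lra.
Qed.

End PieceBound.
End Pieces.

(** * From measurable selections to a summable pointwise majorant *)

Section MaximalSum.
Variable R : realType.
Variables (I : set R) (T : nat -> R -> nat -> R) (B : nat -> R) (Bsum : R).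

(* The form of measurability of an index choice [v] that is used: it avoids
   equipping [nat] with a sigma-algebra. *)
Definition selection (v : R -> nat) := forall phi : nat -> R -> R,
  (forall j, measurable_fun setT (phi j)) ->
  measurable_fun setT (fun x => phi (v x) x).

Hypothesis mI : measurable I.
Hypothesis TB : forall k v, selection v ->
  L1 I (fun x => T k x (v x)) /\ \int[mu]_(x in I) `|T k x (v x)| <= B k.
Hypothesis Bs : forall N, \sum_(k < N) B k <= Bsum.

Let Tr k j := (fun x => T k x j) \_ I.

Let sel_cst j : selection (fun=> j).
Proof. by move=> phi; apply. Qed.

Let mTr k j : measurable_fun setT (Tr k j).
Proof.
apply/(measurable_restrictT _ mI); apply: L1_meas.
by have [] := TB k (sel_cst j).
Qed.

(** The recursion makes it a selection by induction: each step chooses between two indices by a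
    measurable comparison. *)
Fixpoint argmax k n x : nat :=
  if n is n'.+1 then
    if `|Tr k (argmax k n' x) x| < `|Tr k n'.+1 x| then n'.+1 else argmax k n' x
  else 0%N.

Let mabs (f : R -> R) : measurable_fun setT f -> measurable_fun setT (fun x => `|f x|).
Proof. by move=> mf; apply: (measurableT_comp (@normr_measurable R setT)). Qed.

Let sel_argmax k n : selection (argmax k n).
Proof.
elim: n => [|n IH] phi mphi /=; first exact: mphi.
have -> : (fun x => phi (if `|Tr k (argmax k n x) x| < `|Tr k n.+1 x| then n.+1
    else argmax k n x) x) = (fun x => if `|Tr k (argmax k n x) x| < `|Tr k n.+1 x| then
    phi n.+1 x else phi (argmax k n x) x).
  by apply/funext => x; case: ifP.
apply: measurable_fun_ifT; [|exact: mphi|exact: IH].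
apply: measurable_fun_ltr; apply: mabs; last exact: mTr.
exact: (IH _ (mTr k)).
Qed.

Let M k n x := `|Tr k (argmax k n x) x|.

Let M_nd k x : {homo (fun n => M k n x) : i j / (i <= j)%N >-> i <= j}.
Proof.
apply: homo_leq => //; first by move=> a b c; exact: le_trans.
by move=> n; rewrite /M /=; case: ltP => // /ltW.
Qed.

Let M_ge k n j x : (j <= n)%N -> `|Tr k j x| <= M k n x.
Proof.
move=> jn; apply: le_trans (M_nd k x jn); rewrite /M.
by case: j {jn} => [|j] //=; case: ltP.
Qed.

Let mM k n : measurable_fun setT (M k n).
Proof. by apply: mabs; exact: (sel_argmax k n (mTr k)). Qed.

Let M_int k n : (\int[mu]_(x in I) (M k n x)%:E <= (B k)%:E)%E.
Proof.
have [TL bnd] := TB k (sel_argmax k n).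
have -> : (\int[mu]_(x in I) (M k n x)%:E = \int[mu]_(x in I) (`|T k x (argmax k n x)|)%:E)%E.
  by apply: eq_integral => x xI; rewrite /M /Tr patchE xI.
by rewrite -EFin_Rint ?lee_fin//; exact: L1_norm.
Qed.

Let Ms k x : \bar R := limn (fun n => (M k n x)%:E).

Let M_cvg k x : cvgn (fun n => (M k n x)%:E).
Proof.
by apply: ereal_nondecreasing_is_cvgn => i j ij; rewrite lee_fin; exact: M_nd.
Qed.

Let Ms_ge k j x : I x -> (`|T k x j|%:E <= Ms k x)%E.
Proof.
move=> Ix; apply: lime_ge; first exact: M_cvg.
near=> n; rewrite lee_fin; apply: le_trans (@M_ge k n j x _); last first.
  by near: n; exact: nbhs_infty_ge.
by rewrite /Tr patchE mem_set.
Unshelve. all: by end_near. Qed.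

Let Ms_ge0 k x : (0 <= Ms k x)%E.
Proof.
by apply: lime_ge; [exact: M_cvg|apply: nearW => n; rewrite lee_fin; exact: normr_ge0].
Qed.

Let mMs k : measurable_fun setT (Ms k).
Proof.
apply: (emeasurable_fun_cvg (fun n => EFin \o M k n)) => [n|x _].
  by apply/measurable_EFinP; exact: mM.
exact: M_cvg.
Qed.

Let Ms_int k : (\int[mu]_(x in I) Ms k x <= (B k)%:E)%E.
Proof.
have mf n : measurable_fun I (fun x => (M k n x)%:E).
  by apply/measurable_EFinP; apply: measurable_funTS; exact: mM.
rewrite (@monotone_convergence _ _ _ mu I mI (fun n x => (M k n x)%:E) mf); last 2 first.
- by move=> n x _; rewrite lee_fin; exact: normr_ge0.
- by move=> x _ i j ij; rewrite lee_fin; exact: M_nd.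
apply: lime_le; last by apply: nearW => n; exact: M_int.
apply: ereal_nondecreasing_is_cvgn => i j ij; apply: ge0_le_integral => //.
- by move=> x _; rewrite lee_fin; exact: normr_ge0.
- exact: mf.
- exact: mf.
- by move=> x _; rewrite lee_fin; exact: M_nd.
Qed.

Let W0 x : \bar R := (\sum_(k <oo) Ms k x)%E.

Let W0_int : (\int[mu]_(x in I) W0 x <= Bsum%:E)%E.
Proof.
rewrite integral_nneseries//; last first.
  by move=> n; exact: (measurable_funTS (mMs n)).
apply: lime_le.
  by apply: is_cvg_nneseries => n _ _; exact: integral_ge0.
apply: nearW => n.
apply: (@le_trans _ _ (\sum_(k < n) (B k)%:E)%E).
  by rewrite big_mkord; apply: lee_sum => k _; exact: Ms_int.
by rewrite sumEFin lee_fin.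
Qed.

Let mW0 : measurable_fun setT W0.
Proof. by apply: ge0_emeasurable_sum => // k x _ _; exact: Ms_ge0. Qed.

Let W0_ge0 x : (0 <= W0 x)%E.
Proof. by apply: nneseries_ge0 => k _ _; exact: Ms_ge0. Qed.

Let iW0 : mu.-integrable I W0.
Proof.
apply/integrableP; split; first exact: measurable_funTS.
apply: le_lt_trans (ltry Bsum); apply: le_trans W0_int.
rewrite le_eqVlt; apply/orP; left; apply/eqP; apply: eq_integral => x _.
by rewrite gee0_abs.
Qed.

(** [c k] is the supremum over all indices: the bound for the selection [argmax k n] passes to the
    limit in [n] by monotone convergence. The sum over [k] is then integrable, hence finite almost
    everywhere, and [fine] loses nothing there. *)
Lemma maximal_sum : exists W : R -> R, L1 I W /\
  {ae mu, forall x, I x -> exists c : nat -> R,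
    [/\ forall k, 0 <= c k, forall N, \sum_(k < N) c k <= W x &
        forall k j, `|T k x j| <= c k]}.
Proof.
exists (fun x => fine (W0 x)); split.
  apply: le_integrable iW0 => //.
    apply/measurable_EFinP; apply: (measurableT_comp (fine_measurable measurableT)).
    exact: (measurable_funTS mW0).
  by move=> x _ /=; case: (W0 x) => [r||] /=; rewrite ?normr0 ?leey.
have := integrable_ae _ iW0 => /(_ mI); apply: filterS => x fin Ix.
have W0fin := fin Ix.
have Msfin k : Ms k x \is a fin_num.
  rewrite ge0_fin_numE//; apply: (@le_lt_trans _ _ (W0 x)); last first.
    by rewrite -ge0_fin_numE.
  apply: le_trans (nneseries_lim_ge k.+1 _) => //.
  by rewrite big_nat_recr//= leeDr// sume_ge0.
exists (fun k => fine (Ms k x)); split.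
- by move=> k; rewrite fine_ge0.
- move=> N; rewrite -lee_fin fineK// -sumEFin.
  under eq_bigr do rewrite fineK//.
  by rewrite -(@big_mkord _ _ _ N xpredT (fun k => Ms k x)); exact: nneseries_lim_ge.
- by move=> k j; rewrite -lee_fin fineK//; exact: Ms_ge.
Qed.

End MaximalSum.

(** * Dominated limits, almost everywhere equality, interchange of limits *)

Section Limits.
Variable R : realType.
Implicit Types (D : set R) (f g F : R -> R).

Lemma aeS (P Q : R -> Prop) : (forall x, P x -> Q x) ->
  {ae mu, forall x, P x} -> {ae mu, forall x, Q x}.
Proof. exact: (@filterS _ _ (ae_filter_ringOfSetsType mu)). Qed.

Lemma aeS2 (P Q S : R -> Prop) : (forall x, P x -> Q x -> S x) ->
  {ae mu, forall x, P x} -> {ae mu, forall x, Q x} -> {ae mu, forall x, S x}.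
Proof. exact: (@filterS2 _ _ (ae_filter_ringOfSetsType mu)). Qed.

Lemma Rint_dominated D (f_ : nat -> R -> R) f g : measurable D ->
  (forall n, measurable_fun D (f_ n)) -> measurable_fun D f -> L1 D g ->
  {ae mu, forall x, D x -> (fun n => f_ n x) @ \oo --> f x} ->
  {ae mu, forall x, D x -> forall n, `|f_ n x| <= g x} ->
  (fun n => \int[mu]_(x in D) f_ n x) @ \oo --> \int[mu]_(x in D) f x.
Proof.
move=> mD mf_ mf ig fcvg fbnd.
have [||||||fint _ h] := @dominated_convergence _ _ R mu D _
   (fun n x => (f_ n x)%:E) (fun x => (f x)%:E) (fun x => (g x)%:E).
- exact: mD.
- by move=> n; apply/measurable_EFinP; exact: mf_.
- by apply/measurable_EFinP; exact: mf.
- apply: aeS fcvg => x fx Dx; apply: cvg_EFin; [exact: nearW|exact: fx].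
- exact: ig.
- apply: aeS fbnd => x fx n Dx; rewrite lee_fin; exact: fx.
apply: fine_cvg; rewrite fineK; first exact: h.
by apply: integrable_fin_num.
Qed.

Lemma L1_sq_mul D f g : measurable D -> measurable_fun D f -> measurable_fun D g ->
  L1 D (fun x => f x ^+ 2) -> L1 D (fun x => g x ^+ 2) -> L1 D (fun x => f x * g x).
Proof.
move=> mD mf mg f2 g2; apply: (@L1_le _ _ _ (fun x => 2^-1 * (f x ^+ 2 + g x ^+ 2))) => //.
- exact: measurable_funM.
- by apply: L1Zl => //; apply: L1D.
- move=> x _; rewrite normrM -(real_normK (num_real (f x))) -(real_normK (num_real (g x))).
  have := sqr_ge0 (`|f x| - `|g x|); rewrite sqrrB; lra.
Qed.

Lemma L1_inv_oneDsqr : L1 setT (fun x : R => (1 + x ^+ 2)^-1).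
Proof.
have c : continuous (fun x : R => (1 + x ^+ 2)^-1) by exact: continuous_oneDsqrV.
apply: L1_ge0 => //.
- exact: continuous_measurable_fun.
- by move=> x _; rewrite invr_ge0 addr_ge0// sqr_ge0.
- rewrite ge0_symfun_integralT//.
  + rewrite (_ : [set x | 0 <= x] = `[0, +oo[%classic); last by rewrite set_itvcy.
    by rewrite integral0y_oneDsqr -EFinM ltry.
  + by move=> x; rewrite invr_ge0 addr_ge0// sqr_ge0.
  + by move=> x /=; rewrite sqrrN.
Qed.

Lemma Rint_exhaust F (a : nat -> R) : L1 setT F ->
  (forall x : R, \forall n \near \oo, `|x| <= a n) ->
  (fun n => \int[mu]_(x in `[- a n, a n]) F x) @ \oo --> \int[mu]_x F x.
Proof.
move=> iF ha; pose f_ n := F \_ `[- a n, a n].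
have -> : (fun n => \int[mu]_(x in `[- a n, a n]) F x) = (fun n => \int[mu]_x f_ n x).
  by apply/funext => n; rewrite Rintegral_mkcond.
have mF := L1_meas iF.
apply: (@Rint_dominated _ _ _ (fun x => `|F x|)) => //.
- have mi n : measurable (`[- a n, a n] : set R) by exact: measurable_itv.
  move=> n; apply/(measurable_restrictT _ (mi n)).
  exact: measurable_funTS.
- exact: L1_norm.
- apply: aeW => x _; apply: cvg_near_cst.
  near=> n; rewrite /f_ patchE mem_set//=; rewrite in_itv/= -ler_norml.
  by near: n; exact: ha.
- apply: aeW => x _ n; rewrite /f_ patchE; case: ifP => // _.
  by rewrite normr0.
Unshelve. all: by end_near. Qed.

Lemma powR_dist (p t e : R) : 0 < p -> 0 <= t -> 0 < e ->
  exists2 d : R, 0 < d & forall t' : R, 0 <= t' -> `|t' - t| < d -> `|t' `^ p - t `^ p| < e.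
Proof.
move=> p0; rewrite le_eqVlt => /predU1P[<-|t0] e0.
  exists (e `^ p^-1); first exact: powR_gt0.
  move=> t' t'0; rewrite subr0 ger0_norm// powR0 ?gt_eqF// subr0 ger0_norm ?powR_ge0//.
  move=> h; rewrite -[ltRHS](powRr1 (ltW e0)) -(mulVf (lt0r_neq0 p0)) powRrM.
  by apply: gt0_ltr_powR => //; rewrite nnegrE ?powR_ge0.
have := @cont_powR R p t t0 => /cvgrPdist_lt /(_ _ e0) [d /= d0 hd].
exists d => // t' _ tt'; rewrite distrC; apply: hd => /=.
by rewrite distrC.
Qed.

(** The primitive of the difference vanishes identically, and by Lebesgue differentiation its
    derivative is the difference almost everywhere. *)
Lemma ae_eq_itv (A B : R) f g : A < B -> L1 `[A, B] f -> L1 `[A, B] g ->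
  (forall b, A <= b <= B -> \int[mu]_(x in `[A, b]) f x = \int[mu]_(x in `[A, b]) g x) ->
  {ae mu, forall x, x \in `]A, B[ -> f x = g x}.
Proof.
move=> AB fi gi fg; pose h : R -> R := (fun x => f x - g x) \_ `[A, B].
have mAB : measurable (`[A, B] : set R) by exact: measurable_itv.
have hi : L1 setT h := (L1_restrict _ mAB).1 (L1B mAB fi gi).
have lh : locally_integrable setT h.
  by apply: open_integrable_locally => //; exact: openT.
have hiy y : L1 `[A, y] h by apply: (L1S _ _ _ hi).
have := FTC1 hiy lh; apply: aeS => x /(_ _)/= H; rewrite in_itv/= => /andP[Ax xB].
have [|dF F'] := H; first by rewrite lte_fin.
suff : h x = 0.
  rewrite /h patchE mem_set; first by move/eqP; rewrite subr_eq0 => /eqP.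
  by rewrite /= in_itv/= !ltW.
rewrite -F'.
have F0 y : y \in `]A, B[ -> \int[mu]_(t in `[A, y]) h t = 0.
  rewrite in_itv/= => /andP[Ay yB].
  have sub : `[A, y] `<=` `[A, B] by apply: subset_itvl; rewrite bnd_simp ltW.
  transitivity (\int[mu]_(t in `[A, y]) (f t - g t)).
    by apply: Rint_eq => z zA; rewrite /h patchE mem_set//; exact: sub.
  rewrite RintB//; [|exact: L1S sub _|exact: L1S sub _].
  by rewrite fg ?subrr// !ltW.
have xAB : x \in `]A, B[ by rewrite in_itv/= Ax.
rewrite derive1E (@near_eq_derive _ _ _ _ (cst 0)); first exact: derive_cst.
by near=> y; rewrite F0//; near: y; exact: near_in_itvoo.
Unshelve. all: by end_near. Qed.

(** The intervals used are centred at the multiples of [1/2], so they overlap and every point is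
    interior to one of them. *)
Lemma ae_unit_intervals (P : R -> Prop) :
  (forall A : R, {ae mu, forall x, x \in `]A, A + 1[ -> P x}) -> {ae mu, forall x, P x}.
Proof.
move=> h.
have h1 : {ae mu, forall x (n : nat), x \in `](n%:R / 2 - 1/2), (n%:R / 2 - 1/2 + 1)[ -> P x}.
  by apply/ae_foralln => n.
have h2 : {ae mu, forall x (n : nat), x \in `](- (n%:R / 2) - 1/2), (- (n%:R / 2) - 1/2 + 1)[ -> P x}.
  by apply/ae_foralln => n.
apply: aeS2 h1 h2 => x h1 h2.
have [x0|x0] := leP 0 x.
  have x20 : 0 <= 2 * x by lra.
  have /andP[t1 t2] := truncn_itv x20.
  have {}t2 : 2 * x < (Num.trunc (2 * x))%:R + 1 by rewrite natr1.
  by apply: (h1 (Num.trunc (2 * x))); rewrite in_itv/=; apply/andP; split; lra.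
have nx0 : 0 <= - (2 * x) by lra.
have /andP[t1 t2] := truncn_itv nx0.
have {}t2 : - (2 * x) < (Num.trunc (- (2 * x)))%:R + 1 by rewrite natr1.
by apply: (h2 (Num.trunc (- (2 * x)))); rewrite in_itv/=; apply/andP; split; lra.
Qed.

Lemma bounded_tail (c : nat -> R) (W e : R) : (forall k, 0 <= c k) ->
  (forall N, \sum_(k < N) c k <= W) -> 0 < e ->
  exists K, forall L, (K <= L)%N -> \sum_(K <= k < L) c k <= e.
Proof.
move=> c0 cW e0; pose a N := \sum_(0 <= k < N) c k.
have nd : nondecreasing_seq a.
  by apply/nondecreasing_seqP => n; rewrite /a big_nat_recr//= lerDl.
have ub : has_ubound (range a).
  by exists W => _ [n _ <-]; rewrite /a big_mkord.
have cv := nondecreasing_cvgn nd ub.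
move/cvgrPdist_lt : cv => /(_ _ e0) [K _ HK].
exists K => L KL.
have := HK K (leqnn K); rewrite ltr_norml => /andP[_ h].
have hL : a L <= sup (range a) by apply: ub_le_sup => //; exists L.
have : a L = a K + \sum_(K <= k < L) c k by rewrite /a -big_cat_nat.
by lra.
Qed.

(** An enumeration of the rationals of [[0, 1]]: by continuity in time the maximal function needs
    only countably many times. A number that codes no pair gives 0. *)
Definition times (n : nat) : R :=
  if unpickle n is Some (i, j) then Num.min 1 (i%:R / j.+1%:R) else 0.

Lemma times01 n : 0 <= times n <= 1.
Proof.
rewrite /times; case: unpickle => [[i j]|]; last by rewrite lexx ler01.
by rewrite le_min ler01 ge_min lexx divr_ge0.
Qed.

Lemma times_dense (t d : R) : 0 <= t <= 1 -> 0 < d -> exists n, `|times n - t| < d.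
Proof.
move=> /andP[t0 t1] d0.
pose j := Num.trunc d^-1; have j1 : d^-1 < j.+1%:R by exact: truncnS_gt.
have jd : j.+1%:R^-1 < d by rewrite invf_plt ?posrE.
pose i := Num.trunc (t * j.+1%:R).
have tj : 0 <= t * j.+1%:R by rewrite mulr_ge0.
have /andP[i1 i2] := truncn_itv tj.
exists (pickle (i, j)); rewrite /times pickleK.
have h1 : i%:R / j.+1%:R <= t by rewrite ler_pdivrMr.
have h2 : t < i%:R / j.+1%:R + j.+1%:R^-1.
  by rewrite -[X in _ + X]mul1r -mulrDl ltr_pdivlMr// natr1.
have h3 : i%:R / j.+1%:R <= 1 :> R by apply: le_trans t1.
rewrite min_r// ltr_norml; move: h1 h2 jd; set z := _^-1; set w := i%:R * z => h1 h2 jd.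
by apply/andP; split; lra.
Qed.

(** The limits in [L] and in [t] commute because the first is uniform in [t], time 0 included. This
    links [F], a limit taken at time 0 only, to the values [P t] at positive times. *)
Lemma uniform_interchange (S : nat -> R -> R) (P : R -> R) (F : R) :
  (forall e, 0 < e -> exists K, forall L, (K <= L)%N -> forall t, 0 <= t <= 1 ->
     `|S L t - S K t| <= e) ->
  (forall t, 0 < t <= 1 -> S ^~ t @ \oo --> P t) ->
  S ^~ 0 @ \oo --> F ->
  (forall K e, 0 < e -> exists2 d, 0 < d & forall t, 0 <= t <= 1 -> t < d ->
     `|S K t - S K 0| <= e) ->
  P @ 0^'+ --> F.
Proof.
move=> unif SP SF cont; apply/cvgrPdist_le => e e0.
have e3 : 0 < e / 3 by lra.
have [K HK] := unif _ e3; have [d d0 Hd] := cont K _ e3.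
have lim_le (u : nat -> R) (v : R) (t : R) : 0 <= t <= 1 -> u = S ^~ t ->
    u @ \oo --> v -> `|v - S K t| <= e / 3.
  move=> t01 -> uv.
  have : (fun L => `|S L t - S K t|) @ \oo --> `|v - S K t|.
    by apply: cvg_norm; apply: cvgB => //; exact: cvg_cst.
  move=> h; rewrite -(cvg_lim (@Rhausdorff R) h); apply: limr_le; first exact: cvgP h.
  near=> L; apply: HK => //.
  by near: L; exact: nbhs_infty_ge.
near=> t.
have t0 : 0 < t by near: t; exact: nbhs_right_gt.
have t1 : t <= 1 by near: t; exact: nbhs_right_le.
have td : t < d by near: t; exact: nbhs_right_lt.
have t01 : 0 <= t <= 1 by rewrite ltW.
have h1 := lim_le _ _ t t01 erefl (SP t _).
have h2 := lim_le _ _ 0 _ erefl SF.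
have h3 := Hd t t01 td.
have {}h1 : `|P t - S K t| <= e / 3 by apply: h1; rewrite t0.
have {}h2 : `|F - S K 0| <= e / 3 by apply: h2; rewrite lexx ler01.
have -> : F - P t = (F - S K 0) - (S K t - S K 0) - (P t - S K t) by ring.
apply: le_trans (ler_normB _ _) _.
have := ler_normB (F - S K 0) (S K t - S K 0); lra.
Unshelve. all: by end_near. Qed.

End Limits.

(** * Almost everywhere convergence from the maximal bound *)

Section Convergence.
Variable R : realType.
Implicit Types (D : set R).

Lemma lipschitz_of_derivative_le1 (f f' : R -> R) (a b : R) :
  (forall x : R, is_derive x 1 f (f' x)) ->
  (forall x, a <= x -> x <= b -> `|f' x| <= 1) -> a <= b -> `|f b - f a| <= b - a.
Proof.
move=> df bd ab.
have cf : {within `[a, b], continuous f}.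
  by apply: cont_itv => x _; apply: D_continuous; exact: df.
have [c cab ->] := MVT_segment ab (fun x _ => df x) cf.
rewrite normrM (ger0_norm (_ : 0 <= b - a)) ?subr_ge0//.
by rewrite ler_piMl ?subr_ge0//; apply: bd; move: cab; rewrite in_itv/= => /andP[].
Qed.

Lemma cos_lip (x y : R) : `|cos x - cos y| <= `|x - y|.
Proof.
have h (a b : R) : a <= b -> `|cos b - cos a| <= b - a.
  move=> ab; apply: (@lipschitz_of_derivative_le1 _ (fun x => - sin x)) => //.
  by move=> z _ _; rewrite normrN ler_norml sin_geN1 sin_le1.
have [xy|/ltW yx] := leP x y.
  by rewrite distrC (distrC x) (ger0_norm (_ : 0 <= y - x)) ?subr_ge0//; exact: h.
by rewrite (ger0_norm (_ : 0 <= x - y)) ?subr_ge0//; exact: h.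
Qed.

Lemma sin_lip (x y : R) : `|sin x - sin y| <= `|x - y|.
Proof.
have h (a b : R) : a <= b -> `|sin b - sin a| <= b - a.
  move=> ab; apply: (@lipschitz_of_derivative_le1 _ (fun x => cos x)) => //.
  by move=> z _ _; rewrite ler_norml cos_geN1 cos_le1.
have [xy|/ltW yx] := leP x y.
  by rewrite distrC (distrC x) (ger0_norm (_ : 0 <= y - x)) ?subr_ge0//; exact: h.
by rewrite (ger0_norm (_ : 0 <= x - y)) ?subr_ge0//; exact: h.
Qed.

Lemma expN_lip (x y : R) : 0 <= x -> 0 <= y -> `|expR (- x) - expR (- y)| <= `|x - y|.
Proof.
have h (a b : R) : 0 <= a -> a <= b -> `|expR (- b) - expR (- a)| <= b - a.
  move=> a0 ab; apply: (@lipschitz_of_derivative_le1 (fun x => expR (- x)) (fun x => - expR (- x))) => //.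
    move=> z; have hn : is_derive z 1 (fun x : R => - x) (- 1) by exact: is_deriveN.
    have := @is_derive1_comp R expR (fun x => - x) z (expR (- z)) (-1) (is_derive_expR _) hn.
    by rewrite mulrN1.
  move=> z az _; rewrite normrN ger0_norm ?expR_ge0// -expR0 ler_expR oppr_le0.
  exact: le_trans az.
move=> x0 y0; have [xy|/ltW yx] := leP x y.
  by rewrite distrC (distrC x) (ger0_norm (_ : 0 <= y - x)) ?subr_ge0//; exact: h.
by rewrite (ger0_norm (_ : 0 <= x - y)) ?subr_ge0//; exact: h.
Qed.

Lemma norm_prod_sub (c c' d d' : R) : `|c| <= 1 -> `|d'| <= 1 ->
  `|c * d - c' * d'| <= `|c - c'| + `|d - d'|.
Proof.
move=> c1 d1; have -> : c * d - c' * d' = c * (d - d') + (c - c') * d' by ring.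
apply: le_trans (ler_normD _ _) _; rewrite !normrM addrC lerD//.
  by rewrite ler_piMr.
by rewrite ler_piMl.
Qed.

Lemma dominated_limit D (S : nat -> R -> R) (b : R -> R) : measurable D ->
  (forall L, measurable_fun D (S L)) -> L1 D b ->
  {ae mu, forall x, D x -> exists l : R, S ^~ x @ \oo --> l} ->
  {ae mu, forall x, D x -> forall L, `|S L x| <= b x} ->
  exists F : R -> R, [/\ L1 D F,
    {ae mu, forall x, D x -> S ^~ x @ \oo --> F x} &
    forall E, measurable E -> E `<=` D ->
      (fun L => \int[mu]_(x in E) S L x) @ \oo --> \int[mu]_(x in E) F x].
Proof.
move=> mD mS ib cv bd.
pose F0 x := fine (limn_esup (fun L => (S L x)%:E)).
(* On a null set the upper limit may be infinite or exceed the majorant; clipping at [|b x|] makes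
   the domination hold everywhere without changing the limit elsewhere. *)
pose F x := Num.max (- `|b x|) (Num.min `|b x| (F0 x)).
have mb := L1_meas ib.
have mF0 : measurable_fun D F0.
  apply: (measurableT_comp (fine_measurable measurableT)).
  apply: measurable_fun_limn_esup => L.
  by apply/measurable_EFinP; exact: mS.
have mnb : measurable_fun D (fun x => `|b x|) by apply: measurableT_comp.
have mF : measurable_fun D F.
  apply: measurable_maxr; first exact: measurableT_comp.
  exact: measurable_minr.
have Fb x : `|F x| <= `|b x|.
  by rewrite ler_norml /F le_max lexx/= ge_max ge_min lexx/= andbT ge0_cp.
have Fcv : {ae mu, forall x, D x -> S ^~ x @ \oo --> F x}.
  apply: aeS2 cv bd => x cv bd Dx; have [l Sl] := cv Dx; have {}bd := bd Dx.
  suff -> : F x = l by [].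
  have F0l : F0 x = l.
    rewrite /F0 (_ : limn_esup _ = l%:E)//.
    have Sl' : (fun L => (S L x)%:E) @ \oo --> l%:E by apply: cvg_EFin => //; exact: nearW.
    have [h1 h2] := cvg_limn_einf_sup Sl'.
    by rewrite h2.
  have lb : `|l| <= b x.
    have h : (fun L => `|S L x|) @ \oo --> `|l| by exact: cvg_norm.
    rewrite -(cvg_lim (@Rhausdorff R) h); apply: limr_le; first exact: cvgP h.
    by apply: nearW => L; exact: bd.
  have {}lb : `|l| <= `|b x| by apply: le_trans (ler_norm _).
  rewrite /F F0l; move: lb; rewrite ler_norml => /andP[l1 l2].
  by rewrite min_r// max_r.
exists F; split=> //; first exact: (L1_le mD mF (L1_norm mD ib)).
move=> E mE ED; apply: (@Rint_dominated _ _ _ _ b) => //.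
- by move=> L; exact: measurable_funS (mS L).
- exact: measurable_funS mF.
- exact: L1S ib.
- by apply: aeS Fcv => x h /ED.
- by apply: aeS bd => x h /ED.
Qed.

Lemma L1Zr D (f : R -> R) (r : R) : measurable D -> L1 D f -> L1 D (fun x => f x * r).
Proof.
move=> mD fi; rewrite (_ : (fun x => _) = (fun x : R => (r * f x)%:E)); first exact: L1Zl.
by apply/funext => x; rewrite mulrC.
Qed.

Lemma L1_of_sq (a b : R) (g : R -> R) : measurable_fun setT g ->
  L1 setT (fun x => g x ^+ 2) -> L1 `[a, b] g.
Proof.
move=> mg g2; have mI : measurable (`[a, b] : set R) by exact: measurable_itv.
have g2' : L1 `[a, b] (fun x => g x ^+ 2) by apply: L1S g2.
have i1 : L1 `[a, b] (fun=> 1 : R) by apply: L1_itv_1 => // x; rewrite normr1.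
apply: (L1_le mI (measurable_funTS mg) (L1D mI i1 g2')) => x _.
rewrite -(real_normK (num_real (g x))); have := sqr_ge0 (`|g x| - 1).
by rewrite sqrrB; have := normr_ge0 (g x); lra.
Qed.

Section Weighted.
Variables (s : R) (g1 g2 : R -> R).
Hypothesis s0 : 0 <= s.
Hypothesis mg1 : measurable_fun setT g1.
Hypothesis mg2 : measurable_fun setT g2.
Hypothesis wg : L1 setT (fun xi => (1 + xi ^+ 2) `^ s * (g1 xi ^+ 2 + g2 xi ^+ 2)).

Lemma weight_ge1 (xi : R) : 1 <= (1 + xi ^+ 2) `^ s.
Proof.
have h : 1 <= 1 + xi ^+ 2 by rewrite lerDl sqr_ge0.
by have := ler_powR h s0; rewrite powRr0.
Qed.

Lemma weighted_sq1 : L1 setT (fun xi => g1 xi ^+ 2).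
Proof.
apply: (L1_le measurableT _ wg); first exact: measurable_funX.
move=> xi _; rewrite ger0_norm ?sqr_ge0//.
have := weight_ge1 xi; have := sqr_ge0 (g1 xi); have := sqr_ge0 (g2 xi); nra.
Qed.

Lemma weighted_sq2 : L1 setT (fun xi => g2 xi ^+ 2).
Proof.
apply: (L1_le measurableT _ wg); first exact: measurable_funX.
move=> xi _; rewrite ger0_norm ?sqr_ge0//.
have := weight_ge1 xi; have := sqr_ge0 (g1 xi); have := sqr_ge0 (g2 xi); nra.
Qed.

Lemma dyadic_mass (E : set R) (l : R) : measurable E -> 1 <= l -> (forall xi, E xi -> l <= `|xi|) ->
  \int[mu]_(xi in E) (g1 xi ^+ 2) + \int[mu]_(xi in E) (g2 xi ^+ 2) <=
  l `^ (- (2 * s)) *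
  \int[mu]_xi ((1 + xi ^+ 2) `^ s * (g1 xi ^+ 2 + g2 xi ^+ 2)).
Proof.
move=> mE l1 El; have l0 : 0 < l by lra.
have i1 : L1 E (fun xi => g1 xi ^+ 2) by apply: L1S weighted_sq1.
have i2 : L1 E (fun xi => g2 xi ^+ 2) by apply: L1S weighted_sq2.
rewrite -(RintD mE i1 i2).
have wE : L1 E (fun xi => (1 + xi ^+ 2) `^ s * (g1 xi ^+ 2 + g2 xi ^+ 2)) by apply: L1S wg.
apply: (@le_trans _ _ (\int[mu]_(xi in E) (l `^ (- (2 * s)) *
   ((1 + xi ^+ 2) `^ s * (g1 xi ^+ 2 + g2 xi ^+ 2))))).
  apply: Rint_le => //; [exact: L1D|exact: L1Zl|move=> xi Exi].
  have lp : 0 < l `^ (2 * s) by exact: powR_gt0.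
  suff h : l `^ (2 * s) <= (1 + xi ^+ 2) `^ s.
    rewrite mulrA powRN; apply: ler_peMl; first by rewrite addr_ge0 ?sqr_ge0.
    by rewrite mulrC ler_pdivlMr// mul1r.
  rewrite powRrM powR_mulrn ?(ltW l0)//.
  have b0 : 0 <= 1 + xi ^+ 2 by rewrite addr_ge0 ?sqr_ge0.
  apply: (ge0_ler_powR s0); rewrite ?nnegrE ?sqr_ge0//.
  rewrite -(real_normK (num_real xi)) -[leLHS]add0r lerD//.
  by rewrite lerXn2r ?nnegrE ?(ltW l0)// El.
rewrite RintZl// ler_wpM2l ?powR_ge0//.
apply: (@le_trans _ _ (\int[mu]_xi ((fun xi => (1 + xi ^+ 2) `^ s * (g1 xi ^+ 2 + g2 xi ^+ 2)) \_ E) xi)).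
  by rewrite Rintegral_mkcond.
apply: Rint_le => //; first exact: (L1_restrict _ mE).1.
move=> xi _; rewrite patchE; case: ifP => // _.
by rewrite mulr_ge0 ?powR_ge0 ?addr_ge0 ?sqr_ge0.
Qed.

End Weighted.

Lemma damp_decay (m gam t : R) : 0 < m -> 0 < t -> exists2 C : R, 0 < C &
  forall xi, damp m gam t xi <= C * (1 + xi ^+ 2)^-1.
Proof.
move=> m0 t0.
(* Decay of order [2 / m] in [|xi|^m] is decay of order 2 in [xi]. *)
have N0 : 0 <= 2 / m by rewrite divr_ge0// ltW.
have [C C0 hC] := powR_decay N0.
have tg : 0 < t `^ gam by exact: powR_gt0.
pose B := C * (t `^ gam) `^ (- (2 / m)).
have B0 : 0 < B by rewrite mulr_gt0 ?powR_gt0.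
exists (1 + B); first by lra.
move=> xi; have x2 : 0 < 1 + xi ^+ 2 by have := sqr_ge0 xi; lra.
rewrite ler_pdivlMr//.
have /andP[dp0 dp1] := damp_le1 m gam t xi.
have [x0|x0] := eqVneq xi 0; first by rewrite [X in 1 + X ^+ 2]x0 expr0n/= addr0 mulr1; lra.
have nx : 0 < `|xi| by rewrite normr_gt0.
have : damp m gam t xi <= B * `|xi| `^ (- 2).
  rewrite /damp; apply: le_trans (hC _ _) _; first by rewrite mulr_gt0 ?powR_gt0.
  rewrite powRM ?powR_ge0// /B -mulrA -(powRrM `|xi|) (_ : m * - (2 / m) = - 2)//.
  by field; rewrite gt_eqF.
rewrite powRN powR_mulrn// real_normK ?num_real// ler_pdivlMr ?exprn_even_gt0//.
by lra.
Qed.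

Section OscLimits.
Variables (m gam : R) (g1 g2 : R -> R).
Hypothesis m1 : 1 < m.
Hypothesis g0 : 0 < gam.
Hypothesis mg1 : measurable_fun setT g1.
Hypothesis mg2 : measurable_fun setT g2.
Local Notation ph := (phase m).
Local Notation dp := (damp m gam).
Local Notation os := (osc m gam).

Lemma L1_osc (E : set R) (G u : R) : measurable E -> L1 E g1 -> L1 E g2 ->
  L1 E (fun xi => cos (ph G u xi) * dp u xi * g1 xi - sin (ph G u xi) * dp u xi * g2 xi).
Proof.
move=> mE i1 i2; apply: (L1B mE).
- apply: (L1_mulb mE i1 (C := 1)).
    exact: (measurable_funTS (meas_cos_damp1 m gam G u)).
  by move=> xi _; exact: cos_damp_le1.
- apply: (L1_mulb mE i2 (C := 1)).
    exact: (measurable_funTS (meas_sin_damp1 m gam G u)).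
  by move=> xi _; exact: sin_damp_le1.
Qed.

Hypothesis sq1 : L1 setT (fun xi => g1 xi ^+ 2).
Hypothesis sq2 : L1 setT (fun xi => g2 xi ^+ 2).

Lemma osc_double (l G u : R) : 0 <= l ->
  os `[- (2 * l), 2 * l] g1 g2 G u =
  os `[- l, l] g1 g2 G u + (os `[l, 2 * l] g1 g2 G u + os `[- (2 * l), - l] g1 g2 G u).
Proof.
move=> l0.
have h (a b : R) : L1 `[a, b] (fun xi => cos (ph G u xi) * dp u xi * g1 xi -
    sin (ph G u xi) * dp u xi * g2 xi).
  by apply: L1_osc; [exact: measurable_itv|exact: L1_of_sq|exact: L1_of_sq].
rewrite /osc (@Rint_split _ (- (2 * l)) (- l) (2 * l))//; [|lra|lra].
by rewrite (@Rint_split _ (- l) l (2 * l))//; [ring|lra|lra].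
Qed.

Lemma osc_close (l G G' u u' : R) : 0 <= l -> 0 <= u -> 0 <= u' ->
  `|os `[- l, l] g1 g2 G u - os `[- l, l] g1 g2 G' u'| <=
  (`|G - G'| * l + `|u - u'| * l `^ m + `|u `^ gam - u' `^ gam| * l `^ m) *
  (\int[mu]_(xi in `[- l, l]) (`|g1 xi| + `|g2 xi|)).
Proof.
move=> l0 u0 u0'.
have mE : measurable (`[- l, l] : set R) by exact: measurable_itv.
have i1 : L1 `[- l, l] g1 by exact: L1_of_sq.
have i2 : L1 `[- l, l] g2 by exact: L1_of_sq.
have i12 := L1D mE (L1_norm mE i1) (L1_norm mE i2).
rewrite -(RintB mE (L1_osc G u mE i1 i2) (L1_osc G' u' mE i1 i2)) -(RintZl _ mE i12).
apply: norm_Rint_le => //; [exact: L1B (L1_osc G u mE i1 i2) (L1_osc G' u' mE i1 i2)|exact: L1Zl|].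
move=> xi; rewrite /= in_itv/= -ler_norml => xil.
set q := _ + _ + _.
have xm : `|xi| `^ m <= l `^ m by apply: ge0_ler_powR; rewrite ?nnegrE// ltW// (lt_trans ltr01 m1).
have hph : `|ph G u xi - ph G' u' xi| <= `|G - G'| * l + `|u - u'| * l `^ m.
  rewrite /phase (_ : _ - _ = (G - G') * xi + (u - u') * `|xi| `^ m); last by ring.
  apply: le_trans (ler_normD _ _) _; rewrite !normrM (ger0_norm (powR_ge0 _ _)).
  by rewrite lerD// ler_wpM2l.
have hd : `|dp u xi - dp u' xi| <= `|u `^ gam - u' `^ gam| * l `^ m.
  rewrite /damp; apply: le_trans (expN_lip _ _) _; rewrite ?mulr_ge0 ?powR_ge0//.
  by rewrite -mulrBl normrM (ger0_norm (powR_ge0 `|xi| _)) ler_wpM2l.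
have d1 : `|dp u' xi| <= 1 by have /andP[h1 h2] := damp_le1 m gam u' xi; rewrite ger0_norm.
have c1 : `|cos (ph G u xi)| <= 1 by rewrite ler_norml cos_geN1 cos_le1.
have s1 : `|sin (ph G u xi)| <= 1 by rewrite ler_norml sin_geN1 sin_le1.
have hc : `|cos (ph G u xi) * dp u xi - cos (ph G' u' xi) * dp u' xi| <= q.
  apply: le_trans (norm_prod_sub _ _ c1 d1) _; rewrite lerD//.
  exact: le_trans (cos_lip _ _) hph.
have hs : `|sin (ph G u xi) * dp u xi - sin (ph G' u' xi) * dp u' xi| <= q.
  apply: le_trans (norm_prod_sub _ _ s1 d1) _; rewrite lerD//.
  exact: le_trans (sin_lip _ _) hph.
rewrite (_ : _ - _ = (cos (ph G u xi) * dp u xi - cos (ph G' u' xi) * dp u' xi) * g1 xi -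
  (sin (ph G u xi) * dp u xi - sin (ph G' u' xi) * dp u' xi) * g2 xi); last by ring.
apply: le_trans (ler_normB _ _) _; rewrite !normrM mulrDr.
by apply: lerD; apply: ler_wpM2r.
Qed.

Lemma osc_continuous (Gx : R -> R) (C3 alpha l t e : R) : 0 < C3 -> 0 < alpha ->
  (forall t t', 0 <= t <= 1 -> 0 <= t' <= 1 -> `|Gx t - Gx t'| <= C3 * `|t - t'| `^ alpha) ->
  0 <= l -> 0 <= t <= 1 -> 0 < e -> exists2 d, 0 < d &
  forall t', 0 <= t' <= 1 -> `|t' - t| < d ->
  `|os `[- l, l] g1 g2 (Gx t') t' - os `[- l, l] g1 g2 (Gx t) t| <= e.
Proof.
move=> C30 a0 hG l0 t01 e0; have /andP[t0 t1] := t01.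
set J := \int[mu]_(xi in `[- l, l]) (`|g1 xi| + `|g2 xi|).
have J0 : 0 <= J by apply: Rintegral_ge0 => xi _; rewrite addr_ge0.
have K0 : 0 < 1 + C3 * l + l `^ m + l `^ m.
  by have h3 := powR_ge0 l m; have h4 : 0 <= C3 * l; [rewrite mulr_ge0// ltW|lra].
pose eta := e / ((1 + C3 * l + l `^ m + l `^ m) * (1 + J)).
have eta0 : 0 < eta by rewrite divr_gt0// mulr_gt0//; lra.
have [d1 d10 h1] := powR_dist a0 (lexx 0) eta0.
have [d2 d20 h2] := powR_dist g0 t0 eta0.
exists (Num.min eta (Num.min d1 d2)); first by rewrite !lt_min eta0 d10 d20.
move=> t' t'01; rewrite !lt_min => /andP[te /andP[td1 td2]].
have /andP[t'0 t'1] := t'01.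
apply: le_trans (osc_close _ _ l0 t'0 t0) _; rewrite -/J.
have k1 : `|Gx t' - Gx t| <= C3 * eta.
  apply: le_trans (hG _ _ t'01 t01) _; rewrite ler_pM2l//.
  have := h1 `|t' - t| (normr_ge0 _); rewrite subr0 normr_id => /(_ td1).
  by rewrite powR0 ?gt_eqF// subr0 ger0_norm ?powR_ge0// => /ltW.
have k2 := ltW (h2 t' t'0 td2).
apply: (@le_trans _ _ ((1 + C3 * l + l `^ m + l `^ m) * eta * (1 + J))).
  apply: ler_pM => //; last by lra.
    by rewrite !addr_ge0// mulr_ge0 ?powR_ge0.
  have p0 := powR_ge0 l m.
  have q1 : `|Gx t' - Gx t| * l <= C3 * eta * l by exact: ler_wpM2r.
  have q2 : `|t' - t| * l `^ m <= eta * l `^ m by apply: ler_wpM2r => //; exact: ltW.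
  have q3 : `|t' `^ gam - t `^ gam| * l `^ m <= eta * l `^ m by exact: ler_wpM2r.
  clear -q1 q2 q3 eta0; lra.
rewrite /eta le_eqVlt; apply/orP; left; apply/eqP; field.
by apply/andP; split; rewrite gt_eqF//; lra.
Qed.

(** At a positive time the damping is square integrable, and so are [g1] and [g2]; hence the
    products are integrable on the whole line. At time 0 the damping is 1 and this argument is
    lost. *)
Lemma L1_osc_T (G t : R) : 0 < t ->
  L1 setT (fun xi => cos (ph G t xi) * dp t xi * g1 xi - sin (ph G t xi) * dp t xi * g2 xi).
Proof.
move=> t0; have [C C0 hC] := damp_decay gam (lt_trans ltr01 m1) t0.
have mdp : measurable_fun setT (dp t).
  by rewrite /damp; meas.
have dsq : L1 setT (fun xi => dp t xi ^+ 2).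
  apply: (@L1_le _ _ _ (fun xi => C * (1 + xi ^+ 2)^-1)) => //.
  - exact: measurable_funX.
  - by apply: L1Zl => //; exact: L1_inv_oneDsqr.
  - move=> xi _; rewrite ger0_norm ?sqr_ge0//; apply: le_trans (hC xi).
    have /andP[dp0 dp1] := damp_le1 m gam t xi.
    by rewrite expr2 ler_piMr.
have mph : measurable_fun setT (ph G t) by rewrite /phase; meas.
have k (g c : R -> R) : measurable_fun setT c -> (forall y, `|c y| <= 1) ->
    measurable_fun setT g -> L1 setT (fun xi => g xi ^+ 2) ->
    L1 setT (fun xi => c (ph G t xi) * dp t xi * g xi).
  move=> mc c1 mg sq; have i := L1_sq_mul measurableT mdp mg dsq sq.
  under eq_fun do rewrite -mulrA.
  apply: (L1_mulb measurableT i (C := 1)); first exact: measurableT_comp.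
  by move=> xi _; exact: c1.
apply: (L1B measurableT); apply: k => //.
- exact: measurable_cos.
- by move=> y; rewrite ler_norml cos_geN1 cos_le1.
- exact: measurable_sin.
- by move=> y; rewrite ler_norml sin_geN1 sin_le1.
Qed.

Lemma pow2_exhaust (x : R) : \forall n \near \oo, `|x| <= 2 ^+ n.
Proof.
near=> n.
have h : `|x| <= n%:R by near: n; exact: nbhs_infty_ger.
apply: le_trans h _; rewrite -natrX ler_nat ltnW//; exact: ltn_expl.
Unshelve. all: by end_near. Qed.

Lemma osc_exhaust (G t : R) : 0 < t ->
  (fun L : nat => os `[- (2 ^+ L), 2 ^+ L] g1 g2 G t) @ \oo --> os setT g1 g2 G t.
Proof. by move=> t0; apply: Rint_exhaust; [exact: L1_osc_T|exact: pow2_exhaust]. Qed.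

End OscLimits.

Section Window.
Variables (a b : R).
Hypothesis ab : a <= b.

(** [cos_win + i sin_win] is the integral of [e^(i x xi)] over [[a, b]]. Averaging over an interval
    makes it square integrable in [xi], unlike the exponential at a single point, so it can be
    paired with a transform in L^2. *)
Definition cos_win (xi : R) : R := \int[mu]_(x in `[a, b]) cos (x * xi).
Definition sin_win (xi : R) : R := \int[mu]_(x in `[a, b]) sin (x * xi).

Let win_meas (c : R -> R) : measurable_fun setT c -> (forall y, `|c y| <= 1) ->
  measurable_fun setT (fun xi => \int[mu]_(x in `[a, b]) c (x * xi)).
Proof.
move=> mc c1.
have mI : measurable (`[a, b] : set R) by exact: measurable_itv.
have m2 : measurable_fun setT (fun z : R * R => (1 + z.2 ^+ 2)^-1).
  apply: (measurableT_comp (f := fun y : R => (1 + y ^+ 2)^-1)); last exact: measurable_snd.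
  by apply: continuous_measurable_fun; exact: continuous_oneDsqrV.
have mF : measurable_fun setT (fun z : R * R => c (z.1 * z.2) * (1 + z.2 ^+ 2)^-1).
  by apply: measurable_funM => //; apply: measurableT_comp => //; meas.
have i1 : L1 `[a, b] (fun=> 1 : R) by apply: L1_itv_1 => // x; rewrite normr1.
have iw : L1 ([set: R] : set R) (fun x : R => (1 + x ^+ 2)^-1) by exact: L1_inv_oneDsqr.
have [|_ h _] := Fubini_Rint mI measurableT mF i1 iw.
  move=> x y _ _ /=; rewrite normrM (ger0_norm (_ : 0 <= (1 + y ^+ 2)^-1)).
    by rewrite ler_wpM2r// ?invr_ge0 ?addr_ge0 ?sqr_ge0.
  by rewrite invr_ge0 addr_ge0 ?sqr_ge0.
(* Measurability comes from Fubini, which wants an integrable majorant in [xi]: hence the factor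
   [(1 + xi^2)^-1], divided out here. *)
have -> : (fun xi => \int[mu]_(x in `[a, b]) c (x * xi)) =
    (fun xi => (\int[mu]_(x in `[a, b]) (c (x * xi) * (1 + xi ^+ 2)^-1)) * (1 + xi ^+ 2)).
  apply/funext => xi; rewrite RintZr//.
    by rewrite mulfVK// gt_eqF//; have := sqr_ge0 xi; lra.
  apply: L1_itv_1 => //; apply: measurableT_comp => //; meas.
by apply: measurable_funM; [exact: L1_meas h|meas].
Qed.

Lemma meas_cos_win : measurable_fun setT cos_win.
Proof.
by apply: win_meas; [exact: measurable_cos|move=> y; rewrite ler_norml cos_geN1 cos_le1].
Qed.

Lemma meas_sin_win : measurable_fun setT sin_win.
Proof.
by apply: win_meas; [exact: measurable_sin|move=> y; rewrite ler_norml sin_geN1 sin_le1].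
Qed.

(** The bound [|c| <= b - a] controls low frequencies; for high ones [c * xi] is a difference of two
    values of a function bounded by 1, whose square is at most 4. *)
Let sq_bound (c F : R -> R) (xi : R) : (forall y, `|F y| <= 1) -> `|c xi| <= b - a ->
  (xi != 0 -> c xi = (F (b * xi) - F (a * xi)) / xi) ->
  c xi ^+ 2 <= ((b - a) ^+ 2 + 4) * (1 + xi ^+ 2)^-1.
Proof.
move=> F1 cb cF; rewrite ler_pdivlMr; last by have := sqr_ge0 xi; lra.
have h1 : c xi ^+ 2 <= (b - a) ^+ 2.
  by rewrite -(real_normK (num_real (c xi))) lerXn2r ?nnegrE ?subr_ge0.
suff : (c xi * xi) ^+ 2 <= 4 by rewrite exprMn; lra.
have [->|x0] := eqVneq xi 0; first by rewrite mulr0 expr0n/=; lra.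
rewrite cF// divfK// -(real_normK (num_real (_ - _))) (_ : 4 = 2 ^+ 2 :> R); last by ring.
rewrite lerXn2r ?nnegrE//; apply: le_trans (ler_normB _ _) _.
by have := F1 (b * xi); have := F1 (a * xi); lra.
Qed.

Let D_mulr (k x : R) : is_derive x 1 (fun y => y * k) k.
Proof.
have := D_mul (is_derive_id x 1) (is_derive_cst k x 1).
by rewrite mul1r mulr0 addr0.
Qed.

Lemma cos_win_sq (xi : R) : cos_win xi ^+ 2 <= ((b - a) ^+ 2 + 4) * (1 + xi ^+ 2)^-1.
Proof.
apply: (sq_bound (F := @sin R)).
- by move=> y; rewrite ler_norml sin_geN1 sin_le1.
- have := @Rint_bound_itv R a b (fun x => cos (x * xi)) 1 ab; rewrite mul1r; apply.
    by apply: measurable_funTS; meas.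
  by move=> x _; rewrite ler_norml cos_geN1 cos_le1.
- move=> x0; rewrite /cos_win.
  have dF (x : R) : is_derive x 1 (fun x => xi^-1 * sin (x * xi)) (cos (x * xi)).
    have := D_cmul (xi^-1) (D_comp (g := fun x : R => x * xi) (is_derive_sin (x * xi)) (D_mulr xi x)).
    by rewrite mulrCA mulVf// mulr1.
  rewrite (@FTC2_Rint _ a b _ (fun x => xi^-1 * sin (x * xi)) ab _ (fun x _ => dF x)).
    by rewrite -mulrBr mulrC.
  apply: cont_itv => x _; exact: D_continuous.
Qed.

Lemma sin_win_sq (xi : R) : sin_win xi ^+ 2 <= ((b - a) ^+ 2 + 4) * (1 + xi ^+ 2)^-1.
Proof.
apply: (sq_bound (F := fun y => - cos y)).
- by move=> y; rewrite normrN ler_norml cos_geN1 cos_le1.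
- have := @Rint_bound_itv R a b (fun x => sin (x * xi)) 1 ab; rewrite mul1r; apply.
    by apply: measurable_funTS; meas.
  by move=> x _; rewrite ler_norml sin_geN1 sin_le1.
- move=> x0; rewrite /sin_win.
  have dF (x : R) : is_derive x 1 (fun x => xi^-1 * - cos (x * xi)) (sin (x * xi)).
    have := D_cmul (xi^-1) (D_opp (D_comp (g := fun x : R => x * xi) (is_derive_cos (x * xi)) (D_mulr xi x))).
    by rewrite mulNr opprK mulrCA mulVf// mulr1.
  rewrite (@FTC2_Rint _ a b _ (fun x => xi^-1 * - cos (x * xi)) ab _ (fun x _ => dF x)).
    by rewrite -mulrBr mulrC.
  apply: cont_itv => x _; exact: D_continuous.
Qed.

Let win_L2 (c : R -> R) : measurable_fun setT c ->
  (forall xi, c xi ^+ 2 <= ((b - a) ^+ 2 + 4) * (1 + xi ^+ 2)^-1) ->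
  L1 setT (fun xi => c xi ^+ 2).
Proof.
move=> mc h; apply: (@L1_le _ _ _ (fun xi => ((b - a) ^+ 2 + 4) * (1 + xi ^+ 2)^-1)) => //.
- exact: measurable_funX.
- by apply: L1Zl => //; exact: L1_inv_oneDsqr.
- by move=> xi _; rewrite ger0_norm ?sqr_ge0.
Qed.

Lemma cos_win_L2 : L1 setT (fun xi => cos_win xi ^+ 2).
Proof. exact: win_L2 meas_cos_win cos_win_sq. Qed.

Lemma sin_win_L2 : L1 setT (fun xi => sin_win xi ^+ 2).
Proof. exact: win_L2 meas_sin_win sin_win_sq. Qed.

Lemma osc0_Fubini (m gam l : R) (g1 g2 : R -> R) : 0 < gam ->
  measurable_fun setT g1 -> measurable_fun setT g2 ->
  L1 `[- l, l] g1 -> L1 `[- l, l] g2 ->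
  L1 `[a, b] (fun x => osc m gam `[- l, l] g1 g2 x 0) /\
  \int[mu]_(x in `[a, b]) osc m gam `[- l, l] g1 g2 x 0 =
  \int[mu]_(xi in `[- l, l]) (cos_win xi * g1 xi - sin_win xi * g2 xi).
Proof.
move=> g0 mg1 mg2 i1 i2.
have mI (p q : R) : measurable (`[p, q] : set R) by exact: measurable_itv.
have o0 x : osc m gam `[- l, l] g1 g2 x 0 =
    \int[mu]_(xi in `[- l, l]) (cos (x * xi) * g1 xi - sin (x * xi) * g2 xi).
  apply: Rint_eq => xi _; rewrite /phase /damp powR0 ?gt_eqF// !mul0r addr0 oppr0 expR0.
  by rewrite !mulr1.
have mF : measurable_fun setT (fun z : R * R => cos (z.1 * z.2) * g1 z.2 - sin (z.1 * z.2) * g2 z.2).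
  have m1 : measurable_fun setT (fun z : R * R => g1 z.2) by apply: measurableT_comp.
  have m2 : measurable_fun setT (fun z : R * R => g2 z.2) by apply: measurableT_comp.
  by meas.
have ione : L1 `[a, b] (fun=> 1 : R) by apply: L1_itv_1 => // x; rewrite normr1.
have ig := L1D (mI (- l) l) (L1_norm (mI (- l) l) i1) (L1_norm (mI (- l) l) i2).
have [|h1 _ h2] := Fubini_Rint (mI a b) (mI (- l) l) mF ione ig.
  move=> x y _ _ /=; rewrite mul1r; apply: le_trans (ler_normB _ _) _; rewrite !normrM.
  apply: lerD; apply: ler_piMl => //; rewrite ler_norml.
    by rewrite cos_geN1 cos_le1.
  by rewrite sin_geN1 sin_le1.
split.
  rewrite (_ : (fun x => _) = (fun x : R => (\int[mu]_(y in `[- l, l]) (cos (x * y) * g1 y -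
    sin (x * y) * g2 y))%:E)); first exact: h1.
  by apply/funext => x; congr EFin; exact: o0.
transitivity (\int[mu]_(x in `[a, b]) \int[mu]_(y in `[- l, l]) (cos (x * y) * g1 y - sin (x * y) * g2 y)).
  by apply: Rint_eq => x _; exact: o0.
rewrite h2; apply: Rint_eq => xi _ /=.
have ic : L1 `[a, b] (fun x => cos (x * xi)).
  apply: L1_itv_1; first by meas.
  by move=> x; rewrite ler_norml cos_geN1 cos_le1.
have is0 : L1 `[a, b] (fun x => sin (x * xi)).
  apply: L1_itv_1; first by meas.
  by move=> x; rewrite ler_norml sin_geN1 sin_le1.
have ic' : L1 `[a, b] (fun x => cos (x * xi) * g1 xi).
  exact: L1Zr.
have is0' : L1 `[a, b] (fun x => sin (x * xi) * g2 xi).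
  exact: L1Zr.
by rewrite (RintB (mI a b) ic' is0') RintZr// RintZr.
Qed.

End Window.

Lemma norm_three (a b a' b' c e : R) : `|a' - b'| <= c -> `|a' - a| <= e / 2 ->
  `|b' - b| <= e / 2 -> `|a - b| <= c + e.
Proof.
have -> : a - b = (a' - b') - (a' - a) + (b' - b) by ring.
move=> h1 h2 h3; apply: le_trans (ler_normD _ _) _.
by have := ler_normB (a' - b') (a' - a); lra.
Qed.

Section Positive.
Variables (m gam alpha s : R) (Gam : R -> R -> R) (C1 C2 C3 : R) (g1 g2 f1 : R -> R).
Hypothesis m1 : 1 < m.
Hypothesis g0 : 0 < gam.
Hypothesis ma : m^-1 <= alpha.
Hypothesis C10 : 0 < C1.
Hypothesis C20 : 0 < C2.
Hypothesis C30 : 0 < C3.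
Hypothesis GamI : forall x, Gam x 0 = x.
Hypothesis GamL : forall t x x', 0 <= t <= 1 -> C1 * `|x - x'| <= `|Gam x t - Gam x' t|.
Hypothesis GamU : forall t x x', 0 <= t <= 1 -> `|Gam x t - Gam x' t| <= C2 * `|x - x'|.
Hypothesis GamH : forall x t t', 0 <= t <= 1 -> 0 <= t' <= 1 ->
  `|Gam x t - Gam x t'| <= C3 * `|t - t'| `^ alpha.
Hypothesis sc : scrit m gam < s.
Hypothesis s0 : 0 <= s.
Hypothesis mg1 : measurable_fun setT g1.
Hypothesis mg2 : measurable_fun setT g2.
Hypothesis wg : L1 setT (fun xi => (1 + xi ^+ 2) `^ s * (g1 xi ^+ 2 + g2 xi ^+ 2)).
Hypothesis fi : forall a b : R, L1 `[a, b] f1.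
Hypothesis inversion : forall a b : R, a <= b ->
  2 * pi * (\int[mu]_(x in `[a, b]) f1 x) =
  \int[mu]_xi (cos_win a b xi * g1 xi - sin_win a b xi * g2 xi).

Let sq1 := weighted_sq1 s0 mg1 wg.
Let sq2 := weighted_sq2 s0 mg2 wg.
Let mI (a b : R) : measurable (`[a, b] : set R).
Proof. exact: measurable_itv. Qed.

Let S (L : nat) (x t : R) : R := osc m gam `[- (2 ^+ L), 2 ^+ L] g1 g2 (Gam x t) t.
Let piece (b : bool) (k : nat) (x t : R) : R :=
  osc m gam (if b then `[2 ^+ k, 2 * 2 ^+ k]%classic else `[- (2 * 2 ^+ k), - (2 ^+ k)]%classic)
    g1 g2 (Gam x t) t.

Let S_step k x t : S k.+1 x t = S k x t + (piece true k x t + piece false k x t).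
Proof. by rewrite /S exprS osc_double// exprn_ge0. Qed.

Let S_tail x t K L : (K <= L)%N ->
  S L x t - S K x t = \sum_(K <= k < L) (piece true k x t + piece false k x t).
Proof.
move=> KL; rewrite (@telescope_sumr_eq _ K L (fun k => S k x t))// => k _.
by rewrite S_step addrAC subrr add0r.
Qed.

Let meas_Gam t : 0 <= t <= 1 -> measurable_fun setT (Gam ^~ t).
Proof.
move=> t01; apply: continuous_measurable_fun => x.
apply/cvgrPdist_lt => e e0; near=> y.
apply: le_lt_trans (GamU _ _ t01) _; rewrite -ltr_pdivlMl//.
near: y; apply: (@cvgr_dist_lt _ _ _ _ _ id) => //.
by rewrite mulr_gt0// invr_gt0.
Unshelve. all: by end_near. Qed.

Let S_continuous x L t e : 0 <= t <= 1 -> 0 < e -> exists2 d, 0 < d &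
  forall t', 0 <= t' <= 1 -> `|t' - t| < d -> `|S L x t' - S L x t| <= e.
Proof.
move=> t01 e0.
have a0 : 0 < alpha by apply: lt_le_trans ma; rewrite invr_gt0 (lt_trans ltr01 m1).
apply: (osc_continuous m1 g0 mg1 mg2 sq1 sq2 C30 a0 _ _ t01 e0); last by rewrite exprn_ge0.
by move=> t1 t2; exact: GamH.
Qed.

Let maximal (A : R) : exists W : R -> R, L1 `[A, A + 1] W /\
  {ae mu, forall x, x \in `[A, A + 1] -> exists c : nat -> R,
    [/\ forall k, 0 <= c k, forall N, \sum_(k < N) c k <= W x &
        forall K L t, (K <= L)%N -> 0 <= t <= 1 ->
          `|S L x t - S K x t| <= \sum_(K <= k < L) c k]}.
Proof.
have [C [kap [C0 kap0 piece_le]]] := piece_bound m1 g0 ma C10 C30 GamL GamH A sc.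
pose H := \int[mu]_xi ((1 + xi ^+ 2) `^ s * (g1 xi ^+ 2 + g2 xi ^+ 2)).
have H0 : 0 <= H.
  by apply: Rintegral_ge0 => xi _; rewrite mulr_ge0 ?powR_ge0 ?addr_ge0 ?sqr_ge0.
(* Each doubling of the frequency gains the factor [q < 1], so the bounds form a geometric series;
   the factor 2 in [B] counts positive and negative frequencies. *)
pose q : R := 2 `^ (- kap).
pose T k x j := piece true k x (times R j) + piece false k x (times R j).
pose B k := 2 * (C * (1 + H)) * q ^+ k.
have q1 : q < 1.
  rewrite /q powRN invf_lt1 ?powR_gt0//.
  by rewrite /powR gt_eqF// expR_gt1 mulr_gt0// ln_gt0// ltr1n.
have q0 : 0 <= q by exact: powR_ge0.
have B0 : 0 <= 2 * (C * (1 + H)) by rewrite !mulr_ge0// ?(ltW C0)//; lra.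
have Bs N : \sum_(k < N) B k <= 2 * (C * (1 + H)) / (1 - q).
  have e : (1 - q) * (\sum_(i < N) q ^+ i) = 1 - q ^+ N.
    by rewrite -[LHS]opprK -mulNr opprB -subrX1 opprB.
  have q2 : 0 < 1 - q by rewrite subr_gt0.
  rewrite -mulr_sumr ler_wpM2l// -(ler_pM2l q2) e mulfV ?gt_eqF//.
  by rewrite gerBl exprn_ge0.
have pb (b : bool) (k : nat) (v : R -> nat) : selection v ->
    L1 `[A, A + 1] (fun x => piece b k x (times R (v x))) /\
    \int[mu]_(x in `[A, A + 1]) `|piece b k x (times R (v x))| <= C * (1 + H) * q ^+ k.
  move=> sv; have l1 : 1 <= 2 ^+ k :> R by rewrite exprn_ege1// ler1n.
  have l0 : 0 < 2 ^+ k :> R by rewrite exprn_gt0.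
  pose E : set R := if b then `[2 ^+ k, 2 * 2 ^+ k]%classic else `[- (2 * 2 ^+ k), - (2 ^+ k)]%classic.
  have mE : measurable E by rewrite /E; case: (b); exact: mI.
  have ET : E `<=` setT by [].
  have i1 : L1 E g1 by rewrite /E; case: (b); exact: L1_of_sq.
  have i2 : L1 E g2 by rewrite /E; case: (b); exact: L1_of_sq.
  have El (xi : R) : E xi -> 2 ^+ k <= `|xi|.
    rewrite /E; case: (b); rewrite /= in_itv/= => /andP[h1 h2].
      exact: le_trans h1 (ler_norm _).
    rewrite -normrN; apply: le_trans (ler_norm _); lra.
  have mass := dyadic_mass s0 mg1 mg2 wg mE l1 El.
  have mu_ : measurable_fun setT (fun x => times R (v x)).
    by apply: (sv (fun j _ => times R j)) => j.
  have mG : measurable_fun setT (fun x => Gam x (times R (v x))).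
    by apply: (sv (fun j x => Gam x (times R j))) => j; apply: meas_Gam; exact: times01.
  have [h1 h2] := piece_le (2 ^+ k) b g1 g2 (fun x => times R (v x)) H l1 i1 i2
    (L1S mE measurableT ET sq1) (L1S mE measurableT ET sq2) mass mu_ mG (fun x => times01 R (v x)).
  split; first exact: h1.
  apply: le_trans h2 _; rewrite -powR_mulrn// -powRrM (mulrC _ (- kap)) powRrM powR_mulrn//.
  by rewrite -/q mulrAC.
have TB k v : selection v ->
    L1 `[A, A + 1] (fun x => T k x (v x)) /\
    \int[mu]_(x in `[A, A + 1]) `|T k x (v x)| <= B k.
  move=> sv; have [i1 b1] := pb true k v sv; have [i2 b2] := pb false k v sv.
  have mA := mI A (A + 1); split; first exact: L1D.
  apply: (@le_trans _ _ (\int[mu]_(x in `[A, A + 1])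
    (`|piece true k x (times R (v x))| + `|piece false k x (times R (v x))|))).
    apply: Rint_le => //; first by apply: L1_norm => //; exact: L1D.
      by apply: L1D => //; exact: L1_norm.
    by move=> x _; exact: ler_normD.
  rewrite (RintD mA (L1_norm mA i1) (L1_norm mA i2)) /B.
  apply: le_trans (lerD b1 b2) _; rewrite le_eqVlt; apply/orP; left; apply/eqP; ring.
have [W [iW aeW]] := maximal_sum (mI A (A + 1)) TB Bs.
exists W; split=> //; apply: aeS aeW => x h /h [c [c0 cW Tc]].
(* The bound is known at the times of the dense sequence; continuity in time of the two truncations,
   for fixed [K] and [L], carries it to every [t]. *)
exists c; split=> // K L t KL t01; apply/ler_addgt0Pr => e e0.
have e2 : 0 < e / 2 by lra.
have [d1 d10 h1] := S_continuous x L t01 e2.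
have [d2 d20 h2] := S_continuous x K t01 e2.
have d0 : 0 < Num.min d1 d2 by rewrite lt_min d10.
have [n] := times_dense t01 d0; rewrite lt_min => /andP[/h1 k1 /h2 k2].
have {}k1 := k1 (times01 R n); have {}k2 := k2 (times01 R n).
have k3 : `|S L x (times R n) - S K x (times R n)| <= \sum_(K <= k < L) c k.
  rewrite S_tail//; apply: le_trans (ler_norm_sum _ _ _) _.
  by apply: ler_sum => k _; exact: (Tc k n).
exact: norm_three k3 k1 k2.
Qed.

Lemma ae_convergence_real :
  {ae mu, forall x, (fun t => osc m gam setT g1 g2 (Gam x t) t) @ 0^'+ --> 2 * pi * f1 x}.
Proof.
apply: ae_unit_intervals => A.
have [W [iW aeW]] := maximal A.
pose S0 L x : R := osc m gam `[- (2 ^+ L), 2 ^+ L] g1 g2 x 0.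
have S0E L x : S L x 0 = S0 L x by rewrite /S GamI.
have zero01 : 0 <= (0 : R) <= 1 by rewrite lexx ler01.
have A1 : A <= A + 1 by lra.
have S0i (b : R) L : A <= b -> L1 `[A, b] (S0 L) /\
    \int[mu]_(x in `[A, b]) S0 L x =
    \int[mu]_(xi in `[- (2 ^+ L), 2 ^+ L]) (cos_win A b xi * g1 xi - sin_win A b xi * g2 xi).
  move=> Ab; apply: osc0_Fubini => //; exact: L1_of_sq.
have ib : L1 `[A, A + 1] (fun x => `|S0 0%N x| + W x).
  by apply: L1D => //; apply: L1_norm => //; exact: (S0i _ _ A1).1.
have tail x : (exists c : nat -> R,
    [/\ forall k, 0 <= c k, forall N, \sum_(k < N) c k <= W x &
        forall K L t, (K <= L)%N -> 0 <= t <= 1 ->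
          `|S L x t - S K x t| <= \sum_(K <= k < L) c k]) ->
    forall e, 0 < e -> exists K, forall L, (K <= L)%N -> forall t, 0 <= t <= 1 ->
      `|S L x t - S K x t| <= e.
  move=> [c [c0 cW Sc]] e e0; have [K HK] := bounded_tail c0 cW e0.
  exists K => L KL t t01; apply: le_trans (HK L KL); exact: Sc.
have S0cv x : (forall e, 0 < e -> exists K, forall L, (K <= L)%N -> forall t, 0 <= t <= 1 ->
      `|S L x t - S K x t| <= e) -> exists l : R, S0 ^~ x @ \oo --> l.
  move=> h; exists (lim (S0 ^~ x @ \oo)); apply: cauchy_cvg; apply: cauchy_exP => e e0.
  have e2 : 0 < e / 2 by lra.
  have [K HK] := h _ e2; exists (S0 K x); exists K => // L /= KL.
  rewrite /ball/= distrC -!S0E; apply: le_lt_trans (HK L KL 0 zero01) _; lra.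
have [F [iF Fcv Fint]] : exists F : R -> R, [/\ L1 `[A, A + 1] F,
    {ae mu, forall x, x \in `[A, A + 1] -> S0 ^~ x @ \oo --> F x} &
    forall E, measurable E -> E `<=` `[A, A + 1] ->
      (fun L => \int[mu]_(x in E) S0 L x) @ \oo --> \int[mu]_(x in E) F x].
  apply: (@dominated_limit _ _ (fun x => `|S0 0%N x| + W x)) => //.
  - by move=> L; apply: L1_meas; exact: (S0i _ L A1).1.
  - by apply: aeS aeW => x h xA; apply: S0cv; apply: tail; exact: h.
  - apply: aeS aeW => x h xA L; have [c [c0 cW Sc]] := h xA.
    have := Sc 0%N L 0 (leq0n L) zero01; rewrite !S0E big_mkord => h1.
    have := cW L; have := ler_normD (S0 L x - S0 0%N x) (S0 0%N x); rewrite subrK; lra.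
(* Over [[A, b]] the truncations at time 0 integrate, by Fubini, to truncated window integrals.
   Their limit is the integral of [F] by domination, and [2 * pi] times that of [f1] by
   [inversion]. *)
have Ff : {ae mu, forall x, x \in `]A, A + 1[ -> F x = 2 * pi * f1 x}.
  apply: ae_eq_itv; [lra|exact: iF|exact: L1Zl|].
  move=> b /andP[Ab bA]; rewrite RintZl// inversion//.
  have sub : `[A, b] `<=` `[A, A + 1] by apply: subset_itvl; rewrite bnd_simp.
  have l1 := Fint _ (mI A b) sub.
  have ic : L1 setT (fun xi => cos_win A b xi * g1 xi - sin_win A b xi * g2 xi).
    apply: (L1B measurableT); apply: L1_sq_mul => //.
    - exact: meas_cos_win.
    - exact: cos_win_L2.
    - exact: meas_sin_win.
    - exact: sin_win_L2.
  have l2 := Rint_exhaust ic (pow2_exhaust).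
  have E : (fun L => \int[mu]_(x in `[A, b]) S0 L x) = (fun n => \int[mu]_(x in `[- (2 ^+ n), 2 ^+ n])
    (cos_win A b x * g1 x - sin_win A b x * g2 x)).
    by apply/funext => L; exact: (S0i _ L Ab).2.
  rewrite E in l1.
  by rewrite -(cvg_lim (@Rhausdorff R) l1) -(cvg_lim (@Rhausdorff R) l2).
have inc x : x \in `]A, A + 1[ -> x \in `[A, A + 1].
  by rewrite !in_itv/= => /andP[/ltW -> /ltW ->].
have aeWF : {ae mu, forall x, x \in `]A, A + 1[ ->
   (forall e, 0 < e -> exists K, forall L, (K <= L)%N -> forall t, 0 <= t <= 1 ->
      `|S L x t - S K x t| <= e) /\ S0 ^~ x @ \oo --> F x}.
  apply: aeS2 aeW Fcv => x h1 h2 /inc xA; split; last exact: h2.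
  by apply: tail; exact: h1.
apply: aeS2 aeWF Ff => x h1 h2 xA; have [{}h1 h3] := h1 xA; rewrite -(h2 xA).
apply: (@uniform_interchange _ (fun L => S L x)) => //.
- by move=> t /andP[t0 t1]; exact: osc_exhaust.
- by rewrite (_ : (fun L => S L x 0) = S0 ^~ x)//; apply/funext => L; exact: S0E.
- move=> K e e0; have [d d0 hd] := S_continuous x K zero01 e0.
  exists d => // t t01 td; apply: hd => //; rewrite subr0 ger0_norm//.
  by have /andP[] := t01.
Qed.

End Positive.

End Convergence.

(** * Fourier inversion *)

Section Inversion.
Variable R : realType.

Definition poisson (e xi : R) : R := expR (- (e * `|xi|)).

Lemma poisson01 e xi : 0 <= e -> 0 <= poisson e xi <= 1.
Proof.
by move=> e0; rewrite expR_ge0/= -expR0 ler_expR oppr_le0 mulr_ge0.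
Qed.

Lemma meas_poisson e : measurable_fun setT (poisson e).
Proof. by rewrite /poisson; meas. Qed.

Lemma L1_poisson e : 0 < e -> L1 setT (poisson e).
Proof.
move=> e0; have [C C0 hC] := damp_decay 1 ltr01 e0.
apply: (@L1_le _ _ _ (fun xi => C * (1 + xi ^+ 2)^-1)) => //.
- exact: meas_poisson.
- by apply: L1Zl => //; exact: L1_inv_oneDsqr.
- move=> xi _; have /andP[h0 h1] := poisson01 xi (ltW e0); rewrite ger0_norm//.
  by have := hC xi; rewrite /damp !powRr1// ltW.
Qed.

Lemma L1_poisson_mul e (c : R -> R) : 0 < e -> measurable_fun setT c ->
  (forall x, `|c x| <= 1) -> L1 setT (fun xi => poisson e xi * c xi).
Proof.
move=> e0 mc c1; apply: (@L1_le _ _ _ (poisson e)) => //.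
- by apply: measurable_funM => //; exact: meas_poisson.
- exact: L1_poisson.
- move=> xi _; have /andP[h0 h1] := poisson01 xi (ltW e0).
  by rewrite normrM (ger0_norm h0) ler_piMr.
Qed.

Lemma cont_poisson e x : {for x, continuous (poisson e)}.
Proof.
rewrite /poisson; apply: continuous_comp; last exact: continuous_expR.
apply: (@continuousN R R R (fun y => e * `|y|)).
apply: (@continuousM _ R (fun=> e) (fun y => `|y|)); first exact: cvg_cst.
exact: (@cont_norm R id x (@cvg_id _ _)).
Qed.

Lemma poisson_half_cos (e z n : R) : 0 < e -> 0 <= n ->
  \int[mu]_(xi in `[0, n]) (poisson e xi * cos (z * xi)) =
  (e + expR (- (e * n)) * (z * sin (z * n) - e * cos (z * n))) / (e ^+ 2 + z ^+ 2).
Proof.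
move=> e0 n0; have D0 : e ^+ 2 + z ^+ 2 != 0.
  by rewrite gt_eqF// ltr_wpDr ?sqr_ge0// exprn_gt0.
pose F (x : R) := (e ^+ 2 + z ^+ 2)^-1 * (expR (- (e * x)) * (z * sin (z * x) - e * cos (z * x))).
have dl (k x : R) : is_derive x 1 (fun y : R => k * y) k.
  by have := D_cmul k (is_derive_id x 1); rewrite mulr1.
have dF (x : R) : is_derive x 1 F (expR (- (e * x)) * cos (z * x)).
  have h1 := D_comp (f := expR) (g := fun x => - (e * x)) (is_derive_expR _) (D_opp (dl e x)).
  have h2 := D_comp (f := sin) (g := fun x => z * x) (is_derive_sin _) (dl z x).
  have h3 := D_comp (f := cos) (g := fun x => z * x) (is_derive_cos _) (dl z x).
  have := D_cmul ((e ^+ 2 + z ^+ 2)^-1) (D_mul h1 (D_sub (D_cmul z h2) (D_cmul e h3))).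
  congr is_derive; field; exact: D0.
have cf : {within `[0, n], continuous (fun x : R => expR (- (e * x)) * cos (z * x))}.
  apply: cont_itv => x _.
  have h1 := D_comp (f := expR) (g := fun x => - (e * x)) (is_derive_expR _) (D_opp (dl e x)).
  have h3 := D_comp (f := cos) (g := fun x => z * x) (is_derive_cos _) (dl z x).
  exact: D_continuous (D_mul h1 h3).
transitivity (\int[mu]_(xi in `[0, n]) (expR (- (e * xi)) * cos (z * xi))).
  by apply: Rint_eq => xi; rewrite /= in_itv/= => /andP[x0 _]; rewrite /poisson ger0_norm.
rewrite (FTC2_Rint n0 cf (fun x _ => dF x)) /F !mulr0 oppr0 expR0 sin0 cos0.
by field; exact: D0.
Qed.

Lemma poisson_sym (e n : R) (c : R -> R) : continuous c -> 0 <= n ->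
  \int[mu]_(xi in `[- n, n]) (poisson e xi * c xi) =
  \int[mu]_(xi in `[0, n]) (poisson e xi * c (- xi)) +
  \int[mu]_(xi in `[0, n]) (poisson e xi * c xi).
Proof.
move=> cc n0.
have ct (x : R) : {for x, continuous (fun xi : R => poisson e xi * c xi)}.
  apply: continuousM; [exact: cont_poisson|exact: cc].
rewrite (@Rint_split _ (- n) 0 n) ?oppr_le0//; last by apply: L1_cont.
congr (_ + _).
have := @Rint_reflect R 0 n (fun xi => poisson e xi * c xi) n0.
rewrite oppr0 => ->; last by apply: cont_itv.
by apply: Rint_eq => x _; rewrite /poisson normrN.
Qed.

Lemma poisson_cos (e z : R) : 0 < e ->
  \int[mu]_xi (poisson e xi * cos (z * xi)) = 2 * e / (e ^+ 2 + z ^+ 2).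
Proof.
move=> e0; have D0 : 0 < e ^+ 2 + z ^+ 2 by rewrite ltr_wpDr ?sqr_ge0// exprn_gt0.
have cc : continuous (fun xi : R => cos (z * xi)).
  move=> x; have := D_comp (f := cos) (g := fun x => z * x) (is_derive_cos _) (D_cmul z (is_derive_id x 1)).
  exact: D_continuous.
have i : L1 setT (fun xi => poisson e xi * cos (z * xi)).
  apply: L1_poisson_mul => //; first by meas.
  by move=> x; rewrite ler_norml cos_geN1 cos_le1.
have ex (x : R) : \forall n \near \oo, `|x| <= n%:R by exact: nbhs_infty_ger.
have l1 := Rint_exhaust i ex.
rewrite -(cvg_lim (@Rhausdorff R) l1); apply: (cvg_lim (@Rhausdorff R)).
have E (n : nat) : \int[mu]_(x in `[- n%:R, n%:R]) (poisson e x * cos (z * x)) =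
   2 * e / (e ^+ 2 + z ^+ 2) + 2 * (expR (- e) ^+ n * (z * sin (z * n%:R) - e * cos (z * n%:R))
     / (e ^+ 2 + z ^+ 2)).
  rewrite poisson_sym// (_ : (fun x => _) = (fun xi => poisson e xi * cos (z * xi))); last first.
    by apply/funext => x; rewrite mulrN cosN.
  rewrite poisson_half_cos// -expRM_natl mulrN (mulrC n%:R) -mulr2n -mulr_natl.
  by field; rewrite gt_eqF.
have q1 : `|expR (- e)| < 1 by rewrite ger0_norm ?expR_ge0// expR_lt1 oppr_lt0.
apply/cvgrPdist_le => d d0.
have K0 : 0 < 2 * (`|z| + e) / (e ^+ 2 + z ^+ 2).
  by rewrite divr_gt0// mulr_gt0// ltr_wpDl.
have := cvg_expr q1 => /cvgrPdist_le /(_ (d / (2 * (`|z| + e) / (e ^+ 2 + z ^+ 2)))).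
rewrite divr_gt0// => /(_ isT); apply: filterS => n.
rewrite sub0r normrN ler_pdivlMr// E => h; rewrite opprD addrA subrr sub0r normrN.
apply: le_trans h; rewrite !normrM normfV (ger0_norm (ltW D0)) !(ger0_norm (_ : 0 <= 2))//.
rewrite -!mulrA [leRHS]mulrCA ler_wpM2l// ler_wpM2l ?normr_ge0// ler_wpM2r ?invr_ge0 ?(ltW D0)//.
apply: le_trans (ler_normB _ _) _; rewrite !normrM (ger0_norm (ltW e0)).
apply: lerD; [apply: ler_piMr => //|apply: ler_piMr => //; first exact: ltW].
  by rewrite ler_norml sin_geN1 sin_le1.
by rewrite ler_norml cos_geN1 cos_le1.
Qed.

Lemma poisson_sin (e z : R) : 0 < e -> \int[mu]_xi (poisson e xi * sin (z * xi)) = 0.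
Proof.
move=> e0.
have cc : continuous (fun xi : R => sin (z * xi)).
  move=> x; have := D_comp (f := sin) (g := fun x => z * x) (is_derive_sin _) (D_cmul z (is_derive_id x 1)).
  exact: D_continuous.
have i : L1 setT (fun xi => poisson e xi * sin (z * xi)).
  apply: L1_poisson_mul => //; first by meas.
  by move=> x; rewrite ler_norml sin_geN1 sin_le1.
have ex (x : R) : \forall n \near \oo, `|x| <= n%:R by exact: nbhs_infty_ger.
have l1 := Rint_exhaust i ex.
rewrite -(cvg_lim (@Rhausdorff R) l1); apply: (cvg_lim (@Rhausdorff R)).
rewrite (_ : (fun n => _) = cst 0); first exact: cvg_cst.
apply/funext => n; rewrite poisson_sym//.
have ct (x : R) : {for x, continuous (fun xi : R => poisson e xi * sin (z * xi))}.
  apply: continuousM; [exact: cont_poisson|exact: cc].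
rewrite (@Rint_eq _ _ _ (fun xi => (-1) * (poisson e xi * sin (z * xi)))); last first.
  by move=> x _; rewrite mulrN sinN; ring.
rewrite RintZl; [by rewrite mulN1r addNr|exact: measurable_itv|exact: L1_cont].
Qed.

Lemma L1_continuous (p q : R) (c : R -> R) : continuous c -> L1 `[p, q] c.
Proof. by move=> cc; apply: L1_cont => x _; exact: cc. Qed.

Lemma atan_scale (z : R) : 0 < z -> (fun k : nat => atan (z * k.+1%:R)) @ \oo --> (pi / 2 : R).
Proof.
move=> z0; apply: (@cvg_comp _ _ _ (fun k : nat => z * k.+1%:R) atan _ _ _ _ (@cvgy_atan R)).
apply/cvgryPge => A; near=> k.
have : A / z <= k%:R by near: k; exact: nbhs_infty_ger.
rewrite ler_pdivrMr// mulrC => h; apply: le_trans h _.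
by rewrite ler_pM2l// ler_nat.
Unshelve. all: by end_near. Qed.

Lemma atan_scale_sg (z : R) : z != 0 ->
  (fun k : nat => atan (z * k.+1%:R)) @ \oo --> Num.sg z * (pi / 2).
Proof.
case: (ltgtP z 0) => // [z0 _|z0 _]; last by rewrite gtr0_sg// mul1r; exact: atan_scale.
rewrite ltr0_sg// mulN1r; have nz : 0 < - z by rewrite oppr_gt0.
rewrite (_ : (fun k => _) = (fun k : nat => - atan (- z * k.+1%:R))).
  by apply: cvgN; exact: atan_scale.
by apply/funext => k; rewrite mulNr atanN opprK.
Qed.

Lemma ae_neq (a : R) : {ae mu, forall x : R, x != a}.
Proof.
exists [set a]; split; first exact: measurable_set1.
  exact: lebesgue_measure_set1.
by move=> x /= /negP; rewrite negbK => /eqP.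
Qed.

Lemma young_eps (th p q : R) : 0 < th ->
  `|p * q| <= th / 2 * p ^+ 2 + (2 * th)^-1 * q ^+ 2.
Proof.
move=> th0; have th2 : 0 < 2 * th by rewrite mulr_gt0.
have -> : th / 2 * p ^+ 2 + (2 * th)^-1 * q ^+ 2 = (th * th * p ^+ 2 + q ^+ 2) / (2 * th).
  by field; rewrite gt_eqF.
rewrite (ler_pdivlMr _ _ th2) normrM -(real_normK (num_real p)) -(real_normK (num_real q)).
by have := sqr_ge0 (th * `|p| - `|q|); rewrite sqrrB exprMn; lra.
Qed.

Lemma half_add_le (x y e : R) : x <= e -> y <= e / 2 -> x / 2 + y <= e.
Proof. lra. Qed.

Lemma sq_le_sub (g t : R) : t ^+ 2 <= 2 * (g ^+ 2 + (g - t) ^+ 2).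
Proof. by have := sqr_ge0 (2 * g - t); rewrite !sqrrB exprMn; lra. Qed.

Section WindowInversion.
Variables (a b : R).
Hypothesis ab : a <= b.
Let mI (p q : R) : measurable (`[p, q] : set R).
Proof. exact: measurable_itv. Qed.
Local Notation cw := (cos_win a b).
Local Notation sw := (sin_win a b).

Let L1c (k : R) (c : R -> R) : continuous c -> L1 `[a, b] (fun x => c x * k).
Proof. by move=> cc; apply: L1Zr => //; exact: L1_continuous. Qed.

Let ccos (xi : R) : continuous (fun x : R => cos (x * xi)).
Proof.
move=> x; have h : is_derive x 1 (fun y : R => y * xi) xi.
  by have := D_mul (is_derive_id x 1) (is_derive_cst xi x 1); rewrite mul1r mulr0 addr0.
exact: D_continuous (D_comp (f := cos) (g := fun x => x * xi) (is_derive_cos _) h).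
Qed.

Let csin (xi : R) : continuous (fun x : R => sin (x * xi)).
Proof.
move=> x; have h : is_derive x 1 (fun y : R => y * xi) xi.
  by have := D_mul (is_derive_id x 1) (is_derive_cst xi x 1); rewrite mul1r mulr0 addr0.
exact: D_continuous (D_comp (f := sin) (g := fun x => x * xi) (is_derive_sin _) h).
Qed.

Lemma cos_win_shift (y xi : R) :
  \int[mu]_(x in `[a, b]) cos ((x - y) * xi) = cw xi * cos (y * xi) + sw xi * sin (y * xi).
Proof.
rewrite /cos_win /sin_win -(RintZr (cos (y * xi)) (mI a b) (@L1_continuous a b _ (@ccos xi))).
rewrite -(RintZr (sin (y * xi)) (mI a b) (@L1_continuous a b _ (@csin xi))).
rewrite -(RintD (mI a b) (L1c _ (@ccos xi)) (L1c _ (@csin xi))).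
by apply: Rint_eq => x _; rewrite mulrBl cosB.
Qed.

Lemma sin_win_shift (y xi : R) :
  \int[mu]_(x in `[a, b]) sin ((x - y) * xi) = sw xi * cos (y * xi) - cw xi * sin (y * xi).
Proof.
rewrite /cos_win /sin_win -(RintZr (cos (y * xi)) (mI a b) (@L1_continuous a b _ (@csin xi))).
rewrite -(RintZr (sin (y * xi)) (mI a b) (@L1_continuous a b _ (@ccos xi))).
rewrite -(RintB (mI a b) (L1c _ (@csin xi)) (L1c _ (@ccos xi))).
by apply: Rint_eq => x _; rewrite mulrBl sinB.
Qed.

Let swap (c : R -> R) (e y : R) : 0 < e -> continuous c -> (forall x, `|c x| <= 1) ->
  \int[mu]_xi (poisson e xi * \int[mu]_(x in `[a, b]) c ((x - y) * xi)) =
  \int[mu]_(x in `[a, b]) \int[mu]_xi (poisson e xi * c ((x - y) * xi)).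
Proof.
move=> e0 cc c1.
have mc : measurable_fun setT c by exact: continuous_measurable_fun.
have mF : measurable_fun setT (fun z : R * R => poisson e z.2 * c ((z.1 - y) * z.2)).
  apply: measurable_funM; first by apply: measurableT_comp (meas_poisson e) _; meas.
  by apply: measurableT_comp => //; meas.
have ione : L1 `[a, b] (fun=> 1 : R) by apply: L1_itv_1 => // x; rewrite normr1.
have iw : L1 ([set: R] : set R) (poisson e) by exact: L1_poisson.
have [|_ _ ->] := Fubini_Rint (mI a b) measurableT mF ione iw.
  move=> x xi _ _ /=; have /andP[h0 h1] := poisson01 xi (ltW e0).
  by rewrite mul1r normrM (ger0_norm h0) ler_piMr.
apply: Rint_eq => xi _ /=; rewrite RintZl//.
apply: L1_itv_1 => //; apply: measurableT_comp => //; meas.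
Qed.

(** The right side is [2 pi] times the Poisson regularization at scale [e] of the indicator of
    [[a, b]], taken at [y]: as [e] tends to 0 it tends to [2 pi] inside and to 0 outside. *)
Lemma poisson_cos_win (e y : R) : 0 < e ->
  \int[mu]_xi (poisson e xi * (cw xi * cos (y * xi) + sw xi * sin (y * xi))) =
  2 * (atan ((b - y) * e^-1) - atan ((a - y) * e^-1)).
Proof.
move=> e0.
transitivity (\int[mu]_xi (poisson e xi * \int[mu]_(x in `[a, b]) cos ((x - y) * xi))).
  by apply: Rint_eq => xi _; rewrite cos_win_shift.
rewrite (@swap cos)//; [|exact: continuous_cos|by move=> x; rewrite ler_norml cos_geN1 cos_le1].
transitivity (\int[mu]_(x in `[a, b]) (2 * ((1 + ((x - y) * e^-1) ^+ 2)^-1 * e^-1))).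
  apply: Rint_eq => x _; rewrite poisson_cos//.
  have p : e ^+ 2 + (x - y) ^+ 2 != 0 by rewrite gt_eqF// ltr_wpDr ?sqr_ge0// exprn_gt0.
  have q : e != 0 by rewrite gt_eqF.
  by field; rewrite q p.
have dF (x : R) : is_derive x 1 (fun x => 2 * atan ((x - y) * e^-1))
    (2 * ((1 + ((x - y) * e^-1) ^+ 2)^-1 * e^-1)).
  apply: D_cmul.
  suff h : is_derive x 1 (fun x : R => (x - y) * e^-1) e^-1.
    exact: (D_comp (g := fun x => (x - y) * e^-1) (is_derive1_atan _) h).
  have := D_mul (D_sub (is_derive_id x 1) (is_derive_cst y x 1)) (is_derive_cst e^-1 x 1).
  by rewrite subr0 mul1r mulr0 addr0.
have cF : {within `[a, b], continuous (fun x : R => 2 * ((1 + ((x - y) * e^-1) ^+ 2)^-1 * e^-1))}.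
  apply: cont_itv => x _; apply: continuousM; first exact: cst_continuous.
  apply: continuousM; last exact: cst_continuous.
  apply: (@continuous_comp _ _ _ (fun x : R => (x - y) * e^-1) (fun z : R => (1 + z ^+ 2)^-1)).
    apply: continuousM; last exact: cst_continuous.
    by apply: continuousB; [exact: cvg_id|exact: cst_continuous].
  exact: continuous_oneDsqrV.
by rewrite (FTC2_Rint ab cF (fun x _ => dF x)) mulrBr.
Qed.

Lemma poisson_sin_win (e y : R) : 0 < e ->
  \int[mu]_xi (poisson e xi * (sw xi * cos (y * xi) - cw xi * sin (y * xi))) = 0.
Proof.
move=> e0.
transitivity (\int[mu]_xi (poisson e xi * \int[mu]_(x in `[a, b]) sin ((x - y) * xi))).
  by apply: Rint_eq => xi _; rewrite sin_win_shift.
rewrite (@swap sin)//; [|exact: continuous_sin|by move=> x; rewrite ler_norml sin_geN1 sin_le1].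
transitivity (\int[mu]_(x in `[a, b]) 0); last by rewrite Rintegral_cst// mul0r.
by apply: Rint_eq => x _; exact: poisson_sin.
Qed.

(** Real part of the transform of [f1 + i f2] cut off to [[- N, N]]; the imaginary part is the same
    formula for [f2] and [- f1]. *)
Definition trunc_transform (f1 f2 : R -> R) (N xi : R) : R :=
  \int[mu]_(x in `[- N, N]) (cos (x * xi) * f1 x + sin (x * xi) * f2 x).

Section Truncated.
Variables (f1 f2 : R -> R) (N : R).
Hypothesis mf1 : measurable_fun setT f1.
Hypothesis mf2 : measurable_fun setT f2.
Hypothesis i1 : L1 `[- N, N] f1.
Hypothesis i2 : L1 `[- N, N] f2.

Let iN (g1 g2 : R -> R) : L1 `[- N, N] g1 -> L1 `[- N, N] g2 ->
  L1 `[- N, N] (fun x => `|g1 x| + `|g2 x|).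
Proof. by move=> h1 h2; apply: L1D => //; exact: L1_norm. Qed.

Let L1cos (g : R -> R) (xi : R) : L1 `[- N, N] g -> L1 `[- N, N] (fun x => cos (x * xi) * g x).
Proof.
move=> h; apply: (L1_mulb _ h (C := 1)) => //; first by apply: measurable_funTS; meas.
by move=> x _; rewrite ler_norml cos_geN1 cos_le1.
Qed.

Let L1sin (g : R -> R) (xi : R) : L1 `[- N, N] g -> L1 `[- N, N] (fun x => sin (x * xi) * g x).
Proof.
move=> h; apply: (L1_mulb _ h (C := 1)) => //; first by apply: measurable_funTS; meas.
by move=> x _; rewrite ler_norml sin_geN1 sin_le1.
Qed.

Lemma meas_trunc_transform : measurable_fun setT (trunc_transform f1 f2 N).
Proof.
have m2 : measurable_fun setT (fun z : R * R => (1 + z.2 ^+ 2)^-1).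
  apply: (measurableT_comp (f := fun y : R => (1 + y ^+ 2)^-1)); last exact: measurable_snd.
  by apply: continuous_measurable_fun; exact: continuous_oneDsqrV.
have mF : measurable_fun setT (fun z : R * R =>
    (cos (z.1 * z.2) * f1 z.1 + sin (z.1 * z.2) * f2 z.1) * (1 + z.2 ^+ 2)^-1).
  have k1 : measurable_fun setT (fun z : R * R => f1 z.1) by apply: measurableT_comp.
  have k2 : measurable_fun setT (fun z : R * R => f2 z.1) by apply: measurableT_comp.
  by meas.
have iw : L1 ([set: R] : set R) (fun x : R => (1 + x ^+ 2)^-1) by exact: L1_inv_oneDsqr.
have [|_ h _] := Fubini_Rint (mI (- N) N) measurableT mF (iN i1 i2) iw.
  move=> x y _ _ /=; have p : 0 <= (1 + y ^+ 2)^-1 by rewrite invr_ge0 addr_ge0 ?sqr_ge0.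
  rewrite normrM (ger0_norm p) ler_wpM2r//; apply: le_trans (ler_normD _ _) _; rewrite !normrM.
  apply: lerD; apply: ler_piMl => //; rewrite ler_norml.
    by rewrite cos_geN1 cos_le1.
  by rewrite sin_geN1 sin_le1.
have -> : trunc_transform f1 f2 N =
    (fun xi => (\int[mu]_(x in `[- N, N]) ((cos (x * xi) * f1 x + sin (x * xi) * f2 x)
       * (1 + xi ^+ 2)^-1)) * (1 + xi ^+ 2)).
  apply/funext => xi; rewrite (RintZr _ (mI (- N) N) (L1D (mI (- N) N) (L1cos xi i1) (L1sin xi i2))).
  by rewrite mulfVK// gt_eqF//; have := sqr_ge0 xi; lra.
by apply: measurable_funM; [exact: L1_meas h|meas].
Qed.

Let cw_le xi : `|cw xi| <= b - a.
Proof.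
have := @Rint_bound_itv R a b (fun x => cos (x * xi)) 1 ab; rewrite mul1r; apply.
  by apply: measurable_funTS; meas.
by move=> x _; rewrite ler_norml cos_geN1 cos_le1.
Qed.

Let sw_le xi : `|sw xi| <= b - a.
Proof.
have := @Rint_bound_itv R a b (fun x => sin (x * xi)) 1 ab; rewrite mul1r; apply.
  by apply: measurable_funTS; meas.
by move=> x _; rewrite ler_norml sin_geN1 sin_le1.
Qed.

Let bd2 (p q c s : R) : `|p| <= b - a -> `|q| <= b - a -> `|c| <= 1 -> `|s| <= 1 ->
  `|p * c + q * s| <= 2 * (b - a) /\ `|p * c - q * s| <= 2 * (b - a).
Proof.
move=> hp hq hc hs.
have h1 : `|p * c| <= b - a by rewrite normrM; apply: le_trans hp; apply: ler_piMr.
have h2 : `|q * s| <= b - a by rewrite normrM; apply: le_trans hq; apply: ler_piMr.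
by split; [apply: le_trans (ler_normD _ _) _|apply: le_trans (ler_normB _ _) _]; lra.
Qed.

(** Damping by [poisson] makes Fubini legitimate. After the exchange, the factor of [f1] is the
    regularized indicator and the factor of [f2] vanishes by parity. *)
Lemma poisson_inversion (e : R) : 0 < e ->
  \int[mu]_xi (poisson e xi * (cw xi * trunc_transform f1 f2 N xi -
    sw xi * trunc_transform f2 (fun x => - f1 x) N xi)) =
  \int[mu]_(y in `[- N, N]) (2 * (atan ((b - y) * e^-1) - atan ((a - y) * e^-1)) * f1 y).
Proof.
move=> e0.
have mcw := meas_cos_win a b; have msw := meas_sin_win a b.
pose A xi y := cw xi * cos (y * xi) + sw xi * sin (y * xi).
pose B xi y := sw xi * cos (y * xi) - cw xi * sin (y * xi).
have Ab xi y : `|A xi y| <= 2 * (b - a).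
  by apply: (bd2 (cw_le xi) (sw_le xi) _ _).1; rewrite ler_norml ?cos_geN1 ?cos_le1 ?sin_geN1 ?sin_le1.
have Bb xi y : `|B xi y| <= 2 * (b - a).
  by apply: (bd2 (sw_le xi) (cw_le xi) _ _).2; rewrite ler_norml ?cos_geN1 ?cos_le1 ?sin_geN1 ?sin_le1.
have mA2 : measurable_fun setT (fun z : R * R => A z.2 z.1).
  have k1 : measurable_fun setT (fun z : R * R => cw z.2) by apply: measurableT_comp.
  have k2 : measurable_fun setT (fun z : R * R => sw z.2) by apply: measurableT_comp.
  by rewrite /A; meas.
have mB2 : measurable_fun setT (fun z : R * R => B z.2 z.1).
  have k1 : measurable_fun setT (fun z : R * R => cw z.2) by apply: measurableT_comp.
  have k2 : measurable_fun setT (fun z : R * R => sw z.2) by apply: measurableT_comp.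
  by rewrite /B; meas.
have mF : measurable_fun setT (fun z : R * R =>
    poisson e z.2 * (A z.2 z.1 * f1 z.1 - B z.2 z.1 * f2 z.1)).
  have k1 : measurable_fun setT (fun z : R * R => f1 z.1) by apply: measurableT_comp.
  have k2 : measurable_fun setT (fun z : R * R => f2 z.1) by apply: measurableT_comp.
  have k3 : measurable_fun setT (fun z : R * R => poisson e z.2).
    by apply: measurableT_comp (meas_poisson e) _; meas.
  by meas.
have iw : L1 ([set: R] : set R) (poisson e) by exact: L1_poisson.
have [|_ _ sw_] := Fubini_Rint (mI (- N) N) measurableT mF
   (L1Zl (2 * (b - a)) (mI (- N) N) (iN i1 i2)) iw.
  move=> y xi _ _ /=; have /andP[h0 h1] := poisson01 xi (ltW e0).
  rewrite normrM (ger0_norm h0) mulrC ler_wpM2r//.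
  apply: le_trans (ler_normB _ _) _; rewrite !normrM mulrDr.
  by apply: lerD; apply: ler_wpM2r.
transitivity (\int[mu]_xi \int[mu]_(y in `[- N, N])
    (poisson e xi * (A xi y * f1 y - B xi y * f2 y))).
  apply: Rint_eq => xi _.
  have p1 := L1D (mI (- N) N) (L1cos xi i1) (L1sin xi i2).
  have p2 := L1B (mI (- N) N) (L1cos xi i2) (L1sin xi i1).
  have -> : trunc_transform f2 (fun x => - f1 x) N xi =
      \int[mu]_(x in `[- N, N]) (cos (x * xi) * f2 x - sin (x * xi) * f1 x).
    by apply: Rint_eq => x _; rewrite mulrN.
  rewrite /trunc_transform -(RintZl (cw xi) (mI (- N) N) p1) -(RintZl (sw xi) (mI (- N) N) p2).
  have q1 := L1Zl (cw xi) (mI (- N) N) p1; have q2 := L1Zl (sw xi) (mI (- N) N) p2.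
  rewrite -(RintB (mI (- N) N) q1 q2) -(RintZl (poisson e xi) (mI (- N) N) (L1B (mI (- N) N) q1 q2)).
  by apply: Rint_eq => y _; rewrite /A /B; ring.
rewrite -sw_; apply: Rint_eq => y _ /=.
have mc (c : R -> R -> R) : measurable_fun setT (fun z : R * R => c z.2 z.1) ->
    (forall xi y, `|c xi y| <= 2 * (b - a)) -> L1 setT (fun xi => poisson e xi * c xi y).
  move=> m2 cb; apply: (@L1_le _ _ _ (fun xi => 2 * (b - a) * poisson e xi)) => //.
  - apply: measurable_funM; first exact: meas_poisson.
    exact: (measurableT_comp m2 (measurable_pair1 y)).
  - by apply: L1Zl => //; exact: L1_poisson.
  - move=> xi _; have /andP[h0 h1] := poisson01 xi (ltW e0).
    by rewrite normrM (ger0_norm h0) mulrC ler_wpM2r.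
have jA := mc A mA2 Ab; have jB := mc B mB2 Bb.
transitivity (\int[mu]_xi (f1 y * (poisson e xi * A xi y) - f2 y * (poisson e xi * B xi y))).
  by apply: Rint_eq => xi _; ring.
rewrite RintB//; [|exact: L1Zl|exact: L1Zl].
rewrite (RintZl (f1 y) measurableT jA) (RintZl (f2 y) measurableT jB).
by rewrite /A /B poisson_cos_win// poisson_sin_win// mulr0 subr0 mulrC.
Qed.

(** Let [e] tend to 0 in [poisson_inversion]: on the left [|h|] dominates, on the right [2 pi |f1|].
    The endpoints [a] and [b], where the arctangents have another limit, form a null set. *)
Lemma trunc_inversion : - N <= a -> b <= N ->
  L1 setT (fun xi => trunc_transform f1 f2 N xi ^+ 2) ->
  L1 setT (fun xi => trunc_transform f2 (fun x => - f1 x) N xi ^+ 2) ->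
  measurable_fun setT (trunc_transform f2 (fun x => - f1 x) N) ->
  \int[mu]_xi (cw xi * trunc_transform f1 f2 N xi -
    sw xi * trunc_transform f2 (fun x => - f1 x) N xi) =
  2 * pi * (\int[mu]_(x in `[a, b]) f1 x).
Proof.
move=> Na bN q1 q2 mt2.
set h := (fun xi => _ - _).
have ih : L1 setT h.
  apply: (L1B measurableT); apply: L1_sq_mul => //.
  - exact: meas_cos_win.
  - exact: meas_trunc_transform.
  - exact: cos_win_L2.
  - exact: meas_sin_win.
  - exact: sin_win_L2.
pose e (k : nat) : R := k.+1%:R^-1.
have e0 k : 0 < e k by rewrite invr_gt0.
have l1 : (fun k => \int[mu]_xi (poisson (e k) xi * h xi)) @ \oo --> \int[mu]_xi h xi.
  apply: (@Rint_dominated _ _ _ _ (fun xi => `|h xi|)) => //.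
  - by move=> k; apply: measurable_funM; [exact: meas_poisson|exact: L1_meas ih].
  - exact: L1_meas ih.
  - exact: L1_norm.
  - apply: aeW => xi _; rewrite -[X in _ --> X]mul1r; apply: cvgM; last exact: cvg_cst.
    have hl : (fun k => - (e k * `|xi|)) @ \oo --> - (0 * `|xi| : R).
      by apply: cvgN; apply: cvgM; [exact: cvg_harmonic|exact: cvg_cst].
    rewrite mul0r oppr0 in hl; rewrite -expR0 /poisson.
    by apply: continuous_cvg hl; exact: continuous_expR.
  - apply: aeW => xi _ k; have /andP[h0 h1] := poisson01 xi (ltW (e0 k)).
    by rewrite normrM (ger0_norm h0) ler_piMl.
pose g : R -> R := (fun y => 2 * pi * f1 y) \_ `[a, b].
have l2 : (fun k => \int[mu]_(y in `[- N, N]) (2 * (atan ((b - y) * (e k)^-1) -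
    atan ((a - y) * (e k)^-1)) * f1 y)) @ \oo --> \int[mu]_(y in `[- N, N]) g y.
  apply: (@Rint_dominated _ _ _ _ (fun y => 2 * pi * `|f1 y|)) => //.
  - move=> k; apply: measurable_funTS; apply: measurable_funM => //.
    apply: measurable_funM => //; apply: measurable_funB.
      by apply: (measurableT_comp (continuous_measurable_fun (@continuous_atan R))); meas.
    by apply: (measurableT_comp (continuous_measurable_fun (@continuous_atan R))); meas.
  - apply: measurable_funTS; apply/(measurable_restrictT _ (mI a b)).
    by apply: measurable_funTS; apply: measurable_funM.
  - by apply: L1Zl => //; exact: L1_norm.
  - apply: aeS2 (ae_neq a) (ae_neq b) => y ya yb _.
    rewrite /e; under eq_fun do rewrite invrK.
    have c1 : b - y != 0 by rewrite subr_eq0 eq_sym.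
    have c2 : a - y != 0 by rewrite subr_eq0 eq_sym.
    have -> : g y = 2 * (Num.sg (b - y) * (pi / 2) - Num.sg (a - y) * (pi / 2)) * f1 y.
      rewrite /g patchE; case: ifPn => [|].
        rewrite inE/= in_itv/= => /andP[ay yb'].
        rewrite gtr0_sg ?subr_gt0 ?lt_neqAle ?yb// ltr0_sg ?subr_lt0 ?lt_neqAle ?(eq_sym a) ?ya//.
        by field.
      move=> /negP; rewrite inE/= in_itv/= => /negP; rewrite negb_and -!ltNge => /orP[h1|h1].
        rewrite gtr0_sg ?subr_gt0 ?(lt_le_trans h1)// gtr0_sg ?subr_gt0//.
        by rewrite subrr mulr0 mul0r.
      rewrite ltr0_sg ?subr_lt0// ltr0_sg ?subr_lt0 ?(le_lt_trans ab)//.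
      by rewrite subrr mulr0 mul0r.
    apply: cvgM; last exact: cvg_cst.
    by apply: cvgM; [exact: cvg_cst|apply: cvgB; exact: atan_scale_sg].
  - apply: aeW => y _ k; rewrite normrM ler_wpM2r// normrM (ger0_norm (_ : 0 <= 2))// ler_wpM2l//.
    set u := _ * _; set v := _ * _.
    have := atan_gtNpi2 u; have := atan_ltpi2 u; have := atan_gtNpi2 v; have := atan_ltpi2 v.
    rewrite ler_norml => *; apply/andP; split; lra.
have E : (fun k => \int[mu]_xi (poisson (e k) xi * h xi)) =
   (fun k => \int[mu]_(y in `[- N, N]) (2 * (atan ((b - y) * (e k)^-1) -
    atan ((a - y) * (e k)^-1)) * f1 y)).
  by apply/funext => k; exact: poisson_inversion.
rewrite E in l1.
rewrite -(cvg_lim (@Rhausdorff R) l1) (cvg_lim (@Rhausdorff R) l2).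
have iab : L1 `[a, b] f1 by apply: L1S i1 => //; exact: subset_itvScc.
rewrite -(RintZl (2 * pi) (mI a b) iab) Rintegral_mkcond [RHS]Rintegral_mkcond.
apply: Rint_eq => y _; rewrite /g !patchE; case: ifPn => // /negP; rewrite inE/= => yN.
case: ifPn => //; rewrite inE/= => yab; case: yN.
by move: yab; rewrite !in_itv/= => /andP[h1 h2]; rewrite (le_trans Na h1) (le_trans h2 bN).
Qed.

End Truncated.

(** The right side is continuous in [(g1, g2)] for the L^2 norm because the windows are square
    integrable, and the truncated transforms satisfy the identity exactly once [n] is at least
    [|a| + |b|]. *)
Lemma L2_inversion (f1 f2 g1 g2 : R -> R) :
  measurable_fun setT f1 -> measurable_fun setT f2 ->
  measurable_fun setT g1 -> measurable_fun setT g2 ->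
  (forall p q : R, L1 `[p, q] f1) -> (forall p q : R, L1 `[p, q] f2) ->
  L1 setT (fun xi => g1 xi ^+ 2) -> L1 setT (fun xi => g2 xi ^+ 2) ->
  (forall d M : R, 0 < d -> exists2 n : nat, M <= n%:R &
     let r1 xi := g1 xi - trunc_transform f1 f2 n%:R xi in
     let r2 xi := g2 xi - trunc_transform f2 (fun x => - f1 x) n%:R xi in
     [/\ L1 setT (fun xi => r1 xi ^+ 2), L1 setT (fun xi => r2 xi ^+ 2) &
     \int[mu]_xi (r1 xi ^+ 2) + \int[mu]_xi (r2 xi ^+ 2) <= d]) ->
  2 * pi * (\int[mu]_(x in `[a, b]) f1 x) = \int[mu]_xi (cw xi * g1 xi - sw xi * g2 xi).
Proof.
move=> mf1 mf2 mg1 mg2 i1 i2 j1 j2 cv.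
have mcw := meas_cos_win a b; have msw := meas_sin_win a b.
have c2 := cos_win_L2 ab; have s2 := sin_win_L2 ab.
pose K := \int[mu]_xi (cw xi ^+ 2) + \int[mu]_xi (sw xi ^+ 2).
apply/eqP; rewrite eq_sym -subr_eq0 -normr_le0; apply/ler_addgt0Pr => eta eta0; rewrite add0r.
have K0 : 0 <= K by rewrite addr_ge0//; apply: Rintegral_ge0 => xi _; exact: sqr_ge0.
(* In Young's inequality with weight [th] the windows cost [th K / 2 <= eta / 2], and a squared
   error of at most [th * eta] in the transform costs another [eta / 2]. *)
pose th := eta / (1 + K).
have th0 : 0 < th by rewrite divr_gt0//; lra.
have d0 : 0 < th * eta by rewrite mulr_gt0.
have [n nab] := cv _ (`|a| + `|b|) d0.
set t1 := trunc_transform f1 f2 n%:R; set t2 := trunc_transform f2 _ n%:R.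
pose r1 xi := g1 xi - t1 xi; pose r2 xi := g2 xi - t2 xi => -[k1 k2 k3].
have mt1 : measurable_fun setT t1 by exact: meas_trunc_transform.
have mt2 : measurable_fun setT t2.
  by apply: meas_trunc_transform => //; [exact: measurableT_comp|apply: L1N].
have mr1 : measurable_fun setT r1 by exact: measurable_funB.
have mr2 : measurable_fun setT r2 by exact: measurable_funB.
have sq (g t : R -> R) : measurable_fun setT t -> L1 setT (fun xi => g xi ^+ 2) ->
    L1 setT (fun xi => (g xi - t xi) ^+ 2) -> L1 setT (fun xi => t xi ^+ 2).
  move=> mt p1 p2; apply: (@L1_le _ _ _ (fun xi => 2 * (g xi ^+ 2 + (g xi - t xi) ^+ 2))) => //.
  - exact: measurable_funX.
  - by apply: L1Zl => //; exact: L1D.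
  - by move=> xi _; rewrite ger0_norm ?sqr_ge0//; exact: sq_le_sub.
have nb : b <= n%:R.
  by apply: le_trans nab; rewrite -[leLHS]add0r lerD// ler_norm.
have na : - n%:R <= a.
  rewrite lerNl; apply: le_trans nab; rewrite -[leLHS]addr0 lerD//.
  by rewrite -normrN ler_norm.
have <- := trunc_inversion mf1 mf2 (i1 _ _) (i2 _ _) na nb (sq _ _ mt1 j1 k1) (sq _ _ mt2 j2 k2) mt2.
rewrite -/t1 -/t2.
have L2m (p q : R -> R) := @L1_sq_mul R setT p q measurableT.
have u1 := L1B measurableT (L2m _ _ mcw mg1 c2 j1) (L2m _ _ msw mg2 s2 j2).
have u2 := L1B measurableT (L2m _ _ mcw mt1 c2 (sq _ _ mt1 j1 k1)) (L2m _ _ msw mt2 s2 (sq _ _ mt2 j2 k2)).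
rewrite -(RintB measurableT u1 u2).
have v1 := L1Zl (th / 2) measurableT (L1D measurableT c2 s2).
have v2 := L1Zl ((2 * th)^-1) measurableT (L1D measurableT k1 k2).
apply: (@le_trans _ _ (\int[mu]_xi (th / 2 * (cw xi ^+ 2 + sw xi ^+ 2) +
   (2 * th)^-1 * (r1 xi ^+ 2 + r2 xi ^+ 2)))).
  apply: norm_Rint_le => //; [exact: L1B|exact: L1D|move=> xi _].
  have -> : cw xi * g1 xi - sw xi * g2 xi - (cw xi * t1 xi - sw xi * t2 xi) =
    cw xi * r1 xi - sw xi * r2 xi by rewrite /r1 /r2; ring.
  apply: le_trans (ler_normB _ _) _.
  have h1 := young_eps (cw xi) (r1 xi) th0; have h2 := young_eps (sw xi) (r2 xi) th0.
  by apply: le_trans (lerD h1 h2) _; rewrite addrACA !mulrDr.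
rewrite (RintD measurableT v1 v2) (RintZl _ measurableT (L1D measurableT c2 s2)).
rewrite (RintZl _ measurableT (L1D measurableT k1 k2)) (RintD measurableT c2 s2) -/K.
rewrite (RintD measurableT k1 k2).
have h1 : th * K <= eta.
  have K1 : 0 < 1 + K by rewrite ltr_wpDr.
  rewrite /th mulrAC (ler_pdivrMr _ _ K1); apply: ler_wpM2l; first exact: ltW.
  by rewrite lerDr.
have h2 : (2 * th)^-1 * (\int[mu]_xi (r1 xi ^+ 2) + \int[mu]_xi (r2 xi ^+ 2)) <= eta / 2.
  have th2 : 0 < 2 * th by rewrite mulr_gt0.
  rewrite (ler_pdivrMl _ _ th2); have -> : 2 * th * (eta / 2) = th * eta by field.
  exact: k3.
by rewrite mulrAC; exact: half_add_le.
Qed.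

End WindowInversion.

End Inversion.

(** * Complex form of the inversion and of the convergence statement *)

Section PositivePart.
Variable R : realType.

Lemma cReM (z w : complex R) : cRe (z * w) = cRe z * cRe w - cIm z * cIm w.
Proof. by case: z w => [a b] [c d]. Qed.

Lemma cImM (z w : complex R) : cIm (z * w) = cRe z * cIm w + cIm z * cRe w.
Proof. by case: z w => [a b] [c d]. Qed.

Lemma cReB (z w : complex R) : cRe (z - w) = cRe z - cRe w.
Proof. by case: z w => [a b] [c d]. Qed.

Lemma cImB (z w : complex R) : cIm (z - w) = cIm z - cIm w.
Proof. by case: z w => [a b] [c d]. Qed.

Lemma cRe_fourier_trunc (f : R -> complex R) (N xi : R) :
  cRe (fourier_trunc f N xi) = trunc_transform (fun x => cRe (f x)) (fun x => cIm (f x)) N xi.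
Proof.
by apply: Rint_eq => x _; rewrite cReM/= cosN sinN mulNr opprK.
Qed.

Lemma cIm_fourier_trunc (f : R -> complex R) (N xi : R) :
  cIm (fourier_trunc f N xi) = trunc_transform (fun x => cIm (f x)) (fun x => - cRe (f x)) N xi.
Proof.
by apply: Rint_eq => x _; rewrite cImM/= cosN sinN mulNr mulrN.
Qed.

Lemma cRe_Pmg (m gam : R) (g : R -> complex R) (y t : R) :
  cRe (Pmg m gam g y t) =
  (2 * pi)^-1 * osc m gam setT (fun xi => cRe (g xi)) (fun xi => cIm (g xi)) y t.
Proof.
rewrite /Pmg cReM/= mul0r subr0; congr (_ * _).
by apply: Rint_eq => xi _; rewrite cReM !cReM !cImM/= !mul0r subr0 addr0 !mulrA.
Qed.

Lemma cIm_Pmg (m gam : R) (g : R -> complex R) (y t : R) :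
  cIm (Pmg m gam g y t) =
  (2 * pi)^-1 * osc m gam setT (fun xi => cIm (g xi)) (fun xi => - cRe (g xi)) y t.
Proof.
rewrite /Pmg cImM/= mul0r addr0; congr (_ * _).
by apply: Rint_eq => xi _; rewrite cImM !cReM !cImM/= !mul0r subr0 addr0 mulrN opprK !mulrA.
Qed.

Lemma L2_parts (f : R -> complex R) : L2 f ->
  [/\ measurable_fun setT (fun x => cRe (f x)), measurable_fun setT (fun x => cIm (f x)),
    L1 setT (fun x => cRe (f x) ^+ 2) & L1 setT (fun x => cIm (f x) ^+ 2)].
Proof.
move=> [[m1 m2] f2].
have i : L1 setT (fun x => cRe (f x) ^+ 2 + cIm (f x) ^+ 2).
  apply: L1_ge0 => //; last by move=> x _; rewrite addr_ge0 ?sqr_ge0.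
  by apply: measurable_funD; exact: measurable_funX.
split=> //; apply: (L1_le measurableT _ i); try exact: measurable_funX.
  by move=> x _; rewrite ger0_norm ?sqr_ge0// lerDl sqr_ge0.
by move=> x _; rewrite ger0_norm ?sqr_ge0// lerDr sqr_ge0.
Qed.

Lemma trunc_transformN (f1 f2 : R -> R) (N xi : R) : L1 `[- N, N] f1 -> L1 `[- N, N] f2 ->
  trunc_transform (fun x => - f1 x) (fun x => - f2 x) N xi = - trunc_transform f1 f2 N xi.
Proof.
move=> i1 i2; have mN : measurable (`[- N, N] : set R) by exact: measurable_itv.
pose F (x : R) := cos (x * xi) * f1 x + sin (x * xi) * f2 x.
transitivity (\int[mu]_(x in `[- N, N]) ((-1) * F x)).
  by apply: Rint_eq => x _; rewrite !mulrN mulN1r opprD.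
rewrite RintZl//; first by rewrite mulN1r.
apply: L1D => //.
  apply: (L1_mulb mN i1 (C := 1)); first by apply: measurable_funTS; meas.
  by move=> x _; rewrite ler_norml cos_geN1 cos_le1.
apply: (L1_mulb mN i2 (C := 1)); first by apply: measurable_funTS; meas.
by move=> x _; rewrite ler_norml sin_geN1 sin_le1.
Qed.

(** The second identity is the first for [- i f] and its transform [- i g], whose real and imaginary
    parts are [cIm] and [- cRe] of [f] and [g]. *)
Lemma fourier_pair_L2_inversion (f g : R -> complex R) (a b : R) : fourier_pair f g -> a <= b ->
  2 * pi * (\int[mu]_(x in `[a, b]) cRe (f x)) =
    \int[mu]_xi (cos_win a b xi * cRe (g xi) - sin_win a b xi * cIm (g xi)) /\
  2 * pi * (\int[mu]_(x in `[a, b]) cIm (f x)) =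
    \int[mu]_xi (cos_win a b xi * cIm (g xi) - sin_win a b xi * - cRe (g xi)).
Proof.
move=> [/L2_parts [mf1 mf2 f1s f2s] [/L2_parts [mg1 mg2 g1s g2s] lim]] ab.
have i1 (p q : R) : L1 `[p, q] (fun x => cRe (f x)) by exact: L1_of_sq.
have i2 (p q : R) : L1 `[p, q] (fun x => cIm (f x)) by exact: L1_of_sq.
have i1n (p q : R) : L1 `[p, q] (fun x => - cRe (f x)) by apply: L1N.
have mf1n : measurable_fun setT (fun x => - cRe (f x)) by exact: measurableT_comp.
pose r1 (n : nat) xi := cRe (g xi) - trunc_transform (fun x => cRe (f x)) (fun x => cIm (f x)) n%:R xi.
pose r2 (n : nat) xi := cIm (g xi) - trunc_transform (fun x => cIm (f x)) (fun x => - cRe (f x)) n%:R xi.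
have cv (d M : R) : 0 < d -> exists2 n : nat, M <= n%:R &
    [/\ L1 setT (fun xi => r1 n xi ^+ 2), L1 setT (fun xi => r2 n xi ^+ 2) &
     \int[mu]_xi (r1 n xi ^+ 2) + \int[mu]_xi (r2 n xi ^+ 2) <= d].
  move=> d0; have [fin /cvgrPdist_le /(_ _ d0) lim'] := (fine_cvgP _ _).1 lim.
  have [K1 _ h1] := fin; have [K2 _ h2] := lim'.
  have [K3 _ h3] := nbhs_infty_ger M.
  pose n := maxn K1 (maxn K2 K3).
  have n1 : (K1 <= n)%N by rewrite leq_max leqnn.
  have n2 : (K2 <= n)%N by rewrite !leq_max leqnn orbT.
  have n3 : (K3 <= n)%N by rewrite !leq_max leqnn !orbT.
  exists n; first exact: h3.
  have E xi : cnorm2 (g xi - fourier_trunc f n%:R xi) = r1 n xi ^+ 2 + r2 n xi ^+ 2.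
    by rewrite /cnorm2 cReB cImB cRe_fourier_trunc cIm_fourier_trunc.
  have mr1 : measurable_fun setT (r1 n) by apply: measurable_funB => //; exact: meas_trunc_transform.
  have mr2 : measurable_fun setT (r2 n) by apply: measurable_funB => //; exact: meas_trunc_transform.
  have := h1 n n1; have := h2 n n2; rewrite /=.
  under eq_integral do rewrite E.
  rewrite sub0r normrN => hd hfin.
  have ge0 xi : 0 <= r1 n xi ^+ 2 + r2 n xi ^+ 2 by rewrite addr_ge0 ?sqr_ge0.
  have i : L1 setT (fun xi => r1 n xi ^+ 2 + r2 n xi ^+ 2).
    apply: L1_ge0 => //; first by apply: measurable_funD; exact: measurable_funX.
    by move: hfin; rewrite ge0_fin_numE//; apply: integral_ge0 => xi _; rewrite lee_fin.
  have j1 : L1 setT (fun xi => r1 n xi ^+ 2).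
    apply: (L1_le measurableT _ i); first exact: measurable_funX.
    by move=> x _; rewrite ger0_norm ?sqr_ge0// lerDl sqr_ge0.
  have j2 : L1 setT (fun xi => r2 n xi ^+ 2).
    apply: (L1_le measurableT _ i); first exact: measurable_funX.
    by move=> x _; rewrite ger0_norm ?sqr_ge0// lerDr sqr_ge0.
  split=> //; rewrite -(RintD measurableT j1 j2); apply: le_trans hd.
  exact: ler_norm.
split.
  by apply: (@L2_inversion _ a b ab _ (fun x => cIm (f x))) => // d M d0; exact: cv.
apply: (@L2_inversion _ a b ab _ (fun x => - cRe (f x))) => //.
- exact: measurableT_comp.
- by rewrite (_ : (fun xi => _) = (fun xi => (cRe (g xi) ^+ 2)%:E))//; apply/funext => xi; rewrite sqrrN.
- move=> d M d0; have [n Mn [h1 h2 h3]] := cv d M d0; exists n; first exact: Mn.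
  have E xi : (- cRe (g xi) - trunc_transform (fun x => - cRe (f x))
      (fun x => - cIm (f x)) n%:R xi) ^+ 2 = r1 n xi ^+ 2.
    rewrite trunc_transformN; [by rewrite -opprD sqrrN|exact: i1|exact: i2].
  split; first exact: h2.
    rewrite (_ : (fun xi => _) = (fun xi => (r1 n xi ^+ 2)%:E)); first exact: h1.
    by apply/funext => xi; congr EFin; exact: E.
  rewrite [X in _ + X](@Rint_eq _ _ _ (fun xi => r1 n xi ^+ 2)); last by move=> xi _; exact: E.
  by rewrite addrC; exact: h3.
Qed.

Lemma scrit_ge0 (m gam : R) : 0 <= m -> 0 <= scrit m gam.
Proof.
move=> m0; rewrite /scrit le_min invr_ge0 ler0n/=.
by rewrite mulr_ge0 ?divr_ge0// le_max lexx orbT.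
Qed.

Lemma ae_convergence (m gam alpha s : R) (Gam : R -> R -> R) (f g : R -> complex R) :
  1 < m -> 0 < gam -> m^-1 <= alpha -> admissible alpha Gam -> scrit m gam < s ->
  Hs_pair s f g -> ae_conv m gam Gam f g.
Proof.
move=> m1 g0 ma [_ [_ [GI [C1 [C2 [C3 [C10 C20 C30 bil hol]]]]]]] sc [fg Hs].
have s0 : 0 <= s by apply: le_trans (ltW sc); apply: scrit_ge0; lra.
have t11 (t : R) : 0 <= t <= 1 -> -1 <= t <= 1 by move=> /andP[? ?]; apply/andP; split; lra.
have GL t x x' : 0 <= t <= 1 -> C1 * `|x - x'| <= `|Gam x t - Gam x' t|.
  by move=> /t11 t1; have /andP[] := bil t x x' t1.
have GU t x x' : 0 <= t <= 1 -> `|Gam x t - Gam x' t| <= C2 * `|x - x'|.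
  by move=> /t11 t1; have /andP[] := bil t x x' t1.
have GH x t t' : 0 <= t <= 1 -> 0 <= t' <= 1 -> `|Gam x t - Gam x t'| <= C3 * `|t - t'| `^ alpha.
  by move=> /t11 h1 /t11 h2; exact: hol.
have [/L2_parts [mf1 mf2 f1s f2s] [/L2_parts [mg1 mg2 g1s g2s] _]] := fg.
have i1 (p q : R) : L1 `[p, q] (fun x => cRe (f x)) by exact: L1_of_sq.
have i2 (p q : R) : L1 `[p, q] (fun x => cIm (f x)) by exact: L1_of_sq.
have w1 : L1 setT (fun xi => (1 + xi ^+ 2) `^ s * (cRe (g xi) ^+ 2 + cIm (g xi) ^+ 2)).
  apply: L1_ge0 => //; last first.
    by move=> x _; rewrite mulr_ge0 ?powR_ge0 ?addr_ge0 ?sqr_ge0.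
  by apply: measurable_funM; [meas|apply: measurable_funD; exact: measurable_funX].
have w2 : L1 setT (fun xi => (1 + xi ^+ 2) `^ s * (cIm (g xi) ^+ 2 + (- cRe (g xi)) ^+ 2)).
  rewrite (_ : (fun xi => _) = (fun xi => ((1 + xi ^+ 2) `^ s * (cRe (g xi) ^+ 2 + cIm (g xi) ^+ 2))%:E))//.
  by apply/funext => xi; rewrite sqrrN [X in _ * X]addrC.
have mg1n : measurable_fun setT (fun xi => - cRe (g xi)) by exact: measurableT_comp.
have A1 := ae_convergence_real m1 g0 ma C10 C20 C30 GI GL GU GH sc s0 mg1 mg2 w1 i1
   (fun a b ab => (fourier_pair_L2_inversion fg ab).1).
have A2 := ae_convergence_real m1 g0 ma C10 C20 C30 GI GL GU GH sc s0 mg2 mg1n w2 i2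
   (fun a b ab => (fourier_pair_L2_inversion fg ab).2).
have pi0 : 2 * pi != 0 :> R by rewrite mulf_neq0// gt_eqF// pi_gt0.
apply: aeS2 A1 A2 => x h1 h2; split.
  rewrite (_ : (fun t => _) = (fun t => (2 * pi)^-1 * osc m gam setT (fun xi => cRe (g xi))
    (fun xi => cIm (g xi)) (Gam x t) t)); last by apply/funext => t; exact: cRe_Pmg.
  rewrite -[X in _ --> X](mulKf pi0); apply: cvgM; [exact: cvg_cst|exact: h1].
rewrite (_ : (fun t => _) = (fun t => (2 * pi)^-1 * osc m gam setT (fun xi => cIm (g xi))
  (fun xi => - cRe (g xi)) (Gam x t) t)); last by apply/funext => t; exact: cIm_Pmg.
rewrite -[X in _ --> X](mulKf pi0); apply: cvgM; [exact: cvg_cst|exact: h2].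
Qed.

End PositivePart.

(** * Wave packets *)

Section Packets.
Variable R : realType.

Lemma L1_Rint_shift (G : R -> R) (c : R) : continuous G -> (forall x, 0 <= G x) -> L1 setT G ->
  L1 setT (fun x => G (x + c)) /\ \int[mu]_x G (x + c) = \int[mu]_x G x.
Proof.
move=> cG G0 iG.
have dF (x : R) : is_derive x 1 (fun y : R => y + c) 1.
  by have := D_add (is_derive_id x 1) (is_derive_cst c x 1); rewrite addr0.
have F' : derive1 (fun y : R => y + c) = cst 1.
  by apply/funext => x; rewrite derive1E; have := dF x; case.
have e : (\int[mu]_x (G x)%:E = \int[mu]_x (G (x + c))%:E)%E.
  rewrite (@increasing_ge0_integration_by_substitutionT R (fun y => y + c) G)//.
  - by apply: eq_integral => x _; rewrite F' /= mulr1.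
  - by move=> x y xy /=; rewrite ltrD2r.
  - by rewrite F' => x; exact: cst_continuous.
  - by rewrite F'; exact: is_cvg_cst.
  - by rewrite F'; exact: is_cvg_cst.
  - apply/cvgrNyPle => A; near=> x.
    by rewrite -lerBrDr; near: x; apply: nbhs_ninfty_le; exact: num_real.
  - apply/cvgryPge => A; near=> x.
    by rewrite -lerBlDr; near: x; apply: nbhs_pinfty_ge; exact: num_real.
have mGc : measurable_fun setT (fun x : R => G (x + c)).
  apply: measurableT_comp; first exact: continuous_measurable_fun.
  by apply: measurable_funD; [exact: measurable_id|exact: measurable_cst].
have iGc : L1 setT (fun x : R => G (x + c)).
  apply: L1_ge0 => //; rewrite -e.
  case/integrableP : iG => _; under eq_integral do rewrite /= ger0_norm//.
  by [].
by split=> //; rewrite /Rintegral e.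
Unshelve. all: by end_near. Qed.

Lemma L1_Rint_shift_mul (c h : R -> R) (a : R) : continuous c -> continuous h ->
  (forall x, `|c x| <= 1) -> (forall x, 0 <= h x) -> L1 setT h ->
  L1 setT (fun x => c x * h (x - a)) /\
  \int[mu]_x (c x * h (x - a)) = \int[mu]_x (c (x + a) * h x).
Proof.
move=> cc ch c1 h0 ih.
have mc := continuous_measurable_fun cc.
have [ih' e1] := L1_Rint_shift (- a) ch h0 ih.
have chs : continuous (fun x : R => h (x - a)).
  move=> x; apply: (@continuous_comp _ _ _ (fun x : R => x - a) h); last exact: ch.
  by apply: continuousB; [exact: cvg_id|exact: cst_continuous].
have ccs : continuous (fun x : R => c (x + a)).
  move=> x; apply: (@continuous_comp _ _ _ (fun x : R => x + a) c); last exact: cc.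
  by apply: continuousD; [exact: cvg_id|exact: cst_continuous].
have i1 : L1 setT (fun x => c x * h (x - a)).
  by apply: (L1_mulb measurableT ih' mc (C := 1)) => x _; exact: c1.
have i2 : L1 setT (fun x => c (x + a) * h x).
  apply: (L1_mulb measurableT ih (C := 1)); first exact: continuous_measurable_fun.
  by move=> x _; exact: c1.
split=> //.
(* Translation is known for nonnegative functions. Since [|c| <= 1], the factor [1 + c] is
   nonnegative, and the added integral of [h] is itself translation invariant, so it cancels. *)
pose k (x : R) := (1 + c (x + a)) * h x.
have ck : continuous k.
  move=> x; apply: (@continuousM R R (fun x => 1 + c (x + a)) h x); last exact: ch.
  by apply: (@continuousD R R R (fun=> 1) (fun x => c (x + a)) x); [exact: cst_continuous|exact: ccs].
have k0 x : 0 <= k x.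
  by rewrite mulr_ge0//; have := c1 (x + a); rewrite ler_norml => /andP[]; lra.
have ik : L1 setT k.
  rewrite (_ : (fun x => _) = (fun x => (h x + c (x + a) * h x)%:E)); first exact: L1D.
  by apply/funext => x; rewrite /k mulrDl mul1r.
have [_ e2] := L1_Rint_shift (- a) ck k0 ik.
have E1 : \int[mu]_x k x = \int[mu]_x h x + \int[mu]_x (c (x + a) * h x).
  by rewrite -(RintD measurableT ih i2); apply: Rint_eq => x _; rewrite /k mulrDl mul1r.
have E2 : \int[mu]_x k (x - a) = \int[mu]_x h (x - a) + \int[mu]_x (c x * h (x - a)).
  by rewrite -(RintD measurableT ih' i1); apply: Rint_eq => x _; rewrite /k subrK mulrDl mul1r.
by apply: (@addrI _ (\int[mu]_x h x)); rewrite -E1 -[in LHS]e1 -E2.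
Qed.

(** The integrals of [tent] in use run over parts of [[-1, 1]], where it is the triangle function.
    Its transform is the Fejer kernel, which is integrable and nonnegative; the sign makes partial
    sums of packets monotone. *)
Definition tent (x : R) : R := 1 - `|x|.
Definition tent_hat (xi : R) : R := \int[mu]_(x in `[-1, 1]) (tent x * cos (x * xi)).

Lemma cont_tent : continuous tent.
Proof.
move=> x; apply: continuousB; first exact: cst_continuous.
exact: (@cont_norm R id x (@cvg_id _ _)).
Qed.

Lemma tent01 x : x \in `[-1, 1] -> 0 <= tent x <= 1.
Proof.
rewrite in_itv/= -ler_norml => h; rewrite /tent subr_ge0 h/=.
by rewrite gerBl.
Qed.

Lemma cont_cosl (xi : R) : continuous (fun x : R => cos (x * xi)).
Proof.
move=> x; apply: (@continuous_comp _ _ _ (fun x : R => x * xi) (@cos R)); last exact: continuous_cos.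
by apply: continuousM; [exact: cvg_id|exact: cst_continuous].
Qed.

Lemma cont_sinl (xi : R) : continuous (fun x : R => sin (x * xi)).
Proof.
move=> x; apply: (@continuous_comp _ _ _ (fun x : R => x * xi) (@sin R)); last exact: continuous_sin.
by apply: continuousM; [exact: cvg_id|exact: cst_continuous].
Qed.

Lemma L1_tent_mul (p q : R) (c : R -> R) : continuous c -> L1 `[p, q] (fun x => tent x * c x).
Proof.
move=> cc; apply: L1_continuous => x.
by apply: continuousM; [exact: cont_tent|exact: cc].
Qed.

Let tent_half (xi : R) : xi != 0 ->
  \int[mu]_(x in `[0, 1]) (tent x * cos (x * xi)) = (1 - cos xi) / xi ^+ 2.
Proof.
move=> x0.
pose F (x : R) := xi^-1 * ((1 - x) * sin (x * xi)) - xi^-1 ^+ 2 * cos (x * xi).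
have dl (x : R) : is_derive x 1 (fun y : R => y * xi) xi.
  by have := D_mul (is_derive_id x 1) (is_derive_cst xi x 1); rewrite mul1r mulr0 addr0.
have dF (x : R) : is_derive x 1 F ((1 - x) * cos (x * xi)).
  have h2 := D_comp (f := sin) (g := fun x => x * xi) (is_derive_sin _) (dl x).
  have h3 := D_comp (f := cos) (g := fun x => x * xi) (is_derive_cos _) (dl x).
  have h1 := D_sub (is_derive_cst (1 : R) x 1) (is_derive_id x 1).
  have := D_sub (D_cmul xi^-1 (D_mul h1 h2)) (D_cmul (xi^-1 ^+ 2) h3).
  by congr is_derive; rewrite /cst/=; field; exact: x0.
have cf : {within `[0, 1], continuous (fun x : R => (1 - x) * cos (x * xi))}.
  apply: cont_itv => x _; apply: continuousM; last exact: cont_cosl.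
  by apply: continuousB; [exact: cst_continuous|exact: cvg_id].
transitivity (\int[mu]_(x in `[0, 1]) ((1 - x) * cos (x * xi))).
  by apply: Rint_eq => x; rewrite /= in_itv/= => /andP[h _]; rewrite /tent ger0_norm.
rewrite (FTC2_Rint ler01 cf (fun x _ => dF x)) /F mul0r sin0 cos0 mul1r.
by field; exact: x0.
Qed.

Let sym_split (c : R -> R) : continuous c -> \int[mu]_(x in `[-1, 1]) (tent x * c x) =
  \int[mu]_(x in `[0, 1]) (tent x * c (- x)) + \int[mu]_(x in `[0, 1]) (tent x * c x).
Proof.
move=> cc.
have ct (x : R) : {for x, continuous (fun x : R => tent x * c x)}.
  by apply: continuousM; [exact: cont_tent|exact: cc].
rewrite (@Rint_split _ (-1) 0 1) ?lerN10//; last exact: L1_tent_mul.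
congr (_ + _).
have := @Rint_reflect R 0 1 (fun x => tent x * c x) ler01.
rewrite oppr0 => ->; last by apply: cont_itv.
by apply: Rint_eq => x _; rewrite /tent normrN.
Qed.

Lemma tent_sin (xi : R) : \int[mu]_(x in `[-1, 1]) (tent x * sin (x * xi)) = 0.
Proof.
rewrite sym_split; last exact: cont_sinl.
rewrite (@Rint_eq _ _ _ (fun x => (-1) * (tent x * sin (x * xi)))); last first.
  by move=> x _; rewrite (mulNr x) sinN; ring.
rewrite RintZl; [by rewrite mulN1r addNr|exact: measurable_itv|].
by apply: L1_tent_mul; exact: cont_sinl.
Qed.

Lemma tent_hat_formula (xi : R) : xi != 0 -> tent_hat xi = 2 * (1 - cos xi) / xi ^+ 2.
Proof.
move=> x0; rewrite /tent_hat sym_split; last exact: cont_cosl.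
rewrite (@Rint_eq _ _ _ (fun x => tent x * cos (x * xi))); last first.
  by move=> x _; rewrite mulNr cosN.
by rewrite tent_half//; field.
Qed.

Lemma tent_mul_le (c : R) (x : R) : x \in `[-1, 1] -> `|c| <= 1 -> `|tent x * c| <= 1.
Proof.
move=> /tent01 /andP[t0 t1] c1; rewrite normrM (ger0_norm t0).
by rewrite mulr_ile1.
Qed.

Lemma tent_hat_le2 (xi : R) : `|tent_hat xi| <= 2.
Proof.
rewrite (_ : 2 = 1 * (1 - -1)); last by ring.
apply: Rint_bound_itv; first by rewrite lerNl opprK ler11 || lra.
  by apply: L1_meas; apply: L1_tent_mul; exact: cont_cosl.
by move=> x xI; apply: tent_mul_le => //; rewrite ler_norml cos_geN1 cos_le1.
Qed.

Lemma tent_hat0 : 0 < tent_hat 0.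
Proof.
rewrite /tent_hat (@Rint_eq _ _ _ (fun x => tent x * 1)); last by move=> x _; rewrite mulr0 cos0.
have c1 : continuous (fun _ : R => 1 : R) by move=> x; exact: cst_continuous.
rewrite (sym_split c1) (_ : \int[mu]_(x in `[0, 1]) (tent x * 1) = 2^-1); first by lra.
have dF (x : R) : is_derive x 1 (fun x => x - 2^-1 * (x * x)) (1 - x).
  have := D_sub (is_derive_id x 1) (D_cmul 2^-1 (D_mul (is_derive_id x 1) (is_derive_id x 1))).
  by congr is_derive; rewrite mul1r mulr1; lra.
have cf : {within `[0, 1], continuous (fun x : R => 1 - x)}.
  by apply: cont_itv => x _; apply: continuousB; [exact: cst_continuous|exact: cvg_id].
transitivity (\int[mu]_(x in (`[0, 1] : set R)) (1 - x)).
  by apply: Rint_eq => x; rewrite /= in_itv/= => /andP[h _]; rewrite /tent ger0_norm ?mulr1.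
by rewrite (FTC2_Rint ler01 cf (fun x _ => dF x)); field.
Qed.

Lemma tent_hat_ge0 (xi : R) : 0 <= tent_hat xi.
Proof.
have [->|x0] := eqVneq xi 0; first exact: ltW tent_hat0.
rewrite tent_hat_formula// divr_ge0 ?sqr_ge0// mulr_ge0// subr_ge0 cos_le1.
Qed.

(** The constant is [2 + 4]: [tent_hat] is at most 2, and [xi^2] times it at most 4 by the explicit
    formula. *)
Lemma tent_hat_le (xi : R) : tent_hat xi <= 6 * (1 + xi ^+ 2)^-1.
Proof.
have p : 0 < 1 + xi ^+ 2 by rewrite ltr_wpDr ?sqr_ge0.
rewrite ler_pdivlMr// mulrDr mulr1.
have h2 := tent_hat_le2 xi; rewrite ger0_norm ?tent_hat_ge0// in h2.
suff : tent_hat xi * xi ^+ 2 <= 4 by lra.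
have [->|x0] := eqVneq xi 0; first by rewrite expr0n/= mulr0.
rewrite tent_hat_formula// divfK ?expf_neq0//.
by have := cos_geN1 xi; lra.
Qed.

Lemma cont_tent_hat : continuous tent_hat.
Proof.
move=> xi; apply/cvgrPdist_lt => e e0; near=> y.
have i z := L1_tent_mul (-1) 1 (@cont_cosl z).
have mI : measurable (`[-1, 1] : set R) by exact: measurable_itv.
rewrite /tent_hat -(RintB mI (i xi) (i y)).
apply: (@le_lt_trans _ _ (`|xi - y| * (1 - -1))).
  apply: Rint_bound_itv; first by lra.
    by apply: L1_meas; apply: L1B.
  move=> x xI; rewrite -mulrBr normrM; have /andP[t0 t1] := tent01 xI.
  rewrite (ger0_norm t0); apply: le_trans (_ : 1 * `|cos (x * xi) - cos (x * y)| <= _).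
    by rewrite ler_wpM2r.
  rewrite mul1r; apply: le_trans (cos_lip _ _) _; rewrite -mulrBr normrM ler_piMl//.
  by move: xI; rewrite in_itv/= -ler_norml.
rewrite -ltr_pdivlMr; last by lra.
near: y; apply: (@cvgr_dist_lt _ _ _ _ _ id) => //; rewrite divr_gt0//; lra.
Unshelve. all: by end_near. Qed.

Lemma L1_tent_hat : L1 setT tent_hat.
Proof.
apply: (@L1_le _ _ _ (fun xi => 6 * (1 + xi ^+ 2)^-1)) => //.
- exact: continuous_measurable_fun cont_tent_hat.
- by apply: L1Zl => //; exact: L1_inv_oneDsqr.
- by move=> xi _; rewrite ger0_norm ?tent_hat_ge0 ?tent_hat_le.
Qed.

Definition lor (xi : R) : R := (1 + xi ^+ 2)^-1.

Lemma lor_gt0 xi : 0 < lor xi.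
Proof. by rewrite invr_gt0 ltr_wpDr ?sqr_ge0. Qed.

Lemma lor_le1 xi : lor xi <= 1.
Proof. by rewrite invf_le1 ?ltr_wpDr ?sqr_ge0// lerDl sqr_ge0. Qed.

Lemma lorK xi : (1 + xi ^+ 2) * lor xi = 1.
Proof. by rewrite mulfV// gt_eqF// ltr_wpDr ?sqr_ge0. Qed.

Lemma L1_lor_shift (a : R) : L1 setT (fun xi => lor (xi - a)) /\
  \int[mu]_xi lor (xi - a) = \int[mu]_xi lor xi.
Proof.
apply: L1_Rint_shift; first exact: continuous_oneDsqrV.
  by move=> x; exact: ltW (lor_gt0 x).
exact: L1_inv_oneDsqr.
Qed.

(** From [(u - v)^2 <= 2 u^2 + 2 v^2]. The product of two bumps gains decay in the distance of their
    centres while one bump remains for integration: this is the source of almost orthogonality. *)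
Lemma lor_mul (u v : R) : lor u * lor v <= 2 * lor (u - v) * (lor u + lor v).
Proof.
have p0 := lor_gt0 u; have q0 := lor_gt0 v; have w0 := lor_gt0 (u - v).
rewrite -(ler_pM2l (_ : 0 < 1 + (u - v) ^+ 2)); last by rewrite ltr_wpDr ?sqr_ge0.
have -> : (1 + (u - v) ^+ 2) * (2 * lor (u - v) * (lor u + lor v)) =
  ((1 + (u - v) ^+ 2) * lor (u - v)) * (2 * (lor u + lor v)) by ring.
rewrite lorK mul1r.
have -> : 2 * (lor u + lor v) = (2 * ((1 + u ^+ 2) + (1 + v ^+ 2))) * (lor u * lor v).
  transitivity (2 * (((1 + u ^+ 2) * lor u) * lor v + ((1 + v ^+ 2) * lor v) * lor u)); last by ring.
  by rewrite !lorK !mul1r [X in _ * X]addrC.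
rewrite ler_wpM2r ?mulr_ge0 ?(ltW p0) ?(ltW q0)//.
by have := sqr_ge0 (u + v); rewrite sqrrD sqrrB; lra.
Qed.

Lemma sum_lor_le (n : nat) : \sum_(k < n) lor k%:R <= 3.
Proof.
(* The remainder telescopes, since [1 / (1 + x^2) <= 2 / (x (x + 1))] for [x >= 1]; the constant 3
   is [1 + 2]. *)
have h k : \sum_(i < k.+1) lor i%:R <= 3 - 2 / k.+1%:R.
  elim: k => [|k IH].
    by rewrite big_ord_recr big_ord0/= add0r divr1; have := lor_le1 0; lra.
  rewrite big_ord_recr/=; apply: le_trans (lerD IH (lexx _)) _.
  have k0 : 0 <= k%:R :> R by [].
  have e1 : k.+1%:R = k%:R + 1 :> R by rewrite -natr1.
  have e2 : k.+2%:R = k%:R + 1 + 1 :> R by rewrite -natr1 e1.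
  rewrite /lor e1 e2; set x : R := k%:R in k0 *.
  have -> : 3 - 2 / (x + 1) = 3 - 2 / (x + 1 + 1) - 2 / ((x + 1) * (x + 1 + 1)).
    by field; apply/andP; split; rewrite gt_eqF//; lra.
  suff : (1 + (x + 1) ^+ 2)^-1 <= 2 / ((x + 1) * (x + 1 + 1)) by lra.
  have a0 : 0 < (x + 1) * (x + 1 + 1) by rewrite mulr_gt0//; lra.
  have b0 : 0 < 1 + (x + 1) ^+ 2 by rewrite ltr_wpDr ?sqr_ge0.
  rewrite ler_pdivlMr// mulrC ler_pdivrMr//; nra.
case: n => [|n]; first by rewrite big_ord0.
by apply: le_trans (h n) _; rewrite lerBlDr lerDl divr_ge0.
Qed.

Lemma sum_lor_dist (M n : nat) : (n < M)%N ->
  \sum_(k < M) lor (n%:R - k%:R) <= 6.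
Proof.
move=> nM; rewrite -(big_mkord xpredT (fun k => lor (n%:R - k%:R))).
rewrite (@big_cat_nat _ _ _ n)//=; last exact: ltnW.
have h1 : \sum_(0 <= k < n) lor (n%:R - k%:R) <= 3.
  rewrite big_nat_rev/= add0n big_mkord; apply: le_trans (sum_lor_le n.+1).
  rewrite big_ord_recl/= -[leLHS]add0r lerD ?(ltW (lor_gt0 _))//.
  apply: ler_sum => k _; rewrite -natrB; last by rewrite leq_subr.
  by rewrite subKn.
have h2 : \sum_(n <= k < M) lor (n%:R - k%:R) <= 3.
  rewrite -{1}[n]add0n big_addn big_mkord; apply: le_trans (sum_lor_le (M - n)).
  by apply: ler_sum => k _; rewrite natrD opprD addrCA subrr addr0 /lor sqrrN.
lra.
Qed.

Lemma L1_Rint_sum (D : set R) (n : nat) (F : nat -> R -> R) : measurable D ->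
  (forall k, L1 D (F k)) ->
  L1 D (fun x => \sum_(k < n) F k x) /\
  \int[mu]_(x in D) (\sum_(k < n) F k x) = \sum_(k < n) \int[mu]_(x in D) F k x.
Proof.
move=> mD iF; elim: n => [|n [IH1 IH2]].
  split.
    rewrite (_ : (fun x => _) = (fun x => (0 * F 0%N x)%:E)); first exact: L1Zl.
    by apply/funext => x; rewrite big_ord0 mul0r.
  rewrite big_ord0 (@Rint_eq _ _ _ (fun x => 0 * F 0%N x)); last first.
    by move=> x _; rewrite big_ord0 mul0r.
  by rewrite RintZl// mul0r.
split.
  rewrite (_ : (fun x => _) = (fun x => (\sum_(k < n) F k x + F n x)%:E)); first exact: L1D.
  by apply/funext => x; rewrite big_ord_recr.
rewrite big_ord_recr/= -IH2 -(RintD mD IH1 (iF n)).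
by apply: Rint_eq => x _; rewrite big_ord_recr.
Qed.

Lemma lor_scale (y d : R) : 1 <= d -> lor (y * d) <= lor y.
Proof.
move=> d1; rewrite /lor lef_pV2 ?posrE ?ltr_wpDr ?sqr_ge0// lerD2l exprMn ler_peMr ?sqr_ge0//.
by rewrite -[leLHS](expr1n _ 2) lerXn2r// ?nnegrE; lra.
Qed.

(** With [z = y / l^2] and [0 <= s <= 1], the power [z^s] is at most [z] or at most 1. For
    [y = 1 + xi^2] this replaces the fractional weight by one quadratic in [xi], which the
    Lorentzian bounds can absorb. *)
Lemma powR_weight_le (s l y : R) : 0 <= s <= 1 -> 1 <= l -> 1 <= y ->
  y `^ s <= l `^ (2 * s) * (1 + y / l ^+ 2).
Proof.
move=> /andP[s0 s1] l1 y1; have l0 : 0 < l by lra.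
have l20 : 0 < l ^+ 2 by rewrite exprn_gt0.
have -> : y `^ s = l `^ (2 * s) * (y / l ^+ 2) `^ s.
  rewrite powRrM powR_mulrn ?(ltW l0)// -powRM ?(ltW l20)//; last by rewrite divr_ge0 ?(ltW l20)//; lra.
  by rewrite mulrCA mulfV ?gt_eqF// mulr1.
rewrite ler_wpM2l ?powR_ge0//; set z := y / _.
have z0 : 0 < z by rewrite divr_gt0//; lra.
have [z1|z1] := leP 1 z.
  by have := ler_powR z1 s1; rewrite powRr1 ?(ltW z0)//; lra.
have := ge0_ler_powR s0 (ltW z0) ler01 (ltW z1); rewrite powR1; lra.
Qed.

Section Packet.
Variables (M : nat) (lam d : R).
Hypothesis M0 : (0 < M)%N.
Hypothesis d1 : 1 <= d.
Hypothesis lam1 : 1 <= lam.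

Definition freq (n : nat) : R := lam + n%:R * d.
(** The transform of [pack_cos + i pack_sin] cut off to [[-1, 1]]; it is real because [tent] is
    even. *)
Definition pack_hat (xi : R) : R := M%:R^-1 * \sum_(n < M) tent_hat (xi - freq n).
Definition pack_cos (x : R) : R := tent x * (M%:R^-1 * \sum_(n < M) cos (x * freq n)).
Definition pack_sin (x : R) : R := tent x * (M%:R^-1 * \sum_(n < M) sin (x * freq n)).

Let Mi0 : 0 <= M%:R^-1 :> R. Proof. by rewrite invr_ge0. Qed.
Let mI : measurable (`[-1, 1] : set R). Proof. exact: measurable_itv. Qed.
Let J : R := \int[mu]_xi lor xi.

Lemma pack_hat_ge0 xi : 0 <= pack_hat xi.
Proof. by rewrite mulr_ge0// sumr_ge0// => n _; exact: tent_hat_ge0. Qed.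

Let cont_sum (F : nat -> R -> R) (n : nat) : (forall k, continuous (F k)) ->
  continuous (fun x : R => \sum_(k < n) F k x).
Proof.
move=> cF; elim: n => [|n IH] x.
  rewrite (_ : (fun x => _) = cst 0); first exact: cst_continuous.
  by apply/funext => y; rewrite big_ord0.
rewrite (_ : (fun x => _) = (fun x => \sum_(k < n) F k x + F n x)); last first.
  by apply/funext => y; rewrite big_ord_recr.
by apply: (@continuousD R R R (fun x => \sum_(k < n) F k x) (F n) x); [exact: IH|exact: cF].
Qed.

Let cont_hat n : continuous (fun xi : R => tent_hat (xi - freq n)).
Proof.
move=> x; apply: (@continuous_comp _ _ _ (fun x : R => x - freq n) tent_hat); last exact: cont_tent_hat.
by apply: continuousB; [exact: cvg_id|exact: cst_continuous].
Qed.

Lemma cont_pack_hat : continuous pack_hat.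
Proof.
move=> x; apply: (@continuousM R R (fun=> M%:R^-1) (fun xi => \sum_(n < M) tent_hat (xi - freq n)) x).
  exact: cst_continuous.
exact: (@cont_sum (fun n xi => tent_hat (xi - freq n))).
Qed.

Lemma cont_pack_cos : continuous pack_cos.
Proof.
move=> x; apply: (@continuousM R R tent (fun x => M%:R^-1 * \sum_(n < M) cos (x * freq n)) x).
  exact: cont_tent.
apply: (@continuousM R R (fun=> M%:R^-1) (fun x => \sum_(n < M) cos (x * freq n)) x).
  exact: cst_continuous.
by apply: (@cont_sum (fun n x => cos (x * freq n))) => n; exact: cont_cosl.
Qed.

Lemma cont_pack_sin : continuous pack_sin.
Proof.
move=> x; apply: (@continuousM R R tent (fun x => M%:R^-1 * \sum_(n < M) sin (x * freq n)) x).
  exact: cont_tent.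
apply: (@continuousM R R (fun=> M%:R^-1) (fun x => \sum_(n < M) sin (x * freq n)) x).
  exact: cst_continuous.
by apply: (@cont_sum (fun n x => sin (x * freq n))) => n; exact: cont_sinl.
Qed.

(** Translating every bump to the origin leaves one fixed profile [tent_hat] against the average of
    [c] over the frequencies, which is the form that dominated convergence can use when the packet
    varies. *)
Lemma pack_hat_Rint (c : R -> R) : continuous c -> (forall x, `|c x| <= 1) ->
  L1 setT (fun xi => c xi * pack_hat xi) /\
  \int[mu]_xi (c xi * pack_hat xi) =
  \int[mu]_eta ((M%:R^-1 * \sum_(n < M) c (eta + freq n)) * tent_hat eta).
Proof.
move=> cc c1.
have sh n := L1_Rint_shift_mul (freq n) cc cont_tent_hat c1 tent_hat_ge0 L1_tent_hat.
have [i1 e1] := L1_Rint_sum M (F := fun n xi => c xi * tent_hat (xi - freq n)) measurableT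
  (fun n => (sh n).1).
have mc n : measurable_fun setT (fun x : R => c (x + freq n)).
  by apply: measurableT_comp; [exact: continuous_measurable_fun|meas].
have j n : L1 setT (fun xi => c (xi + freq n) * tent_hat xi).
  by apply: (L1_mulb measurableT L1_tent_hat (mc n) (C := 1)) => x _; exact: c1.
have [i2 e2] := L1_Rint_sum M (F := fun n xi => c (xi + freq n) * tent_hat xi) measurableT j.
have E1 (xi : R) : c xi * pack_hat xi = M%:R^-1 * \sum_(n < M) (c xi * tent_hat (xi - freq n)).
  by rewrite /pack_hat mulrCA mulr_sumr.
split.
  rewrite (_ : (fun xi => _) = (fun xi => (M%:R^-1 * \sum_(n < M) (c xi * tent_hat (xi - freq n)))%:E)).
    exact: L1Zl.
  by apply/funext => xi; rewrite E1.
transitivity (\int[mu]_xi (M%:R^-1 * \sum_(n < M) (c xi * tent_hat (xi - freq n)))).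
  by apply: Rint_eq => xi _; exact: E1.
rewrite (RintZl _ measurableT i1) e1.
transitivity (\int[mu]_xi (M%:R^-1 * \sum_(n < M) (c (xi + freq n) * tent_hat xi))).
  rewrite (RintZl _ measurableT i2) e2; congr (_ * _); apply: eq_bigr => n _; exact: (sh n).2.
by apply: Rint_eq => xi _; rewrite -mulr_suml mulrA.
Qed.

Lemma L1_pack_hat : L1 setT pack_hat.
Proof.
have c1 : continuous (fun _ : R => 1 : R) by move=> x; exact: cst_continuous.
have [|h _] := pack_hat_Rint c1; first by move=> x; rewrite normr1.
rewrite (_ : (fun x => _) = (fun xi => (1 * pack_hat xi)%:E))//.
by apply/funext => xi; rewrite mul1r.
Qed.

Lemma trunc_pack (xi : R) : trunc_transform pack_cos pack_sin 1 xi = pack_hat xi.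
Proof.
have [i e] := L1_Rint_sum M (F := fun n x => tent x * cos (x * (xi - freq n))) mI
  (fun n => L1_tent_mul (-1) 1 (@cont_cosl (xi - freq n))).
rewrite /pack_hat -e -(RintZl _ mI i); apply: Rint_eq => x _.
rewrite /pack_cos /pack_sin.
transitivity (M%:R^-1 * (tent x * (\sum_(n < M) (cos (x * xi) * cos (x * freq n)) +
  \sum_(n < M) (sin (x * xi) * sin (x * freq n))))).
  by rewrite -!mulr_sumr; ring.
congr (_ * _); rewrite -big_split/= mulr_sumr; apply: eq_bigr => n _.
by rewrite mulrBr cosB.
Qed.

Lemma trunc_pack_sin (xi : R) : trunc_transform pack_sin (fun x => - pack_cos x) 1 xi = 0.
Proof.
have [i e] := L1_Rint_sum M (F := fun n x => tent x * sin (x * (freq n - xi))) mI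
  (fun n => L1_tent_mul (-1) 1 (@cont_sinl (freq n - xi))).
transitivity (\int[mu]_(x in `[-1, 1]) (M%:R^-1 * \sum_(n < M) (tent x * sin (x * (freq n - xi))))).
  apply: Rint_eq => x _; rewrite /pack_cos /pack_sin.
  transitivity (M%:R^-1 * (tent x * (\sum_(n < M) (cos (x * xi) * sin (x * freq n)) -
    \sum_(n < M) (sin (x * xi) * cos (x * freq n))))).
    by rewrite -!mulr_sumr; ring.
  congr (_ * _); rewrite -sumrB/= mulr_sumr; apply: eq_bigr => n _.
  by rewrite [in RHS]mulrBr sinB; congr (_ * _); ring.
rewrite (RintZl _ mI i) e big1 ?mulr0// => n _; exact: tent_sin.
Qed.

Let lor_freq (n k : nat) : lor (freq n - freq k) <= lor (n%:R - k%:R).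
Proof.
have -> : freq n - freq k = (n%:R - k%:R) * d by rewrite /freq; ring.
exact: lor_scale.
Qed.

Let double_sum : M%:R^-1 * (M%:R^-1 * \sum_(n < M) \sum_(k < M) lor (n%:R - k%:R)) <= 6 * M%:R^-1.
Proof.
have Mp : 0 < M%:R :> R by rewrite ltr0n.
rewrite [leRHS]mulrC ler_wpM2l// ler_pdivrMl//.
apply: le_trans (_ : \sum_(n < M) 6 <= _).
  by apply: ler_sum => n _; exact: sum_lor_dist.
by rewrite sumr_const card_ord mulr_natl.
Qed.

(** Since [tent^2 <= tent] on [[-1, 1]], the squared norm is at most the double sum of
    [tent_hat (freq n - freq k)] divided by [M^2]. The frequencies are at least 1 apart, so each row
    sums to at most [6 * 6]. *)
Lemma pack_sq_le : \int[mu]_(x in `[-1, 1]) (pack_cos x ^+ 2 + pack_sin x ^+ 2) <= 36 * M%:R^-1.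
Proof.
pose D (x : R) := \sum_(n < M) \sum_(k < M) (tent x * cos (x * (freq n - freq k))).
have ic n k := L1_tent_mul (-1) 1 (@cont_cosl (freq n - freq k)).
have ik n := L1_Rint_sum M (F := fun k x => tent x * cos (x * (freq n - freq k))) mI (ic n).
have [i e] := L1_Rint_sum M (F := fun n x => \sum_(k < M) (tent x * cos (x * (freq n - freq k)))) mI
  (fun n => (ik n).1).
have i2 := L1Zl M%:R^-1 mI (L1Zl M%:R^-1 mI i).
apply: (@le_trans _ _ (\int[mu]_(x in `[-1, 1]) (M%:R^-1 * (M%:R^-1 * D x)))).
  apply: Rint_le => //.
    apply: L1_continuous => x.
    apply: (@continuousD R R R (fun x => pack_cos x ^+ 2) (fun x => pack_sin x ^+ 2) x).
      by apply: (@continuousM R R pack_cos pack_cos x); exact: cont_pack_cos.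
    by apply: (@continuousM R R pack_sin pack_sin x); exact: cont_pack_sin.
  move=> x /tent01 /andP[t0 t1].
  set a := \sum_(n < M) cos (x * freq n); set b := \sum_(n < M) sin (x * freq n).
  have -> : D x = tent x * (a ^+ 2 + b ^+ 2).
    rewrite /D !expr2 mulr_suml [b * b]mulr_suml -big_split/= mulr_sumr; apply: eq_bigr => n _.
    rewrite /a /b !mulr_sumr -big_split/= mulr_sumr; apply: eq_bigr => k _.
    by rewrite mulrBr cosB.
  have -> : pack_cos x ^+ 2 + pack_sin x ^+ 2 =
     tent x * (M%:R^-1 * (M%:R^-1 * (tent x * (a ^+ 2 + b ^+ 2)))).
    by rewrite /pack_cos /pack_sin -/a -/b; ring.
  by rewrite ler_piMl// !mulr_ge0// addr_ge0 ?sqr_ge0.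
rewrite (RintZl _ mI (L1Zl _ mI i)) (RintZl _ mI i) e.
rewrite (_ : 36 * _ = 6 * (6 * M%:R^-1)); last by ring.
apply: le_trans (_ : 6 * (M%:R^-1 * (M%:R^-1 * \sum_(n < M) \sum_(k < M) lor (n%:R - k%:R))) <= _); last first.
  by rewrite ler_wpM2l//; exact: double_sum.
rewrite [leRHS]mulrCA ler_wpM2l// [leRHS]mulrCA ler_wpM2l// mulr_sumr; apply: ler_sum => n _.
rewrite (ik n).2 mulr_sumr; apply: ler_sum => k _.
by apply: le_trans (tent_hat_le _) _; rewrite ler_wpM2l//; exact: lor_freq.
Qed.

Lemma pack_hat_sq_le (s : R) : 0 <= s <= 1 -> (forall n, (n < M)%N -> freq n <= 2 * lam) ->
  M%:R <= lam ^+ 2 ->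
  L1 setT (fun xi => (1 + xi ^+ 2) `^ s * pack_hat xi ^+ 2) /\
  \int[mu]_xi ((1 + xi ^+ 2) `^ s * pack_hat xi ^+ 2) <=
    36 * (266 * J) * (lam `^ (2 * s) * M%:R^-1).
Proof.
move=> s01 fr Ml.
(* The weight [1 + (1 + xi^2) / lam^2] times the bumps [p] and [q] is at most
   [11 p q + 2 q / lam^2], because [freq n <= 2 lam] gives [1 + xi^2 <= 10 lam^2 + 2 (1 + (xi - freq
   n)^2)]; then [lor_mul] doubles 11. Row sums of at most 6 lead to [266 = 44 * 6 + 2]. *)
pose B (n k : nat) (xi : R) := 22 * lor (n%:R - k%:R) * (lor (xi - freq n) + lor (xi - freq k)) +
   2 / lam ^+ 2 * lor (xi - freq k).
have l1' := lam1; have d1' := d1; have lam0 : 0 < lam by lra.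
have l20 : 0 < lam ^+ 2 by rewrite exprn_gt0.
have f0 n : 0 <= freq n by rewrite addr_ge0 ?mulr_ge0//; lra.
have iB n k : L1 setT (B n k) /\ \int[mu]_xi B n k xi = 44 * J * lor (n%:R - k%:R) + 2 * J / lam ^+ 2.
  have [i1 e1] := L1_lor_shift (freq n); have [i2 e2] := L1_lor_shift (freq k).
  have i12 := L1D measurableT i1 i2.
  have j1 := L1Zl (22 * lor (n%:R - k%:R)) measurableT i12.
  have j2 := L1Zl (2 / lam ^+ 2) measurableT i2.
  split; first exact: L1D.
  rewrite (RintD measurableT j1 j2) (RintZl _ measurableT i12) (RintZl _ measurableT i2).
  by rewrite (RintD measurableT i1 i2) e1 e2 -/J; field; rewrite gt_eqF.
have pt n k (xi : R) : (n < M)%N -> (1 + (1 + xi ^+ 2) / lam ^+ 2) *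
    (tent_hat (xi - freq n) * tent_hat (xi - freq k)) <= 36 * B n k xi.
  move=> nM; set p := lor (xi - freq n); set q := lor (xi - freq k).
  have p0 : 0 < p := lor_gt0 _; have q0 : 0 < q := lor_gt0 _.
  have w0 : 0 <= 1 + (1 + xi ^+ 2) / lam ^+ 2.
    by rewrite addr_ge0// divr_ge0 ?(ltW l20)// addr_ge0// sqr_ge0.
  apply: (@le_trans _ _ ((1 + (1 + xi ^+ 2) / lam ^+ 2) * ((6 * p) * (6 * q)))).
    by rewrite ler_wpM2l// ler_pM ?tent_hat_ge0 ?tent_hat_le.
  rewrite (_ : _ * _ = 36 * ((1 + (1 + xi ^+ 2) / lam ^+ 2) * (p * q))); last by ring.
  rewrite ler_wpM2l//.
  have h1 : p * q <= 2 * lor (n%:R - k%:R) * (p + q).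
    apply: le_trans (lor_mul _ _) _; rewrite -/p -/q.
    rewrite ler_wpM2r ?addr_ge0 ?(ltW p0) ?(ltW q0)// ler_wpM2l//.
    rewrite (_ : xi - freq n - (xi - freq k) = - (freq n - freq k)); last by ring.
    by rewrite {1}/lor sqrrN; exact: lor_freq.
  have h2 : (1 + xi ^+ 2) * p <= 10 * lam ^+ 2 * p + 2.
    have e := lorK (xi - freq n); rewrite -/p in e.
    have a2 : freq n ^+ 2 <= 4 * lam ^+ 2.
      by have := fr n nM => h; rewrite (_ : 4 * _ = (2 * lam) ^+ 2); [rewrite lerXn2r ?nnegrE//; lra|ring].
    have l21 : 1 <= lam ^+ 2 by rewrite exprn_ege1.
    have : 1 + xi ^+ 2 <= 10 * lam ^+ 2 + 2 * (1 + (xi - freq n) ^+ 2).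
      by have := sqr_ge0 (xi - 2 * freq n); rewrite !sqrrB !exprMn; lra.
    by rewrite -(ler_pM2r p0) [leRHS]mulrDl -[X in _ <= _ + X]mulrA e mulr1.
  rewrite /B -/p -/q; apply: (@le_trans _ _ (11 * (p * q) + 2 / lam ^+ 2 * q)).
    rewrite mulrDl mul1r.
    have : (1 + xi ^+ 2) / lam ^+ 2 * (p * q) <= 10 * (p * q) + 2 / lam ^+ 2 * q.
      have -> : (1 + xi ^+ 2) / lam ^+ 2 * (p * q) = ((1 + xi ^+ 2) * p) * (q / lam ^+ 2) by ring.
      apply: le_trans (ler_wpM2r _ h2) _; first by rewrite divr_ge0 ?ltW.
      by rewrite le_eqVlt; apply/orP; left; apply/eqP; field; rewrite gt_eqF.
    lra.
  by rewrite lerD2r; lra.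
pose T (xi : R) := \sum_(n < M) \sum_(k < M) B n k xi.
have ik n := L1_Rint_sum M (F := B n) measurableT (fun k => (iB n k).1).
have [iT eT] := L1_Rint_sum M (F := fun n xi => \sum_(k < M) B n k xi) measurableT (fun n => (ik n).1).
set L := lam `^ (2 * s); have L0 : 0 <= L by exact: powR_ge0.
pose Bd (xi : R) := L * (36 * (M%:R^-1 * (M%:R^-1 * T xi))).
have i1 := L1Zl M%:R^-1 measurableT (L1Zl M%:R^-1 measurableT iT).
have iBd : L1 setT Bd := L1Zl L measurableT (L1Zl 36 measurableT i1).
have pw (xi : R) : (1 + xi ^+ 2) `^ s * pack_hat xi ^+ 2 <= Bd xi.
  have x1 : 1 <= 1 + xi ^+ 2 by rewrite lerDl sqr_ge0.
  apply: le_trans (ler_wpM2r (sqr_ge0 _) (powR_weight_le s01 lam1 x1)) _.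
  rewrite -mulrA ler_wpM2l//.
  have -> : pack_hat xi ^+ 2 = M%:R^-1 * (M%:R^-1 * \sum_(n < M) \sum_(k < M)
      (tent_hat (xi - freq n) * tent_hat (xi - freq k))).
    rewrite /pack_hat; under [in RHS]eq_bigr do rewrite -mulr_sumr.
    by rewrite -mulr_suml; ring.
  rewrite mulrCA [leRHS]mulrCA ler_wpM2l// mulrCA [leRHS]mulrCA ler_wpM2l//.
  rewrite !mulr_sumr; apply: ler_sum => n _; rewrite !mulr_sumr; apply: ler_sum => k _.
  exact: pt.
have mw : measurable_fun setT (fun xi : R => (1 + xi ^+ 2) `^ s * pack_hat xi ^+ 2).
  apply: measurable_funM; first by meas.
  by apply: measurable_funX; exact: continuous_measurable_fun cont_pack_hat.
have ge0 (xi : R) : 0 <= (1 + xi ^+ 2) `^ s * pack_hat xi ^+ 2 by rewrite mulr_ge0 ?powR_ge0 ?sqr_ge0.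
have iw : L1 setT (fun xi : R => (1 + xi ^+ 2) `^ s * pack_hat xi ^+ 2).
  by apply: (L1_le measurableT mw iBd) => xi _; rewrite ger0_norm.
split=> //; apply: (@le_trans _ _ (\int[mu]_xi Bd xi)).
  by apply: Rint_le => // xi _; exact: pw.
rewrite (RintZl _ measurableT (L1Zl 36 measurableT i1)) (RintZl _ measurableT i1).
rewrite (RintZl _ measurableT (L1Zl M%:R^-1 measurableT iT)) (RintZl _ measurableT iT) eT.
have J0 : 0 <= J by apply: Rintegral_ge0 => xi _; exact: ltW (lor_gt0 xi).
have Mp : 0 < M%:R :> R by rewrite ltr0n.
have S2 : \sum_(n < M) \int[mu]_xi (\sum_(k < M) B n k xi) =
    44 * J * (\sum_(n < M) \sum_(k < M) lor (n%:R - k%:R)) + M%:R * (M%:R * (2 * J / lam ^+ 2)).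
  rewrite mulr_sumr.
  have -> : M%:R * (M%:R * (2 * J / lam ^+ 2)) = \sum_(n < M) (M%:R * (2 * J / lam ^+ 2)).
    by rewrite sumr_const card_ord mulr_natl.
  rewrite -big_split/=; apply: eq_bigr => n _; rewrite (ik n).2 mulr_sumr.
  have -> : M%:R * (2 * J / lam ^+ 2) = \sum_(k < M) (2 * J / lam ^+ 2).
    by rewrite sumr_const card_ord mulr_natl.
  by rewrite -big_split/=; apply: eq_bigr => k _; rewrite (iB n k).2.
rewrite S2 [leRHS]mulrCA ler_wpM2l//.
set DS := \sum_(n < M) \sum_(k < M) _.
have k1 : M%:R^-1 * (M%:R^-1 * DS) <= 6 * M%:R^-1 by exact: double_sum.
have k2 : M%:R^-1 * (M%:R^-1 * (44 * J * DS + M%:R * (M%:R * (2 * J / lam ^+ 2)))) =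
   44 * J * (M%:R^-1 * (M%:R^-1 * DS)) + 2 * J * (lam ^+ 2)^-1.
  by field; rewrite !gt_eqF.
have k3 : (lam ^+ 2)^-1 <= M%:R^-1 by rewrite lef_pV2 ?posrE.
have k4 := ler_wpM2l (mulr_ge0 (ler0n _ 44) J0) k1.
have k5 := ler_wpM2l (mulr_ge0 (ler0n _ 2) J0) k3.
rewrite k2; move: k4 k5; set u := M%:R^-1; set v := (lam ^+ 2)^-1; set w := u * (u * DS) => k4 k5.
by rewrite [leRHS](_ : _ = 36 * (44 * J * (6 * u) + 2 * J * u)); [rewrite ler_wpM2l//; exact: lerD|ring].
Qed.

(** The damping is concentrated at the origin and every bump is centred at distance at least [lam]
    from it, so [lor_mul] gains the factor [lor lam]. *)
Lemma pack_hat_damped (m gam t C : R) : 0 <= C -> (forall xi, damp m gam t xi <= C * lor xi) ->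
  \int[mu]_xi (damp m gam t xi * pack_hat xi) <= 24 * C * J * lor lam.
Proof.
move=> C0 hC; have l1' := lam1; have d1' := d1; have lam0 : 0 < lam by lra.
have md : measurable_fun setT (damp m gam t) by rewrite /damp; meas.
pose B (n : nat) (xi : R) := 12 * C * lor lam * (lor xi + lor (xi - freq n)).
have i0 : L1 setT (@lor) by exact: L1_inv_oneDsqr.
have iB n : L1 setT (B n) /\ \int[mu]_xi B n xi = 24 * C * J * lor lam.
  have [i1 e1] := L1_lor_shift (freq n).
  have i01 := L1D measurableT i0 i1; split; first exact: L1Zl.
  by rewrite (RintZl _ measurableT i01) (RintD measurableT i0 i1) e1 -/J; ring.
have [iS eS] := L1_Rint_sum M (F := B) measurableT (fun n => (iB n).1).
apply: (@le_trans _ _ (\int[mu]_xi (M%:R^-1 * \sum_(n < M) B n xi))).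
  apply: Rint_le => //; last first.
  - move=> xi _; have /andP[q0 q1] := damp_le1 m gam t xi.
    rewrite /pack_hat mulrCA ler_wpM2l// mulr_sumr; apply: ler_sum => n _.
    apply: (@le_trans _ _ ((C * lor xi) * (6 * lor (xi - freq n)))).
      by rewrite ler_pM ?tent_hat_ge0 ?tent_hat_le.
    have -> : C * lor xi * (6 * lor (xi - freq n)) = (6 * C) * (lor xi * lor (xi - freq n)) by ring.
    apply: le_trans (ler_wpM2l _ (lor_mul _ _)) _; first by rewrite mulr_ge0.
    have -> : xi - (xi - freq n) = freq n by ring.
    rewrite /B (_ : 6 * C * _ = 12 * C * lor (freq n) * (lor xi + lor (xi - freq n))); last by ring.
    rewrite ler_wpM2r ?addr_ge0 ?(ltW (lor_gt0 _))// ler_wpM2l ?mulr_ge0//.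
    rewrite lef_pV2 ?posrE ?ltr_wpDr ?sqr_ge0// lerD2l lerXn2r ?nnegrE ?(ltW lam0)//.
      by rewrite addr_ge0 ?(ltW lam0)// mulr_ge0//; lra.
    by rewrite lerDl mulr_ge0//; lra.
  - exact: L1Zl.
  - apply: (L1_mulb measurableT L1_pack_hat md (C := 1)) => xi _.
    by have /andP[q0 q1] := damp_le1 m gam t xi; rewrite ger0_norm.
rewrite (RintZl _ measurableT iS) eS (eq_bigr (fun=> 24 * C * J * lor lam)); last first.
  by move=> n _; exact: (iB n).2.
by rewrite sumr_const card_ord -[X in _ * X]mulr_natl mulKf// gt_eqF// ltr0n.
Qed.

End Packet.

End Packets.

(** * Alignment of the phases at the resonance time *)

Section Resonance.
Variable R : realType.

Lemma mvt_abs (f f' : R -> R) (a b r K : R) :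
  (forall x : R, `|x - a| <= r -> is_derive x 1 f (f' x)) ->
  (forall x : R, `|x - a| <= r -> `|f' x| <= K) -> `|b - a| <= r ->
  `|f b - f a| <= K * `|b - a|.
Proof.
move=> df bd bar.
have key p q : p <= q -> (forall x, x \in `[p, q] -> `|x - a| <= r) ->
    `|f q - f p| <= K * (q - p).
  move=> pq inr.
  have cf : {within `[p, q], continuous f}.
    by apply: cont_itv => x xI; apply: D_continuous; exact: df (inr x xI).
  have sub : forall x : R, x \in `]p, q[ -> is_derive x 1 f (f' x).
    move=> x xI; apply: df; apply: inr.
    by move: xI; rewrite !in_itv/= => /andP[/ltW -> /ltW ->].
  have [c cI ->] := MVT_segment pq sub cf.
  by rewrite normrM (ger0_norm (_ : 0 <= q - p)) ?subr_ge0// ler_wpM2r ?subr_ge0// bd// inr.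
move: bar; rewrite ler_norml => /andP[r1 r2].
have [ab|/ltW ba] := leP a b.
  rewrite (ger0_norm (_ : 0 <= b - a)) ?subr_ge0//; apply: key => // x.
  rewrite in_itv/= => /andP[h1 h2]; rewrite ler_norml; apply/andP; split; lra.
rewrite distrC (distrC b) (ger0_norm (_ : 0 <= a - b)) ?subr_ge0//; apply: key => // x.
rewrite in_itv/= => /andP[h1 h2]; rewrite ler_norml; apply/andP; split; lra.
Qed.

Lemma powR_comparable (lam y p : R) : 0 < lam -> lam / 2 <= y -> y <= 2 * lam ->
  y `^ p <= (2 `^ p + 2 `^ (- p)) * lam `^ p.
Proof.
move=> l0 h1 h2; have y0 : 0 < y by lra.
have -> : y `^ p = (y / lam) `^ p * lam `^ p.
  by rewrite -powRM ?divr_ge0 ?ltW// divfK// gt_eqF.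
rewrite ler_wpM2r ?powR_ge0//; set z := y / lam.
have z0 : 0 < z by rewrite divr_gt0.
have z1 : 2^-1 <= z by rewrite ler_pdivlMr//; lra.
have z2 : z <= 2 by rewrite ler_pdivrMr.
have q1 := powR_ge0 (2 : R) p; have q2 := powR_ge0 (2 : R) (- p).
have [p0|/ltW p0] := leP 0 p.
  have := ge0_ler_powR p0 (ltW z0) (ler0n R 2) z2; lra.
have np0 : 0 <= - p by rewrite oppr_ge0.
suff : z `^ p <= 2 `^ (- p) by lra.
have zi : z^-1 <= 2 by rewrite invf_ple ?posrE.
have := ge0_ler_powR np0 (ltW (_ : 0 < z^-1)) (ler0n R 2) zi.
rewrite invr_gt0 z0 => /(_ isT); apply: le_trans.
by rewrite -powR_inv1 ?(ltW z0)// -powRrM mulN1r opprK.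
Qed.

(** The mean value theorem twice; the bound on [v] keeps the argument within a factor 2 of [lam],
    where powers are comparable. *)
Lemma powR_taylor (m : R) : 1 < m -> exists2 C : R, 0 < C & forall lam v : R, 0 < lam ->
  `|v| <= lam / 2 ->
  `|(lam + v) `^ m - lam `^ m - m * lam `^ (m - 1) * v| <= C * lam `^ (m - 2) * v ^+ 2.
Proof.
move=> m1; pose K := 2 `^ (m - 2) + 2 `^ (- (m - 2)) : R.
have K0 : 0 < K by rewrite addr_gt0 ?powR_gt0.
exists (m * ((m - 1) * K)); first by rewrite !mulr_gt0//; lra.
move=> lam v l0 vl.
have pos (x : R) : `|x - 0| <= `|v| -> lam / 2 <= lam + x /\ lam + x <= 2 * lam.
  rewrite subr0 => h; have : `|x| <= lam / 2 by apply: le_trans h vl.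
  by rewrite ler_norml => /andP[]; lra.
have dp (p x : R) : `|x - 0| <= `|v| ->
    is_derive x 1 (fun x : R => (lam + x) `^ p) (p * (lam + x) `^ (p - 1)).
  move=> /pos [h _]; have h0 : 0 < lam + x by lra.
  have ds : is_derive x 1 (fun x : R => lam + x) 1.
    by have := D_add (is_derive_cst lam x 1) (is_derive_id x 1); rewrite add0r.
  have := D_comp (f := fun y => y `^ p) (g := fun x => lam + x) (is_derive1_powR p h0) ds.
  by rewrite mulr1.
have b2 (x : R) : `|x - 0| <= `|v| -> `|(m - 1) * (lam + x) `^ (m - 1 - 1)| <= (m - 1) * K * lam `^ (m - 2).
  move=> /pos [h1 h2]; rewrite ger0_norm ?mulr_ge0 ?powR_ge0//; last by lra.
  rewrite -mulrA ler_wpM2l//; first by lra.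
  rewrite (_ : m - 1 - 1 = m - 2); last by ring.
  exact: powR_comparable.
pose f (x : R) := (lam + x) `^ m - m * lam `^ (m - 1) * x.
have b1 (x : R) : `|x - 0| <= `|v| -> `|m * (lam + x) `^ (m - 1) - m * lam `^ (m - 1)| <=
    m * ((m - 1) * K) * lam `^ (m - 2) * `|v|.
  move=> xv; rewrite -mulrBr normrM (ger0_norm (_ : 0 <= m)); last by lra.
  have := @mvt_abs (fun x => (lam + x) `^ (m - 1)) _ 0 x `|v| _ (fun x => @dp (m - 1) x) b2 xv.
  rewrite addr0 subr0 => h; rewrite -!mulrA ler_wpM2l//; first by lra.
  apply: le_trans h _; rewrite -!mulrA ler_wpM2l//; first by lra.
  rewrite ler_wpM2l ?(ltW K0)// ler_wpM2l ?powR_ge0//.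
  by rewrite subr0 in xv.
have df (x : R) : `|x - 0| <= `|v| -> is_derive x 1 f (m * (lam + x) `^ (m - 1) - m * lam `^ (m - 1)).
  move=> xv; have := D_sub (dp m x xv) (D_cmul (m * lam `^ (m - 1)) (is_derive_id x 1)).
  by rewrite mulr1.
have := @mvt_abs f _ 0 v `|v| _ df b1; rewrite subr0 lexx => /(_ isT).
rewrite /f addr0 mulr0 subr0 -[v ^+ 2](real_normK (num_real v)) expr2 mulrA.
congr (`|_| <= _); ring.
Qed.

Lemma powR_cvg0 (p : R) : 0 < p -> (fun n : nat => n.+1%:R `^ (- p) : R) @ \oo --> (0 : R).
Proof.
move=> p0; have h : (fun n : nat => n.+1%:R^-1 : R) @ \oo --> (0 : R) by exact: cvg_harmonic.
apply/cvgrPdist_lt => e e0.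
have [d d0 hd] := powR_dist p0 (lexx (0 : R)) e0.
move/cvgrPdist_lt : h => /(_ _ d0); apply: filterS => n; rewrite sub0r normrN => hn.
have := hd n.+1%:R^-1; rewrite subr0 invr_ge0 ler0n => /(_ isT hn).
rewrite powR0 ?gt_eqF// subr0 sub0r normrN -powR_inv1// -powRrM mulN1r.
by [].
Qed.

Lemma cont_abs_powR (m : R) : 0 < m -> continuous (fun xi : R => `|xi| `^ m).
Proof.
move=> m0 x; apply/cvgrPdist_lt => e e0.
have [d d0 hd] := powR_dist m0 (normr_ge0 x) e0.
near=> y; rewrite distrC; apply: hd => //.
apply: le_lt_trans (ler_dist_dist _ _) _; rewrite distrC.
near: y; exact: (@cvgr_dist_lt _ _ _ _ _ id).
Unshelve. all: by end_near. Qed.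

Lemma floor_gap (T y : R) : T <= y -> y < T + 1 -> 1 <= T + 1 + 1 - y <= 2.
Proof. by move=> h1 h2; apply/andP; split; lra. Qed.

Lemma cosDn2pi (x : R) (n : nat) : cos (x + 2 * pi * n%:R) = cos x.
Proof.
rewrite -(periodicn (@cosD2pi R) n x); congr (cos (_ + _)).
by rewrite mulr_natr mulr_natl.
Qed.

Section Core.
Variables (m gam kap nu : R).
Hypothesis m1 : 1 < m.
Hypothesis g0 : 0 < gam.
Hypothesis kap0 : 0 < kap.
Hypothesis nu0 : 0 < nu.
Hypothesis damp_exp : m < gam * (kap + m - 1).
Hypothesis quad_exp : 2 * nu + kap < 1.

Definition gap (lam : R) : R := 2 * pi * lam `^ kap.
Definition mult (lam : R) : nat := (Num.trunc (lam `^ nu)).+1.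
(** Time in which the speed [m lam^(m-1)] covers the distance [lam^(- kap)], which is the spatial
    period [2 pi / gap lam] of the packet. *)
Definition tau (lam : R) : R := lam `^ (- kap) / (m * lam `^ (m - 1)).
(* The summand [+2] keeps [res_time] between [tau] and [2 * tau]. *)
Definition winding (x lam : R) : nat := (Num.trunc (x * lam `^ kap)).+2.
Definition res_time (x lam : R) : R := ((winding x lam)%:R - x * lam `^ kap) * tau lam.

Lemma gap_ge1 lam : 1 <= lam -> 1 <= gap lam.
Proof.
move=> l1; have h : 1 <= lam `^ kap by have := ler_powR l1 (ltW kap0); rewrite powRr0.
by rewrite /gap; have := @pi_ge2 R; nra.
Qed.

Lemma tau_gt0 lam : 0 < lam -> 0 < tau lam.
Proof. by move=> l0; rewrite divr_gt0 ?mulr_gt0 ?powR_gt0// (lt_trans ltr01 m1). Qed.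

Lemma res_time_bounds x lam : 0 <= x -> 0 < lam -> tau lam <= res_time x lam <= 2 * tau lam.
Proof.
move=> x0 l0; have t0 := tau_gt0 l0.
have y0 : 0 <= x * lam `^ kap by rewrite mulr_ge0 ?powR_ge0.
have /andP[h1 h2] := truncn_itv y0; rewrite -natr1 in h2.
have e : (winding x lam)%:R = (Num.trunc (x * lam `^ kap))%:R + 1 + 1 :> R.
  by rewrite /winding -[in LHS]natr1 -[in LHS]natr1.
have /andP[w1 w2] := floor_gap h1 h2; rewrite -e in w1 w2.
by rewrite /res_time ler_peMl ?(ltW t0)//= ler_wpM2r ?(ltW t0).
Qed.

Lemma mult_le lam : 1 <= lam -> (mult lam)%:R <= 2 * lam `^ nu.
Proof.
move=> l1; have h : 1 <= lam `^ nu by have := ler_powR l1 (ltW nu0); rewrite powRr0.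
have h0 : 0 <= lam `^ nu by lra.
have /andP[h1 h2] := truncn_itv h0; rewrite /mult -[in leLHS]natr1; lra.
Qed.

Lemma mult_ge lam : lam `^ nu <= (mult lam)%:R.
Proof. by rewrite ltW// /mult; exact: truncnS_gt. Qed.

(** To first order, raising the frequency by one [gap] changes the phase by the left side; being a
    multiple of [2 pi], it puts all the copies in phase. *)
Lemma res_time_winding x lam : 0 < lam ->
  (x + res_time x lam * (m * lam `^ (m - 1))) * gap lam = 2 * pi * (winding x lam)%:R.
Proof.
move=> l0; have m0 : m != 0 by rewrite gt_eqF// (lt_trans ltr01 m1).
have p1 : lam `^ (m - 1) != 0 by rewrite gt_eqF ?powR_gt0.
have k0 : lam `^ kap != 0 by rewrite gt_eqF ?powR_gt0.
rewrite /res_time /tau /gap powRN; field.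
by rewrite m0 p1 k0.
Qed.

Variable C : R.
Hypothesis C_taylor : 0 < C /\ forall lam v : R, 0 < lam -> `|v| <= lam / 2 ->
  `|(lam + v) `^ m - lam `^ m - m * lam `^ (m - 1) * v| <= C * lam `^ (m - 2) * v ^+ 2.

(** The summands bound the curvature of the phase, the drift of the profile variable [eta] during
    the resonance time, and the deviation of the damping from 1. *)
Let err (lam eta : R) : R :=
  2 * tau lam * (C * lam `^ (m - 2) * (2 * eta ^+ 2 + 2 * ((mult lam)%:R * gap lam) ^+ 2)) +
  2 * tau lam * (m * lam `^ (m - 1)) * `|eta| +
  (2 * tau lam) `^ gam * (2 * lam) `^ m.

Lemma phase_error x lam eta (n : nat) : 0 <= x -> 1 <= lam -> (n < mult lam)%N ->
  `|eta| <= lam / 4 -> (mult lam)%:R * gap lam <= lam / 4 ->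
  `|cos (phase m x (res_time x lam) (eta + freq lam (gap lam) n) -
      (x * lam + res_time x lam * lam `^ m)) *
    damp m gam (res_time x lam) (eta + freq lam (gap lam) n) - cos (x * eta)| <= err lam eta.
Proof.
move=> x0 l1 nM el Ml; have l0 : 0 < lam by lra.
have [C0 tay] := C_taylor.
set t := res_time x lam; set d := gap lam; set v := eta + n%:R * d.
rewrite -/d in Ml; have d1 : 1 <= d by exact: gap_ge1.
have nd : 0 <= n%:R * d <= (mult lam)%:R * d.
  by rewrite mulr_ge0//= ?ler_wpM2r ?ler_nat//; [lra|exact: ltnW|lra].
have /andP[nd0 nd1] := nd.
have vl : `|v| <= lam / 2.
  by apply: le_trans (ler_normD _ _) _; rewrite (ger0_norm nd0); lra.
have xiE : eta + freq lam d n = lam + v by rewrite /freq /v; ring.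
have vb := vl; rewrite ler_norml in vb; have /andP[vb1 vb2] := vb.
have xi0 : 0 < lam + v by lra.
have xi2 : lam + v <= 2 * lam by lra.
have tb := res_time_bounds x0 l0; rewrite -/t in tb; have /andP[t1 t2] := tb.
have tt0 := tau_gt0 l0.
have t0 : 0 < t by lra.
rewrite xiE.
(* After expansion at [lam], the linear terms in [n%:R * d] add up to the multiple of [2 pi] given
   by [res_time_winding]; [rho] is what remains besides [x * eta]. *)
pose rho := t * ((lam + v) `^ m - lam `^ m - m * lam `^ (m - 1) * v) +
  t * (m * lam `^ (m - 1)) * eta.
have phE : phase m x t (lam + v) - (x * lam + t * lam `^ m) =
    (x * eta + rho) + 2 * pi * (n * winding x lam)%:R.
  have w := res_time_winding x l0; rewrite -/t -/d in w.
  rewrite natrM mulrCA -w /phase ger0_norm ?ltW// /rho /v; ring.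
rewrite phE cosDn2pi.
have hr : `|rho| <= 2 * tau lam * (C * lam `^ (m - 2) * (2 * eta ^+ 2 + 2 * ((mult lam)%:R * gap lam) ^+ 2)) +
  2 * tau lam * (m * lam `^ (m - 1)) * `|eta|.
  have ml0 : 0 <= m * lam `^ (m - 1).
    by rewrite mulr_ge0 ?powR_ge0// ltW// (lt_trans ltr01 m1).
  apply: le_trans (ler_normD _ _) _; rewrite (normrM t) (normrM (t * (m * lam `^ (m - 1))) eta).
  rewrite (normrM t (m * lam `^ (m - 1))) (ger0_norm (ltW t0)) (ger0_norm ml0).
  apply: lerD; last first.
    by rewrite ler_wpM2r// ler_wpM2r.
  apply: ler_pM => //; first exact: ltW.
  apply: le_trans (tay _ _ l0 vl) _; rewrite ler_wpM2l ?mulr_ge0 ?powR_ge0 ?(ltW C0)//.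
  have h : (n%:R * d) ^+ 2 <= ((mult lam)%:R * d) ^+ 2.
    by rewrite lerXn2r ?nnegrE//; exact: le_trans nd0 nd1.
  by rewrite /v; have := sqr_ge0 (eta - n%:R * d); rewrite sqrrB sqrrD -/d; lra.
have hd : `|damp m gam t (lam + v) - 1| <= (2 * tau lam) `^ gam * (2 * lam) `^ m.
  rewrite -[X in _ - X]expR0 -[X in _ - expR X]oppr0 /damp; apply: le_trans (expN_lip _ _) _ => //.
    by rewrite mulr_ge0 ?powR_ge0.
  rewrite subr0 ger0_norm ?mulr_ge0 ?powR_ge0// (ger0_norm (ltW xi0)).
  have gg := ltW g0; have mm : 0 <= m by rewrite ltW// (lt_trans ltr01 m1).
  apply: ler_pM; rewrite ?powR_ge0//; first by apply: ge0_ler_powR => //; rewrite nnegrE; lra.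
  by apply: ge0_ler_powR => //; rewrite nnegrE; lra.
rewrite -[X in _ - X]mulr1; apply: le_trans (norm_prod_sub _ _ _ _) _.
- by rewrite ler_norml cos_geN1 cos_le1.
- by rewrite normr1.
apply: lerD; last exact: hd.
by apply: le_trans (cos_lip _ _) _; rewrite addrAC subrr add0r.
Qed.

(** Since [tau] is of order [lam^(1 - m - kap)], the powers of [lam] are [-(kap + 1)] and
    [2 nu + kap - 1] from the curvature, [- kap] from the drift, and [m - gam (kap + m - 1)] from
    the damping; [quad_exp] and [damp_exp] make them all negative. *)
Lemma err_cvg0 eta : (fun n : nat => err n.+1%:R eta) @ \oo --> (0 : R).
Proof.
have [C0 _] := C_taylor.
have mm : 0 < m := lt_trans ltr01 m1.
pose b1 (l : R) := 2 / m * C * (2 * eta ^+ 2) * l `^ (- (kap + 1)).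
pose b2 (l : R) := 2 / m * C * (32 * pi ^+ 2) * l `^ (- (1 - (2 * nu + kap))).
pose b3 (l : R) := 2 * `|eta| * l `^ (- kap).
pose b4 (l : R) := (2 / m) `^ gam * 2 `^ m * l `^ (- (gam * (kap + m - 1) - m)).
have cst0 (k p : R) : 0 < p -> (fun n : nat => k * n.+1%:R `^ (- p)) @ \oo --> (0 : R).
  by move=> p0; rewrite -[X in _ --> X](mulr0 k); apply: cvgM; [exact: cvg_cst|exact: powR_cvg0].
have Bcv : (fun n : nat => b1 n.+1%:R + b2 n.+1%:R + b3 n.+1%:R + b4 n.+1%:R) @ \oo --> (0 : R).
  rewrite -[X in _ --> X](_ : 0 + 0 + 0 + 0 = 0 :> R); last by rewrite !addr0.
  have k1 : 0 < kap + 1 by apply: addr_gt0.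
  have k2 : 0 < 1 - (2 * nu + kap) by rewrite subr_gt0.
  have k4 : 0 < gam * (kap + m - 1) - m by rewrite subr_gt0.
  by do 3?apply: cvgD; exact: cst0.
apply: (squeeze_cvgr _ (@cvg_cst _ (0 : R) _ _ _) Bcv).
apply: nearW => n; set l : R := n.+1%:R.
have l1 : 1 <= l by rewrite ler1n.
have l0 : 0 < l by lra.
have t0 := tau_gt0 l0.
have e1 : tau l = m^-1 * l `^ (- (kap + m - 1)).
  have -> : - (kap + m - 1) = - kap + - (m - 1) by ring.
  rewrite powR_add// /tau [l `^ (- (m - 1))]powRN; field.
  by rewrite !gt_eqF ?powR_gt0.
have e2 : tau l * l `^ (m - 2) = m^-1 * l `^ (- (kap + 1)).
  by rewrite e1 -mulrA -powR_add//; congr (_ * _ `^ _); ring.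
have e3 : tau l * (m * l `^ (m - 1)) = l `^ (- kap).
  rewrite e1 mulrACA mulVf ?gt_eqF// mul1r -powR_add//; congr (_ `^ _); ring.
have Md : ((mult l)%:R * gap l) ^+ 2 <= 16 * pi ^+ 2 * l `^ (2 * (nu + kap)).
  have -> : 16 * pi ^+ 2 * l `^ (2 * (nu + kap)) = (2 * l `^ nu * gap l) ^+ 2 :> R.
    have -> : l `^ (2 * (nu + kap)) = (l `^ nu * l `^ kap) ^+ 2.
      by rewrite -powR_add// mulrC powRrM powR_mulrn ?powR_ge0.
    rewrite /gap; ring.
  have gl : 0 <= gap l by apply: le_trans (gap_ge1 l1).
  rewrite lerXn2r ?nnegrE ?mulr_ge0 ?powR_ge0 ?pi_ge0//.
  by rewrite ler_wpM2r// mult_le.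
apply/andP; split.
  have t20 : 0 <= 2 * tau l := mulr_ge0 (ler0n R 2) (ltW t0).
  apply: addr_ge0; last by rewrite mulr_ge0 ?powR_ge0.
  apply: addr_ge0; apply: mulr_ge0 => //.
    apply: mulr_ge0; first by rewrite mulr_ge0 ?powR_ge0 ?(ltW C0).
    by rewrite addr_ge0// mulr_ge0// sqr_ge0.
  by apply: mulr_ge0 => //; rewrite mulr_ge0 ?powR_ge0 ?(ltW mm).
apply: lerD; last first.
  rewrite le_eqVlt; apply/orP; left; apply/eqP.
  rewrite /b4 e1 mulrA powRM ?powR_ge0 ?divr_ge0 ?(ltW mm)// (powRM _ (ler0n R 2) (ltW l0)).
  have -> : - (gam * (kap + m - 1) - m) = - (kap + m - 1) * gam + m by ring.
  by rewrite powR_add// [in RHS]powRrM; ring.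
apply: lerD; last first.
  by rewrite /b3 -e3 le_eqVlt; apply/orP; left; apply/eqP; ring.
have -> : 2 * tau l * (C * l `^ (m - 2) * (2 * eta ^+ 2 + 2 * ((mult l)%:R * gap l) ^+ 2)) =
  2 * C * (tau l * l `^ (m - 2)) * (2 * eta ^+ 2 + 2 * ((mult l)%:R * gap l) ^+ 2) by ring.
rewrite e2 mulrDr; apply: lerD.
  by rewrite /b1 le_eqVlt; apply/orP; left; apply/eqP; ring.
have -> : b2 l = 2 * C * (m^-1 * l `^ (- (kap + 1))) * (2 * (16 * pi ^+ 2 * l `^ (2 * (nu + kap)))).
  rewrite /b2 (_ : - (1 - (2 * nu + kap)) = - (kap + 1) + 2 * (nu + kap)); last by ring.
  by rewrite powR_add//; ring.
rewrite ler_wpM2l//; first by rewrite !mulr_ge0 ?powR_ge0 ?invr_ge0 ?(ltW C0) ?(ltW mm).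
by rewrite ler_wpM2l.
Qed.

(** The bandwidth of the packet is of order [lam^(nu + kap)], and [quad_exp] forces
    [nu + kap < 1]. *)
Lemma mult_gap_le (e : R) : 0 < e ->
  \forall n \near \oo, (mult n.+1%:R)%:R * gap n.+1%:R <= e * n.+1%:R.
Proof.
move=> e0; have p0 : 0 < 1 - (nu + kap).
  by rewrite subr_gt0; apply: le_lt_trans quad_exp; rewrite lerD2r ler_peMl ?(ltW nu0)// ler1n.
have h : (fun n : nat => 4 * pi * n.+1%:R `^ (- (1 - (nu + kap)))) @ \oo --> (0 : R).
  by rewrite -[X in _ --> X](mulr0 (4 * pi)); apply: cvgM; [exact: cvg_cst|exact: powR_cvg0].
move/cvgrPdist_le : h => /(_ _ e0); apply: filterS => n; set l : R := n.+1%:R.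
have l1 : 1 <= l by rewrite ler1n.
have l0 : 0 < l by rewrite ltr0n.
rewrite sub0r normrN ger0_norm ?mulr_ge0 ?pi_ge0 ?powR_ge0// => h.
have gl : 0 <= gap l by apply: le_trans (gap_ge1 l1).
apply: le_trans (ler_wpM2r gl (mult_le l1)) _.
have e1 : l `^ (- (1 - (nu + kap))) * l = l `^ nu * l `^ kap.
  rewrite -[X in _ * X = _](powRr1 (ltW l0)) -!powR_add//; congr (_ `^ _); ring.
have -> : 2 * l `^ nu * gap l = 4 * pi * (l `^ (- (1 - (nu + kap))) * l).
  by rewrite e1 /gap; ring.
rewrite mulrA; by rewrite ler_pM2r.
Qed.

(** By [pack_hat_Rint] this is the integral of [tent_hat] against an average [A n] of symbols, which
    [phase_error] sends to [cos (x * eta)]; since [|A n| <= 1], [tent_hat] is the majorant. *)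
Lemma resonance_taylor x : 0 <= x ->
  (fun n : nat => let lam := n.+1%:R in let t := res_time x lam in
    \int[mu]_xi (cos (phase m x t xi - (x * lam + t * lam `^ m)) * damp m gam t xi *
      pack_hat (mult lam) lam (gap lam) xi)) @ \oo -->
  \int[mu]_eta (cos (x * eta) * tent_hat eta).
Proof.
move=> x0; have mm : 0 < m := lt_trans ltr01 m1.
pose c (n : nat) (xi : R) := cos (phase m x (res_time x n.+1%:R) xi -
   (x * n.+1%:R + res_time x n.+1%:R * n.+1%:R `^ m)) * damp m gam (res_time x n.+1%:R) xi.
have c1 n xi : `|c n xi| <= 1.
  have /andP[h0 h1] := damp_le1 m gam (res_time x n.+1%:R) xi.
  by rewrite normrM mulr_ile1// ?(ger0_norm h0)// ler_norml cos_geN1 cos_le1.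
have cc n : continuous (c n).
  move=> xi; have ca := cont_abs_powR mm.
  apply: continuousM.
    apply: (@continuous_comp _ _ _ _ (@cos R)); last exact: continuous_cos.
    apply: continuousB; last exact: cst_continuous.
    apply: continuousD; first by apply: continuousM; [exact: cst_continuous|exact: cvg_id].
    by apply: continuousM; [exact: cst_continuous|exact: ca].
  apply: (@continuous_comp _ _ _ _ (@expR R)); last exact: continuous_expR.
  by apply: continuousN; apply: continuousM; [exact: cst_continuous|exact: ca].
pose A (n : nat) (eta : R) := (mult n.+1%:R)%:R^-1 *
  \sum_(k < mult n.+1%:R) c n (eta + freq n.+1%:R (gap n.+1%:R) k).
have Mp n : (0 < (mult n.+1%:R)%:R :> R) by rewrite ltr0n.
have A1 n eta : `|A n eta| <= 1.
  rewrite normrM ger0_norm ?invr_ge0// ler_pdivrMl// mulr1.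
  apply: le_trans (ler_norm_sum _ _ _) _.
  rewrite -[leRHS]mulr1 mulr_natl -[X in _ <= _ *+ X](card_ord (mult n.+1%:R)) -sumr_const.
  by apply: ler_sum => k _; exact: c1.
rewrite (_ : (fun n => _) = (fun n => \int[mu]_eta (A n eta * tent_hat eta))); last first.
  by apply/funext => n; exact: (pack_hat_Rint (mult n.+1%:R) n.+1%:R (gap n.+1%:R) (cc n) (c1 n)).2.
apply: (@Rint_dominated _ _ _ _ (@tent_hat R)) => //.
- move=> n; apply: measurable_funM; last exact: continuous_measurable_fun (@cont_tent_hat R).
  apply: measurable_funM => //; apply: measurable_sum => k.
  by apply: measurableT_comp; [exact: continuous_measurable_fun|meas].
- apply: measurable_funM; last exact: continuous_measurable_fun (@cont_tent_hat R).
  by meas.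
- exact: L1_tent_hat.
- apply: aeW => eta _; apply: cvgM; last exact: cvg_cst.
  apply/cvgrPdist_le => e e0.
  have /cvgrPdist_le /(_ _ e0) herr := err_cvg0 eta.
  have e4 : 0 < 4^-1 :> R by rewrite invr_gt0.
  have hMM := mult_gap_le e4.
  near=> n; set l : R := n.+1%:R.
  have hl : `|eta| <= l / 4.
    rewrite ler_pdivlMr//; have : `|eta| * 4 <= n%:R by near: n; exact: nbhs_infty_ger.
    by move=> h; apply: le_trans h _; rewrite ler_nat.
  have hM : (mult l)%:R * gap l <= l / 4.
    by rewrite [leRHS]mulrC /l; near: n; exact: hMM.
  have he : err l eta <= e.
    apply: le_trans (_ : `|0 - err l eta| <= _); last by rewrite /l; near: n; exact: herr.
    by rewrite sub0r normrN ler_norm.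
  have l1 : 1 <= l by rewrite ler1n.
  have -> : cos (x * eta) - A n eta = - ((mult l)%:R^-1 * \sum_(k < mult l)
      (c n (eta + freq l (gap l) k) - cos (x * eta))).
    have ec : (mult l)%:R^-1 * (cos (x * eta) *+ mult l) = cos (x * eta).
      by rewrite -[cos _ *+ _]mulr_natl mulKf// gt_eqF.
    by rewrite sumrB sumr_const card_ord mulrBr ec opprB.
  rewrite normrN normrM ger0_norm ?invr_ge0// ler_pdivrMl//.
  apply: le_trans (ler_norm_sum _ _ _) _.
  rewrite mulr_natl -[X in _ <= _ *+ X](card_ord (mult l)) -sumr_const.
  by apply: ler_sum => k _; apply: le_trans he; exact: phase_error.
- apply: aeW => eta _ n; rewrite normrM (ger0_norm (tent_hat_ge0 _)).
  by rewrite ler_piMl ?tent_hat_ge0.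
Unshelve. all: by end_near. Qed.

Lemma small_tau (e : R) : 0 < e -> \forall n \near \oo, 2 * tau n.+1%:R <= e.
Proof.
move=> e0; have mm : 0 < m := lt_trans ltr01 m1.
have p0 : 0 < kap + (m - 1) by rewrite addr_gt0// subr_gt0.
have h : (fun n : nat => 2 / m * n.+1%:R `^ (- (kap + (m - 1)))) @ \oo --> (0 : R).
  by rewrite -[X in _ --> X](mulr0 (2 / m)); apply: cvgM; [exact: cvg_cst|exact: powR_cvg0].
move/cvgrPdist_le : h => /(_ _ e0); apply: filterS => n; set l : R := n.+1%:R.
have l0 : 0 < l by rewrite ltr0n.
rewrite sub0r normrN ger0_norm ?mulr_ge0 ?divr_ge0 ?powR_ge0 ?invr_ge0 ?(ltW mm)// => h; apply: le_trans h.
rewrite opprD powR_add// /tau [l `^ (- (m - 1))]powRN le_eqVlt; apply/orP; left; apply/eqP.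
by field; rewrite !gt_eqF ?powR_gt0.
Qed.

Let mult_inv_le (l : R) : 0 < l -> (mult l)%:R^-1 <= l `^ (- nu).
Proof. by move=> l0; rewrite powRN lef_pV2 ?posrE ?powR_gt0// ?ltr0n// mult_ge. Qed.

Lemma small_pack_sq (e : R) : 0 < e -> \forall n \near \oo, let l := n.+1%:R in
  \int[mu]_(x in `[-1, 1]) (pack_cos (mult l) l (gap l) x ^+ 2 +
    pack_sin (mult l) l (gap l) x ^+ 2) <= e.
Proof.
move=> e0.
have h : (fun n : nat => 36 * n.+1%:R `^ (- nu)) @ \oo --> (0 : R).
  by rewrite -[X in _ --> X](mulr0 36); apply: cvgM; [exact: cvg_cst|exact: powR_cvg0].
move/cvgrPdist_le : h => /(_ _ e0); apply: filterS => n; set l : R := n.+1%:R.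
have l0 : 0 < l by rewrite ltr0n.
have l1 : 1 <= l by rewrite ler1n.
rewrite sub0r normrN ger0_norm ?mulr_ge0 ?powR_ge0// => h /=.
apply: le_trans (pack_sq_le l _ (gap_ge1 l1)) _ => //.
by apply: le_trans h; rewrite ler_wpM2l// mult_inv_le.
Qed.

Lemma small_pack_weight (s e : R) : 0 <= s <= 1 -> 2 * s < nu -> 0 < e ->
  \forall n \near \oo, let l := n.+1%:R in
  L1 setT (fun xi => (1 + xi ^+ 2) `^ s * pack_hat (mult l) l (gap l) xi ^+ 2) /\
  \int[mu]_xi ((1 + xi ^+ 2) `^ s * pack_hat (mult l) l (gap l) xi ^+ 2) <= e.
Proof.
move=> s01 snu e0; pose J : R := \int[mu]_xi lor xi.
have J0 : 0 <= J by apply: Rintegral_ge0 => xi _; exact: ltW (lor_gt0 xi).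
have [K K0 hK] : exists2 K : R, 0 <= K & 36 * (266 * J) = K.
  exists (36 * (266 * J)); last by reflexivity.
  exact: mulr_ge0 (ler0n R 36) (mulr_ge0 (ler0n R 266) J0).
have p0 : 0 < nu - 2 * s by rewrite subr_gt0.
have h : (fun n : nat => K * n.+1%:R `^ (- (nu - 2 * s))) @ \oo --> (0 : R).
  by rewrite -[X in _ --> X](mulr0 (K)); apply: cvgM; [exact: cvg_cst|exact: powR_cvg0].
move/cvgrPdist_le : h => /(_ _ e0) h.
apply: (@filterS2 _ _ _ _ _ _ _ h (mult_gap_le ltr01)) => n; set l : R := n.+1%:R.
have l0 : 0 < l by rewrite ltr0n.
have l1 : 1 <= l by rewrite ler1n.
have g1 := gap_ge1 l1.
rewrite mul1r sub0r normrN ger0_norm ?mulr_ge0 ?powR_ge0// => {}h hM /=.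
have Ml : (mult l)%:R <= l by apply: le_trans hM; rewrite ler_peMr.
have [k nM||i b] := pack_hat_sq_le (isT : (0 < mult l)%N) g1 l1 s01.
- rewrite /freq (_ : 2 * l = l + l) ?lerD2l; last by ring.
  apply: le_trans hM.
  by rewrite ler_wpM2r ?ler_nat ?(ltnW nM)// (le_trans ler01).
- by apply: le_trans Ml _; rewrite expr2 ler_peMr ?(ltW l0).
- split=> //; apply: le_trans b _; apply: le_trans h; rewrite -/J hK.
  rewrite ler_wpM2l//.
  apply: (@le_trans _ _ (l `^ (2 * s) * l `^ (- nu))).
    by rewrite ler_wpM2l ?powR_ge0// mult_inv_le.
  by rewrite -powR_add// (_ : 2 * s + - nu = - (nu - 2 * s))//; ring.
Qed.

(** The damping factor decreases in time, so the decay at time [sig] serves all later times. *)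
Lemma small_damped (sig e : R) : 0 < sig -> 0 < e -> \forall n \near \oo,
  let l := n.+1%:R in forall t, sig <= t ->
  \int[mu]_xi (damp m gam t xi * pack_hat (mult l) l (gap l) xi) <= e.
Proof.
move=> sig0 e0; pose J : R := \int[mu]_xi lor xi.
have J0 : 0 <= J by apply: Rintegral_ge0 => xi _; exact: ltW (lor_gt0 xi).
have [B B0 hB] := damp_decay gam (lt_trans ltr01 m1) sig0.
have h : (fun n : nat => 24 * B * J * n.+1%:R `^ (- 2)) @ \oo --> (0 : R).
  by rewrite -[X in _ --> X](mulr0 (24 * B * J)); apply: cvgM; [exact: cvg_cst|exact: powR_cvg0].
move/cvgrPdist_le : h => /(_ _ e0); apply: filterS => n; set l : R := n.+1%:R.
have l0 : 0 < l by rewrite ltr0n.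
have l1 : 1 <= l by rewrite ler1n.
rewrite sub0r normrN ger0_norm ?mulr_ge0 ?powR_ge0 ?(ltW B0)// => h /= t st.
have hB' (xi : R) : damp m gam t xi <= B * lor xi.
  apply: le_trans (hB xi); rewrite /damp ler_expR lerN2 ler_wpM2r ?powR_ge0//.
  by apply: ge0_ler_powR; rewrite ?nnegrE ?(ltW g0) ?(ltW sig0)// (le_trans (ltW sig0)).
apply: le_trans (pack_hat_damped _ (gap_ge1 l1) l1 (ltW B0) hB') _ => //.
apply: le_trans h; rewrite ler_wpM2l ?mulr_ge0 ?(ltW B0)//.
rewrite powRN powR_mulrn ?(ltW l0)// /lor lef_pV2 ?posrE ?exprn_gt0//.
  by rewrite lerDr.
by rewrite ltr_wpDr ?sqr_ge0.
Qed.

End Core.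

End Resonance.

(** * Gliding hump *)

Section Gliding.
Variable R : realType.

Definition half_pow (k : nat) : R := 2^-1 ^+ k.

Lemma half_pow_gt0 k : 0 < half_pow k.
Proof. by rewrite exprn_gt0// invr_gt0. Qed.

Lemma half_powS k : half_pow k.+1 * 2 = half_pow k.
Proof. by rewrite /half_pow exprS mulrAC mulVf// mul1r. Qed.

Lemma half_pow_cvg0 : half_pow @ \oo --> (0 : R).
Proof.
apply: cvg_expr; rewrite ger0_norm ?invr_ge0// invf_lt1//.
by rewrite ltr1n.
Qed.

Lemma half_pow_lt (e : R) : 0 < e -> \forall k \near \oo, half_pow k < e.
Proof.
move=> e0; move/cvgrPdist_lt : half_pow_cvg0 => /(_ _ e0); apply: filterS => k.
by rewrite sub0r normrN ger0_norm// ltW// half_pow_gt0.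
Qed.

Lemma half_pow_tail (a K : nat) : \sum_(a <= j < K) half_pow j <= 2 * half_pow a.
Proof.
have h n : \sum_(a <= j < a + n) half_pow j = 2 * half_pow a - 2 * half_pow (a + n).
  elim: n => [|n IH]; first by rewrite addn0 big_geq// subrr.
  by rewrite addnS big_nat_recr ?leq_addr//= IH -(half_powS (a + n)); ring.
have [Ka|/ltnW aK] := leqP K a; first by rewrite big_geq// mulr_ge0// ltW// half_pow_gt0.
by rewrite -(subnKC aK) h gerBl mulr_ge0// ltW// half_pow_gt0.
Qed.

Lemma half_pow_sum (K : nat) : \sum_(j < K) half_pow j <= 2.
Proof.
by have := half_pow_tail 0 K; rewrite big_mkord /half_pow expr0 mulr1.
Qed.

Section Hump.
Variables (p : nat -> R -> R) (P : R -> R) (sg t : nat -> R) (L : R).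
Hypothesis sumP : forall u, 0 < u -> (fun K => \sum_(j < K) p j u) @ \oo --> P u.
Hypothesis sg0 : forall k, 0 < sg k.
Hypothesis sg_t : forall k, sg k.+1 <= t k.+1 <= sg k.
Hypothesis sg_half : forall k, sg k <= half_pow k.
Hypothesis high : forall j k u, (k < j)%N -> sg k <= u -> `|p j u| <= half_pow j.
Hypothesis low1 : forall j u, 0 <= u <= sg j -> `|p j u - p j 0| <= half_pow j.
Hypothesis low2 : forall j e, 0 < e -> exists2 d, 0 < d &
  forall u, 0 <= u <= d -> `|p j u - p j 0| <= e.
Hypothesis PL : P @ 0^'+ --> L.

Let sg_anti j k : (j <= k)%N -> sg k <= sg j.
Proof.
move=> jk; rewrite -(subnKC jk); elim: (k - j)%N => [|n IH]; first by rewrite addn0.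
by rewrite addnS; have /andP[h1 h2] := sg_t (j + n); apply: le_trans IH; exact: le_trans h2.
Qed.

Let tail k u : sg k <= u -> `|P u - \sum_(j < k.+1) p j u| <= half_pow k.
Proof.
move=> ku; have u0 : 0 < u := lt_le_trans (sg0 k) ku.
have h : (fun K => `|\sum_(j < K) p j u - \sum_(j < k.+1) p j u|) @ \oo -->
    `|P u - \sum_(j < k.+1) p j u|.
  by apply: cvg_norm; apply: cvgB; [exact: sumP|exact: cvg_cst].
rewrite -(cvg_lim (@Rhausdorff R) h); apply: limr_le; first exact: cvgP h.
near=> K; have kK : (k < K)%N by near: K; exact: nbhs_infty_gt.
rewrite -!(big_mkord xpredT (fun j => p j u)) (@big_cat_nat _ _ _ k.+1)//= addrAC subrr add0r.
apply: le_trans (ler_norm_sum _ _ _) _; rewrite -half_powS mulrC.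
apply: le_trans (half_pow_tail k.+1 K); rewrite big_nat_cond [leRHS]big_nat_cond.
by apply: ler_sum => j /andP[/andP[kj _] _]; exact: high ku.
Unshelve. all: by end_near. Qed.

Let low_sum J e : 0 < e -> exists2 d, 0 < d &
  forall u, 0 <= u <= d -> \sum_(j < J) `|p j u - p j 0| <= e.
Proof.
elim: J e => [|J IH] e e0; first by exists 1 => // u _; rewrite big_ord0 ltW.
have e2 : 0 < e / 2 by rewrite divr_gt0.
have [d1 d10 h1] := IH _ e2; have [d2 d20 h2] := low2 J e2.
exists (Num.min d1 d2); first by rewrite lt_min d10.
move=> u; rewrite le_min => /andP[u0 /andP[ud1 ud2]].
rewrite big_ord_recr/= [leRHS](splitr e); apply: lerD; first by apply: h1; rewrite u0.
by apply: h2; rewrite u0.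
Qed.

(** The packets up to a fixed index [J] are continuous at 0; those after [J] and up to [k] are
    frozen on [[0, sg k]] up to [half_pow j], which is the tail of a convergent series. *)
Let low e : 0 < e -> \forall k \near \oo, forall u, 0 <= u <= sg k ->
  `|\sum_(j < k.+1) p j u - \sum_(j < k.+1) p j 0| <= e.
Proof.
move=> e0; have e2 : 0 < e / 2 by rewrite divr_gt0.
have [J _ /(_ J (leqnn J)) /ltW hJ] := half_pow_lt e2.
have [d d0 hd] := low_sum J.+1 e2.
have hp := half_pow_lt d0.
near=> k => u /andP[u0 uk].
have Jk : (J <= k)%N by near: k; exact: nbhs_infty_ge.
have skd : sg k <= d.
  by apply: le_trans (sg_half k) _; apply: ltW; near: k.
rewrite -sumrB; apply: le_trans (ler_norm_sum _ _ _) _.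
rewrite -(big_mkord xpredT (fun j => `|p j u - p j 0|)) (@big_cat_nat _ _ _ J.+1)//=.
rewrite [leRHS](splitr e); apply: lerD.
  by rewrite big_mkord; apply: hd; rewrite u0 (le_trans uk).
apply: le_trans hJ; rewrite -half_powS mulrC.
apply: le_trans (half_pow_tail J.+1 k.+1); rewrite big_nat_cond [leRHS]big_nat_cond.
apply: ler_sum => j /andP[/andP[_ jk] _]; apply: low1; rewrite u0/=.
by apply: le_trans uk _; apply: sg_anti.
Unshelve. all: by end_near. Qed.

(** At time [t k.+1] every packet beyond [k.+1] is negligible, and the sum of those up to [k] hardly
    changes on [[0, sg k]]. Hence [p k.+1 (t k.+1)] is close to [P (t k.+1) - P (sg k)], which tends
    to 0 when [P] has a limit. The six errors are, at each of the two times, a tail, a freezing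
    error and a distance to the limit. *)
Lemma gliding_hump : (fun k => p k.+1 (t k.+1)) @ \oo --> (0 : R).
Proof.
apply/cvgrPdist_le => e e0; have e6 : 0 < e / 6 by rewrite divr_gt0.
have hp := half_pow_lt e6.
have hl := low e6.
move/cvgrPdist_le : PL => /(_ _ e6) [d /= d0 hd].
have hs := half_pow_lt d0.
near=> k; rewrite sub0r normrN.
have /andP[t1 t2] := sg_t k.
have s0 := sg0 k; have tp : 0 < t k.+1 := lt_le_trans (sg0 k.+1) t1.
have qk : half_pow k <= e / 6 by apply: ltW; near: k.
have qk1 : half_pow k.+1 <= e / 6.
  by apply: le_trans qk; have := half_powS k; have := half_pow_gt0 k.+1; lra.
have skd : sg k < d.
  by apply: le_lt_trans (sg_half k) _; near: k.
have lowk : forall u, 0 <= u <= sg k ->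
    `|\sum_(j < k.+1) p j u - \sum_(j < k.+1) p j 0| <= e / 6 by near: k; exact: hl.
have a1 := tail (lexx (sg k)).
have a2 := tail t1; rewrite big_ord_recr/= in a2.
have a3 : `|\sum_(j < k.+1) p j (sg k) - \sum_(j < k.+1) p j 0| <= e / 6.
  by apply: lowk; rewrite lexx ltW.
have a4 : `|\sum_(j < k.+1) p j (t k.+1) - \sum_(j < k.+1) p j 0| <= e / 6.
  by apply: lowk; rewrite t2 ltW.
have a5 : `|L - P (sg k)| <= e / 6.
  by apply: hd => //=; rewrite sub0r normrN gtr0_norm.
have a6 : `|L - P (t k.+1)| <= e / 6.
  by apply: hd => //=; rewrite sub0r normrN gtr0_norm// (le_lt_trans t2).
move: a1 a2 a3 a4 a5 a6.
set S := \sum_(j < k.+1) p j (sg k); set S' := \sum_(j < k.+1) p j (t k.+1).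
set Q := \sum_(j < k.+1) p j 0; set x := p k.+1 _; set P1 := P _; set P2 := P _.
clear -qk qk1; rewrite !ler_norml => /andP[? ?] /andP[? ?] /andP[? ?] /andP[? ?] /andP[? ?] /andP[? ?].
by apply/andP; split; lra.
Unshelve. all: by end_near. Qed.

End Hump.

(** Between the times [u] and 0 the phase changes by [u |xi|^m], free of [x], so [d] can be chosen
    uniformly in [x]. This uniformity lets one sequence of scales serve every point. High
    frequencies are handled by the integrability of [G]. *)
Lemma packet_low (m gam : R) (c G : R -> R) (e : R) : 1 < m -> 0 < gam ->
  measurable_fun setT c -> (forall a, `|c a| <= 1) -> (forall a b, `|c a - c b| <= `|a - b|) ->
  (forall xi, 0 <= G xi) -> L1 setT G -> 0 < e ->
  exists2 d : R, 0 < d & forall x u : R, 0 <= u <= d ->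
  `|\int[mu]_xi (c (phase m x u xi) * damp m gam u xi * G xi) -
    \int[mu]_xi (c (phase m x 0 xi) * damp m gam 0 xi * G xi)| <= e.
Proof.
move=> m1 g0 mc c1 cl G0 iG e0; have mm : 0 < m := lt_trans ltr01 m1.
have e4 : 0 < e / 4 by rewrite divr_gt0.
have ex := Rint_exhaust iG (@pow2_exhaust R).
move/cvgrPdist_le : ex => /(_ _ e4) [n _ /(_ n (leqnn n))] /=.
set l : R := 2 ^+ n; have l0 : 0 <= l by rewrite exprn_ge0.
set I := `[- l, l]%classic => tailG.
have mI : measurable (I : set R) by exact: measurable_itv.
set J := \int[mu]_x G x in tailG.
have J0 : 0 <= J by apply: Rintegral_ge0 => xi _; exact: G0.
have lm := powR_ge0 l m.
pose eta := e / 4 / (l `^ m * J + 1).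
have D0 : 0 < l `^ m * J + 1 by rewrite ltr_wpDl// mulr_ge0.
have eta0 : 0 < eta by rewrite divr_gt0.
have [d1 d10 hd1] := powR_dist g0 (lexx 0) eta0.
exists (Num.min eta (d1 / 2)); first by rewrite lt_min eta0 divr_gt0.
move=> x u; rewrite le_min => /andP[u0 /andP[ueta ud]].
have ug : u `^ gam <= eta.
  have := hd1 u u0; rewrite subr0 ger0_norm// powR0 ?gt_eqF// subr0 ger0_norm ?powR_ge0// => h.
  by apply/ltW/h; lra.
pose B (v : R) (xi : R) := c (phase m x v xi) * damp m gam v xi.
have mB v : measurable_fun setT (B v).
  apply: measurable_funM; last by rewrite /damp; meas.
  by apply: measurableT_comp => //; rewrite /phase; meas.
have B1 v xi : `|B v xi| <= 1.
  have /andP[h0 h1] := damp_le1 m gam v xi.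
  by rewrite normrM mulr_ile1// (ger0_norm h0).
have iB v : L1 setT (fun xi => B v xi * G xi).
  by apply: (L1_mulb measurableT iG (mB v) (C := 1)) => xi _.
have iGI : L1 setT (G \_ I) := (L1_restrict _ mI).1 (L1S mI measurableT (@subsetT _ _) iG).
have k1 := L1Zl (2 * eta * l `^ m) measurableT iG.
have k2 := L1Zl 2 measurableT (L1B measurableT iG iGI).
rewrite -(RintB measurableT (iB u) (iB 0)).
apply: (@le_trans _ _ (\int[mu]_xi (2 * eta * l `^ m * G xi + 2 * (G xi - (G \_ I) xi)))).
  apply: norm_Rint_le => //; [exact: L1B|exact: L1D|move=> xi _].
  rewrite -mulrBl normrM (ger0_norm (G0 xi)) patchE; case: ifPn => [xiI|_].
    rewrite subrr mulr0 addr0 ler_wpM2r//.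
    have xil : `|xi| <= l.
      have : xi \in `[- l, l] by rewrite inE in xiI.
      by rewrite in_itv/= -ler_norml.
    have xm : `|xi| `^ m <= l `^ m by apply: ge0_ler_powR; rewrite ?nnegrE// ltW.
    have /andP[h0 h1] := damp_le1 m gam 0 xi.
    apply: le_trans (norm_prod_sub _ _ (c1 _) _) _; first by rewrite ger0_norm.
    have -> : 2 * eta * l `^ m = eta * l `^ m + eta * l `^ m by ring.
    apply: lerD.
      apply: le_trans (cl _ _) _; rewrite /phase (_ : _ - _ = u * `|xi| `^ m); last by ring.
      by rewrite ger0_norm ?mulr_ge0 ?powR_ge0// ler_pM ?powR_ge0.
    rewrite /damp; apply: le_trans (expN_lip _ _) _; rewrite ?mulr_ge0 ?powR_ge0//.
    by rewrite powR0 ?gt_eqF// mul0r subr0 ger0_norm ?mulr_ge0 ?powR_ge0// ler_pM ?powR_ge0.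
  rewrite subr0 -mulrDl ler_wpM2r//.
  apply: le_trans (_ : 2 <= _); last first.
    by rewrite lerDr; exact: mulr_ge0 (mulr_ge0 (ler0n R 2) (ltW eta0)) lm.
  by apply: le_trans (ler_normB _ _) _; have := B1 u xi; have := B1 0 xi; rewrite /B; lra.
rewrite (RintD measurableT k1 k2) (RintZl _ measurableT iG) (RintZl _ measurableT (L1B measurableT iG iGI)).
rewrite (RintB measurableT iG iGI) -/J -Rintegral_mkcond.
have h1 : 2 * eta * l `^ m * J <= e / 2.
  have -> : 2 * eta * l `^ m * J = 2 * (eta * (l `^ m * J)) by ring.
  have : eta * (l `^ m * J) <= e / 4 by rewrite /eta mulrAC ler_pdivrMr// ler_wpM2l ?(ltW e4)// lerDl.
  lra.
have h2 : J - \int[mu]_(x in I) G x <= e / 4 by apply: le_trans (ler_norm _) tailG.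
lra.
Qed.

End Gliding.

(** * Superposition of packets at rapidly increasing scales *)

Section Superposition.
Variable R : realType.

Lemma Fatou_L1 (D : set R) (f_ : nat -> R -> R) (f : R -> R) (C : R) : measurable D ->
  (forall n, L1 D (f_ n)) -> (forall n x, D x -> 0 <= f_ n x) ->
  (forall n, \int[mu]_(x in D) f_ n x <= C) -> measurable_fun D f ->
  {ae mu, forall x, D x -> f_ ^~ x @ \oo --> f x} -> (forall x, D x -> 0 <= f x) -> L1 D f.
Proof.
move=> mD if_ f0_ fC mf fcv f0; apply: L1_ge0 => //.
have mf_ n : measurable_fun D (fun x => (f_ n x)%:E).
  by apply/measurable_EFinP; exact: L1_meas (if_ n).
apply: (@le_lt_trans _ _ C%:E); last exact: ltry.
have ft := @fatou _ _ R mu D mD (fun n x => (f_ n x)%:E) mf_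
  (fun n x Dx => f0_ n x Dx).
apply: (@le_trans _ _ (\int[mu]_(x in D) limn_einf (fun n => (f_ n x)%:E))%E).
  rewrite le_eqVlt; apply/orP; left; apply/eqP; apply: ae_eq_integral => //.
  - by apply/measurable_EFinP.
  - rewrite (_ : (fun x => _) = (fun x => (- limn_esup (fun n => (- f_ n x)%:E))%E)).
      apply: measurableT_comp; first exact: oppe_measurable.
      apply: measurable_fun_limn_esup => n; apply/measurable_EFinP.
      by apply: measurableT_comp => //; exact: L1_meas (if_ n).
    by apply/funext => x; rewrite -limn_einfN; congr limn_einf; apply/funext => n /=; rewrite opprK.
  - apply: aeS fcv => x h Dx.
    have Sl : (fun n => (f_ n x)%:E) @ \oo --> (f x)%:E.
      by apply: cvg_EFin; [exact: nearW|exact: h].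
    by have [-> _] := cvg_limn_einf_sup Sl.
apply: le_trans ft _; apply: (@le_trans _ _ (limn_einf (fun=> C%:E))).
  rewrite !limn_einf_lim; apply: lee_lim; [exact: is_cvg_einfs|exact: is_cvg_einfs|].
  apply: nearW => n; apply: le_ereal_inf_tmp => _ [k /= nk <-].
  apply: (@le_trans _ _ (\int[mu]_(x in D) (f_ k x)%:E)%E).
    by apply: ereal_inf_lbound; exists k.
  by rewrite -EFin_Rint// lee_fin.
by have [-> _] := cvg_limn_einf_sup (@cvg_cst _ C%:E _ \oo _).
Qed.

(** Cauchy-Schwarz with the weights [half_pow], whose total mass is at most 2. *)
Lemma sum_sq_weighted (a : nat -> R) (K : nat) :
  (\sum_(i < K) a i) ^+ 2 <= 2 * \sum_(i < K) (a i ^+ 2 / half_pow R i).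
Proof.
rewrite expr2 mulr_suml.
apply: (@le_trans _ _ (\sum_(i < K) \sum_(j < K)
  (2^-1 * (a i ^+ 2 / half_pow R i * half_pow R j) + 2^-1 * (half_pow R i * (a j ^+ 2 / half_pow R j))))).
  apply: ler_sum => i _; rewrite mulr_sumr; apply: ler_sum => j _.
  set p := half_pow R i; set q := half_pow R j.
  have p0 : 0 < p := half_pow_gt0 _ _; have q0 : 0 < q := half_pow_gt0 _ _.
  have -> : 2^-1 * (a i ^+ 2 / p * q) + 2^-1 * (p * (a j ^+ 2 / q)) =
    (a i ^+ 2 * q ^+ 2 + a j ^+ 2 * p ^+ 2) / (2 * p * q) by field; rewrite !gt_eqF.
  rewrite ler_pdivlMr ?mulr_gt0//.
  by have := sqr_ge0 (a i * q - a j * p); rewrite sqrrB !exprMn; lra.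
have h2 := @half_pow_sum R K.
set A := \sum_(i < K) (a i ^+ 2 / half_pow R i); set B := \sum_(j < K) half_pow R j in h2.
have A0 : 0 <= A.
  by apply: sumr_ge0 => i _; rewrite divr_ge0 ?sqr_ge0// ltW// half_pow_gt0.
have -> : \sum_(i < K) \sum_(j < K)
  (2^-1 * (a i ^+ 2 / half_pow R i * half_pow R j) + 2^-1 * (half_pow R i * (a j ^+ 2 / half_pow R j))) =
  2^-1 * (A * B) + 2^-1 * (B * A).
  rewrite [A * B]mulr_suml [B * A]mulr_suml !mulr_sumr -big_split/=; apply: eq_bigr => i _.
  by rewrite big_split/= -!mulr_sumr.
have := ler_wpM2l A0 h2; rewrite [B * A]mulrC; lra.
Qed.

(** A squared norm of at most [half_pow k ^+ 2] leaves [half_pow k] after division by the weight of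
    [sum_sq_weighted], so all partial sums have squared norm at most [2 * 2]; Fatou passes this to
    the limit. *)
Lemma series_weighted_L2 (D : set R) (w F : R -> R) (a : nat -> R -> R) : measurable D ->
  (forall x, D x -> 0 <= w x) -> measurable_fun D w -> (forall k, measurable_fun D (a k)) ->
  measurable_fun D F ->
  (forall k, L1 D (fun x => w x * a k x ^+ 2)) ->
  (forall k, \int[mu]_(x in D) (w x * a k x ^+ 2) <= half_pow R k ^+ 2) ->
  {ae mu, forall x, D x -> (fun K => \sum_(k < K) a k x) @ \oo --> F x} ->
  L1 D (fun x => w x * F x ^+ 2).
Proof.
move=> mD w0 mw ma mF ia ba cv.
pose b k x := w x * a k x ^+ 2 * (half_pow R k)^-1.
have ib k : L1 D (b k) by exact: L1Zr.
have sb K := L1_Rint_sum K mD ib.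
have mS K : measurable_fun D (fun x => \sum_(k < K) a k x).
  by apply: measurable_sum => k; exact: ma.
have pw K x : D x -> w x * (\sum_(k < K) a k x) ^+ 2 <= 2 * \sum_(k < K) b k x.
  move=> Dx; apply: le_trans (ler_wpM2l (w0 x Dx) (sum_sq_weighted (fun k => a k x) K)) _.
  by rewrite mulrCA ler_wpM2l// mulr_sumr; apply: ler_sum => k _; rewrite mulrA.
have iS K : L1 D (fun x => w x * (\sum_(k < K) a k x) ^+ 2).
  apply: (L1_le mD _ (L1Zl 2 mD (sb K).1)).
    by apply: measurable_funM => //; exact: measurable_funX.
  by move=> x Dx; rewrite ger0_norm ?pw// mulr_ge0 ?sqr_ge0// w0.
apply: (@Fatou_L1 D (fun K x => w x * (\sum_(k < K) a k x) ^+ 2) _ 4) => //.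
- by move=> K x Dx; rewrite mulr_ge0 ?sqr_ge0// w0.
- move=> K; apply: (@le_trans _ _ (\int[mu]_(x in D) (2 * \sum_(k < K) b k x))).
    by apply: Rint_le => //; [exact: L1Zl (sb K).1|move=> x Dx; exact: pw].
  rewrite (RintZl _ mD (sb K).1) (sb K).2.
  have h := @half_pow_sum R K.
  suff : \sum_(k < K) \int[mu]_(x in D) b k x <= \sum_(k < K) half_pow R k by lra.
  apply: ler_sum => k _; rewrite /b RintZr// ler_pdivrMr ?half_pow_gt0//.
- by apply: measurable_funM => //; exact: measurable_funX.
- apply: aeS cv => x h Dx; apply: cvgM; first exact: cvg_cst.
  by under eq_fun do rewrite expr2; rewrite expr2; apply: cvgM; exact: h.
- by move=> x Dx; rewrite mulr_ge0 ?sqr_ge0// w0.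
Qed.

Lemma cvg_abs_sum (a : nat -> R) (W : R) : (forall N, \sum_(k < N) `|a k| <= W) ->
  exists l : R, (fun N => \sum_(k < N) a k) @ \oo --> l.
Proof.
move=> aW; exists (lim ((fun N => \sum_(k < N) a k) @ \oo)); apply: cauchy_cvg; apply: cauchy_exP => e e0.
have e2 : 0 < e / 2 by rewrite divr_gt0.
have [K HK] := bounded_tail (fun k => normr_ge0 (a k)) aW e2.
exists (\sum_(k < K) a k); exists K => // L /= KL.
rewrite /ball/= distrC -!(big_mkord xpredT a) (@big_cat_nat _ _ _ K)//= addrAC subrr add0r.
apply: le_lt_trans (ler_norm_sum _ _ _) _; apply: le_lt_trans (HK L KL) _.
by rewrite ltr_pdivrMr// ltr_pMr// ltr1n.
Qed.

Section Packets_at_scale.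
Variables (m gam kap nu : R).
Hypothesis m1 : 1 < m.
Hypothesis g0 : 0 < gam.
Hypothesis kap0 : 0 < kap.
Hypothesis nu0 : 0 < nu.
Hypothesis damp_exp : m < gam * (kap + m - 1).
Hypothesis quad_exp : 2 * nu + kap < 1.

Local Notation l n := (n.+1%:R : R).
Definition scale_hat (n : nat) := pack_hat (mult nu (l n)) (l n) (gap kap (l n)).
Definition scale_cos (n : nat) := pack_cos (mult nu (l n)) (l n) (gap kap (l n)).
Definition scale_sin (n : nat) := pack_sin (mult nu (l n)) (l n) (gap kap (l n)).
(** For a real transform [g], the cases of cosine and sine are [2 pi] times the real and imaginary
    parts of the damped operator along the vertical line. *)
Definition wave (c : R -> R) (g : R -> R) (x u : R) : R :=
  \int[mu]_xi (c (phase m x u xi) * damp m gam u xi * g xi).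

Lemma meas_wave_symbol (c : R -> R) (x u : R) : measurable_fun setT c ->
  measurable_fun setT (fun xi => c (phase m x u xi) * damp m gam u xi).
Proof.
move=> mc; apply: measurable_funM; last by rewrite /damp; meas.
by apply: measurableT_comp => //; rewrite /phase; meas.
Qed.

Lemma wave_symbol_le (c : R -> R) (x u xi : R) : (forall a, `|c a| <= 1) ->
  `|c (phase m x u xi) * damp m gam u xi| <= damp m gam u xi.
Proof.
move=> c1; have /andP[h0 h1] := damp_le1 m gam u xi.
by rewrite normrM (ger0_norm h0) ler_piMl.
Qed.

Lemma L1_wave (c g : R -> R) (x u : R) : measurable_fun setT c -> (forall a, `|c a| <= 1) ->
  L1 setT g -> L1 setT (fun xi => c (phase m x u xi) * damp m gam u xi * g xi).
Proof.
move=> mc c1 ig; apply: (L1_mulb measurableT ig (meas_wave_symbol x u mc) (C := 1)) => xi _.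
apply: le_trans (wave_symbol_le _ _ _ c1) _.
by have /andP[] := damp_le1 m gam u xi.
Qed.

Lemma resonance x : 0 <= x ->
  (fun n : nat => let t := res_time m kap x (l n) in let th := x * l n + t * l n `^ m in
    cos th * wave (@cos R) (scale_hat n) x t + sin th * wave (@sin R) (scale_hat n) x t) @ \oo -->
  \int[mu]_eta (cos (x * eta) * tent_hat eta).
Proof.
move=> x0; have [C C0 hC] := powR_taylor m1.
have := resonance_taylor m1 g0 kap0 nu0 damp_exp quad_exp (conj C0 hC) x0.
apply: cvg_trans; apply: near_eq_cvg; apply: nearW => n /=.
set t := res_time _ _ _ _; set th := x * _ + _.
have ih : L1 setT (scale_hat n) by exact: L1_pack_hat.
have c1 (a : R) : `|cos a| <= 1 by rewrite ler_norml cos_geN1 cos_le1.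
have s1 (a : R) : `|sin a| <= 1 by rewrite ler_norml sin_geN1 sin_le1.
have j1 := L1_wave x t (@measurable_cos R) c1 ih.
have j2 := L1_wave x t (@measurable_sin R) s1 ih.
rewrite /wave -(RintZl _ measurableT j1) -(RintZl _ measurableT j2).
rewrite -(RintD measurableT (L1Zl _ measurableT j1) (L1Zl _ measurableT j2)).
by apply: Rint_eq => xi _; rewrite cosB /scale_hat; ring.
Qed.

Variable s : R.
Hypothesis s01 : 0 <= s <= 1.
Hypothesis snu : 2 * s < nu.

(* [ns] is a pair (index of the frequency, time below which the packet is
   frozen); [sig] is the time after which the packet must be negligible. *)
Definition good_scale (k : nat) (sig : R) (ns : nat * R) : Prop :=
  [/\ (k <= ns.1)%N /\ 2 * tau m kap (l ns.1) <= sig,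
      forall t, sig <= t ->
        \int[mu]_xi (damp m gam t xi * scale_hat ns.1 xi) <= half_pow R k,
      \int[mu]_(x in `[-1, 1]) (scale_cos ns.1 x ^+ 2 + scale_sin ns.1 x ^+ 2) <= half_pow R k ^+ 2,
      L1 setT (fun xi => (1 + xi ^+ 2) `^ s * scale_hat ns.1 xi ^+ 2) /\
      \int[mu]_xi ((1 + xi ^+ 2) `^ s * scale_hat ns.1 xi ^+ 2) <= half_pow R k ^+ 2 &
      [/\ 0 < ns.2, ns.2 <= tau m kap (l ns.1), ns.2 <= half_pow R k &
       forall x u, 0 <= u <= ns.2 ->
        `|wave (@cos R) (scale_hat ns.1) x u - wave (@cos R) (scale_hat ns.1) x 0| <= half_pow R k /\
        `|wave (@sin R) (scale_hat ns.1) x u - wave (@sin R) (scale_hat ns.1) x 0| <= half_pow R k]].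

Lemma wave_low (c : R -> R) (n : nat) (e : R) : measurable_fun setT c ->
  (forall a, `|c a| <= 1) -> (forall a b, `|c a - c b| <= `|a - b|) -> 0 < e ->
  exists2 d : R, 0 < d & forall x u : R, 0 <= u <= d ->
  `|wave c (scale_hat n) x u - wave c (scale_hat n) x 0| <= e.
Proof.
move=> mc c1 cl e0; apply: packet_low => //; first by move=> xi; exact: pack_hat_ge0.
exact: L1_pack_hat.
Qed.

Lemma exists_good_scale (k : nat) (sig : R) : 0 < sig -> exists ns, good_scale k sig ns.
Proof.
move=> sig0; have q0 := half_pow_gt0 R k.
have q20 : 0 < half_pow R k ^+ 2 by rewrite exprn_gt0.
have h1 := small_tau m1 kap0 sig0.
have h2 := small_damped nu m1 g0 kap0 sig0 q0.
have h3 := small_pack_sq kap0 nu0 q20.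
have h4 := small_pack_weight kap0 nu0 quad_exp s01 snu q20.
near \oo => n.
have cos1 (a : R) : `|cos a| <= 1 by rewrite ler_norml cos_geN1 cos_le1.
have sin1 (a : R) : `|sin a| <= 1 by rewrite ler_norml sin_geN1 sin_le1.
have [d1 d10 hd1] := wave_low n (@measurable_cos R) cos1 (@cos_lip R) q0.
have [d2 d20 hd2] := wave_low n (@measurable_sin R) sin1 (@sin_lip R) q0.
have t0 : 0 < tau m kap (l n) by apply: tau_gt0.
(* The freezing time depends on the packet already chosen, so it comes after [n]; taking it below
   [tau] places it before every resonance time of this packet. *)
exists (n, Num.min (tau m kap (l n)) (Num.min (half_pow R k) (Num.min d1 d2))); split=> /=.
- by split; near: n; [exact: nbhs_infty_ge|exact: h1].
- by near: n; exact: h2.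
- by near: n; exact: h3.
- by near: n; exact: h4.
- split.
  + by rewrite !lt_min t0 q0 d10.
  + by rewrite ge_min lexx.
  + by rewrite !ge_min lexx orbT.
  + move=> x u; rewrite !le_min => /andP[u0 /and4P[_ _ ud1 ud2]].
    by split; [apply: hd1|apply: hd2]; rewrite u0.
Unshelve. all: by end_near. Qed.

Lemma exists_scales : exists N : nat -> nat, exists sg : nat -> R,
  forall k, good_scale k.+1 (sg k) (N k.+1, sg k.+1) /\ good_scale 0 1 (N 0%N, sg 0%N).
Proof.
have /choice[F hF] : forall ks : nat * R, exists ns, 0 < ks.2 -> good_scale ks.1 ks.2 ns.
  move=> [k sig]; have [sig0|] := boolP (0 < sig); last by exists (0%N, 0).
  by have [ns h] := exists_good_scale k sig0; exists ns.
(* The freezing time of one packet becomes the time after which the next one must be negligible, so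
   the active time ranges of successive packets are disjoint up to endpoints. *)
pose st := fix st k := if k is k'.+1 then F (k, (st k').2) else F (0%N, 1).
have st0 k : 0 < (st k).2.
  elim: k => [|k IH] /=; first by have [_ _ _ _ []] := hF (0%N, 1) ltr01.
  by have [_ _ _ _ []] := hF (k.+1, (st k).2) IH.
exists (fun k => (st k).1), (fun k => (st k).2) => k; split.
  by have := hF (k.+1, (st k).2) (st0 k); rewrite /=; case: (F _).
by have := hF (0%N, 1) ltr01; rewrite /=; case: (F _).
Qed.

Section Sum.
Variable N : nat -> nat.
Hypothesis smallF : forall k, \int[mu]_(x in `[-1, 1])
  (scale_cos (N k) x ^+ 2 + scale_sin (N k) x ^+ 2) <= half_pow R k ^+ 2.
Hypothesis smallG : forall k, L1 setT (fun xi => (1 + xi ^+ 2) `^ s * scale_hat (N k) xi ^+ 2) /\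
  \int[mu]_xi ((1 + xi ^+ 2) `^ s * scale_hat (N k) xi ^+ 2) <= half_pow R k ^+ 2.

Let I := `[(-1 : R), 1]%classic.
Let mI : measurable (I : set R). Proof. exact: measurable_itv. Qed.
Let c k := scale_cos (N k).
Let d k := scale_sin (N k).
Let cc k : continuous (c k). Proof. exact: cont_pack_cos. Qed.
Let cd k : continuous (d k). Proof. exact: cont_pack_sin. Qed.
Let sq_cont (g : R -> R) : continuous g -> continuous (fun x => g x ^+ 2).
Proof. by move=> cg x; apply: (@continuousM R R g g x); exact: cg. Qed.

Let iSq (g : R -> R) : continuous g -> L1 I (fun x => g x ^+ 2).
Proof. by move=> cg; apply: L1_continuous; exact: sq_cont. Qed.

(** Young's inequality with parameter [half_pow k] bounds the L^1 norms by a summable sequence.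
    [maximal_sum] is then applied to a family that ignores the time index, where it amounts to
    monotone convergence of the series. *)
Let dominant : exists W : R -> R, L1 I W /\
  {ae mu, forall x, I x -> forall K, \sum_(k < K) (`|c k x| + `|d k x|) <= W x}.
Proof.
have ic k : L1 I (c k) := L1_continuous (-1) 1 (@cc k).
have id k : L1 I (d k) := L1_continuous (-1) 1 (@cd k).
have ic2 k : L1 I (fun x => c k x ^+ 2) := L1_continuous (-1) 1 (sq_cont (@cc k)).
have id2 k : L1 I (fun x => d k x ^+ 2) := L1_continuous (-1) 1 (sq_cont (@cd k)).
have iT k : L1 I (fun x => `|c k x| + `|d k x|) by apply: L1D => //; exact: L1_norm.
have TB (k : nat) (v : R -> nat) : selection v -> L1 I (fun x => `|c k x| + `|d k x|) /\
    \int[mu]_(x in I) `| `|c k x| + `|d k x| | <= 3 * half_pow R k.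
  move=> _; split=> //; set q := half_pow R k; have q0 : 0 < q := half_pow_gt0 _ _.
  have i1 := L1Zl ((2 * q)^-1) mI (L1D mI (ic2 k) (id2 k)).
  have iq : L1 I (fun=> q) by apply: L1_continuous => x; exact: cst_continuous.
  apply: (@le_trans _ _ (\int[mu]_(x in I) (q + (2 * q)^-1 * (c k x ^+ 2 + d k x ^+ 2)))).
    apply: Rint_le => //; [exact: L1_norm|exact: L1D|move=> x _].
    rewrite ger0_norm ?addr_ge0//.
    have ab (a : R) : `|a| <= q / 2 + (2 * q)^-1 * a ^+ 2.
      have -> : q / 2 + (2 * q)^-1 * a ^+ 2 = (q ^+ 2 + a ^+ 2) / (2 * q) by field; rewrite gt_eqF.
      rewrite ler_pdivlMr ?mulr_gt0// -(real_normK (num_real a)).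
      by have := sqr_ge0 (`|a| - q); rewrite sqrrB; lra.
    by have := ab (c k x); have := ab (d k x); rewrite mulrDr; lra.
  rewrite (RintD mI iq i1) (RintZl _ mI (L1D mI (ic2 k) (id2 k))).
  have h1 : \int[mu]_(x in I) q <= q * (1 - -1).
    apply: le_trans (ler_norm _) _; apply: Rint_bound_itv; first by lra.
      exact: measurable_cst.
    by move=> x _; rewrite ger0_norm// ltW.
  have h2 : (2 * q)^-1 * \int[mu]_(x in I) (c k x ^+ 2 + d k x ^+ 2) <= q / 2.
    rewrite ler_pdivrMl ?mulr_gt0//; apply: le_trans (smallF k) _; rewrite -/q expr2; lra.
  lra.
have Bs K : \sum_(k < K) 3 * half_pow R k <= 6.
  by rewrite -mulr_sumr; have := half_pow_sum R K; lra.
have [W [iW aeW]] := maximal_sum mI (T := fun k x _ => `|c k x| + `|d k x|) TB Bs.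
exists W; split=> //; apply: aeS aeW => x h /h [e [e0 eW Te]] K.
apply: le_trans (eW K); apply: ler_sum => k _.
by apply: le_trans (Te k 0%N); rewrite ler_norm.
Qed.

(** The series converges almost everywhere on [[-1, 1]] under an integrable majorant, so the
    transforms, being integrals over [[-1, 1]], converge at every [xi]. The L^2 bounds on both sides
    come from [series_weighted_L2]. *)
Lemma exists_superposition : exists f1 f2 : R -> R,
  [/\ f1 = f1 \_ `[-1, 1] /\ f2 = f2 \_ `[-1, 1],
      measurable_fun setT f1 /\ measurable_fun setT f2,
      L1 setT (fun x => f1 x ^+ 2) /\ L1 setT (fun x => f2 x ^+ 2),
      forall xi, (fun K => \sum_(k < K) scale_hat (N k) xi) @ \oo --> trunc_transform f1 f2 1 xi &
      (forall xi, trunc_transform f2 (fun x => - f1 x) 1 xi = 0) /\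
      L1 setT (fun xi => (1 + xi ^+ 2) `^ s * trunc_transform f1 f2 1 xi ^+ 2)].
Proof.
have [W [iW aeW]] := dominant.
pose S (a : nat -> R -> R) K x := \sum_(k < K) a k x.
have mk (a : nat -> R -> R) : (forall k, continuous (a k)) ->
    (forall k x, `|a k x| <= `|c k x| + `|d k x|) ->
    (forall k, \int[mu]_(x in I) a k x ^+ 2 <= half_pow R k ^+ 2) ->
  exists F : R -> R, [/\ F = F \_ I, measurable_fun setT F, L1 setT (fun x => F x ^+ 2),
    L1 I F & {ae mu, forall x, I x -> S a ^~ x @ \oo --> F x}].
  move=> ca abd asq.
  have mS K : measurable_fun I (S a K).
    by apply: measurable_sum => k; apply: measurable_funTS; exact: continuous_measurable_fun.
  have [F [iF Fcv _]] : exists F : R -> R, [/\ L1 I F,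
      {ae mu, forall x, I x -> S a ^~ x @ \oo --> F x} &
      forall E, measurable E -> E `<=` I ->
      (fun L => \int[mu]_(x in E) S a L x) @ \oo --> \int[mu]_(x in E) F x].
    apply: (dominated_limit mI mS iW).
      apply: aeS aeW => x h Ix; apply: (@cvg_abs_sum (fun k => a k x) (W x)) => K.
      by apply: le_trans (h Ix K); apply: ler_sum => k _.
    apply: aeS aeW => x h Ix K; apply: le_trans (h Ix K).
    by apply: le_trans (ler_norm_sum _ _ _) _; apply: ler_sum => k _.
  have mF := L1_meas iF.
  have mFI : measurable_fun setT (F \_ I) by apply/(measurable_restrictT _ mI).
  have F2 : L1 I (fun x => 1 * F x ^+ 2).
    apply: (@series_weighted_L2 I (fun=> 1) F a) => //.
    - by move=> k; apply: measurable_funTS; exact: continuous_measurable_fun.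
    - by move=> k; apply: L1Zl => //; apply: iSq; exact: ca.
    - move=> k; rewrite (@Rint_eq _ _ _ (fun x => a k x ^+ 2)); first exact: asq.
      by move=> x _; rewrite mul1r.
  exists (F \_ I); split=> //.
  - by apply/funext => x; rewrite !patchE; case: ifP => // ->.
  - have h := (L1_restrict _ mI).1 F2.
    rewrite (_ : (fun x => _) = (fun x => (((fun x => 1 * F x ^+ 2) \_ I) x)%:E)); first exact: h.
    apply/funext => x; rewrite !patchE; case: ifP => _; first by rewrite mul1r.
    by rewrite expr0n.
  - rewrite (_ : (fun x => _) = (fun x => ((F \_ I) x)%:E))//.
    by apply: L1S (_ : L1 setT (F \_ I)) => //; exact: (L1_restrict _ mI).1.
  - apply: aeS Fcv => x h Ix; have := h Ix.
    by rewrite [X in _ --> X -> _](_ : F x = (F \_ I) x)// patchE mem_set.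
have sqle (a b : nat -> R -> R) k : (forall k, continuous (a k)) -> (forall k, continuous (b k)) ->
    \int[mu]_(x in I) (a k x ^+ 2 + b k x ^+ 2) <= half_pow R k ^+ 2 ->
    \int[mu]_(x in I) a k x ^+ 2 <= half_pow R k ^+ 2.
  move=> ca cb; apply: le_trans; apply: Rint_le => //.
  - apply: iSq; exact: ca.
  - apply: L1D => //; [apply: iSq; exact: ca|apply: iSq; exact: cb].
  - by move=> x _; rewrite lerDl sqr_ge0.
have [||f1 [f1I mf1 f1s if1 f1cv]] := mk c cc.
- by move=> k x; rewrite lerDl.
- by move=> k; apply: (sqle c d) => //; exact: smallF.
have [||f2 [f2I mf2 f2s if2 f2cv]] := mk d cd.
- by move=> k x; rewrite lerDr.
- move=> k; apply: (sqle d c) => //; apply: le_trans (smallF k).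
  by rewrite le_eqVlt; apply/orP; left; apply/eqP; apply: Rint_eq => x _; rewrite addrC.
have limT (a b : nat -> R -> R) (F G : R -> R) (xi : R) :
    (forall k, continuous (a k)) -> (forall k, continuous (b k)) ->
    (forall k x, `|a k x| <= `|c k x| + `|d k x|) -> (forall k x, `|b k x| <= `|c k x| + `|d k x|) ->
    measurable_fun setT F -> measurable_fun setT G ->
    {ae mu, forall x, I x -> S a ^~ x @ \oo --> F x} ->
    {ae mu, forall x, I x -> S b ^~ x @ \oo --> G x} ->
    (fun K => \sum_(k < K) trunc_transform (a k) (b k) 1 xi) @ \oo --> trunc_transform F G 1 xi.
  move=> ca cb abd bbd mF mG Fcv Gcv.
  have mS (a' : nat -> R -> R) K : (forall k, continuous (a' k)) -> measurable_fun setT (S a' K).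
    by move=> ca'; apply: measurable_sum => k; exact: continuous_measurable_fun.
  have mtr (F' G' : R -> R) : measurable_fun setT F' -> measurable_fun setT G' ->
      measurable_fun I (fun x => cos (x * xi) * F' x + sin (x * xi) * G' x).
    by move=> ? ?; apply: measurable_funTS; meas.
  have ik k : L1 I (fun x => cos (x * xi) * a k x + sin (x * xi) * b k x).
    apply: L1_continuous => x.
    apply: (@continuousD R R R (fun x => cos (x * xi) * a k x) (fun x => sin (x * xi) * b k x) x).
      by apply: (@continuousM R R (fun x => cos (x * xi)) (a k) x); [exact: cont_cosl|exact: ca].
    by apply: (@continuousM R R (fun x => sin (x * xi)) (b k) x); [exact: cont_sinl|exact: cb].
  rewrite (_ : (fun K => _) = (fun K => \int[mu]_(x in I)
      (cos (x * xi) * S a K x + sin (x * xi) * S b K x))); last first.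
    apply/funext => K; rewrite -(L1_Rint_sum K mI ik).2; apply: Rint_eq => x _.
    by rewrite /S !mulr_sumr -big_split.
  apply: (@Rint_dominated _ _ _ _ (fun x => W x + W x)) => //.
  - by move=> K; apply: mtr; exact: mS.
  - exact: mtr.
  - exact: L1D.
  - apply: aeS2 Fcv Gcv => x h1 h2 Ix.
    by apply: cvgD; apply: cvgM; [exact: cvg_cst|exact: h1|exact: cvg_cst|exact: h2].
  - apply: aeS aeW => x h Ix K; have {}h := h Ix K.
    have bd (a' : nat -> R -> R) (t : R) : (forall k x, `|a' k x| <= `|c k x| + `|d k x|) ->
        `|t| <= 1 -> `|t * S a' K x| <= W x.
      move=> a'bd t1; rewrite normrM; apply: le_trans (_ : `|S a' K x| <= _).
        by rewrite ler_piMl.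
      apply: le_trans h; apply: le_trans (ler_norm_sum _ _ _) _.
      by apply: ler_sum => k _.
    apply: le_trans (ler_normD _ _) _; apply: lerD; apply: bd => //.
      by rewrite ler_norml cos_geN1 cos_le1.
    by rewrite ler_norml sin_geN1 sin_le1.
have gcv xi : (fun K => \sum_(k < K) scale_hat (N k) xi) @ \oo --> trunc_transform f1 f2 1 xi.
  rewrite (_ : (fun K => _) = (fun K => \sum_(k < K) trunc_transform (c k) (d k) 1 xi)).
    by apply: limT => // k x; rewrite ?lerDl ?lerDr.
  by apply/funext => K; apply: eq_bigr => k _; rewrite trunc_pack.
exists f1, f2; split=> //; split.
- move=> xi.
  have h : (fun K => \sum_(k < K) trunc_transform (d k) (fun x => - c k x) 1 xi) @ \oo -->
      trunc_transform f2 (fun x => - f1 x) 1 xi.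
    apply: (limT d (fun k x => - c k x)) => //.
    - by move=> k x; apply: (@continuousN R R R (c k) x); exact: cc.
    - by move=> k x; rewrite lerDr.
    - by move=> k x; rewrite normrN lerDl.
    - exact: measurableT_comp.
    - apply: aeS f1cv => x h Ix; rewrite /S; under eq_fun do rewrite sumrN.
      by apply: cvgN; exact: h.
  rewrite -(cvg_lim (@Rhausdorff R) h); apply: (cvg_lim (@Rhausdorff R)).
  rewrite (_ : (fun K => _) = cst 0); first exact: cvg_cst.
  by apply/funext => K; rewrite big1// => k _; exact: trunc_pack_sin.
- have mw : measurable_fun setT (fun xi : R => (1 + xi ^+ 2) `^ s) by meas.
  apply: (@series_weighted_L2 setT (fun xi => (1 + xi ^+ 2) `^ s) _ (fun k => scale_hat (N k))) => //.
  + by move=> x _; exact: powR_ge0.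
  + by move=> k; apply: continuous_measurable_fun; exact: cont_pack_hat.
  + exact: meas_trunc_transform.
  + by move=> k; exact: (smallG k).1.
  + by move=> k; exact: (smallG k).2.
  + by apply: aeS (ae_neq (0 : R)) => xi _ _; exact: gcv.
Qed.

End Sum.

End Packets_at_scale.

End Superposition.

(** * Failure of convergence for the vertical lines *)

Section Divergence.
Variable R : realType.

Lemma L1_lty (f : R -> R) : L1 setT f -> (forall x, 0 <= f x) ->
  (\int[mu]_x (f x)%:E < +oo)%E.
Proof.
move=> /integrableP[_ h] f0; apply: le_lt_trans h.
by under [leRHS]eq_integral do rewrite /= ger0_norm//.
Qed.

Lemma trunc_transform_support (f1 f2 : R -> R) (n : nat) (xi : R) : (0 < n)%N ->
  f1 = f1 \_ `[-1, 1] -> f2 = f2 \_ `[-1, 1] ->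
  trunc_transform f1 f2 n%:R xi = trunc_transform f1 f2 1 xi.
Proof.
move=> n0 e1 e2; have n1 : 1 <= n%:R :> R by rewrite ler1n.
rewrite /trunc_transform Rintegral_mkcond [RHS]Rintegral_mkcond.
apply: Rint_eq => x _; rewrite !patchE; case: ifPn => [_|/negP]; case: ifPn => [|/negP] //.
  move=> xI; have z (f : R -> R) : f = f \_ `[-1, 1] -> f x = 0.
    by move=> ->; rewrite patchE; case: ifP.
  by rewrite (z _ e1) (z _ e2) !mulr0 addr0.
rewrite !inE/= => x1 xn; case: xn; move: x1; rewrite !in_itv/= => /andP[? ?].
by apply/andP; split; lra.
Qed.

Lemma Rint_itv0 (a b : R) : \int[mu]_(x in `[a, b]) (0 : R) = 0.
Proof. by rewrite Rintegral_cst// mul0r. Qed.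

Lemma tent_window : 0 < \int[mu]_(x in `[(0 : R), 2^-1]) tent x.
Proof.
have h0 : (0 : R) <= 2^-1 by rewrite invr_ge0.
have mI : measurable (`[(0 : R), 2^-1] : set R) by exact: measurable_itv.
have ih : L1 `[(0 : R), 2^-1] (fun=> 2^-1) by apply: L1_continuous => x; exact: cst_continuous.
have it : L1 `[(0 : R), 2^-1] (@tent R) by apply: L1_continuous; exact: cont_tent.
apply: (@lt_le_trans _ _ (\int[mu]_(x in `[(0 : R), 2^-1]) 2^-1)).
  have dF (x : R) : is_derive x 1 (fun x => 2^-1 * x) 2^-1.
    by have := D_cmul 2^-1 (is_derive_id x 1); rewrite mulr1.
  rewrite (FTC2_Rint h0 _ (fun x _ => dF x)); first by lra.
  by apply: cont_itv => x _; exact: cst_continuous.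
apply: Rint_le => // x; rewrite /= in_itv/= => /andP[x0 x1].
by rewrite /tent ger0_norm//; lra.
Qed.

Lemma trunc_transform_tent (xi : R) : trunc_transform (@tent R) (fun=> 0) 1 xi = tent_hat xi.
Proof. by apply: Rint_eq => x _; rewrite mulr0 addr0 mulrC. Qed.

Lemma trunc_transform_itent (xi : R) :
  trunc_transform (fun=> 0) (fun x => - @tent R x) 1 xi = 0.
Proof.
rewrite /trunc_transform (@Rint_eq _ _ _ (fun x => (-1) * (tent x * sin (x * xi)))); last first.
  by move=> x _; rewrite mulr0 add0r; ring.
have mI : measurable (`[-1, 1] : set R) by exact: measurable_itv.
have it1 := L1_tent_mul (-1) 1 (@cont_sinl R xi).
by rewrite (RintZl (-1) mI it1) tent_sin mulr0.
Qed.

Lemma cos_win_mul (xi c : R) :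
  cos_win 0 2^-1 xi * c = \int[mu]_(x in `[(0 : R), 2^-1]) (cos (x * xi) * c).
Proof.
rewrite RintZr//.
by apply: L1_continuous; exact: cont_cosl.
Qed.

Lemma tent_window_inversion :
  \int[mu]_eta \int[mu]_(x in `[(0 : R), 2^-1]) (cos (x * eta) * tent_hat eta) =
  2 * pi * \int[mu]_(x in `[(0 : R), 2^-1]) tent x.
Proof.
have h0 : (0 : R) <= 2^-1 by rewrite invr_ge0.
have c0 : continuous (fun _ : R => 0 : R) by move=> x; exact: cst_continuous.
have mt : measurable_fun setT (@tent R) := continuous_measurable_fun (@cont_tent R).
have mh : measurable_fun setT (@tent_hat R) := continuous_measurable_fun (@cont_tent_hat R).
have it : L1 `[(-1 : R), 1] (@tent R) by apply: L1_continuous; exact: cont_tent.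
have i0 : L1 `[(-1 : R), 1] (fun=> 0 : R) by apply: L1_continuous.
have m0 : measurable_fun setT (fun _ : R => 0 : R) by exact: measurable_cst.
have inv := trunc_inversion h0 mt m0 it i0.
rewrite -inv.
- apply: Rint_eq => eta _.
  by rewrite trunc_transform_tent trunc_transform_itent mulr0 subr0 cos_win_mul.
- by lra.
- by lra.
- rewrite (_ : (fun xi => _) = (fun xi => (tent_hat xi ^+ 2)%:E)); last first.
    by apply/funext => xi; rewrite trunc_transform_tent.
  apply: (@L1_le _ _ _ (fun xi => 2 * tent_hat xi)) => //.
  + exact: measurable_funX.
  + by apply: L1Zl => //; exact: L1_tent_hat.
  + move=> xi _; have := tent_hat_ge0 xi; have := tent_hat_le2 xi => h1 h2.
    by rewrite ger0_norm ?sqr_ge0// expr2 ler_wpM2r//; rewrite ger0_norm in h1.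
- rewrite (_ : (fun xi => _) = (fun xi => (0 * tent_hat xi)%:E)); last first.
    by apply/funext => xi; rewrite trunc_transform_itent expr0n mul0r.
  by apply: L1Zl => //; exact: L1_tent_hat.
- rewrite (_ : trunc_transform _ _ _ = cst 0); first exact: measurable_cst.
  by apply/funext => xi; exact: trunc_transform_itent.
Qed.

(** By inversion the inner integral should be [2 pi * tent x]. Only its nonvanishing on a set of
    positive measure matters, and for that its integral over [[0, 1/2]] is enough, which needs
    Fubini and the inversion integrated over an interval. *)
Lemma tent_hat_not_ae0 : ~ {ae mu, forall x : R, `[0, 2^-1]%classic x ->
  \int[mu]_eta (cos (x * eta) * tent_hat eta) = 0}.
Proof.
move=> ae0.
have h0 : (0 : R) <= 2^-1 by rewrite invr_ge0.
have mI (p q : R) : measurable (`[p, q] : set R) by exact: measurable_itv.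
pose Hc (x : R) := \int[mu]_eta (cos (x * eta) * tent_hat eta).
have mh : measurable_fun setT (@tent_hat R) := continuous_measurable_fun (@cont_tent_hat R).
have mF : measurable_fun setT (fun z : R * R => cos (z.1 * z.2) * tent_hat z.2).
  have k1 : measurable_fun setT (fun z : R * R => tent_hat z.2) by apply: measurableT_comp.
  by meas.
have ione : L1 `[(0 : R), 2^-1] (fun=> 1 : R) by apply: L1_itv_1 => // x; rewrite normr1.
have iw : L1 ([set: R] : set R) (@tent_hat R) by exact: L1_tent_hat.
have [|iH _ sw] := Fubini_Rint (mI 0 2^-1) measurableT mF ione iw.
  move=> x y _ _ /=; rewrite mul1r normrM (ger0_norm (tent_hat_ge0 y)).
  by rewrite ler_piMl ?tent_hat_ge0// ler_norml cos_geN1 cos_le1.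
have Z : \int[mu]_(x in `[(0 : R), 2^-1]) Hc x = 0.
  have h : (fun _ : nat => \int[mu]_(x in `[(0 : R), 2^-1]) (0 : R)) @ \oo -->
      \int[mu]_(x in `[(0 : R), 2^-1]) Hc x.
    apply: (@Rint_dominated R `[(0 : R), 2^-1] (fun _ _ => 0) Hc (fun=> 1)).
    - exact: mI.
    - by move=> _; exact: measurable_cst.
    - exact: L1_meas iH.
    - exact: ione.
    - by apply: aeS ae0 => x h Ix; rewrite /Hc (h Ix); exact: cvg_cst.
    - by apply: aeS ae0 => x _ _ _; rewrite normr0.
  rewrite -(cvg_lim (@Rhausdorff R) h); apply: (cvg_lim (@Rhausdorff R)).
  by rewrite Rint_itv0; exact: cvg_cst.
have pi2 : 0 < 2 * pi :> R by apply: mulr_gt0; [exact: ltr0n|exact: pi_gt0].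
have := mulr_gt0 pi2 tent_window.
by rewrite -tent_window_inversion -sw Z ltxx.
Qed.

(** The damping condition asks [kap > b], and [s < scrit] says precisely [b < 1 - 4 s], so [kap] is
    the midpoint of these two bounds. Then [2 s < (1 - kap) / 2] and [nu] is the midpoint of
    those. *)
Lemma subcritical_params (m gam s : R) : 1 < m -> 0 < gam -> 0 <= s -> s < scrit m gam ->
  exists kap nu : R, [/\ 0 < kap, 0 < nu, m < gam * (kap + m - 1), 2 * nu + kap < 1 &
    2 * s < nu /\ s <= 1].
Proof.
move=> m1 g0 s0; rewrite /scrit lt_min => /andP[s4 sm].
have gi : gam * gam^-1 = 1 by rewrite mulfV// gt_eqF.
set z := gam^-1 in gi sm.
have h : 4 * s < m * (1 - z).
  move: sm; rewrite /Num.max; case: ifP => _ sm; last by lra.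
  by move: sm; rewrite mulr0; lra.
have s4' : s < 4^-1 := s4.
have s41 : 4 * s < 1 by lra.
pose b : R := Num.max 0 (m * z - m + 1).
have b1 : b < 1 - 4 * s by rewrite /b gt_max; apply/andP; split; lra.
have b0 : 0 <= b by rewrite /b le_max lexx.
have bm : m * z - m + 1 <= b by rewrite /b le_max lexx orbT.
pose kap := (b + (1 - 4 * s)) / 2.
have k1 : b < kap by rewrite /kap; lra.
have k2 : kap < 1 - 4 * s by rewrite /kap; lra.
exists kap, ((2 * s + (1 - kap) / 2) / 2); split; [lra|lra| |lra|split; lra].
have -> : m = gam * (m * z) by rewrite mulrCA gi mulr1.
by rewrite ltr_pM2l//; rewrite mulrCA gi mulr1; lra.
Qed.

Section WaveSum.
Variables (m gam : R).
Hypothesis m1 : 1 < m.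
Local Notation wave := (wave m gam).

(** The terms [h k] are nonnegative, so all partial sums lie below [g], and the damping times [g] is
    an integrable majorant, as a product of two square integrable functions. *)
Lemma cvg_wave_sum (h : nat -> R -> R) (g c : R -> R) (x u : R) :
  measurable_fun setT c -> (forall a, `|c a| <= 1) -> (forall k, L1 setT (h k)) ->
  (forall k xi, 0 <= h k xi) -> measurable_fun setT g -> L1 setT (fun xi => g xi ^+ 2) ->
  (forall xi, (fun K => \sum_(k < K) h k xi) @ \oo --> g xi) -> 0 < u ->
  (fun K => \sum_(k < K) wave c (h k) x u) @ \oo --> wave c g x u.
Proof.
move=> mc c1 ih h0 mg g2 hg u0.
have mm : 0 < m := lt_trans ltr01 m1.
have [C C0 hC] := damp_decay gam mm u0.
have md : measurable_fun setT (damp m gam u) by rewrite /damp; meas.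
have d2 : L1 setT (fun xi => damp m gam u xi ^+ 2).
  apply: (@L1_le _ _ _ (fun xi => C * (1 + xi ^+ 2)^-1)) => //.
  - exact: measurable_funX.
  - by apply: L1Zl => //; exact: L1_inv_oneDsqr.
  - move=> xi _; rewrite ger0_norm ?sqr_ge0//; apply: le_trans (hC xi).
    have /andP[dp0 dp1] := damp_le1 m gam u xi.
    by rewrite expr2 ler_piMr.
have idg := L1_sq_mul measurableT md mg d2 g2.
have iw k := L1_wave m gam x u mc c1 (ih k).
rewrite (_ : (fun K => _) = (fun K => \int[mu]_xi
    (c (phase m x u xi) * damp m gam u xi * \sum_(k < K) h k xi))); last first.
  apply/funext => K; rewrite /wave -(L1_Rint_sum K measurableT iw).2.
  by apply: Rint_eq => xi _; rewrite mulr_sumr.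
have ms := meas_wave_symbol m gam x u mc.
have le_g K xi : \sum_(k < K) h k xi <= g xi.
  rewrite -(cvg_lim (@Rhausdorff R) (hg xi)).
  apply: (@nondecreasing_cvgn_le _ (fun K => \sum_(k < K) h k xi)); last exact: cvgP (hg xi).
  by apply/nondecreasing_seqP => n; rewrite big_ord_recr/= lerDl.
apply: (@Rint_dominated _ _ _ _ (fun xi => damp m gam u xi * g xi)) => //.
- move=> K; apply: measurable_funM => //; apply: measurable_sum => k.
  exact: L1_meas (ih k).
- exact: measurable_funM.
- by apply: aeS (ae_neq (0 : R)) => xi _ _; apply: cvgM; [exact: cvg_cst|exact: hg].
- apply: aeS (ae_neq (0 : R)) => xi _ _ K; rewrite normrM.
  have s0 : 0 <= \sum_(k < K) h k xi by apply: sumr_ge0.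
  by apply: ler_pM => //; [exact: wave_symbol_le|rewrite ger0_norm].
Qed.

End WaveSum.

(** Although the resonance time depends on [x], it lies between [tau] and [2 tau], hence between
    [sg k.+1] and [sg k] for every [x >= 0]. If both parts converged, the gliding hump would send
    the contribution of the resonating packet to 0, while [resonance] gives its limit as this
    integral. *)
Lemma wave_not_both_cvg (m gam kap nu s : R) (N : nat -> nat) (sg : nat -> R) (gr : R -> R)
    (x La Lb : R) :
  1 < m -> 0 < gam -> 0 < kap -> 0 < nu -> m < gam * (kap + m - 1) -> 2 * nu + kap < 1 ->
  good_scale m gam kap nu s 0 1 (N 0%N, sg 0%N) ->
  (forall k, good_scale m gam kap nu s k.+1 (sg k) (N k.+1, sg k.+1)) ->
  measurable_fun setT gr -> L1 setT (fun xi => gr xi ^+ 2) ->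
  (forall xi, (fun K => \sum_(k < K) scale_hat kap nu (N k) xi) @ \oo --> gr xi) ->
  0 <= x ->
  (fun t => wave m gam (@cos R) gr x t) @ 0^'+ --> La ->
  (fun t => wave m gam (@sin R) gr x t) @ 0^'+ --> Lb ->
  \int[mu]_eta (cos (x * eta) * tent_hat eta) = 0.
Proof.
move=> m1 g0 kap0 nu0 de qe good0 goodS mgr gr2 gcv x0 cL sL.
pose h k := scale_hat kap nu (N k).
have ih k : L1 setT (h k) by exact: L1_pack_hat.
have h0 k xi : 0 <= h k xi by exact: pack_hat_ge0.
have cos1 (a : R) : `|cos a| <= 1 by rewrite ler_norml cos_geN1 cos_le1.
have sin1 (a : R) : `|sin a| <= 1 by rewrite ler_norml sin_geN1 sin_le1.
pose t k := res_time m kap x (N k).+1%:R.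
have sg0 k : 0 < sg k by case: k => [|k]; [have [_ _ _ _ []] := good0|have [_ _ _ _ []] := goodS k].
have sgt k : sg k.+1 <= t k.+1 <= sg k.
  have [[_ g2] _ _ _ [_ g3 _ _]] := goodS k; rewrite /= in g2 g3.
  have /andP[b1 b2] := res_time_bounds kap m1 x0 (ltr0Sn R (N k.+1)).
  by rewrite (le_trans g3 b1) (le_trans b2 g2).
have sgh k : sg k <= half_pow R k.
  by case: k => [|k]; [have [_ _ _ _ []] := good0|have [_ _ _ _ []] := goodS k].
have anti j k : (j <= k)%N -> sg k <= sg j.
  move=> jk; rewrite -(subnKC jk); elim: (k - j)%N => [|n IH]; first by rewrite addn0.
  by rewrite addnS; have /andP[k1 k2] := sgt (j + n)%N; apply: le_trans IH; exact: le_trans k2.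
have hump (c : R -> R) (L : R) : measurable_fun setT c -> (forall a, `|c a| <= 1) ->
    (forall a b, `|c a - c b| <= `|a - b|) ->
    (forall k u, 0 <= u <= sg k -> `|wave m gam c (h k) x u - wave m gam c (h k) x 0| <= half_pow R k) ->
    (fun t => wave m gam c gr x t) @ 0^'+ --> L ->
    (fun k => wave m gam c (h k.+1) x (t k.+1)) @ \oo --> (0 : R).
  move=> mc c1 cl low hL.
  apply: (@gliding_hump R (fun j u => wave m gam c (h j) x u) (fun u => wave m gam c gr x u) sg t L) => //.
  - by move=> u u0; apply: cvg_wave_sum.
  - move=> [//|j] k u; rewrite ltnS => kj ku.
    have [_ g2 _ _ _] := goodS j; have {}g2 := g2 u (le_trans (anti _ _ kj) ku).
    apply: le_trans g2; apply: norm_Rint_le => //.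
    + exact: L1_wave.
    + have i := L1_wave m gam x u (@measurable_cst _ _ _ _ setT (1 : R)) _ (ih j.+1).
      rewrite (_ : (fun xi => _) = (fun xi => (1 * damp m gam u xi * h j.+1 xi)%:E)).
        by apply: i => a; rewrite normr1.
      by apply/funext => xi; rewrite mul1r.
    + move=> xi _; rewrite normrM (ger0_norm (h0 _ _)) ler_wpM2r//.
      exact: wave_symbol_le.
  - move=> j e e0; have [d d0 hd] := wave_low kap nu m1 g0 (N j) mc c1 cl e0.
    by exists d => // u ud; exact: (hd x u).
have lowc k u : 0 <= u <= sg k ->
    `|wave m gam (@cos R) (h k) x u - wave m gam (@cos R) (h k) x 0| <= half_pow R k /\
    `|wave m gam (@sin R) (h k) x u - wave m gam (@sin R) (h k) x 0| <= half_pow R k.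
  by case: k => [|k] uk; [have [_ _ _ _ [_ _ _]] := good0|have [_ _ _ _ [_ _ _]] := goodS k]; apply.
have hc := hump (@cos R) _ (@measurable_cos R) cos1 (@cos_lip R) (fun k u uk => (lowc k u uk).1) cL.
have hs := hump (@sin R) _ (@measurable_sin R) sin1 (@sin_lip R) (fun k u uk => (lowc k u uk).2) sL.
pose th k := x * (N k.+1).+1%:R + t k.+1 * (N k.+1).+1%:R `^ m.
have res : (fun k => cos (th k) * wave m gam (@cos R) (h k.+1) x (t k.+1) +
    sin (th k) * wave m gam (@sin R) (h k.+1) x (t k.+1)) @ \oo -->
    \int[mu]_eta (cos (x * eta) * tent_hat eta).
  have Ninf : (fun k => N k.+1) @ \oo --> \oo.
    apply/cvgnyPge => A; near=> k; have [[g1 _] _ _ _ _] := goodS k; rewrite /= in g1.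
    by apply: leq_trans g1; apply: leqW; near: k; exact: nbhs_infty_ge.
  have r := resonance m1 g0 kap0 nu0 de qe x0.
  exact: (cvg_comp _ _ Ninf r).
have zero : (fun k => cos (th k) * wave m gam (@cos R) (h k.+1) x (t k.+1) +
    sin (th k) * wave m gam (@sin R) (h k.+1) x (t k.+1)) @ \oo --> (0 : R).
  apply/cvgrPdist_le => e e0; have e2 : 0 < e / 2 by rewrite divr_gt0.
  move/cvgrPdist_le : hc => /(_ _ e2) hc; move/cvgrPdist_le : hs => /(_ _ e2) hs.
  near=> k; rewrite sub0r normrN; apply: le_trans (ler_normD _ _) _; rewrite !normrM (splitr e).
  apply: lerD.
    apply: le_trans (_ : `|wave m gam (@cos R) (h k.+1) x (t k.+1)| <= _); first by rewrite ler_piMl.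
    by rewrite -normrN -sub0r; near: k; exact: hc.
  apply: le_trans (_ : `|wave m gam (@sin R) (h k.+1) x (t k.+1)| <= _); first by rewrite ler_piMl.
  by rewrite -normrN -sub0r; near: k; exact: hs.
by rewrite -(cvg_lim (@Rhausdorff R) res) (cvg_lim (@Rhausdorff R) zero).
Unshelve. all: by end_near. Qed.

Lemma ae_divergence (m gam s : R) : 1 < m -> 0 < gam -> 0 <= s -> s < scrit m gam ->
  exists f g : R -> complex R, Hs_pair s f g /\ ~ ae_conv m gam (fun x _ => x) f g.
Proof.
move=> m1 g0 s0 sc.
have [kap [nu [kap0 nu0 de qe [snu s1]]]] := subcritical_params m1 g0 s0 sc.
have s01 : 0 <= s <= 1 by rewrite s0.
have [N [sg good]] := exists_scales m1 g0 kap0 nu0 qe s01 snu.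
have good0 := (good 0%N).2; have goodS k := (good k).1.
have smallF k : \int[mu]_(x in `[-1, 1]) (scale_cos kap nu (N k) x ^+ 2 +
    scale_sin kap nu (N k) x ^+ 2) <= half_pow R k ^+ 2.
  by case: k => [|k]; [have [_ _ ? _ _] := good0|have [_ _ ? _ _] := goodS k].
have smallG k : L1 setT (fun xi => (1 + xi ^+ 2) `^ s * scale_hat kap nu (N k) xi ^+ 2) /\
    \int[mu]_xi ((1 + xi ^+ 2) `^ s * scale_hat kap nu (N k) xi ^+ 2) <= half_pow R k ^+ 2.
  by case: k => [|k]; [have [_ _ _ ? _] := good0|have [_ _ _ ? _] := goodS k].
have [f1 [f2 [[f1I f2I] [mf1 mf2] [f1s f2s] gcv [im0 wgr]]]] := exists_superposition smallF smallG.
pose gr := trunc_transform f1 f2 1.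
have loc (f : R -> R) (p q : R) : measurable_fun setT f -> L1 setT (fun x => f x ^+ 2) -> L1 `[p, q] f.
  by move=> mf f2'; exact: L1_of_sq.
have mgr : measurable_fun setT gr by apply: meas_trunc_transform => //; exact: loc.
have gr2 : L1 setT (fun xi => gr xi ^+ 2).
  apply: (L1_le measurableT _ wgr); first exact: measurable_funX.
  by move=> xi _; rewrite ger0_norm ?sqr_ge0// ler_peMl ?sqr_ge0//; exact: weight_ge1.
pose f (x : R) : complex R := Complex (f1 x) (f2 x).
pose g (xi : R) : complex R := Complex (gr xi) 0.
exists f, g; split.
  split; last first.
    rewrite (_ : (\int[mu]_xi _)%E = (\int[mu]_xi ((1 + xi ^+ 2) `^ s * gr xi ^+ 2)%:E)%E).
      by apply: L1_lty => // xi; rewrite mulr_ge0 ?powR_ge0 ?sqr_ge0.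
    by apply: eq_integral => xi _; rewrite /cnorm2/= expr0n addr0.
  split; [split|split; [split|]].
  - by split.
  - apply: (@L1_lty (fun x => f1 x ^+ 2 + f2 x ^+ 2)); first exact: L1D.
    by move=> x; rewrite addr_ge0 ?sqr_ge0.
  - by split => /=; [exact: mgr|exact: measurable_cst].
  - rewrite (_ : (\int[mu]_x _)%E = (\int[mu]_xi (gr xi ^+ 2)%:E)%E).
      by apply: L1_lty => // xi; rewrite sqr_ge0.
    by apply: eq_integral => xi _; rewrite /cnorm2/= expr0n addr0.
  (* Both [f1] and [f2] are supported in [[-1, 1]], so every truncated transform with [n > 0] equals
     [g] and the L^2 error is 0. *)
  - apply: cvg_near_cst; near=> n.
    have n0 : (0 < n)%N by near: n; exact: nbhs_infty_gt.
    rewrite (_ : (fun xi : R => _) = (fun=> 0%E)); first by rewrite integral0.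
    apply/funext => xi; rewrite /cnorm2 cReB cImB cRe_fourier_trunc cIm_fourier_trunc/=.
    rewrite (trunc_transform_support xi n0 f1I f2I) trunc_transform_support//.
      by rewrite im0 !subrr expr0n addr0.
    by apply/funext => x; rewrite {1}f1I !patchE; case: ifP => // _; rewrite oppr0.
move=> conv; apply: (@tent_hat_not_ae0).
apply: aeS conv => x [cre cim]; rewrite /= in_itv/= => /andP[x0 _].
have pi0 : 2 * pi != 0 :> R by rewrite mulf_neq0// gt_eqF// pi_gt0.
have wc t : wave m gam (@cos R) gr x t = 2 * pi * cRe (Pmg m gam g x t).
  rewrite cRe_Pmg mulVKf//; apply: Rint_eq => xi _; rewrite mulr0 subr0.
  by [].
have ws t : wave m gam (@sin R) gr x t = 2 * pi * cIm (Pmg m gam g x t).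
  rewrite cIm_Pmg mulVKf//; apply: Rint_eq => xi _; rewrite mulr0 sub0r mulrN opprK.
  by [].
apply: (@wave_not_both_cvg m gam kap nu s N sg gr x (2 * pi * f1 x) (2 * pi * f2 x)) => //.
- rewrite (_ : (fun t => _) = (fun t => 2 * pi * cRe (Pmg m gam g x t))).
    by apply: cvgM; [exact: cvg_cst|exact: cre].
  by apply/funext => t; exact: wc.
- rewrite (_ : (fun t => _) = (fun t => 2 * pi * cIm (Pmg m gam g x t))).
    by apply: cvgM; [exact: cvg_cst|exact: cim].
  by apply/funext => t; exact: ws.
Unshelve. all: by end_near. Qed.

Lemma admissible_fst (alpha : R) : 0 < alpha <= 1 -> admissible alpha (fun x _ : R => x).
Proof.
move=> a01; split=> //; split.
  by apply: continuous_subspaceT => z; exact: cvg_fst.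
split=> //; exists 1, 1, 1; split=> //.
- by move=> t x x' _; rewrite mul1r lexx.
- by move=> x t t' _ _; rewrite subrr normr0 mul1r powR_ge0.
Qed.

End Divergence.

Theorem theorem4p7 (R : realType) (m gamma alpha : R) :
  1 < m -> 0 < gamma -> m^-1 <= alpha <= 1 ->
  (forall Gam : R -> R -> R, admissible alpha Gam ->
     forall s : R, scrit m gamma < s ->
     forall f g : R -> complex R, Hs_pair s f g -> ae_conv m gamma Gam f g) /\
  (exists Gam : R -> R -> R, admissible alpha Gam /\
     forall s : R, 0 <= s -> s < scrit m gamma ->
     exists f g : R -> complex R, Hs_pair s f g /\ ~ ae_conv m gamma Gam f g).
Proof.
move=> m1 g0 /andP[ma a1]; split.
  by move=> Gam adm s sc f g Hs; exact: ae_convergence m1 g0 ma adm sc Hs.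
exists (fun x _ => x); split; last by move=> s s0 sc; exact: ae_divergence.
by apply: admissible_fst; rewrite a1 andbT (lt_le_trans _ ma)// invr_gt0 (lt_trans ltr01).
Qed.
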